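(* Assume (A1) and (A2) (both spelled out in the context), let $u_h^\infty$ be a discrete steady state solution with $\|\nabla u_h^\infty\|\le\frac{\nu}{4N}$, let $w_0\in H^1(\Omega)$, and let $w_h$ be the semidiscrete solution with $w_h(0)=w_{0h}$. Let $0\le\alpha\le \frac{1}{2C_F}\min\{\frac{\nu}{2},\,c_0+\frac{7\nu}{4}\}$. Then for all $t>0$ $$\|\nabla w_h(t)\|^2+\int_{\partial\Omega}\frac{c_0+\nu+2|u_h^\infty|}{\nu}\,w_h(t)^2\,d\Gamma+\frac{1}{9\nu c_0}\|w_h(t)\|^4_{L^4(\partial\Omega)}+\nu e^{-2\alpha t}\int_0^t\|e^{\alpha s}\Delta_h w_h(s)\|^2\,ds\le Ce^{C}e^{-2\alpha t},$$ where $C=C(\|w_0\|_3,\nu,f^\infty)>0$ is a generic constant independent of $h$ and $t$.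
   Context: Setting. $\Omega\subset\mathbb{R}^2$ is bounded with smooth boundary $\partial\Omega$; $\nu>0$ and $c_0>0$ are constants; $\mathbf 1=(1,1)$; $f^\infty=f^\infty(x)$ is a time-independent force. $(\cdot,\cdot)$ and $\|\cdot\|$ are the inner product and norm of $L^2(\Omega)$, $\|\cdot\|_m$ is the norm of $H^m(\Omega)$, and $\langle\cdot,\cdot\rangle_{\partial\Omega}$ is the inner product of $L^2(\partial\Omega)$. Put $B(v;w,\phi)=\int_\Omega v\,(\nabla w\cdot\mathbf 1)\,\phi\,dx$. $H^1/\mathbb{R}$ is the quotient space of $H^1(\Omega)$ by constants, normed by $\|\nabla v\|$. Put $|||z|||^2=\|\nabla z\|^2+\|z\|_{L^2(\partial\Omega)}^2$, $\|f^\infty\|_{-1}=\sup_{v\in H^1/\mathbb{R}}\frac{(f^\infty,v)}{\|\nabla v\|}$, $N_1=\sup_{v,z,\phi\in H^1/\mathbb{R}}\frac{B(v;z,\phi)}{\|\nabla v\|\,\|\nabla z\|\,\|\nabla\phi\|}$, $N_2=\sup_{v\in H^1/\mathbb{R},\ (z,\phi)\in (H^1(\Omega))^2}\frac{B(v;z,\phi)}{\|\nabla v\|\,|||z|||\,|||\phi|||}$, and $N=\max(N_1,N_2)$. Assumption (A1): $\|f^\infty\|_{-1}\le\frac{3\nu^2}{16N}$. Steady state: $u^\infty\in H^1/\mathbb{R}$ satisfies $\nu(\nabla u^\infty,\nabla v)+B(u^\infty;u^\infty,v)=(f^\infty,v)$ for all $v\in H^1/\mathbb{R}$ (weak form of $-\nu\Delta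 u^\infty+u^\infty(\nabla u^\infty\cdot\mathbf 1)=f^\infty$ in $\Omega$, $\partial u^\infty/\partial n=0$ on $\partial\Omega$), with $\|\nabla u^\infty\|\le\frac{\nu}{4N}$. Continuous closed-loop problem: $w(0)=w_0=u_0-u^\infty$ and, for all $v\in H^1(\Omega)$, $$(w_t,v)+\nu(\nabla w,\nabla v)+B(u^\infty;w,v)+B(w;u^\infty,v)+B(w;w,v)+\Big\langle(c_0+\nu+2|u^\infty|)w+\tfrac{2}{9c_0}w^3,v\Big\rangle_{\partial\Omega}=0,$$ i.e. feedback law $\frac{\partial w}{\partial n}=v_2:=-\frac1\nu\big((c_0+\nu+2|u^\infty|)w+\frac{2}{9c_0}w^3\big)$ on $\partial\Omega$. Assumption (A2): $u^\infty\in H^2(\Omega)$, $f^\infty\in L^2(\Omega)$; the compatibility conditions $\frac{\partial w_0}{\partial n}=v_2(x,0)$ and $\frac{\partial w_t}{\partial n}(x,0)=v_{2t}(x,0)$ hold at $t=0$; and there is a unique weak solution $w$, satisfying $\|w(t)\|_2^2+\|w_t(t)\|_1^2+\int_0^t\|w_t(s)\|_2^2\,ds\le C$. Discretization: $\mathcal T_h$ is a regular triangulation of $\overline\Omega$ with mesh size $h$ and $V_h=\{v_h\in C^0(\overline\Omega): v_h|_K\in\mathcal P_1(K)\ \forall K\in\mathcal T_h\}$. Discrete steady state: $u_h^\infty\in V_h$ with $\nu(\nabla u_h^\infty,\nabla\chi)+B(u_h^\infty;u_h^\infty,\chi)=(f^\infty,\chi)$ for all $\chi\in V_h$. Semidiscrete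 problem: $w_h(t)\in V_h$ satisfies, for all $\chi\in V_h$, $$(w_{ht},\chi)+\nu(\nabla w_h,\nabla\chi)+B(u_h^\infty;w_h,\chi)+B(w_h;u_h^\infty,\chi)+B(w_h;w_h,\chi)+\int_{\partial\Omega}\Big((c_0+\nu+2|u_h^\infty|)w_h+\tfrac{2}{9c_0}w_h^3\Big)\chi\,d\Gamma=0,$$ with $w_h(0)=w_{0h}:=P_hu_0-u_h^\infty$, an approximation of $w_0$, where $P_hu_0$ is the $H^1$-projection of $u_0$ onto $V_h$, satisfying $\|u_0-P_hu_0\|_j\le Ch^{2-j}\|u_0\|_2$, $j=0,1$. Discrete Laplacian: the discrete normal derivative of $w_h$ on $\partial\Omega$ is $\frac{\partial w_h}{\partial n}=v_{0h}:=-\frac1\nu\big((c_0+\nu+2|u_h^\infty|)w_h+\frac{2}{9c_0}w_h^3\big)$, and $\Delta_hw_h\in V_h$ is defined by $(-\Delta_hw_h,\chi)=(\nabla w_h,\nabla\chi)-\langle \frac{\partial w_h}{\partial n},\chi\rangle_{\partial\Omega}$ for all $\chi\in V_h$. $C_F>0$ is the constant in Friedrichs's inequality $\|y\|^2\le C_F(\|\nabla y\|^2+\|y\|^2_{L^2(\partial\Omega)})$, $y\in H^1(\Omega)$.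
   Formalization: The discrete steady state u_h^∞ is required to have zero mean (to lie in V_h ∩ H^1/R, like u^∞) and is tested only against zero-mean χ; otherwise, for f^∞=0, u^∞=0, arbitrarily large constants u_h^∞=c contradict the uniform bound. *)

(* Defs.v *)
From HB Require Import structures.
From mathcomp Require Import all_boot all_order all_algebra.
From mathcomp Require Import all_classical all_reals all_analysis.

Set Implicit Arguments.
Unset Strict Implicit.
Unset Printing Implicit Defensive.
Import Order.TTheory GRing.Theory Num.Theory.
Import numFieldNormedType.Exports.
Local Open Scope classical_set_scope.
Local Open Scope ring_scope.

(* The library norm of R * R is the max norm; lengths and diameters below are
   Euclidean. *)
Definition enorm (R : realType) (x : R * R) : R :=
  Num.sqrt (x.1 ^+ 2 + x.2 ^+ 2).

Definition area (R : realType) : set (R * R) -> \bar R :=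
  (@lebesgue_measure R \x @lebesgue_measure R)%E.

Definition pderiv (R : realType) (a b : nat) (phi : R * R -> R) : R * R -> R :=
  iter a (fun g x => 'D_((1, 0) : R * R) g x)
    (iter b (fun g x => 'D_((0, 1) : R * R) g x) phi).

Definition smooth (R : realType) (phi : R * R -> R) : Prop :=
  forall a b x, differentiable (pderiv a b phi) x.

Definition smooth1 (R : realType) (g : R -> R) : Prop :=
  forall n s, derivable (derive1n n g) s 1.

(* A bounded connected open set whose boundary is a finite disjoint union of
   smooth regular simple closed curves, parametrized by 1-periodic maps and
   oriented so that the domain lies on the left; the boundary integral [bint]
   does not depend on the parametrization.  Connectedness is what makes
   |grad v| a norm on H^1/R. *)
Definition velocity (R : realType) (g : R -> R * R) (s : R) : R * R :=
  (derive1 (fun r => (g r).1) s, derive1 (fun r => (g r).2) s).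

Definition unit_normal (R : realType) (g : R -> R * R) (s : R) : R * R :=
  ((velocity g s).2 / enorm (velocity g s),
   - (velocity g s).1 / enorm (velocity g s)).

Record smooth_domain (R : realType) := SmoothDomain {
  dom :> set (R * R);
  ncurves : nat;
  curve : 'I_ncurves -> R -> R * R;
  dom_open : open dom;
  dom_connected : connected dom;
  dom_nonempty : dom !=set0;
  dom_bounded : exists M : R, forall x, dom x -> enorm x <= M;
  curve_smooth : forall j, smooth1 (fun s => (curve j s).1) /\
                           smooth1 (fun s => (curve j s).2);
  curve_periodic : forall j s, curve j (s + 1) = curve j s;
  curve_regular : forall j s, velocity (curve j) s <> (0, 0);
  curve_simple : forall i j s t, 0 <= s < 1 -> 0 <= t < 1 ->
    curve i s = curve j t -> i = j /\ s = t;
  curve_boundary :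
    closure dom `\` dom = [set x | exists j s, x = curve j s];
  curve_outward : forall j s, \forall e \near (0 : R)^'+,
    let n := unit_normal (curve j) s in
    dom ((curve j s).1 - e * n.1, (curve j s).2 - e * n.2) /\
    ~ closure dom ((curve j s).1 + e * n.1, (curve j s).2 + e * n.2)
}.

Section Sobolev.
Variables (R : realType) (Om : smooth_domain R).
Implicit Types (u v w z g phi : R * R -> R).

Definition inner u v : R := \int[@area R]_(x in Om) (u x * v x).

Definition L2norm u : R := Num.sqrt (inner u u).

Definition L2 u : Prop :=
  measurable_fun (Om : set (R * R)) u /\
  (\int[@area R]_(x in Om) ((u x ^+ 2)%:E) < +oo)%E.

Definition test_function phi : Prop :=
  smooth phi /\ exists K : set (R * R),
    [/\ compact K, K `<=` Om & forall x, ~ K x -> phi x = 0].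

Definition is_weak_deriv (a b : nat) u g : Prop :=
  L2 g /\ forall phi, test_function phi ->
    inner u (pderiv a b phi) = (-1) ^+ (a + b) * inner g phi.

(* A representative of the weak derivative; 0 when there is none in L^2. *)
Definition wderiv (a b : nat) u : R * R -> R :=
  xget (fun=> 0) [set g | is_weak_deriv a b u g].

Definition sobolev (m : nat) u : Prop :=
  L2 u /\ forall a b : nat, (a + b <= m)%N -> exists g, is_weak_deriv a b u g.

Definition Hnorm (m : nat) u : R :=
  Num.sqrt (\sum_(a < m.+1) \sum_(b < m.+1 | (a + b <= m)%N)
              inner (wderiv a b u) (wderiv a b u)).

(* The square of the H^m norm, +oo outside of H^m. *)
Definition sqHnorm (m : nat) u : \bar R :=
  if `[< sobolev m u >] then (Hnorm m u ^+ 2)%:E else +oo%E.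

Definition grad_inner u v : R :=
  inner (wderiv 1 0 u) (wderiv 1 0 v) + inner (wderiv 0 1 u) (wderiv 0 1 v).

Definition grad_norm u : R := Num.sqrt (grad_inner u u).

Definition trilinear v w phi : R :=
  \int[@area R]_(x in Om) (v x * (wderiv 1 0 w x + wderiv 0 1 w x) * phi x).

(* H^1/R, each class being represented by its element of zero mean; B and
   (f, .) are not invariant under the addition of constants, so a
   representative has to be fixed for N and |f|_{-1} to be meaningful. *)
Definition H1quot v : Prop :=
  sobolev 1 v /\ \int[@area R]_(x in Om) v x = 0.

Definition bint g : R :=
  \sum_(j < ncurves Om) \int[@lebesgue_measure R]_(s in `[0%R, 1%R])
    (g (curve j s) * enorm (velocity (curve j) s)).

Definition L2bdry g : Prop := forall j : 'I_(ncurves Om),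
  measurable_fun `[(0 : R), 1] (fun s => g (curve j s)) /\
  (\int[@lebesgue_measure R]_(s in `[0%R, 1%R])
     ((g (curve j s) ^+ 2 * enorm (velocity (curve j) s))%:E) < +oo)%E.

(* The trace operator is the continuous extension to H^1 of the restriction
   to the boundary of functions smooth up to the boundary. *)
Definition is_trace u g : Prop :=
  [/\ sobolev 1 u, L2bdry g & exists phi : nat -> R * R -> R,
    [/\ forall n, smooth (phi n),
        (fun n => Hnorm 1 (fun x => phi n x - u x)) @ \oo --> (0 : R) &
        (fun n => bint (fun x => (phi n x - g x) ^+ 2)) @ \oo --> (0 : R)]].

Definition trace u : R * R -> R :=
  xget (fun=> 0) [set g | is_trace u g].

Definition normal_deriv u (j : 'I_(ncurves Om)) (s : R) : R :=
  let n := unit_normal (curve j) s in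
  trace (wderiv 1 0 u) (curve j s) * n.1 +
  trace (wderiv 0 1 u) (curve j s) * n.2.

Definition triple_norm z : R :=
  Num.sqrt (grad_norm z ^+ 2 + bint (fun x => trace z x ^+ 2)).

Definition dual_norm (f : R * R -> R) : \bar R :=
  ereal_sup [set r | exists v, [/\ H1quot v, grad_norm v != 0 &
    r = (inner f v / grad_norm v)%:E]].

Definition N1 : \bar R :=
  ereal_sup [set r | exists v z phi,
    [/\ [/\ H1quot v, H1quot z & H1quot phi],
        [/\ grad_norm v != 0, grad_norm z != 0 & grad_norm phi != 0] &
        r = (trilinear v z phi /
               (grad_norm v * grad_norm z * grad_norm phi))%:E]].

Definition N2 : \bar R :=
  ereal_sup [set r | exists v z phi,
    [/\ [/\ H1quot v, sobolev 1 z & sobolev 1 phi],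
        [/\ grad_norm v != 0, triple_norm z != 0 & triple_norm phi != 0] &
        r = (trilinear v z phi /
               (grad_norm v * triple_norm z * triple_norm phi))%:E]].

Definition friedrichs (CF : R) : Prop :=
  0 < CF /\ forall y, sobolev 1 y ->
    L2norm y ^+ 2 <= CF * (grad_norm y ^+ 2 + bint (fun x => trace y x ^+ 2)).

End Sobolev.

(* The boundary nonlinearity (c0 + nu + 2|a|) w + 2/(9 c0) w^3, where a is the
   boundary value of the steady state, and its derivative along w_t. *)
Definition feedback (R : realType) (c0 nu a w : R) : R :=
  (c0 + nu + 2 * `|a|) * w + 2 / (9 * c0) * w ^+ 3.

Definition feedback_t (R : realType) (c0 nu a w wt : R) : R :=
  (c0 + nu + 2 * `|a|) * wt + 2 / (9 * c0) * (3 * w ^+ 2 * wt).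

Section ContinuousProblem.
Variables (R : realType) (Om : smooth_domain R) (nu c0 : R).
Implicit Types (f v uinf : R * R -> R) (w wt : R -> R * R -> R).

Definition steady_state (N : R) f uinf : Prop :=
  [/\ H1quot Om uinf,
      forall v, H1quot Om v ->
        nu * grad_inner Om uinf v + trilinear Om uinf uinf v = inner Om f v &
      grad_norm Om uinf <= nu / (4 * N)].

(* [wt] is the time derivative of [w]: (w, v)' = (wt, v) for all v in H^1.
   The equation at t = 0 is what identifies [wt 0] with w_t(0). *)
Definition weak_solution uinf (w0 : R * R -> R) w wt : Prop :=
  [/\ {ae @area R, forall x, dom Om x -> w 0 x = w0 x},
      forall t, 0 <= t -> sobolev Om 1 (w t) /\ L2 Om (wt t),
      forall v, sobolev Om 1 v ->
        (fun t => inner Om (w t) v) @ (0 : R)^'+ --> inner Om (w 0) v,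
      forall v, sobolev Om 1 v -> forall t : R, 0 < t ->
        is_derive t 1 (fun s => inner Om (w s) v) (inner Om (wt t) v) &
      forall v, sobolev Om 1 v -> forall t : R, 0 <= t ->
        inner Om (wt t) v + nu * grad_inner Om (w t) v
        + trilinear Om uinf (w t) v + trilinear Om (w t) uinf v
        + trilinear Om (w t) (w t) v
        + bint Om (fun x =>
            feedback c0 nu (trace Om uinf x) (trace Om (w t) x) * trace Om v x)
        = 0].

Definition assumption_A2 f uinf (w0 : R * R -> R) : Prop :=
  [/\ sobolev Om 2 uinf, L2 Om f &
   exists w wt,
     [/\ weak_solution uinf w0 w wt,
         forall w' wt', weak_solution uinf w0 w' wt' -> forall t, 0 <= t ->
           {ae @area R, forall x, dom Om x -> w' t x = w t x},
         exists K : R, forall t, 0 < t ->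
           (sqHnorm Om 2 (w t) + sqHnorm Om 1 (wt t)
            + \int[@lebesgue_measure R]_(s in `[0%R, t]) sqHnorm Om 2 (wt s)
            <= K%:E)%E,
         sobolev Om 2 w0 /\
         (forall j : 'I_(ncurves Om), {ae @lebesgue_measure R, forall s, 0 <= s <= 1 ->
           normal_deriv w0 j s =
           - nu^-1 * feedback c0 nu (trace Om uinf (curve j s))
                       (trace Om w0 (curve j s))}) &
         sobolev Om 2 (wt 0) /\
         (forall j : 'I_(ncurves Om), {ae @lebesgue_measure R, forall s, 0 <= s <= 1 ->
           normal_deriv (wt 0) j s =
           - nu^-1 * feedback_t c0 nu (trace Om uinf (curve j s))
                       (trace Om w0 (curve j s))
                       (trace Om (wt 0) (curve j s))})]].

End ContinuousProblem.

Definition bary (R : realType) (k : 'I_3) (x : R * R) : R :=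
  nth 0 [:: 1 - x.1 - x.2; x.1; x.2] k.

Definition ref_triangle (R : realType) : set (R * R) :=
  [set x | forall k, 0 <= bary k x].

Definition ref_edge (R : realType) (k : 'I_3) : set (R * R) :=
  [set x | ref_triangle x /\ bary k x = 0].

Definition ref_vertex (R : realType) (k : 'I_3) : set (R * R) :=
  [set x | ref_triangle x /\ bary k x = 1].

Definition is_segment (R : realType) (E : set (R * R)) : Prop :=
  exists a b : R * R, E = [set x | exists s : R, 0 <= s <= 1 /\
    x = (a.1 + s * (b.1 - a.1), a.2 + s * (b.2 - a.2))].

(* Since the boundary of Om is smooth, an exact triangulation of its closure
   has curved edges: the elements are homeomorphic images of the reference
   triangle whose edges are straight, except possibly those which lie on the
   boundary. *)
Record triangulation (R : realType) (Om : smooth_domain R) := Triangulation {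
  nelem : nat;
  emap : 'I_nelem -> R * R -> R * R;
  emap_continuous : forall i, {within @ref_triangle R, continuous (emap i)};
  emap_injective : forall i x y, ref_triangle x -> ref_triangle y ->
    emap i x = emap i y -> x = y;
  emap_edges : forall i k, is_segment (emap i @` @ref_edge R k) \/
    emap i @` @ref_edge R k `<=` closure Om `\` Om;
  emap_cover : closure Om = \bigcup_i (emap i @` @ref_triangle R);
  emap_conforming : forall i j, i != j ->
    let I := (emap i @` @ref_triangle R) `&` (emap j @` @ref_triangle R) in
    [\/ I = set0,
        exists k l, I = emap i @` @ref_vertex R k /\
                    I = emap j @` @ref_vertex R l |
        exists k l, I = emap i @` @ref_edge R k /\
                    I = emap j @` @ref_edge R l]
}.

Section Discretization.
Variables (R : realType) (Om : smooth_domain R) (Th : triangulation Om).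
Implicit Types (v chi : R * R -> R).

Definition element (i : 'I_(nelem Th)) : set (R * R) :=
  emap i @` @ref_triangle R.

Definition diam (K : set (R * R)) : R :=
  sup [set r | exists x y, [/\ K x, K y & r = enorm (x - y)]].

Definition mesh_size : R := \big[Num.max/0]_(i < nelem Th) diam (element i).

(* Shape regularity: every element of diameter h_K contains a disc of radius
   at least h_K / sigma. *)
Definition regular (sigma : R) : Prop := forall i : 'I_(nelem Th),
  exists (c : R * R) (rho : R),
    [/\ 0 < rho, [set x | enorm (x - c) <= rho] `<=` element i &
        diam (element i) <= sigma * rho].

Definition Vh v : Prop :=
  {within closure (Om : set (R * R)), continuous v} /\
  forall i : 'I_(nelem Th), exists a b c : R,
    forall x, element i x -> v x = a + b * x.1 + c * x.2.

Definition is_H1_projection (u p : R * R -> R) : Prop :=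
  Vh p /\ forall chi, Vh chi ->
    inner Om (fun x => u x - p x) chi
    + grad_inner Om (fun x => u x - p x) chi = 0.

(* As in the continuous problem, the solution and the test functions are in
   H^1/R, i.e. of zero mean. *)
Definition disc_steady_state (nu : R) (f uh : R * R -> R) : Prop :=
  [/\ Vh uh, H1quot Om uh &
      forall chi, Vh chi -> H1quot Om chi ->
        nu * grad_inner Om uh chi + trilinear Om uh uh chi = inner Om f chi].

(* Functions of Vh matter on the closure of Om only, where the time derivative
   can be taken pointwise as Vh is finite dimensional. *)
Definition semidiscrete (nu c0 : R) (uh w0h : R * R -> R)
    (wh wht : R -> R * R -> R) : Prop :=
  [/\ forall x, closure Om x -> wh 0 x = w0h x,
      forall t, 0 <= t -> Vh (wh t),
      forall x, closure Om x -> (fun t => wh t x) @ (0 : R)^'+ --> wh 0 x,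
      forall t : R, 0 < t -> Vh (wht t) /\ forall x, closure Om x ->
        is_derive t 1 (fun s => wh s x) (wht t x) &
      forall t : R, 0 < t -> forall chi, Vh chi ->
        inner Om (wht t) chi + nu * grad_inner Om (wh t) chi
        + trilinear Om uh (wh t) chi + trilinear Om (wh t) uh chi
        + trilinear Om (wh t) (wh t) chi
        + bint Om (fun x => feedback c0 nu (uh x) (wh t x) * chi x) = 0].

(* L is the discrete Laplacian of w. *)
Definition is_disc_laplacian (nu c0 : R) (uh w L : R * R -> R) : Prop :=
  Vh L /\ forall chi, Vh chi ->
    inner Om (fun x => - L x) chi =
    grad_inner Om w chi
    - bint Om (fun x => (- nu^-1 * feedback c0 nu (uh x) (w x)) * chi x).

End Discretization.

(* Main.v *)
(* Let y = |w_h|^2 and let E be the energy on the left-hand side. By Green's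
   formula the transport terms tested with w_h are boundary integrals, which the
   feedback absorbs; with N2 and Friedrichs's inequality,
   y' <= - 2 alpha y - (nu / 2) E. Testing with Delta_h w_h gives
   E' + nu |Delta_h w_h|^2 <= 2 K (E + E^2), as soon as |Delta_h w_h| controls
   |w_h grad w_h| uniformly in h. For that, Delta_h w_h is tested with the nodal
   interpolant of sgn(w_h) (|w_h| - M)_+^3, with M of the order of the H^1 norm,
   which behaves like w_h^3 up to lower order terms. The Poincare inequality comes
   from N1 < oo, with z = x_1 - mean. *)
Require Import Defs.
From HB Require Import structures.
From mathcomp Require Import all_boot all_order all_algebra.
From mathcomp Require Import all_classical all_reals all_analysis.
From mathcomp Require Import measurable_realfun.
From mathcomp Require Import ring lra.
Set Implicit Arguments. Unset Strict Implicit. Unset Printing Implicit Defensive.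
Import Order.TTheory GRing.Theory Num.Theory.
Import numFieldNormedType.Exports.
Local Open Scope classical_set_scope.
Local Open Scope ring_scope.

(** Elements may have curved edges on the boundary, and shape regularity only gives a disc inside
    each, so no affine reference map is available. Everything is therefore derived for functions
    that are C^1 off finitely many lines ([PC1]): two affine pieces with different gradients agree
    on a line at most, so the shape of the elements never enters Green's formula. That formula comes
    from integration along three directions, two of which are transversal to the boundary near each
    of its points; the same two give the embedding of W^{1,1} in L^2, hence all moments. Weak
    derivatives and traces are choices: the former are identified by the du Bois-Reymond lemma, for
    the latter an upper bound suffices. The threshold M is needed because interpolating w^3 is
    faithful only where w dominates its oscillation on the element; elsewhere w is of the order of
    its H^1 norm and the cube is a lower order term. Tracking that norm as a scale S keeps the
    nonlinear term at most quadratic in E, and since e^(2 alpha t) E is integrable in time the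
    resulting constant does not depend on t. *)

Notation area_measure R := (@area R : {measure set (measurableTypeR R * measurableTypeR R)%type -> \bar R}).
Notation o3_0 := (@Ordinal 3 0 isT).
Notation o3_1 := (@Ordinal 3 1 isT).
Notation o3_2 := (@Ordinal 3 2 isT).

Notation clos Om := (closure (Om : set (_ * _))).

Ltac itvlra := apply/andP; split; lra.
Ltac nn_atom := fail.
Ltac nn := first [assumption | nn_atom | exact: ler0n | exact: ltr0Sn | exact: ler01 | exact: ltr01 | exact: sqr_ge0 | exact: normr_ge0 | exact: expR_ge0 | exact: expR_gt0
  | apply: ltW; assumption
  | apply: exprn_ge0; nn | apply: exprn_gt0; nn | apply: divr_ge0; nn | apply: divr_gt0; nn | apply: mulr_ge0; nn | apply: mulr_gt0; nn
  | rewrite invr_ge0; nn | rewrite invr_gt0; nn | apply: addr_ge0; nn | apply: addr_gt0; nn | apply: ltr_pwDl; nn | apply: ltr_wpDl; nn].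

(** * Topology and Borel sets of the plane *)

Lemma normr2 (R : realDomainType) (a : R) : `|a| ^+ 2 = a ^+ 2.
Proof. by rewrite real_normK ?num_real. Qed.

Lemma le_of_eq (R : realType) (a b : R) : a = b -> a <= b.
Proof. by move=> ->. Qed.

Lemma open_box (R : realType) (A : set (R * R)) (x : R * R) : open A -> A x ->
  exists2 e : R, 0 < e &
    forall y : R * R, `|x.1 - y.1| < e -> `|x.2 - y.2| < e -> A y.
Proof.
move=> oA Ax; have /nbhs_ballP[e/= e0 eA] : nbhs x A by exact: open_nbhs_nbhs.
by exists e => // y y1 y2; apply: eA; split; rewrite /ball/=.
Qed.

Lemma nbhs_box (R : realType) (A : set (R * R)) (x : R * R) : nbhs x A <->
  exists2 e : R, 0 < e &
    forall y : R * R, `|x.1 - y.1| < e -> `|x.2 - y.2| < e -> A y.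
Proof.
split.
  move=> /nbhs_ballP[e/= e0 eA].
  by exists e => // y y1 y2; apply: eA; split; rewrite /ball/=.
move=> [e e0 eA]; apply/nbhs_ballP; exists e => //= y [y1 y2]; exact: eA.
Qed.

Lemma within_box (R : realType) (K : set (R * R)) (g : R * R -> R) :
  {within K, continuous g} <-> forall x, K x -> forall e : R, 0 < e ->
  exists2 d : R, 0 < d & forall y, K y -> `|x.1 - y.1| < d -> `|x.2 - y.2| < d ->
    `|g x - g y| < e.
Proof.
split=> [/subspace_continuousP cg x Kx e e0|H].
  have /cvgrPdist_lt/(_ e e0) := cg x Kx.
  rewrite near_withinE => /nbhs_box[d d0 dA].
  by exists d => // y Ky y1 y2; apply: dA.
apply/subspace_continuousP => x Kx; apply/cvgrPdist_lt => e e0.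
rewrite near_withinE; apply/nbhs_box; have [d d0 dA] := H x Kx e e0.
by exists d => // y y1 y2 Ky; apply: dA.
Qed.

(** The product sigma-algebra contains rectangles, and an open set is the union of the countably
    many rational squares [B q] that it contains. *)
Lemma open_measurable2 (R : realType) (A : set (R * R)) :
  open A -> measurable A.
Proof.
move=> oA.
pose B (q : rat * rat * rat) : set (R * R) :=
  `]ratr q.1.1 - ratr q.2, ratr q.1.1 + ratr q.2[ `*`
  `]ratr q.1.2 - ratr q.2, ratr q.1.2 + ratr q.2[.
pose C q := if `[< B q `<=` A >] then B q else set0.
have -> : A = \bigcup_(q in [set: rat * rat * rat]) C q.
  apply/seteqP; split => [x Ax|x [q _]]; last first.
    by rewrite /C; case: ifPn => // /asboolP qA /qA.
  have [e e0 eA] := open_box oA Ax.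
  have e4 : 0 < e / 4 :> R by lra.
  have [r] := @rat_in_itvoo R (e / 4) (e / 2) ltac:(lra).
  rewrite in_itv/= => /andP[r1 r2].
  have [a] := @rat_in_itvoo R (x.1 - e / 4) (x.1 + e / 4) ltac:(lra).
  rewrite in_itv/= => /andP[a1 a2].
  have [b] := @rat_in_itvoo R (x.2 - e / 4) (x.2 + e / 4) ltac:(lra).
  rewrite in_itv/= => /andP[b1 b2].
  have Bx : B (a, b, r) x.
    by split; rewrite /= in_itv/=; itvlra.
  exists (a, b, r) => //; rewrite /C; rewrite ifT//; apply/asboolP => y [/=].
  rewrite !in_itv/= => /andP[y1 y2] /andP[y3 y4].
  by apply: eA; rewrite ltr_norml; itvlra.
rewrite -(image_id [set: rat * rat * rat]).
have /countable_bijP[D] := (countableP [set: rat * rat * rat]).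
rewrite card_eq_sym => /pcard_eqP/bijPex[f [f1 f2 f3]].
have -> : \bigcup_(q in id @` [set: rat * rat * rat]) C q = \bigcup_(n in D) C (f n).
  apply/seteqP; split => x [q Dq Cq].
    by have [n Dn fn] := f3 q I; exists n => //; rewrite fn.
  by exists (f q) => //; exists (f q).
apply: bigcup_measurable => n _; rewrite /C; case: ifPn => // _.
by apply: measurableX; exact: measurable_itv.
Qed.

Lemma itvcc_lty (R : realType) (a b : R) : ((@lebesgue_measure R) (`[a, b]%classic : set R) < +oo)%E.
Proof. by rewrite lebesgue_measure_itv/=; case: ifP => // _; rewrite -EFinD ltry. Qed.

(** * Area of bounded sets and invariance under translation *)

Section area_facts.
Variable R : realType.
Notation R2 := (R * R)%type.
Notation mu := (@lebesgue_measure R).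

Lemma open_within_measurable (D K : set R2) (g : R * R -> R) :
  open D -> D `<=` K ->
  {within K, continuous g} -> measurable_fun D g.
Proof.
move=> oD DK /within_box cg; have mD := open_measurable2 oD.
apply: (measurability _ (RGenOpens.measurableE R)) => _ [_ [a [b ->] <-]].
apply: open_measurable2; rewrite openE => x [Dx /=]; rewrite in_itv/= => /andP[ax xb].
have [e e0 eD] := open_box oD Dx.
have m0 : 0 < Num.min (g x - a) (b - g x).
  by rewrite lt_min !subr_gt0 ax.
have [d d0 dA] := cg x (DK _ Dx) _ m0.
apply/nbhs_box; exists (Num.min d e); first by rewrite lt_min d0.
move=> y; rewrite !lt_min => /andP[y1 y2] /andP[y3 y4]; have Dy := eD _ y2 y4.
split => //=; have := dA y (DK _ Dy) y1 y3; rewrite lt_min !ltr_norml in_itv/=.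
by move=> /andP[/andP[? ?] /andP[? ?]]; itvlra.
Qed.

Lemma area_rect (a b c d : R) : a <= b -> c <= d ->
  @area R (`[a, b] `*` `[c, d]) = ((b - a) * (d - c))%:E.
Proof.
move=> ab cd; rewrite /area product_measure1E//.
have E (x y : R) : x <= y -> lebesgue_measure `[x, y]%classic = (y - x)%:E.
  rewrite lebesgue_measure_itv/= lte_fin => xy; case: ifPn => //.
  by rewrite -leNgt => yx; congr (_%:E); lra.
by rewrite [X in (X * _)%E]E// [X in (_ * X)%E]E// EFinM.
Qed.

Lemma area_bounded_lty (D : set R2) (M : R) : measurable D ->
  (forall x, D x -> `|x.1| <= M /\ `|x.2| <= M) -> (@area R D < +oo)%E.
Proof.
move=> mD DM; have [M0|M0] := leP 0 M; last first.
  suff -> : D = set0 by rewrite [area _]measure0.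
  by apply/seteqP; split => x // /DM[]; have := normr_ge0 x.1 => ? ? ?; lra.
have : (@area R D <= @area R (`[(- M)%R, M] `*` `[(- M)%R, M]))%E.
  apply: le_measure; rewrite ?inE//; first by apply: measurableX; exact: measurable_itv.
  by move=> x /DM[]; rewrite !ler_norml => ? ?; split; rewrite /= in_itv.
by move=> /le_lt_trans; apply; rewrite area_rect ?ltry//; lra.
Qed.

Definition trans (a : R) (y : measurableTypeR R) : measurableTypeR R := a + y.

Lemma measurable_trans (a : R) : measurable_fun setT (trans a).
Proof. exact: measurable_funD. Qed.

HB.instance Definition _ a := isMeasurableFun.Build _ _ _ _ _ (measurable_trans a).

Lemma pushforward_trans (a : R) (A : set (measurableTypeR R)) : measurable A ->
  pushforward mu (trans a) A = mu A.
Proof.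
move=> mA; symmetry.
apply: (@lebesgue_measure_unique R (pushforward mu (trans a))) => // X [[b c] _ <-] /=.
rewrite /pushforward/=.
have -> : trans a @^-1` `]b, c] = `](b - a), (c - a)]%classic.
  by apply/seteqP; split => x /=; rewrite !in_itv/= /trans => /andP[? ?]; itvlra.
rewrite !lebesgue_measure_itv/= !lte_fin ltrD2r; case: ifP => // _.
by rewrite -!EFinD; congr (_%:E); ring.
Qed.

Lemma ge0_integral_translate (a : R) (f : R -> \bar R) :
  measurable_fun [set: R] f -> (forall x, (0 <= f x)%E) ->
  (\int[mu]_y f (a + y)%R = \int[mu]_y f y)%E.
Proof.
move=> mf f0.
have <- : (\int[pushforward mu (trans a)]_y f y = \int[mu]_y f y)%E.
  by apply: eq_measure_integral => A mA _; exact: pushforward_trans.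
by rewrite (ge0_integral_pushforward (measurable_trans a))// preimage_setT.
Qed.

End area_facts.

(** By induction on [S]: an exceptional point inside the interval splits it into two, and continuity
    makes the two constants agree there. *)
Lemma zero_derive_cst (R : realType) (S : seq R) (f : R -> R) (a b : R) : a <= b ->
  {within `[a, b], continuous f} ->
  (forall x, x \in `]a, b[ -> x \notin S -> is_derive x 1 f 0) -> f b = f a.
Proof.
elim: S a b => [|c S IH] a b ab cf df.
  have [x _ /eqP] := MVT_segment ab (fun x xab => df x xab isT) cf.
  by rewrite mul0r subr_eq0 => /eqP.
have [cab|cab] := boolP (c \in `]a, b[); last first.
  apply: (IH a b) => // x xab xS; apply: df => //; rewrite inE negb_or xS andbT.
  by apply: contraNneq cab => <-.
move: cab; rewrite in_itv/= => /andP[ac cb].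
have cb' : c <= b by exact: ltW.
have ac' : a <= c by exact: ltW.
have c1 : {within `[c, b], continuous f}.
  by apply: continuous_subspaceW cf => x /=; rewrite !in_itv/= => /andP[? ?]; itvlra.
have c2 : {within `[a, c], continuous f}.
  by apply: continuous_subspaceW cf => x /=; rewrite !in_itv/= => /andP[? ?]; itvlra.
have d1 x : x \in `]c, b[ -> x \notin S -> is_derive x 1 f 0.
  rewrite in_itv/= => /andP[x1 x2] xS; apply: df.
    by rewrite in_itv/=; itvlra.
  by rewrite inE negb_or xS andbT gt_eqF.
have d2 x : x \in `]a, c[ -> x \notin S -> is_derive x 1 f 0.
  rewrite in_itv/= => /andP[x1 x2] xS; apply: df.
    by rewrite in_itv/=; itvlra.
  by rewrite inE negb_or xS andbT lt_eqF.
by rewrite (IH c b cb' c1 d1) (IH a c ac' c2 d2).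
Qed.

(** [f] minus the indefinite integral of [f'] is continuous with zero derivative off [S]. The
    exceptional list is there because the gradient of a piecewise affine function jumps where a line
    crosses from one piece to another. *)
Lemma FTC_finite (R : realType) (S : seq R) (f f' : R -> R) (a b M : R) : a <= b ->
  {within `[a, b], continuous f} ->
  measurable_fun `[a, b] f' -> (forall x, x \in `[a, b] -> `|f' x| <= M) ->
  (forall x, x \in `]a, b[ -> x \notin S ->
     is_derive x 1 f (f' x) /\ {for x, continuous f'}) ->
  \int[lebesgue_measure]_(x in `[a, b]) f' x = f b - f a.
Proof.
move=> ab cf mf' f'M df.
have if' : lebesgue_measure.-integrable `[a, b] (EFin \o f').
  apply: measurable_bounded_integrable => //.
    exact: itvcc_lty.
  exists M; split; first exact: num_real.
  by move=> y My x xab; apply: le_trans (ltW My); apply: f'M.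
pose G x := \int[lebesgue_measure]_(t in `[a, x]) f' t.
have cG : {within `[a, b], continuous G}.
  exact: parameterized_integral_continuous.
have : (f \- G) b = (f \- G) a.
  apply: (@zero_derive_cst _ S) => //.
    by move=> x; apply: cvgB; [exact: cf|exact: cG].
  move=> x xab xS; have [dfx cfx] := df x xab xS.
  move: xab; rewrite in_itv/= => /andP[ax xb].
  have [dG Gx] := continuous_FTC1_closed xb if' ax cfx.
  have dGx : is_derive x 1 G (f' x) by rewrite -Gx derive1E; apply/derivableP.
  by apply: is_derive_eq; rewrite subrr.
rewrite /= {2}/G set_itv1 Rintegral_set1 subr0 => /eqP.
by rewrite subr_eq addrC -subr_eq => /eqP ->.
Qed.

(** * Fubini's theorem along three directions *)

Section directions.
Variable R : realType.
Notation mu := (@lebesgue_measure R).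
Notation AR := (area_measure R).
Implicit Types (k : 'I_3) (z : R * R) (s t : R).

(** Three directions rather than two: a tangent line is parallel to at most one of them, so two
    remain transversal at every boundary point. *)
Definition dirv k : R * R := nth (0, 0) [:: (1, 0); (0, 1); (1, 1)] k.

(** Coordinates adapted to [dirv k]: s runs along the direction and t labels the lines. Each of
    these linear maps has determinant 1 or -1, hence preserves area. *)
Definition lin k s t : R * R := nth (0, 0) [:: (s, t); (t, s); (s, s + t)] k.

Definition scoor k z : R := nth 0 [:: z.1; z.2; z.1] k.

Definition tcoor k z : R := nth 0 [:: z.2; z.1; z.2 - z.1] k.

Lemma ord3P (P : 'I_3 -> Prop) :
  P o3_0 -> P o3_1 -> P o3_2 -> forall k, P k.
Proof.
move=> P0 P1 P2 [[|[|[|//]]] i].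
- by rewrite (_ : Ordinal i = o3_0)//; exact: val_inj.
- by rewrite (_ : Ordinal i = o3_1)//; exact: val_inj.
- by rewrite (_ : Ordinal i = o3_2)//; exact: val_inj.
Qed.

Lemma lin_coor k z : lin k (scoor k z) (tcoor k z) = z.
Proof.
by elim/ord3P: k; rewrite /lin/= -?surjective_pairing// addrC subrK -surjective_pairing.
Qed.

Lemma scoor_lin k s t : scoor k (lin k s t) = s.
Proof. by elim/ord3P: k. Qed.

Lemma tcoor_lin k s t : tcoor k (lin k s t) = t.
Proof. by elim/ord3P: k => //=; rewrite /tcoor/lin/= addrC addKr. Qed.

Lemma lin_shift k s t h :
  lin k (s + h) t = ((lin k s t).1 + h * (dirv k).1, (lin k s t).2 + h * (dirv k).2).
Proof. by elim/ord3P: k; rewrite /lin/dirv/= ?mulr1 ?mulr0 ?addr0// addrAC. Qed.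

Lemma measurable_tcoor k : measurable_fun setT (tcoor k).
Proof.
elim/ord3P: k; rewrite /tcoor/=; [exact: measurable_snd|exact: measurable_fst|].
by apply: measurable_funB; [exact: measurable_snd|exact: measurable_fst].
Qed.

Lemma measurable_lin k : measurable_fun setT (fun z => lin k z.1 z.2).
Proof.
elim/ord3P: k; rewrite /lin/=.
- by apply: measurable_fun_pair; [exact: measurable_fst|exact: measurable_snd].
- by apply: measurable_fun_pair; [exact: measurable_snd|exact: measurable_fst].
- apply: measurable_fun_pair; first exact: measurable_fst.
  by apply: measurable_funD; [exact: measurable_fst|exact: measurable_snd].
Qed.

Lemma tonelli_snd (f : R * R -> \bar R) : measurable_fun setT f ->
  (forall z, (0 <= f z)%E) ->
  (\int[AR]_z f z = \int[mu]_t \int[mu]_s f (s, t))%E.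
Proof.
move=> mf f0.
exact: (@fubini_tonelli2 _ _ (measurableTypeR R) (measurableTypeR R) R mu mu f mf f0).
Qed.

Lemma tonelli_fst (f : R * R -> \bar R) : measurable_fun setT f ->
  (forall z, (0 <= f z)%E) ->
  (\int[AR]_z f z = \int[mu]_t \int[mu]_s f (t, s))%E.
Proof.
move=> mf f0.
exact: (@fubini_tonelli1 _ _ (measurableTypeR R) (measurableTypeR R) R mu mu f mf f0).
Qed.

Lemma measurable_lin_integral k (f : R * R -> \bar R) :
  measurable_fun setT f -> (forall z, (0 <= f z)%E) ->
  measurable_fun setT (fun t => \int[mu]_s f (lin k s t))%E.
Proof.
move=> mf f0; have mfl : measurable_fun setT (f \o (fun z => lin k z.1 z.2)).
  by apply: measurableT_comp => //; exact: measurable_lin.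
exact: (@measurable_fun_fubini_tonelli_G _ _ (measurableTypeR R) (measurableTypeR R) R mu _ mfl (fun x => f0 _)).
Qed.

(** Only the diagonal needs an argument: the shear is absorbed by translating the inner integral,
    after which the order of integration is exchanged. *)
Lemma ge0_area_fubini k (f : R * R -> \bar R) :
  measurable_fun setT f -> (forall z, (0 <= f z)%E) ->
  (\int[AR]_z f z = \int[mu]_t \int[mu]_s f (lin k s t))%E.
Proof.
move=> mf f0; elim/ord3P: k.
- exact: tonelli_snd.
- exact: tonelli_fst.
have mfl : measurable_fun setT (f \o (fun z => lin o3_2 z.1 z.2)).
  by apply: measurableT_comp => //; exact: measurable_lin.
rewrite tonelli_fst; [|by []|by []].
transitivity (\int[mu]_x \int[mu]_y (f \o (fun z => lin o3_2 z.1 z.2)) (x, y))%E.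
  apply: eq_integral => x _; rewrite -(@ge0_integral_translate _ x (fun y => f (x, y)))//.
  exact: (measurableT_comp mf (measurable_pair1 x)).
rewrite -(tonelli_fst mfl)//; last by move=> z; exact: f0.
by rewrite (tonelli_snd mfl)//; move=> z; exact: f0.
Qed.

Lemma area_fubini k (f : R * R -> R) :
  AR.-integrable setT (EFin \o f) ->
  (\int[AR]_z (f z)%:E = \int[mu]_t \int[mu]_s (f (lin k s t))%:E)%E.
Proof.
move=> intf; have mf := measurable_int _ intf.
have mfl : measurable_fun setT ((EFin \o f) \o (fun z => lin k z.1 z.2)).
  by apply: measurableT_comp => //; exact: measurable_lin.
(* The change of variables for nonnegative functions; it gives integrability of the composition and
   is then applied to the positive and negative parts. *)
have P (g : R * R -> \bar R) : measurable_fun setT g -> (forall z, (0 <= g z)%E) ->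
    (\int[AR]_z g z = \int[AR]_z g (lin k z.1 z.2))%E.
  move=> mg g0; rewrite (@ge0_area_fubini k)// tonelli_snd//.
  by apply: measurableT_comp => //; exact: measurable_lin.
have intfl : AR.-integrable setT ((EFin \o f) \o (fun z => lin k z.1 z.2)).
  apply/integrableP; split => //.
  move/integrableP : intf => [_].
  by rewrite (P (fun z => `|(EFin \o f) z|)%E)//; exact: measurableT_comp.
have e2 := @integral21_prod_meas1 _ _ (measurableTypeR R) (measurableTypeR R) R mu mu _ intfl.
transitivity (\int[AR]_z (((EFin \o f) \o (fun z => lin k z.1 z.2)) z))%E; last first.
  by rewrite -[LHS]e2; apply: eq_integral.
rewrite [LHS]integralE [RHS]integralE.
rewrite P//; last exact: measurable_funepos.
rewrite [X in (_ - X)%E]P//; last exact: measurable_funeneg.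
by congr (_ - _)%E; apply: eq_integral => x _; rewrite ?funeposE ?funenegE.
Qed.

(** Two of the three directions always have determinant 1 or -1, so in the coordinates [tcoor k],
    [tcoor k'] the area is again a product. This is the product step of the Gagliardo-Nirenberg
    argument in [local_sobolev]. *)
Lemma area_prod k k' (A B : R -> \bar R) : k != k' ->
  measurable_fun setT A -> measurable_fun setT B ->
  (forall t, (0 <= A t)%E) -> (forall t, (0 <= B t)%E) ->
  (\int[AR]_z (A (tcoor k z) * B (tcoor k' z)) = \int[mu]_t A t * \int[mu]_t B t)%E.
Proof.
wlog : k k' A B / (k < k')%N.
  move=> H kk' mA mB A0 B0; move: (kk'); rewrite -val_eqE neq_ltn => /orP[k1|k1].
    exact: H.
  rewrite muleC -(H k' k)//; last by rewrite eq_sym.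
  by apply: eq_integral => z _; rewrite muleC.
move=> kk' _ mA mB A0 B0.
have mAB : measurable_fun setT (fun z => A (tcoor k z) * B (tcoor k' z))%E.
  by apply: emeasurable_funM; apply: measurableT_comp => //; exact: measurable_tcoor.
have AB0 z : (0 <= A (tcoor k z) * B (tcoor k' z))%E by exact: mule_ge0.
have IA : (0 <= \int[mu]_t A t)%E by exact: integral_ge0.
have IB : (0 <= \int[mu]_t B t)%E by exact: integral_ge0.
rewrite (@ge0_area_fubini k')// muleC -ge0_integralZr//.
apply: eq_integral => t _.
under eq_integral do rewrite tcoor_lin muleC.
rewrite ge0_integralZl//; last first.
  apply: measurableT_comp => //; apply: (measurableT_comp (measurable_tcoor k)).
  exact: (measurableT_comp (measurable_lin k') (measurable_pair2 t)).
congr (_ * _)%E; move: k k' kk' {mAB AB0}.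
apply: ord3P; apply: ord3P => //= _; rewrite /tcoor/lin//=.
under eq_integral do rewrite addrC.
exact: ge0_integral_translate.
Qed.

End directions.

(** * Functions that are C^1 off finitely many lines *)

Section piecewise_C1.
Variables (R : realType) (Om : smooth_domain R).
Notation AR := (area_measure R).
Notation cl := (clos Om).
Implicit Types (f g h : R * R -> R) (x y d : R * R).

Definition I f : R := \int[AR]_(x in (Om : set (R * R))) f x.

Definition intg f : Prop := AR.-integrable (Om : set (R * R)) (EFin \o f).

Definition bm f : Prop :=
  measurable_fun (Om : set (R * R)) f /\ exists M : R, forall x, dom Om x -> `|f x| <= M.

Lemma measurable_dom : measurable (Om : set (R * R)).
Proof. exact: open_measurable2 (@dom_open _ Om). Qed.

Lemma enorm_ge (v : R * R) : `|v.1| <= enorm v /\ `|v.2| <= enorm v.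
Proof.
rewrite /enorm; split; rewrite -sqrtr_sqr; apply: ler_wsqrtr.
  by rewrite lerDl sqr_ge0.
by rewrite lerDr sqr_ge0.
Qed.

Lemma cl_bounded : exists2 M : R, 0 < M & forall x, cl x -> `|x.1| <= M /\ `|x.2| <= M.
Proof.
have [M HM] := @dom_bounded _ Om.
exists (`|M| + 1); first by rewrite ltr_wpDl.
move=> x clx; have /clx[y [Omy [y1 y2]]] : nbhs x (ball x (1 : R)) by exact: nbhsx_ballx.
have [h1 h2] := enorm_ge y; have := HM _ Omy => h3; have := ler_norm M => h4.
rewrite /ball/= in y1 y2.
have := ler_normD (x.1 - y.1) y.1; have := ler_normD (x.2 - y.2) y.2; rewrite !subrK => h5 h6.
by split; lra.
Qed.

Lemma compact_cl : compact cl.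
Proof.
have [M M0 HM] := cl_bounded.
apply: (@subclosed_compact _ _ (`[- M, M]%classic `*` `[- M, M]%classic)).
- exact: closed_closure.
- by apply: compact_setX; exact: segment_compact.
- by move=> x /HM[]; rewrite !ler_norml => h1 h2; split; rewrite /= in_itv.
Qed.

Lemma dom_cl x : dom Om x -> cl x.
Proof. exact: subset_closure. Qed.

Lemma area_dom_lty : (AR (Om : set (R * R)) < +oo)%E.
Proof.
have [M M0 HM] := cl_bounded.
by apply: (@area_bounded_lty _ _ M); [exact: measurable_dom|move=> x /dom_cl/HM].
Qed.

Lemma bm_intg f : bm f -> intg f.
Proof.
move=> [mf [M HM]]; apply: measurable_bounded_integrable => //.
- exact: measurable_dom.
- exact: area_dom_lty.
exists M; split; first exact: num_real.
by move=> N MN x Omx; apply: le_trans (ltW MN); exact: HM.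
Qed.

Lemma cont_cl_bounded f : {within cl, continuous f} ->
  exists2 M : R, 0 < M & forall x, cl x -> `|f x| <= M.
Proof.
move=> cf; have := continuous_compact cf compact_cl => /compact_bounded[M [_ HM]].
exists (`|M| + 1); first by rewrite ltr_wpDl.
move=> x clx; apply: (HM (`|M| + 1)); last by exists x.
by have := ler_norm M; lra.
Qed.

Lemma cont_cl_bm f : {within cl, continuous f} -> bm f.
Proof.
move=> cf; split; last by have [M _ HM] := cont_cl_bounded cf; exists M => x /dom_cl/HM.
by apply: open_within_measurable cf; [exact: dom_open|move=> x /dom_cl].
Qed.

Lemma bm_cst (c : R) : bm (fun=> c).
Proof. by split; [exact: measurable_cst|exists `|c|]. Qed.

Lemma bm_add f g : bm f -> bm g -> bm (fun x => f x + g x).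
Proof.
move=> [mf [M HM]] [mg [N HN]]; split; first exact: measurable_funD.
by exists (M + N) => x Ox; rewrite (le_trans (ler_normD _ _))// lerD// ?HM ?HN.
Qed.

Lemma bm_mul f g : bm f -> bm g -> bm (fun x => f x * g x).
Proof.
move=> [mf [M HM]] [mg [N HN]]; split; first exact: measurable_funM.
by exists (M * N) => x Ox; rewrite normrM ler_pM// ?HM ?HN.
Qed.

Lemma bm_norm f : bm f -> bm (fun x => `|f x|).
Proof.
move=> [mf [M HM]]; split; first exact: measurableT_comp.
by exists M => x Ox; rewrite normr_id HM.
Qed.

Lemma bm_opp f : bm f -> bm (fun x => - f x).
Proof.
move=> /(bm_mul (bm_cst (-1))).
by rewrite (_ : (fun x => -1 * f x) = (fun x => - f x))//; apply/funext => x; rewrite mulN1r.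
Qed.

Lemma bm_sub f g : bm f -> bm g -> bm (fun x => f x - g x).
Proof. by move=> bf /bm_opp bg; exact: bm_add. Qed.

Lemma bm_exp f n : bm f -> bm (fun x => f x ^+ n).
Proof.
move=> bf; elim: n => [|n IH]; first exact: bm_cst.
by under eq_fun do rewrite exprS; exact: bm_mul.
Qed.

Lemma bm_sum (J : Type) (r : seq J) (F : J -> R * R -> R) : (forall j, bm (F j)) ->
  bm (fun x => \sum_(j <- r) F j x).
Proof.
move=> bF; elim: r => [|j r IH].
  by under eq_fun do rewrite big_nil; exact: bm_cst.
by under eq_fun do rewrite big_cons; exact: bm_add.
Qed.

(** Derivatives along straight lines only: this is what the fundamental theorem on lines uses, and
    sums, products and compositions then follow from one-variable calculus. *)
Definition der_at g x (p q : R) : Prop := forall d : R * R,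
  is_derive (0 : R) (1 : R) (fun s => g (x.1 + s * d.1, x.2 + s * d.2))
    (p * d.1 + q * d.2).

(** A triple ((a, b), c) stands for the line a x_1 + b x_2 = c; [lines] rules out equations with a =
    b = 0, which might exclude every point. *)
Definition off (Z : seq (R * R * R)) x : Prop :=
  forall l, l \in Z -> l.1.1 * x.1 + l.1.2 * x.2 != l.2.

Definition lines (Z : seq (R * R * R)) : Prop := forall l, l \in Z -> l.1 != (0, 0).

(* Continuous up to the boundary, and C^1 inside off finitely many lines, with
   bounded partial derivatives g1 and g2. *)
Record PC1 g g1 g2 : Prop := MkPC1 {
  pc_cont : {within cl, continuous g};
  pc_bm1 : bm g1;
  pc_bm2 : bm g2;
  pc_der : exists Z, lines Z /\ forall x, dom Om x -> off Z x ->
    [/\ der_at g x (g1 x) (g2 x), {for x, continuous g1} & {for x, continuous g2}] }.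

Lemma within_dom_cont g x : {within cl, continuous g} -> dom Om x -> {for x, continuous g}.
Proof.
move=> /subspace_continuousP cg Ox; have cx := cg x (dom_cl Ox).
apply: cvg_trans cx; apply: cvg_app => A nA0.
have nA : nbhs x [set y | cl y -> A y] := nA0.
have nO : nbhs x (Om : set (R * R)) by apply: open_nbhs_nbhs; split => //; exact: dom_open.
by apply: filterS2 nA nO => y + /dom_cl; apply.
Qed.

Lemma off_cat Z Z' x : off (Z ++ Z') x -> off Z x /\ off Z' x.
Proof. by move=> H; split => l lZ; apply: H; rewrite mem_cat lZ ?orbT. Qed.

Lemma lines_cat Z Z' : lines Z -> lines Z' -> lines (Z ++ Z').
Proof. by move=> H H' l; rewrite mem_cat => /orP[/H|/H']. Qed.

Lemma der_at_add g h x p q p' q' : der_at g x p q -> der_at h x p' q' ->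
  der_at (fun y => g y + h y) x (p + p') (q + q').
Proof.
move=> dg dh d; have := dg d; have := dh d => ? ?.
by apply: is_derive_eq; ring.
Qed.

Lemma der_at_mul g h x p q p' q' : der_at g x p q -> der_at h x p' q' ->
  der_at (fun y => g y * h y) x (g x * p' + h x * p) (g x * q' + h x * q).
Proof.
move=> dg dh d; have dg' := dg d; have dh' := dh d.
have := is_deriveM dg' dh'; rewrite !mul0r !addr0 -!surjective_pairing.
by move=> H; apply: (is_derive_eq H); rewrite /GRing.scale/=; ring.
Qed.

Lemma der_at_comp (phi : R -> R) g x p q (l : R) : der_at g x p q ->
  is_derive (g x) 1 phi l -> der_at (fun y => phi (g y)) x (l * p) (l * q).
Proof.
move=> dg dphi d; have dg' := dg d.
have dphi' : is_derive ((fun s => g (x.1 + s * d.1, x.2 + s * d.2)) 0) 1 phi l.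
  by rewrite /= !mul0r !addr0 -surjective_pairing.
have := is_derive1_comp (x := 0 : R) (g := (fun s => g (x.1 + s * d.1, x.2 + s * d.2))) (f := phi).
by move=> /(_ _ _ dphi' dg') H; apply: is_derive_eq; rewrite /GRing.scale/=; ring.
Qed.

Lemma PC1_add g g1 g2 h h1 h2 : PC1 g g1 g2 -> PC1 h h1 h2 ->
  PC1 (fun x => g x + h x) (fun x => g1 x + h1 x) (fun x => g2 x + h2 x).
Proof.
move=> [cg b1 b2 [Z [lZ HZ]]] [ch b1' b2' [Z' [lZ' HZ']]]; split.
- by move=> x; apply: cvgD; [exact: cg|exact: ch].
- exact: bm_add.
- exact: bm_add.
- exists (Z ++ Z'); split; first exact: lines_cat.
  move=> x Ox /off_cat[/(HZ _ Ox)[? ? ?] /(HZ' _ Ox)[? ? ?]].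
  by split; [exact: der_at_add|exact: cvgD|exact: cvgD].
Qed.

Lemma PC1_mul g g1 g2 h h1 h2 : PC1 g g1 g2 -> PC1 h h1 h2 ->
  PC1 (fun x => g x * h x) (fun x => g x * h1 x + h x * g1 x)
      (fun x => g x * h2 x + h x * g2 x).
Proof.
move=> [cg b1 b2 [Z [lZ HZ]]] [ch b1' b2' [Z' [lZ' HZ']]].
have bg := cont_cl_bm cg; have bh := cont_cl_bm ch; split.
- by move=> x; apply: cvgM; [exact: cg|exact: ch].
- by apply: bm_add; exact: bm_mul.
- by apply: bm_add; exact: bm_mul.
- exists (Z ++ Z'); split; first exact: lines_cat.
  move=> x Ox /off_cat[/(HZ _ Ox)[? ? ?] /(HZ' _ Ox)[? ? ?]].
  have cgx := within_dom_cont cg Ox; have chx := within_dom_cont ch Ox.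
  by split; [exact: der_at_mul|apply: cvgD; apply: cvgM|apply: cvgD; apply: cvgM].
Qed.

Lemma PC1_comp (phi phi' : R -> R) g g1 g2 : PC1 g g1 g2 ->
  (forall x, cl x -> is_derive (g x) 1 phi (phi' (g x))) ->
  (forall x, cl x -> {for g x, continuous phi'}) ->
  PC1 (fun x => phi (g x)) (fun x => phi' (g x) * g1 x) (fun x => phi' (g x) * g2 x).
Proof.
move=> [cg b1 b2 [Z [lZ HZ]]] dphi cphi'.
have C (psi : R -> R) : (forall x, cl x -> {for g x, continuous psi}) ->
    {within cl, continuous (fun x => psi (g x))}.
  move=> cpsi; apply/subspace_continuousP => x clx.
  apply: (cvg_comp _ _ ((subspace_continuousP _ _).1 cg x clx)); exact: cpsi.
have cphi x : cl x -> {for g x, continuous phi}.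
  by move=> clx; apply/differentiable_continuous/derivable1_diffP; have := dphi x clx; case.
split.
- exact: C.
- by apply: bm_mul => //; apply: cont_cl_bm; exact: C.
- by apply: bm_mul => //; apply: cont_cl_bm; exact: C.
- exists Z; split => // x Ox offx; have [? ? ?] := HZ x Ox offx.
  have cc : {for x, continuous (fun x => phi' (g x))}.
    by apply: within_dom_cont Ox; exact: C.
  split; [|exact: cvgM|exact: cvgM].
  by apply: der_at_comp => //; apply: dphi; exact: dom_cl.
Qed.

Lemma PC1_cst (c : R) : PC1 (fun=> c) (fun=> 0) (fun=> 0).
Proof.
split; [|exact: bm_cst|exact: bm_cst|].
- by move=> x; exact: cvg_cst.
- exists [::]; split => // x _ _; split; [|exact: cvg_cst|exact: cvg_cst].
  by move=> d; apply: is_derive_eq; rewrite !mul0r addr0.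
Qed.

Lemma PC1_fst : PC1 (fun x => x.1) (fun=> 1) (fun=> 0).
Proof.
split; [|exact: bm_cst|exact: bm_cst|].
- by apply: continuous_subspaceT => x; exact: cvg_fst.
- exists [::]; split => // x _ _; split; [|exact: cvg_cst|exact: cvg_cst].
  by move=> d; apply: is_derive_eq; rewrite /GRing.scale/=; ring.
Qed.

Lemma PC1_snd : PC1 (fun x => x.2) (fun=> 0) (fun=> 1).
Proof.
split; [|exact: bm_cst|exact: bm_cst|].
- by apply: continuous_subspaceT => x; exact: cvg_snd.
- exists [::]; split => // x _ _; split; [|exact: cvg_cst|exact: cvg_cst].
  by move=> d; apply: is_derive_eq; rewrite /GRing.scale/=; ring.
Qed.

Lemma PC1_ext g g1 g2 h h1 h2 : PC1 g g1 g2 -> g =1 h -> g1 =1 h1 -> g2 =1 h2 -> PC1 h h1 h2.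
Proof. by move=> H /funext <- /funext <- /funext <-. Qed.

Lemma PC1_scale (c : R) g g1 g2 : PC1 g g1 g2 ->
  PC1 (fun x => c * g x) (fun x => c * g1 x) (fun x => c * g2 x).
Proof.
move=> /(PC1_mul (PC1_cst c))/PC1_ext; apply=> x //=; by rewrite mulr0 addr0.
Qed.

Lemma PC1_opp g g1 g2 : PC1 g g1 g2 ->
  PC1 (fun x => - g x) (fun x => - g1 x) (fun x => - g2 x).
Proof. by move=> /(PC1_scale (-1))/PC1_ext; apply=> x; rewrite mulN1r. Qed.

Lemma PC1_sub g g1 g2 h h1 h2 : PC1 g g1 g2 -> PC1 h h1 h2 ->
  PC1 (fun x => g x - h x) (fun x => g1 x - h1 x) (fun x => g2 x - h2 x).
Proof. by move=> H /PC1_opp; exact: PC1_add. Qed.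

Lemma PC1_exp g g1 g2 n : PC1 g g1 g2 ->
  PC1 (fun x => g x ^+ n.+1) (fun x => n.+1%:R * g x ^+ n * g1 x)
      (fun x => n.+1%:R * g x ^+ n * g2 x).
Proof.
move=> H; apply: (@PC1_comp (fun u => u ^+ n.+1) (fun u => n.+1%:R * u ^+ n)) => // x _.
  have H' := is_deriveX n.+1 (is_derive_id (g x) (1 : R)).
  have <- : (id : R -> R) ^+ n.+1 = (fun u => u ^+ n.+1) by apply/funext => u; rewrite exprfctE.
  by apply: (is_derive_eq H'); rewrite /GRing.scale/= mulr1.
by apply: cvgM; [exact: cvg_cst|exact: exprn_continuous].
Qed.

Lemma PC1_inv g g1 g2 : PC1 g g1 g2 -> (forall x, cl x -> g x != 0) ->
  PC1 (fun x => (g x)^-1) (fun x => - (g x) ^- 2 * g1 x) (fun x => - (g x) ^- 2 * g2 x).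
Proof.
move=> H g0; apply: (@PC1_comp (fun u => u^-1) (fun u => - u ^- 2)) => // x clx.
  have g0' := g0 x clx.
  have := is_deriveV (x := g x) (v := 1 : R) (f := (id : R -> R)) g0'.
  by move=> /(_ _ _) H'; apply: is_derive_eq; rewrite /GRing.scale/= mulr1.
by apply: cvgN; apply: cvgV; [rewrite expf_neq0// g0|exact: exprn_continuous].
Qed.

Lemma smooth_PC1 (phi : R * R -> R) : smooth phi ->
  PC1 phi (pderiv 1 0 phi) (pderiv 0 1 phi).
Proof.
move=> sphi.
have C a b : {within cl, continuous (pderiv a b phi)}.
  by apply: continuous_subspaceT => x; apply: differentiable_continuous; exact: sphi.
split; [exact: (C 0 0)%N|exact: cont_cl_bm|exact: cont_cl_bm|].
exists [::]; split => // x _ _; split; last 2 first.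
- by apply: differentiable_continuous; exact: sphi.
- by apply: differentiable_continuous; exact: sphi.
move=> d; have dx : differentiable phi x by exact: (sphi 0 0)%N.
have dd : derivable phi x d by exact: diff_derivable.
pose F (s : R) := phi (x.1 + s * d.1, x.2 + s * d.2).
have E : (fun r : R => r^-1 *: ((F \o shift 0) (r *: (1 : R)) - F 0)) =
   (fun r : R => r^-1 *: ((phi \o shift x) (r *: d) - phi x)).
  apply/funext => r; rewrite /F/= addr0 !mul0r !addr0 -surjective_pairing; congr (_ *: (phi _ - _)).
  by rewrite (addrC (r *: d)); congr pair; rewrite /= /GRing.scale/= mulr1.
change (is_derive (0 : R) (1 : R) F (pderiv 1 0 phi x * d.1 + pderiv 0 1 phi x * d.2)).
apply: DeriveDef; first by rewrite /derivable E.
rewrite /derive E -[LHS]/('D_d phi x) deriveE//.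
rewrite /pderiv/= !deriveE//.
have -> : d = d.1 *: (1, 0) + d.2 *: (0, 1).
  by rewrite [LHS]surjective_pairing; congr pair; rewrite /= /GRing.scale/= ?mulr1 ?mulr0 ?addr0 ?add0r.
by rewrite linearD !linearZ /= /GRing.scale/= !(mulr1, mulr0, addr0, add0r); ring.
Qed.

End piecewise_C1.

Ltac bmt := repeat first [assumption | apply: bm_cst | apply: bm_add | apply: bm_sub | apply: bm_mul | apply: bm_exp | apply: bm_norm
  | apply: bm_opp | eapply pc_bm1; eassumption | eapply pc_bm2; eassumption | apply: cont_cl_bm; eapply pc_cont; eassumption].

(** * Green's formula and sup bounds in a box where the domain lies on one side of a graph *)

Section local_green.
Variables (R : realType) (Om : smooth_domain R).
Notation mu := (@lebesgue_measure R).
Notation AR := (area_measure R).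
Notation cl := (clos Om).
Notation PC1 := (@PC1 R Om).
Notation bm := (@bm R Om).
Implicit Types (k : 'I_3) (g : R * R -> R) (x y z p : R * R).

Definition dk k g1 g2 z := g1 z * (dirv R k).1 + g2 z * (dirv R k).2.

Lemma bm_dk k g1 g2 : bm g1 -> bm g2 -> bm (dk k g1 g2).
Proof. by move=> b1 b2; apply: bm_add; apply: bm_mul => //; exact: bm_cst. Qed.

(** A line of [Z] parallel to [dirv k] is avoided by excluding a single t; any other line meets each
    line of that direction in a single s. *)
Lemma line_off k Z : lines Z -> exists T : seq R, forall t, t \notin T ->
  exists S : seq R, forall s, s \notin S -> off Z (lin k s t).
Proof.
elim: Z => [|[[a b] c] Z IH] lZ.
  by exists [::] => t _; exists [::].
have [T HT] := IH (fun l lZ' => lZ l (mem_behead (s := (a, b, c) :: Z) lZ')).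
have ab0 : (a, b) != (0, 0) by apply: (lZ (a, b, c)); exact: mem_head.
pose al := a * (dirv R k).1 + b * (dirv R k).2.
pose be := a * (lin k 0 1).1 + b * (lin k 0 1).2.
have E s t : a * (lin k s t).1 + b * (lin k s t).2 = al * s + be * t.
  by rewrite /al /be; move: k {IH HT al be}; apply: ord3P; rewrite /lin/dirv/=; ring.
have [al0|al0] := eqVneq al 0.
  have be0 : be != 0.
    apply: contraNneq ab0 => be0; move: al0 be0; rewrite /al/be; clear -a b.
    by elim/ord3P: k; rewrite /lin/dirv/= ?(mulr0, mulr1, add0r, addr0);
      [move=> -> ->|move=> -> ->|move=> h1 h2; rewrite h2 addr0 in h1; rewrite h1 h2].
  exists (c / be :: T) => t; rewrite inE negb_or => /andP[tc tT].
  have [S HS] := HT t tT; exists S => s sS l; rewrite inE => /predU1P[->/=|lZ'].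
    by rewrite E al0 mul0r add0r; apply: contraNneq tc => <-; rewrite mulrAC mulfV// mul1r.
  exact: HS.
exists T => t tT; have [S HS] := HT t tT; exists ((c - be * t) / al :: S) => s.
rewrite inE negb_or => /andP[sc sS] l; rewrite inE => /predU1P[->/=|lZ'].
  by rewrite E; apply: contraNneq sc => <-; rewrite addrK mulrAC mulfV// mul1r.
exact: HS.
Qed.

Lemma continuous_lin_s k t : continuous (fun s : R => lin k s t).
Proof.
move=> s A /nbhs_box[e e0 eA].
have : \forall r \near s, ball s e r by exact: nbhsx_ballx.
apply: filterS => r sr; apply: eA; elim/ord3P: k; rewrite /lin/= ?subrr ?normr0//.
by rewrite opprD addrACA subrr addr0.
Qed.

Lemma measurable_fun_linR k g t : measurable_fun setT g -> measurable_fun setT (fun s => g (lin k s t)).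
Proof.
move=> mf; have mfl : measurable_fun setT (g \o (fun z => lin k z.1 z.2)).
  by apply: measurableT_comp => //; exact: measurable_lin.
exact: (measurableT_comp mfl (measurable_pair2 t)).
Qed.

Definition ext0 g : R * R -> R := g \_ (Om : set (R * R)).

Lemma ext0_in g z : dom Om z -> ext0 g z = g z.
Proof. by move=> Oz; rewrite /ext0 patchE mem_set. Qed.

Lemma ext0_out g z : ~ dom Om z -> ext0 g z = 0.
Proof. by move=> Oz; rewrite /ext0 patchE memNset. Qed.

Lemma measurable_ext0 g : bm g -> measurable_fun setT (ext0 g).
Proof. by move=> [mg _]; apply/(measurable_restrictT _ (measurable_dom Om)). Qed.

Lemma ext0_bounded g : bm g -> exists2 M : R, 0 < M & forall z, `|ext0 g z| <= M.
Proof.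
move=> [_ [M HM]]; exists (`|M| + 1); first by rewrite ltr_wpDl.
move=> z; have := ler_norm M; have [Oz|Oz] := pselect (dom Om z).
  by rewrite ext0_in//; have := HM z Oz; lra.
by rewrite ext0_out// normr0; have := normr_ge0 M; lra.
Qed.

Lemma ext0_intg g : bm g -> AR.-integrable setT (EFin \o ext0 g).
Proof.
by move=> /bm_intg; rewrite /intg integrable_mkcond//; [rewrite restrict_EFin|exact: measurable_dom].
Qed.

Lemma I_ext0 g : bm g -> (I Om g)%:E = (\int[AR]_z (ext0 g z)%:E)%E.
Proof.
move=> bg; rewrite /I Rintegral_mkcond /Rintegral fineK//.
by apply: integrable_fin_num => //; exact: ext0_intg.
Qed.

Lemma ftc_line k g g1 g2 : PC1 g g1 g2 -> exists T : seq R, forall t, t \notin T ->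
  forall a b, a <= b -> (forall s, a <= s <= b -> cl (lin k s t)) ->
  (forall s, a < s < b -> dom Om (lin k s t)) ->
  \int[mu]_(s in `[a, b]) ext0 (dk k g1 g2) (lin k s t) = g (lin k b t) - g (lin k a t).
Proof.
move=> [cg b1 b2 [Z [lZ HZ]]]; have [T HT] := line_off k lZ; exists T => t tT.
have [S HS] := HT t tT => a b ab clab Oab.
have bF := bm_dk k b1 b2; have [M M0 HM] := ext0_bounded bF.
apply: (@FTC_finite _ S (fun s => g (lin k s t)) (fun s => ext0 (dk k g1 g2) (lin k s t)) a b M) => //.
- apply/subspace_continuousP => s; rewrite /= in_itv/= => sab.
  have := (subspace_continuousP _ _).1 cg (lin k s t) (clab s sab).
  apply: cvg_trans => A /= nA.
  have nA' : nbhs (lin k s t) [set y | cl y -> A (g y)] := nA.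
  have nB : nbhs s [set r | cl (lin k r t) -> A (g (lin k r t))].
    exact: (@continuous_lin_s k t s _ nA').
  apply: filterS nB => r /= Hr; rewrite in_itv/= => rab; apply: Hr; exact: clab.
- by apply: measurable_funS (measurable_fun_linR k t (measurable_ext0 bF)).
- move=> s; rewrite in_itv/= => sab sS.
  have Os := Oab s sab; have offs := HS s sS.
  have [dg cg1 cg2] := HZ _ Os offs; split.
    rewrite ext0_in//; have := dg (dirv R k) => D.
    have -> : (fun s => g (lin k s t)) = 
      (fun r => g ((lin k s t).1 + r * (dirv R k).1, (lin k s t).2 + r * (dirv R k).2)) \o center s.
      by apply/funext => r /=; rewrite -lin_shift subrKC.
    have D' : is_derive (center s s) 1 (fun r => g ((lin k s t).1 + r * (dirv R k).1, (lin k s t).2 + r * (dirv R k).2)) (dk k g1 g2 (lin k s t)).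
      by rewrite /= subrr.
    have dc : is_derive s 1 (center s) 1 by apply: is_derive_eq; rewrite subr0.
    have H := is_derive1_comp D' dc.
    by apply: (is_derive_eq H); rewrite /GRing.scale/= mulr1.
  have nO : nbhs (lin k s t) (Om : set (R * R)) by apply: open_nbhs_nbhs; split => //; exact: dom_open.
  have nO' : \forall r \near s, dom Om (lin k r t) by exact: (@continuous_lin_s k t s _ nO).
  have : {for s, continuous (fun r => dk k g1 g2 (lin k r t))}.
    have H : {for lin k s t, continuous (dk k g1 g2)}.
      by apply: cvgD; apply: cvgM => //; exact: cvg_cst.
    exact: (cvg_comp _ _ (@continuous_lin_s k t s) H).
  rewrite /prop_for/continuous_at ext0_in// => H; apply: cvg_trans H.
  by apply: near_eq_cvg; near=> r; rewrite ext0_in//; near: r.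
Unshelve. all: by end_near. Qed.

Lemma finite_seq_measurable (S : seq R) : measurable [set` S].
Proof.
elim: S => [|c S IH]; first by rewrite (_ : [set` [::]] = set0)//; apply/seteqP; split.
have -> : [set` c :: S] = [set c] `|` [set` S].
  by apply/seteqP; split => x /=; rewrite inE => /predU1P.
by apply: measurableU => //; exact: measurable_set1.
Qed.

Lemma dist_ge_l (x a e : R) : x <= a - e -> e <= `|x - a|.
Proof. by move=> h; rewrite distrC; apply: le_trans (ler_norm _); lra. Qed.

Lemma dist_ge_r (x a e : R) : a + e <= x -> e <= `|x - a|.
Proof. by move=> h; apply: le_trans (ler_norm _); lra. Qed.

Definition inbox k p (dl ep : R) z : Prop :=
  `|tcoor k z - tcoor k p| < dl /\ `|scoor k z - scoor k p| < ep.

(* In the box, [Om] is the part of the lines of direction [dirv k] that lies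
   before (sg = true) or after the graph of [G]. *)
Record halfbox k p (dl ep : R) (sg : bool) (G : R -> R) : Prop := HalfBox {
  hb_dl : 0 < dl;
  hb_ep : 0 < ep;
  hb_G : forall t, `|t - tcoor k p| < dl -> `|G t - scoor k p| <= ep;
  hb_dom : forall z, inbox k p dl ep z ->
    dom Om z <-> if sg then scoor k z < G (tcoor k z) else G (tcoor k z) < scoor k z;
  hb_cont : forall t, `|t - tcoor k p| < dl -> {for t, continuous G};
  hb_cl : forall t, `|t - tcoor k p| < dl -> cl (lin k (G t) t) }.

Definition supp_in k p (dl ep : R) g g1 g2 : Prop :=
  forall z, cl z -> ~ inbox k p dl ep z -> [/\ g z = 0, g1 z = 0 & g2 z = 0].

Lemma lin_integrable k t (F : R * R -> R) (a b : R) : bm F ->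
  mu.-integrable `[a, b] (EFin \o (fun s => ext0 F (lin k s t))).
Proof.
move=> bF; have [M M0 HM] := ext0_bounded bF.
apply: measurable_bounded_integrable => //; first exact: itvcc_lty.
  by apply: measurable_funS (measurable_fun_linR k t (measurable_ext0 bF)).
by exists M; split; [exact: num_real|move=> L ML x _; apply: le_trans (ltW ML)].
Qed.

Lemma lin_integral_itv k g g1 g2 : PC1 g g1 g2 -> exists T : seq R, forall t, t \notin T ->
  forall a b, a <= b -> (forall s, a <= s <= b -> cl (lin k s t)) ->
  (forall s, a < s < b -> dom Om (lin k s t)) ->
  (forall s, ~~ (a <= s <= b) -> ext0 (dk k g1 g2) (lin k s t) = 0) ->
  (\int[mu]_s (ext0 (dk k g1 g2) (lin k s t))%:E = (g (lin k b t) - g (lin k a t))%:E)%E.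
Proof.
move=> pg; have [T HT] := ftc_line k pg; exists T => t tT a b ab clab Oab F0.
rewrite -(HT t tT a b ab clab Oab).
have int := lin_integrable k t a b (bm_dk k (pc_bm1 pg) (pc_bm2 pg)).
rewrite /Rintegral fineK; last exact: integrable_fin_num.
rewrite [RHS]integral_mkcond; apply: eq_integral => s _; rewrite patchE.
case: ifPn => //; rewrite notin_setE/= in_itv/= => /negP /F0 ->//.
Qed.

(** On each line of direction [dirv k] the domain in the box is a half-line ending at the graph, so
    the fundamental theorem leaves the value on the graph: at the other end the function is already
    zero. The sign records at which end the graph is. *)
Lemma local_green k p dl ep dl' ep' sg G g g1 g2 :
  halfbox k p dl ep sg G -> dl' < dl -> ep' < ep ->
  PC1 g g1 g2 -> supp_in k p dl' ep' g g1 g2 ->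
  ((I Om (dk k g1 g2))%:E =
   \int[mu]_(t in `](tcoor k p - dl)%R, (tcoor k p + dl)%R[)
     ((-1) ^+ (~~ sg) * g (lin k (G t) t))%R%:E)%E.
Proof.
move=> hb dl'dl ep'ep pg sg0; have bF := bm_dk k (pc_bm1 pg) (pc_bm2 pg).
have mF := measurable_ext0 bF.
rewrite I_ext0// (area_fubini k (ext0_intg bF)) [RHS]integral_mkcond.
set t0 := tcoor k p; set s0 := scoor k p.
have nb1 : ep' <= `|s0 - ep' - s0| by rewrite addrAC subrr sub0r normrN ler_norm.
have nb2 : ep' <= `|s0 + ep' - s0| by rewrite addrAC subrr add0r ler_norm.
have [T HT] := lin_integral_itv k pg.
have in_t t : (t \in `]t0 - dl, t0 + dl[) = (`|t - t0| < dl).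
  by rewrite in_itv/= ltr_distl.
have F_out s t : ~ inbox k p dl' ep' (lin k s t) -> ext0 (dk k g1 g2) (lin k s t) = 0.
  move=> nin; have [Oz|Oz] := pselect (dom Om (lin k s t)); last by rewrite ext0_out.
  by rewrite ext0_in// /dk; have [_ -> ->] := sg0 _ (dom_cl Oz) nin; rewrite !mul0r addr0.
apply: ae_eq_integral => //.
- under eq_fun do rewrite integralE.
  have H (f : R * R -> \bar R) : measurable_fun setT f -> (forall z, (0 <= f z)%E) -> 
     measurable_fun setT (fun t => \int[mu]_s f (lin k s t))%E by exact: measurable_lin_integral.
  apply: emeasurable_funB; under eq_fun do
    under eq_integral do rewrite ?funeposE ?funenegE.
  + apply: (H (fun z => maxe (ext0 (dk k g1 g2) z)%:E 0)%E); last by move=> z; rewrite le_max lexx orbT.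
    by apply: measurable_maxe => //; exact/measurable_EFinP.
  + apply: (H (fun z => maxe (- ext0 (dk k g1 g2) z)%R%:E 0)%E); last by move=> z; rewrite le_max lexx orbT.
    by apply: measurable_maxe => //; apply/measurable_EFinP; exact: measurable_funN.
- suff mh : measurable_fun (`]t0 - dl, t0 + dl[%classic : set R) (fun t => (-1) ^+ (~~ sg) * g (lin k (G t) t)).
    have mh' : measurable_fun (`]t0 - dl, t0 + dl[%classic : set R) (fun t => ((-1) ^+ (~~ sg) * g (lin k (G t) t))%:E) by exact/measurable_EFinP.
    by have := (measurable_restrictT _ (measurable_itv `]t0 - dl, t0 + dl[)).1 mh'.
  apply: measurable_funM => //.
  apply: open_continuous_measurable_fun; first exact: interval_open.
  move=> t; rewrite inE/= in_t => tt0.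
  have cG := hb_cont hb tt0.
  move=> A /= nA.
  have cg := (subspace_continuousP _ _).1 (pc_cont pg) _ (hb_cl hb tt0).
  have nA' : nbhs (lin k (G t) t) [set y | cl y -> A (g y)] := cg _ nA.
  have cc : (fun t => lin k (G t) t) @ t --> lin k (G t) t.
    move=> B /nbhs_box[e e0 eB].
    have e2 : 0 < e / 2 by lra.
    have n1 : \forall r \near t, ball t (e / 2) r by exact: nbhsx_ballx.
    have n2 : \forall r \near t, ball (G t) (e / 2) (G r) by apply: cG; exact: nbhsx_ballx.
    apply: filterS2 n1 n2 => r; rewrite /ball/= !ltr_distl => /andP[r1 r2] /andP[r3 r4].
    by apply: eB; clear -r1 r2 r3 r4; case: (k) => [[|[|[|//]]] ?]; rewrite /lin/= ltr_distl; itvlra.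
  have n3 := cc _ nA'.
  have n4 : \forall r \near t, `|r - t0| < dl.
    have : nbhs t `]t0 - dl, t0 + dl[%classic.
      by apply: open_nbhs_nbhs; split; [exact: interval_open|rewrite /= in_t].
    by apply: filterS => r /=; rewrite in_t.
  have n3' : nbhs t [set r | cl (lin k (G r) r) -> A (g (lin k (G r) r))] := n3.
  by apply: filterS2 n3' n4 => r /= Hr rt; apply: Hr; exact: (hb_cl hb).
(* The two integrands in t agree off the finite list [T], a null set. *)
exists [set` T]; split.
- exact: finite_seq_measurable.
- by apply: countable_lebesgue_measure0; apply: finite_set_countable; exact: finite_seq.
move=> t /= /not_implyP[_ neq]; have [//|tT] := boolP (t \in T); exfalso; apply: neq.
rewrite patchE; case: ifPn; last first.
  rewrite notin_setE/= in_t => tt0; apply: integral0_eq => s _.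
  by rewrite F_out// => -[]; rewrite tcoor_lin => h _; apply: tt0; exact: (lt_trans h dl'dl).
rewrite inE/= in_t => tt0.
have := hb_G hb tt0; rewrite -/t0 -/s0 => Gs0.
have nbox s : ep' <= `|s - s0| -> ~ inbox k p dl' ep' (lin k s t).
  by move=> h [_]; rewrite scoor_lin ltNge h.
have hd s : `|s - s0| < ep -> dom Om (lin k s t) <-> if sg then s < G t else G t < s.
  move=> h; have := hb_dom hb (z := lin k s t).
  by rewrite scoor_lin tcoor_lin; apply; split; rewrite ?tcoor_lin ?scoor_lin.
have clG := hb_cl hb tt0.
have off s : (`|s - s0| < ep' -> ~ (if sg then s < G t else G t < s)) -> ext0 (dk k g1 g2) (lin k s t) = 0.
  have [ss _|ss h] := leP ep' `|s - s0|; first by rewrite F_out//; exact: nbox.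
  by rewrite ext0_out// hd; [exact: h|exact: lt_trans ep'ep].
case: (sg) hd off => hd off; rewrite ?expr0 ?expr1 ?mul1r ?mulN1r.
(* If the graph lies before the support, both sides vanish; otherwise the integrand lives exactly
   between [s0 - ep'] and [G t]. *)
- have [aG|Ga] := leP (s0 - ep') (G t); last first.
    have nbG : ep' <= `|G t - s0| by apply: dist_ge_l; lra.
    have [-> _ _] := sg0 _ clG (nbox _ nbG).
    apply: integral0_eq => s _; congr (_%:E).
    by apply: off; rewrite ltr_distl => /andP[? ?] ?; lra.
  have cla s : s0 - ep' <= s -> s < G t -> dom Om (lin k s t).
    by move=> h1 h2; apply/hd => //; move: Gs0; rewrite ler_distl ltr_distl => /andP[? ?]; itvlra.
  have clb s : s0 - ep' <= s <= G t -> cl (lin k s t).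
    move=> /andP[h1]; rewrite le_eqVlt => /predU1P[->//|h2]; apply: dom_cl; exact: cla.
  rewrite (HT t tT _ _ aG)//.
  + have clb0 : s0 - ep' <= s0 - ep' <= G t by rewrite lexx.
    by have [-> _ _] := sg0 _ (clb _ clb0) (nbox _ nb1); rewrite subr0.
  + by move=> s /andP[h1 h2]; apply: cla => //; exact: ltW.
  + move=> s; rewrite negb_and -!ltNge => /orP[h|h].
      by rewrite F_out//; apply: nbox; apply: dist_ge_l; lra.
    by apply: off => _ ?; lra.
- have [aG|Ga] := leP (G t) (s0 + ep'); last first.
    have nbG : ep' <= `|G t - s0| by apply: dist_ge_r; lra.
    have [-> _ _] := sg0 _ clG (nbox _ nbG).
    rewrite oppr0; apply: integral0_eq => s _; congr (_%:E).
    by apply: off; rewrite ltr_distl => /andP[? ?] ?; lra.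
  have cla s : G t < s -> s <= s0 + ep' -> dom Om (lin k s t).
    by move=> h1 h2; apply/hd => //; move: Gs0; rewrite ler_distl ltr_distl => /andP[? ?]; itvlra.
  have clb s : G t <= s <= s0 + ep' -> cl (lin k s t).
    move=> /andP[]; rewrite le_eqVlt => /predU1P[<-//|h2 h1]; apply: dom_cl; exact: cla.
  rewrite (HT t tT _ _ aG)//.
  + have clb0 : G t <= s0 + ep' <= s0 + ep' by rewrite lexx andbT.
    by have [-> _ _] := sg0 _ (clb _ clb0) (nbox _ nb2); rewrite sub0r.
  + by move=> s /andP[h1 h2]; apply: cla => //; exact: ltW.
  + move=> s; rewrite negb_and -!ltNge => /orP[h|h]; last first.
      by rewrite F_out//; apply: nbox; apply: dist_ge_r; lra.
    by apply: off => _ ?; lra.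
Qed.

Definition supbound k g g1 g2 : Prop := exists T : seq R, forall z, dom Om z ->
  tcoor k z \notin T ->
  ((`|g z|)%:E <= \int[mu]_s (`|ext0 (dk k g1 g2) (lin k s (tcoor k z))|)%:E)%E.

(** From z one follows the line away from the graph: the path stays in the domain until it leaves
    the support, where g is zero. *)
Lemma local_sup k p dl ep dl' ep' sg G g g1 g2 :
  halfbox k p dl ep sg G -> dl' < dl -> ep' < ep ->
  PC1 g g1 g2 -> supp_in k p dl' ep' g g1 g2 -> supbound k g g1 g2.
Proof.
move=> hb dl'dl ep'ep pg sg0; have bF := bm_dk k (pc_bm1 pg) (pc_bm2 pg).
have mF := measurable_ext0 bF.
set s0 := scoor k p.
have nb1 : ep' <= `|s0 - ep' - s0| by rewrite addrAC subrr sub0r normrN ler_norm.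
have nb2 : ep' <= `|s0 + ep' - s0| by rewrite addrAC subrr add0r ler_norm.
have [T HT] := ftc_line k pg; exists T => z Oz tT.
have [zin|zin] := pselect (inbox k p dl' ep' z); last first.
  by have [-> _ _] := sg0 z (dom_cl Oz) zin; rewrite normr0; apply: integral_ge0 => s _; rewrite lee_fin.
have [zt zs] := zin; rewrite -/s0 in zs.
set t := tcoor k z in tT *.
have tt0 : `|t - tcoor k p| < dl by exact: lt_trans dl'dl.
have Gs0 := hb_G hb tt0; rewrite -/s0 in Gs0.
have hd s : `|s - s0| < ep -> dom Om (lin k s t) <-> if sg then s < G t else G t < s.
  move=> h; have := hb_dom hb (z := lin k s t).
  by rewrite scoor_lin tcoor_lin; apply; split; rewrite ?tcoor_lin ?scoor_lin.
have zE : z = lin k (scoor k z) t by rewrite lin_coor.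
have nbox s : ep' <= `|s - s0| -> ~ inbox k p dl' ep' (lin k s t).
  by move=> h [_]; rewrite scoor_lin ltNge h.
have bnd a b : a <= b -> (`| \int[mu]_(s in `[a, b]) ext0 (dk k g1 g2) (lin k s t)|%:E <= 
     \int[mu]_s (`|ext0 (dk k g1 g2) (lin k s t)|)%:E)%E.
  move=> ab; have int := lin_integrable k t a b bF.
  rewrite EFin_normr_Rintegral//.
  apply: le_trans (le_abse_integral _ _ _) _ => //; first by case/integrableP : int.
  apply: ge0_subset_integral => //.
  by apply/measurable_EFinP; apply: measurableT_comp => //; exact: measurable_fun_linR.
have hz : if sg then scoor k z < G t else G t < scoor k z.
  by apply/hd; [exact: lt_trans ep'ep|rewrite -zE].
case: (sg) hd hz => hd hz.
- have az : s0 - ep' <= scoor k z by move: zs; rewrite ltr_distl => /andP[? ?]; lra.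
  have cla s : s0 - ep' <= s -> s <= scoor k z -> dom Om (lin k s t).
    move=> h1 h2; apply/hd; last exact: le_lt_trans hz.
    by move: zs Gs0; rewrite ler_distl !ltr_distl => /andP[? ?] /andP[? ?]; itvlra.
  have := HT t tT _ _ az; rewrite -zE.
  have [-> _ _] := sg0 _ (dom_cl (cla (s0 - ep') (lexx _) az)) (nbox _ nb1).
  rewrite subr0 => <-; [exact: bnd| |].
  + by move=> s /andP[h1 h2]; apply: dom_cl; exact: cla.
  + by move=> s /andP[h1 h2]; apply: cla; exact: ltW.
- have az : scoor k z <= s0 + ep' by move: zs; rewrite ltr_distl => /andP[? ?]; lra.
  have cla s : s <= s0 + ep' -> scoor k z <= s -> dom Om (lin k s t).
    move=> h1 h2; apply/hd; last exact: lt_le_trans hz _.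
    by move: zs Gs0; rewrite ler_distl !ltr_distl => /andP[? ?] /andP[? ?]; itvlra.
  have := HT t tT _ _ az; rewrite -zE.
  have [-> _ _] := sg0 _ (dom_cl (cla (s0 + ep') (lexx _) az)) (nbox _ nb2).
  rewrite sub0r -[`|g z|]normrN => <-; [exact: bnd| |].
  + by move=> s /andP[h1 h2]; apply: dom_cl; exact: cla.
  + by move=> s /andP[h1 h2]; apply: cla; exact: ltW.
Qed.

(** The square of |g| is at most a function of [tcoor k] times a function of [tcoor k'], and by
    [area_prod] the integral of such a product factorizes. *)
Lemma local_sobolev k k' g g1 g2 : k != k' -> PC1 g g1 g2 ->
  supbound k g g1 g2 -> supbound k' g g1 g2 ->
  I Om (fun z => g z ^+ 2) <=
    I Om (fun z => `|dk k g1 g2 z|) * I Om (fun z => `|dk k' g1 g2 z|).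
Proof.
move=> kk' pg [T HT] [T' HT'].
have bF j := bm_dk j (pc_bm1 pg) (pc_bm2 pg).
have bg2 := bm_exp 2 (cont_cl_bm (pc_cont pg)).
(* The value +oo on the exceptional list makes the bound of |g| valid on every line and does not
   change the integral. *)
pose A (j : 'I_3) (S : seq R) t : \bar R :=
  (if t \in S then +oo else \int[mu]_s (`|ext0 (dk j g1 g2) (lin j s t)|)%:E)%E.
have mn j : measurable_fun setT (fun z => (`|ext0 (dk j g1 g2) z|)%:E).
  by apply/measurable_EFinP; apply: measurableT_comp => //; exact: measurable_ext0.
have mi j := measurable_lin_integral j (mn j) (fun z => normr_ge0 _ : (0 <= `|_|%:E)%E).
have mT (S : seq R) : measurable [set` S] by exact: finite_seq_measurable.
have muS (S : seq R) : mu [set` S] = 0%E.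
  by apply: countable_lebesgue_measure0; apply: finite_set_countable; exact: finite_seq.
have mA j S : measurable_fun setT (A j S).
  apply: measurable_fun_ifT; [|exact: measurable_cst|exact: mi].
  by apply: (measurable_fun_bool true); rewrite setTI (_ : _ @^-1` _ = [set` S]).
have A0 j S t : (0 <= A j S t)%E.
  by rewrite /A; case: ifP => // _; apply: integral_ge0 => s _; rewrite lee_fin.
have IA j S : (\int[mu]_t A j S t = (I Om (fun z => `|dk j g1 g2 z|))%:E)%E.
  have -> : (\int[mu]_t A j S t = \int[mu]_t \int[mu]_s (`|ext0 (dk j g1 g2) (lin j s t)|)%:E)%E.
    apply: ae_eq_integral => //; [exact: mA|exact: mi|].
    exists [set` S]; split; [exact: mT|exact: muS|].
    move=> t /= /not_implyP[_ neq]; have [//|tS] := boolP (t \in S); exfalso; apply: neq.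
    by rewrite /A (negbTE tS).
  transitivity (\int[AR]_z (`|ext0 (dk j g1 g2) z|)%:E)%E.
    by symmetry; apply: (ge0_area_fubini j (mn j)) => z; rewrite lee_fin.
  rewrite I_ext0; last exact: bm_norm.
  apply: eq_integral => z _; congr (_%:E); rewrite /ext0 !patchE; case: ifP => // _.
  by rewrite normr0.
rewrite -lee_fin EFinM -(IA k T) -(IA k' T') I_ext0//.
rewrite -(@area_prod _ k k')//.
apply: (@le_trans _ _ (\int[AR]_z (`|ext0 g z| * `|ext0 g z|)%:E)%E).
  apply: ge0_le_integral => //.
  - by move=> z _; rewrite /ext0 patchE; case: ifP => // _; rewrite lee_fin sqr_ge0.
  - by apply/measurable_EFinP; exact: measurable_ext0.
  - apply/measurable_EFinP; apply: measurable_funM; apply: measurableT_comp => //;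
      exact: measurable_ext0 (cont_cl_bm (pc_cont pg)).
  - move=> z _; rewrite lee_fin /ext0 !patchE; case: ifP => _; last by rewrite normr0 mulr0.
    by rewrite -expr2 real_normK// num_real.
apply: ge0_le_integral => //.
- apply/measurable_EFinP; apply: measurable_funM; apply: measurableT_comp => //;
    exact: measurable_ext0 (cont_cl_bm (pc_cont pg)).
- by apply: emeasurable_funM; apply: measurableT_comp => //; exact: measurable_tcoor.
have gA j S z : (forall z, dom Om z -> tcoor j z \notin S ->
    ((`|g z|)%:E <= \int[mu]_s (`|ext0 (dk j g1 g2) (lin j s (tcoor j z))|)%:E)%E) ->
    (`|ext0 g z|%:E <= A j S (tcoor j z))%E.
  rewrite /A => h; case: ifPn => [_|tS]; first exact: leey.
  have [Oz|Oz] := pselect (dom Om z); first by rewrite ext0_in//; exact: h.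
  by rewrite ext0_out// normr0; apply: integral_ge0 => s _; rewrite lee_fin.
by move=> z _; rewrite EFinM; apply: lee_pmul; rewrite ?lee_fin//; exact: gA.
Qed.

End local_green.

(** * The boundary curves and fluxes through them *)

Section curves.
Variables (R : realType) (Om : smooth_domain R).
Notation mu := (@lebesgue_measure R).
Notation cl := (clos Om).
Notation vel j := (velocity (@curve _ Om j)).
Implicit Types (k : 'I_3) (i j : 'I_(ncurves Om)) (h : R * R -> R) (x y p : R * R) (s t r a b c d : R).

Definition bdry x : Prop := cl x /\ ~ dom Om x.

(** The orientation of the coordinates ([scoor k], [tcoor k]), negative for the vertical direction,
    where they are swapped. *)
Definition dsgn k : R := nth 0 [:: 1; -1; 1] k.

Lemma dsgn_cases k : dsgn k = 1 \/ dsgn k = -1.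
Proof. by elim/ord3P: k; rewrite /dsgn/=; auto. Qed.

Lemma dirv_normal k (v : R * R) :
  (dirv R k).1 * v.2 - (dirv R k).2 * v.1 = dsgn k * tcoor k v.
Proof. by elim/ord3P: k; rewrite /dsgn/tcoor/dirv/=; ring. Qed.

Lemma bdryP x : bdry x <-> exists j s, x = curve j s.
Proof.
have E := @curve_boundary _ Om; split.
  by move=> [cx nx]; have : (cl `\` Om) x by []; rewrite E.
by move=> H; have : [set x | exists j s, x = @curve _ Om j s] x by []; rewrite -E.
Qed.

Lemma is_derive_curve1 j s : is_derive s 1 (fun s => (@curve _ Om j s).1) (vel j s).1.
Proof.
have [H _] := @curve_smooth _ Om j; have := H 0%N s => /= d.
by rewrite /velocity/= derive1E; exact/derivableP.
Qed.

Lemma is_derive_curve2 j s : is_derive s 1 (fun s => (@curve _ Om j s).2) (vel j s).2.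
Proof.
have [_ H] := @curve_smooth _ Om j; have := H 0%N s => /= d.
by rewrite /velocity/= derive1E; exact/derivableP.
Qed.

Lemma continuous_vel1 j : continuous (fun s => (vel j s).1).
Proof.
move=> s; have [H _] := @curve_smooth _ Om j; have := H 1%N s => /= d.
by apply/differentiable_continuous/derivable1_diffP.
Qed.

Lemma continuous_vel2 j : continuous (fun s => (vel j s).2).
Proof.
move=> s; have [_ H] := @curve_smooth _ Om j; have := H 1%N s => /= d.
by apply/differentiable_continuous/derivable1_diffP.
Qed.

Lemma continuous_curve1 j : continuous (fun s => (@curve _ Om j s).1).
Proof.
move=> s; apply/differentiable_continuous/derivable1_diffP.
by have := is_derive_curve1 j s; case.
Qed.

Lemma continuous_curve2 j : continuous (fun s => (@curve _ Om j s).2).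
Proof.
move=> s; apply/differentiable_continuous/derivable1_diffP.
by have := is_derive_curve2 j s; case.
Qed.

Lemma continuous_pairR (f g : R -> R) : continuous f -> continuous g ->
  continuous (fun s => (f s, g s)).
Proof.
move=> cf cg s A /nbhs_box[e e0 eA].
have n1 : \forall r \near s, ball (f s) e (f r) by apply: cf; exact: nbhsx_ballx.
have n2 : \forall r \near s, ball (g s) e (g r) by apply: cg; exact: nbhsx_ballx.
by apply: filterS2 n1 n2 => r b1 b2; apply: eA.
Qed.

Lemma continuous_curve j : continuous (@curve _ Om j).
Proof.
have -> : @curve _ Om j = fun s => ((@curve _ Om j s).1, (@curve _ Om j s).2).
  by apply/funext => s; rewrite -surjective_pairing.
by apply: continuous_pairR; [exact: continuous_curve1|exact: continuous_curve2].
Qed.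

Lemma is_derive_tcoor k j s : is_derive s 1 (fun s => tcoor k (@curve _ Om j s)) (tcoor k (vel j s)).
Proof.
have d1 := is_derive_curve1 j s; have d2 := is_derive_curve2 j s.
elim/ord3P: k; rewrite /tcoor/=; [exact: d2|exact: d1|].
exact: (is_deriveB d2 d1).
Qed.

Lemma continuous_tcoor_vel k j : continuous (fun s => tcoor k (vel j s)).
Proof.
have c1 := continuous_vel1 (j := j); have c2 := continuous_vel2 (j := j).
elim/ord3P: k; rewrite /tcoor//= => s.
by apply: cvgB; [exact: c2|exact: c1].
Qed.

Lemma continuous_scoor_curve k j : continuous (fun s => scoor k (@curve _ Om j s)).
Proof.
have c1 := continuous_curve1 (j := j); have c2 := continuous_curve2 (j := j).
by elim/ord3P: k; rewrite /scoor.
Qed.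

Lemma curve_shift j s : forall n : nat, curve j (s + n%:R) = curve j s.
Proof.
by elim=> [|n IH]; [rewrite addr0|rewrite -natr1 addrA curve_periodic].
Qed.

Lemma curve_shiftz j s (n : int) : curve j (s + n%:~R) = curve j s.
Proof.
case: n => n; first exact: curve_shift.
by rewrite NegzE mulrNz -[in RHS](subrK n.+1%:R s) curve_shift.
Qed.

Lemma vel_shiftz j s (n : int) : vel j (s + n%:~R) = vel j s.
Proof.
have H (f : R -> R) l : is_derive s 1 f l -> (forall r, f (r + n%:~R) = f r) ->
    is_derive (s + n%:~R) 1 f l.
  move=> df per; have -> : f = f \o (fun r => r - n%:~R).
    by apply/funext => r; rewrite /= -{1}(subrK n%:~R r) per.
  have df' : is_derive (s + n%:~R - n%:~R) 1 f l by rewrite addrK.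
  have dg : is_derive (s + n%:~R) 1 (fun r : R => r - n%:~R) 1 by apply: is_derive_eq; rewrite subr0.
  have D := @is_derive1_comp R f (fun r : R => r - n%:~R) (s + n%:~R) l 1 df' dg.
  by apply: (is_derive_eq D); rewrite /GRing.scale/= mulr1.
rewrite /velocity; congr pair; rewrite derive1E.
  have D := H _ _ (is_derive_curve1 j s) (fun r => congr1 fst (curve_shiftz j r n)).
  by rewrite derive_val.
have D := H _ _ (is_derive_curve2 j s) (fun r => congr1 snd (curve_shiftz j r n)).
by rewrite derive_val.
Qed.

Lemma shift_window (s c : R) : exists n : int, c <= s + n%:~R < c + 1.
Proof.
exists (- Num.floor (s - c)); rewrite mulrNz.
have := floor_le_tmp (s - c); have := lt_succ_floor (s - c); rewrite intrD1 => h1 h2.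
by itvlra.
Qed.

Lemma pos_min (f : R -> R) (c d : R) : continuous f -> (forall s, c <= s <= d -> 0 < f s) ->
  exists2 m : R, 0 < m & forall s, c <= s <= d -> m <= f s.
Proof.
move=> cf f0; have [cd|dc] := leP c d; last first.
  by exists 1 => // s /andP[h1 h2]; lra.
have [m mcd Hm] := @EVT_min R f c d cd (continuous_subspaceT cf).
exists (f m); first by apply: f0; move: mcd; rewrite in_itv.
by move=> s sc; apply: Hm; rewrite in_itv.
Qed.

Lemma fin_min (n : nat) (m : 'I_n -> R) : (forall i : 'I_n, 0 < m i) ->
  exists2 m0 : R, 0 < m0 & forall i : 'I_n, m0 <= m i.
Proof.
move=> m0.
suff [r r0 Hr] : exists2 r : R, 0 < r & forall i : 'I_n, i \in enum 'I_n -> r <= m i.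
  by exists r => // i; apply: Hr; rewrite mem_enum.
elim: (enum 'I_n) => [|i s [r r0 Hr]]; first by exists 1.
exists (Num.min r (m i)); first by rewrite lt_min r0 m0.
by move=> l; rewrite inE ge_min => /predU1P[->|/Hr ->//]; rewrite lexx orbT.
Qed.

(** Periodicity moves s into [0, 1), where [curve_simple] applies; the shift is an integer of
    absolute value at most 1/2, hence 0. *)
Lemma curve_injective i j s t : 0 <= t < 1 -> `|s - t| <= 1 / 2 ->
  curve i s = curve j t -> i = j /\ s = t.
Proof.
move=> t01 st E; have [n n01] := shift_window s 0.
rewrite add0r in n01.
have [ij sE] := curve_simple n01 t01 (etrans (curve_shiftz i s n) E).
split => //; suff n0 : n = 0 by rewrite -sE n0 addr0.
have : `|n%:~R : R| <= 1 / 2 by rewrite -normrN; move: st; rewrite -sE opprD addrA subrr sub0r.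
have [//|n0] := eqVneq n 0.
have h1 : (1 : R) <= `|n%:~R| by rewrite -intr_norm -[1]/(1%:~R) ler_int -gtz0_ge1 normr_gt0.
by move=> h2; exfalso; have := le_trans h1 h2; lra.
Qed.

(** On the compact set of parameters at distance at least [a] from t, and on the other curves, the
    distance to the point is positive and so bounded below. Parameters are taken within half a
    period of t, which covers every curve once. *)
Lemma curve_isolated j t a : 0 <= t < 1 -> 0 < a ->
  exists2 r : R, 0 < r & forall i s, `|s - t| <= 1 / 2 ->
    `|(curve i s).1 - (curve j t).1| < r -> `|(curve i s).2 - (curve j t).2| < r ->
    i = j /\ `|s - t| < a.
Proof.
move=> t01 a0.
pose f i s := `|(@curve _ Om i s).1 - (curve j t).1| + `|(curve i s).2 - (curve j t).2|.
have cf i : continuous (f i).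
  move=> s; apply: cvgD; apply: cvg_norm; apply: cvgB; try exact: cvg_cst.
    exact: continuous_curve1.
  exact: continuous_curve2.
have f0 i s : `|s - t| <= 1 / 2 -> (i != j) || (a <= `|s - t|) -> 0 < f i s.
  move=> st ne; rewrite lt_neqAle addr_ge0// andbT eq_sym paddr_eq0// !normr_eq0 !subr_eq0.
  apply/negP => /andP[/eqP e1 /eqP e2].
  have E : curve i s = curve j t by rewrite [LHS]surjective_pairing [RHS]surjective_pairing e1 e2.
  have [ij sE] := curve_injective t01 st E.
  by move: ne; rewrite ij sE eqxx/= subrr normr0 leNgt a0.
have H i : exists2 m : R, 0 < m & forall s, `|s - t| <= 1 / 2 -> (i != j) || (a <= `|s - t|) -> m <= f i s.
  have [->|ij] := eqVneq i j; last first.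
    have h1 s : t - 1 / 2 <= s <= t + 1 / 2 -> 0 < f i s.
      by move=> h1; apply: f0; rewrite ?ler_distl// ij.
    have [m m0 Hm] := pos_min (cf i) h1.
    by exists m => // s; rewrite ler_distl => h _; exact: Hm.
  have h1 s : t - 1 / 2 <= s <= t - a -> 0 < f j s.
    move=> /andP[h1 h2]; apply: f0; first by rewrite ler_distl; itvlra.
    by rewrite eqxx; exact: dist_ge_l.
  have h2 s : t + a <= s <= t + 1 / 2 -> 0 < f j s.
    move=> /andP[h2 h3]; apply: f0; first by rewrite ler_distl; itvlra.
    by rewrite eqxx; exact: dist_ge_r.
  have [m1 m10 H1] := pos_min (cf j) h1; have [m2 m20 H2] := pos_min (cf j) h2.
  exists (Num.min m1 m2); first by rewrite lt_min m10.
  move=> s; rewrite ler_distl /= ler_normr ge_min => /andP[g1 g2] /orP[g|g]; apply/orP.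
    by right; apply: H2; itvlra.
  by left; apply: H1; itvlra.
have [m Hm] := choice (fun i => let: ex_intro2 m h1 h2 := H i in ex_intro _ m (conj h1 h2)).
have [r r0 Hr] := fin_min (fun i => (Hm i).1).
exists (r / 2); first by lra.
move=> i s st h1 h2; have [ij|ne] := boolP ((i != j) || (a <= `|s - t|)).
  have := (Hm i).2 s st ij; have := Hr i; rewrite /f; lra.
by move: ne; rewrite negb_or negbK -ltNge => /andP[/eqP].
Qed.

(** Along a path that avoids the boundary the preimages of the domain and of its closure coincide,
    so this preimage is open and closed in a connected interval. *)
Lemma path_dom (phi : R -> R * R) (a b : R) : a <= b -> continuous phi ->
  (forall s, a <= s <= b -> ~ bdry (phi s)) -> dom Om (phi a) <-> dom Om (phi b).
Proof.
move=> ab cphi nb.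
have cO : open (phi @^-1` Om) by move/continuousP : cphi; apply; exact: dom_open.
have cC : closed (phi @^-1` cl) by move/continuous_closedP : cphi; apply; exact: closed_closure.
have conn := @segment_connected R a b.
have E : `[a, b]%classic `&` (phi @^-1` Om) = `[a, b]%classic `&` (phi @^-1` cl).
  apply/seteqP; split => s [sab]; first by move=> /dom_cl.
  move=> cs; split => //; apply: contrapT => nO; apply: (nb s); first by move: sab; rewrite /= in_itv.
  by split.
have aab : `[a, b]%classic a by rewrite /= in_itv/= lexx.
have bab : `[a, b]%classic b by rewrite /= in_itv/= lexx andbT.
have P s : `[a, b]%classic s -> dom Om (phi s) -> forall r, `[a, b]%classic r -> dom Om (phi r).
  move=> sab Os r rab.
  have F : `[a, b]%classic `&` (phi @^-1` Om) = `[a, b]%classic.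
    apply: conn; first by exists s.
      by exists (phi @^-1` Om).
    by exists (phi @^-1` cl).
  by have [] : (`[a, b]%classic `&` (phi @^-1` Om)) r by rewrite F.
by split => H; [exact: (P a)|exact: (P b)].
Qed.

Definition dot (n x : R * R) : R := n.1 * x.1 + n.2 * x.2.

Lemma unit_normalE j s (n := unit_normal (curve j) s) :
  [/\ n.1 ^+ 2 + n.2 ^+ 2 = 1, dot n (vel j s) = 0, 0 < enorm (vel j s) &
     forall k, dot (dirv R k) n * enorm (vel j s) = dsgn k * tcoor k (vel j s)].
Proof.
rewrite /n /unit_normal; have := @curve_regular _ Om j s.
move: (vel j s) {n} => v v0.
have q0 : 0 < v.1 ^+ 2 + v.2 ^+ 2.
  rewrite lt_neqAle addr_ge0 ?sqr_ge0// andbT eq_sym paddr_eq0 ?sqr_ge0// !sqrf_eq0.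
  by apply/negP => /andP[/eqP h1 /eqP h2]; apply: v0; rewrite [LHS]surjective_pairing h1 h2.
have e0 : 0 < enorm v by rewrite sqrtr_gt0.
have e2 : enorm v ^+ 2 = v.1 ^+ 2 + v.2 ^+ 2 by rewrite sqr_sqrtr// ltW.
have ne : enorm v != 0 by rewrite gt_eqF.
rewrite /dot /=; split => //.
- by rewrite mulNr sqrrN !expr_div_n -mulrDl e2 addrC mulfV// gt_eqF.
- by field.
- by move=> k; rewrite -dirv_normal; field.
Qed.

Lemma near_gt (f : R -> R) t c : continuous f -> c < f t ->
  exists2 e : R, 0 < e & forall s, `|s - t| < e -> c < f s.
Proof.
move=> cf cft; have e0 : 0 < f t - c by rewrite subr_gt0.
have : nbhs t [set s | ball (f t) (f t - c) (f s)] by apply: cf; exact: nbhsx_ballx.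
move=> /nbhs_ballP[e /= e1 He]; exists e => // s st.
have := He s; rewrite /ball/= distrC => /(_ st); rewrite ltr_distl => /andP[? ?]; lra.
Qed.

Lemma tcoor_le k x : `|tcoor k x| <= `|x.1| + `|x.2|.
Proof.
elim/ord3P: k; rewrite /tcoor/= ?lerDl ?lerDr//.
by rewrite -normrN opprB ler_normB.
Qed.

Lemma coor_dist k x p e : `|scoor k x - scoor k p| < e -> `|tcoor k x - tcoor k p| < e ->
  `|x.1 - p.1| < 2 * e /\ `|x.2 - p.2| < 2 * e.
Proof.
elim/ord3P: k; rewrite /tcoor/scoor/= !ltr_distl => /andP[? ?] /andP[? ?];
  split; itvlra.
Qed.

(** The boundary integral of h times the component of the outward normal along [dirv k]: by
    [dirv_normal] the second factor is that component times the speed of the curve. *)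
Definition flux k h : R := \sum_j \int[mu]_(s in `[0, 1]) (h (curve j s) * (dsgn k * tcoor k (vel j s))).

(** [b] tells whether [tcoor k] decreases along the curve at t. The last bound says that the window
    is nearly straight, its normal component being small compared with its transversal speed. *)
Lemma graph_window k j t : tcoor k (vel j t) != 0 -> forall kappa, 0 < kappa ->
  exists b : bool, exists a c : R, [/\ 0 < a < 1 / 2, 0 < c,
   (0 < tcoor k (vel j t)) = ~~ b,
   forall s, `|s - t| <= a -> c <= (-1) ^+ b * tcoor k (vel j s) &
   forall s, `|s - t| <= a -> `|dot (unit_normal (curve j) t) (vel j s)| <= kappa * c].
Proof.
move=> w0 kappa k0; set w := fun s => tcoor k (vel j s).
exists (w t < 0); set b := w t < 0.
have wb : 0 < (-1) ^+ b * w t.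
  rewrite /b; have [h|h|h] := ltgtP (w t) 0; rewrite ?expr1 ?expr0 ?mulN1r ?mul1r ?oppr_gt0//.
  by move: w0; rewrite -/(w t) h eqxx.
set c := ((-1) ^+ b * w t) / 2; have c0 : 0 < c by rewrite divr_gt0.
have [e1 e10 H1] := @near_gt (fun s => (-1) ^+ b * w s) t c
  (fun s => cvgM (cvg_cst _) (@continuous_tcoor_vel k j s)) ltac:(rewrite /c; lra).
have cd : continuous (fun s => - `|dot (unit_normal (curve j) t) (vel j s)|).
  move=> s; apply: cvgN; apply: cvg_norm; apply: cvgD; apply: cvgM; try exact: cvg_cst.
    exact: continuous_vel1.
  exact: continuous_vel2.
have [_ d0 _ _] := unit_normalE j t.
have kc0 : 0 < kappa * c by nn.
have hk : - (kappa * c) < - `|dot (unit_normal (curve j) t) (vel j t)|.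
  by rewrite d0 normr0 oppr0 oppr_lt0.
have [e2 e20 H2] := near_gt cd hk.
have e0 : 0 < Num.min e1 e2 by rewrite lt_min e10.
exists (Num.min (Num.min e1 e2 / 2) (1 / 4)), c; split => //.
- by rewrite lt_min gt_min !divr_gt0//=; apply/orP; right; clear; lra.
- by rewrite /b -leNgt le_eqVlt eq_sym (negbTE w0).
- move=> s; rewrite le_min => /andP[hs _]; apply/ltW/H1.
  have h1 : Num.min e1 e2 <= e1 by rewrite ge_min lexx.
  by rewrite (le_lt_trans hs)//; lra.
- move=> s; rewrite le_min => /andP[hs _].
  have := H2 s; rewrite ltrN2 => H; apply/ltW/H.
  have h1 : Num.min e1 e2 <= e2 by rewrite ge_min lexx orbT.
  by rewrite (le_lt_trans hs)//; lra.
Qed.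

Lemma MVT_mean (f f' : R -> R) (a b : R) : a <= b -> (forall s, a <= s <= b -> is_derive s 1 f (f' s)) ->
  exists2 s, a <= s <= b & f b - f a = f' s * (b - a).
Proof.
move=> ab df; have cf : {within `[a, b], continuous f}.
  by apply: derivable_within_continuous => s; rewrite in_itv/= => /df[].
have df' s : s \in `]a, b[ -> is_derive s 1 f (f' s).
  by rewrite in_itv/= => /andP[h1 h2]; apply: df; rewrite !ltW.
by have [s + ->] := MVT_segment ab df' cf; rewrite in_itv; exists s.
Qed.

Lemma MVT_lower (f f' : R -> R) (a b c : R) : a <= b ->
  (forall s, a <= s <= b -> is_derive s 1 f (f' s)) ->
  (forall s, a <= s <= b -> c <= f' s) -> c * (b - a) <= f b - f a.
Proof.
by move=> ab /(MVT_mean ab)[s sab ->] fc; apply: ler_wpM2r; [rewrite subr_ge0|exact: fc].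
Qed.

Lemma MVT_upper (f f' : R -> R) (a b c : R) : a <= b ->
  (forall s, a <= s <= b -> is_derive s 1 f (f' s)) ->
  (forall s, a <= s <= b -> `|f' s| <= c) -> `|f b - f a| <= c * (b - a).
Proof.
move=> ab /(MVT_mean ab)[s sab ->] fc.
by rewrite normrM (ger0_norm (_ : 0 <= b - a)) ?subr_ge0//; apply: ler_wpM2r; [rewrite subr_ge0|exact: fc].
Qed.

Lemma continuous_h_curve h j : {within cl, continuous h} -> continuous (fun s => h (@curve _ Om j s)).
Proof.
move=> ch s A nA; have cs r : cl (@curve _ Om j r).
  by have [] : bdry (curve j r) by apply/bdryP; exists j, r.
have nA' : nbhs (curve j s) [set y | cl y -> A (h y)] := (subspace_continuousP _ _).1 ch _ (cs s) _ nA.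
have : nbhs s [set r | cl (curve j r) -> A (h (curve j r))] by exact: (@continuous_curve j s _ nA').
by apply: filterS => r; apply.
Qed.

Lemma cont_itv_integrable (f : R -> R) a b : {within `[a, b], continuous f} ->
  mu.-integrable `[a, b] (EFin \o f).
Proof. by move=> cf; apply: continuous_compact_integrable => //; exact: segment_compact. Qed.

(** The integral over [c, c + 1] has derivative f (c + 1) - f c = 0 in c. The primitive starts at
    -1, whence the range of c. *)
Lemma periodic_integral (f : R -> R) (c : R) : continuous f -> (forall s, f (s + 1) = f s) ->
  - 1 < c < 1 ->
  \int[mu]_(s in `[0, 1]) f s = \int[mu]_(s in `[c, c + 1]) f s.
Proof.
move=> cf per c1; pose P (x : R) := \int[mu]_(s in `[- 1, x]) f s.
have int a b : mu.-integrable `[a, b] (EFin \o f).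
  by apply: cont_itv_integrable; exact: continuous_subspaceT.
have dP (x : R) : - 1 < x -> is_derive x 1 P (f x).
  move=> x1; have x12 : x < x + 1 by lra.
  have [d1 d2] := continuous_FTC1_closed x12 (int (- 1) (x + 1)) x1 (cf x).
  by rewrite -d2 derive1E; exact/derivableP.
pose D (x : R) := P (x + 1) - P x.
have dD (x : R) : - 1 < x -> is_derive x 1 D 0.
  move=> x1; have d1 : is_derive (x + 1) 1 P (f (x + 1)) by apply: dP; lra.
  have d2 : is_derive x 1 (fun y : R => y + 1) 1 by apply: is_derive_eq; rewrite addr0.
  have d3 := @is_derive1_comp R P (fun y : R => y + 1) x _ _ d1 d2.
  have d4 := is_deriveB d3 (dP x x1).
  by apply: (is_derive_eq d4); rewrite per /GRing.scale/= mulr1 subrr.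
have E (x : R) : - 1 < x -> D x = \int[mu]_(s in `[x, x + 1]) f s.
  move=> x1; rewrite /D /P (@Rintegral_itvB _ f (BLeft (- 1)) (BRight (x + 1)) x) ?bnd_simp; [|exact: int|lra|lra].
  by rewrite Rintegral_itv_obnd_cbnd//; apply: integrableS (int x (x + 1)) => //; exact: subset_itv_oc_cc.
have DE a b : a <= b -> - 1 < a -> D b = D a.
  move=> ab a1; apply: (@zero_derive_cst R [::] D a b ab).
    apply: derivable_within_continuous => x; rewrite in_itv/= => /andP[ax _].
    by have := dD x (lt_le_trans a1 ax); case.
  by move=> x; rewrite in_itv/= => /andP[ax _] _; apply: dD; lra.
have e1 := E 0 ltac:(lra); rewrite add0r in e1; rewrite -e1 -E; last by case/andP: c1.
by case/andP: c1 => ? ?; have [c0|c0] := leP 0 c; [rewrite (DE 0 c)//; lra|rewrite (DE c 0)//; lra].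
Qed.

Lemma Rintegral_support (A B : set R) (f : R -> R) :
  (forall s, A s -> ~ B s -> f s = 0) -> (forall s, B s -> ~ A s -> f s = 0) ->
  \int[mu]_(s in A) f s = \int[mu]_(s in B) f s.
Proof.
move=> AB BA; rewrite Rintegral_mkcond [RHS]Rintegral_mkcond; congr (Rintegral _ _ _).
apply/funext => s; rewrite !patchE; have [sA|sA] := pselect (A s); have [sB|sB] := pselect (B s);
  rewrite ?(mem_set sA) ?(mem_set sB) ?(memNset sA) ?(memNset sB)//; [exact: AB|by rewrite BA].
Qed.

Section window.
Variables (k : 'I_3) (j : 'I_(ncurves Om)) (t a c : R) (b : bool).
Hypothesis hc : forall s, `|s - t| <= a -> c <= (-1) ^+ b * tcoor k (vel j s).
Let u s := tcoor k (@curve _ Om j s).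

Lemma window_inc (s s' : R) : `|s - t| <= a -> `|s' - t| <= a -> s <= s' -> c * (s' - s) <= (-1) ^+ b * (u s' - u s).
Proof.
rewrite !ler_distl => /andP[h1 h2] /andP[h3 h4] ss; rewrite [leRHS]mulrBr.
apply: (MVT_lower (f := fun s : R => (-1) ^+ b * u s) (f' := fun s => (-1) ^+ b * tcoor k (vel j s)) ss) => r.
  by have d := is_derive_tcoor k j r => _; exact: (is_deriveZ ((-1) ^+ b) d).
by move=> /andP[h5 h6]; apply: hc; rewrite ler_distl; itvlra.
Qed.

Lemma window_lip (s s' : R) : `|s - t| <= a -> `|s' - t| <= a -> c * `|s - s'| <= `|u s - u s'|.
Proof.
wlog ss : s s' / s <= s' => [H|] hs hs'.
  have [ss|/ltW ss] := leP s s'; first exact: H.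
  by rewrite distrC [leRHS]distrC; exact: H.
rewrite distrC ger0_norm ?subr_ge0//; apply: (le_trans (window_inc hs hs' ss)).
by rewrite (le_trans (ler_norm _))// normrM normr_sign mul1r distrC.
Qed.

End window.

(** Only the arc with |s - t| <= a meets the support, and there r = [tcoor k (curve j s)] is an
    admissible change of variables, increasing or decreasing according to [b]. *)
Lemma flux_window k j t a c (b : bool) (dl dl' ep : R) (inv : R -> R) h :
  0 <= t < 1 -> 0 < a < 1 / 2 -> 0 < c ->
  (forall s, `|s - t| <= a -> c <= (-1) ^+ b * tcoor k (vel j s)) ->
  (forall i s, `|s - t| <= 1 / 2 -> inbox k (curve j t) dl ep (curve i s) -> i = j /\ `|s - t| <= a) ->
  (forall s, `|s - t| <= a -> inv (tcoor k (curve j s)) = s) ->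
  dl <= c * a -> {within cl, continuous h} -> dl' < dl ->
  (forall x, cl x -> ~ inbox k (curve j t) dl' ep x -> h x = 0) ->
  flux k h = \int[mu]_(r in `](tcoor k (curve j t) - dl), (tcoor k (curve j t) + dl)[)
     (dsgn k * (-1) ^+ b * h (curve j (inv r))).
Proof.
move=> t01 a01 c0 hc iso hinv dlca ch dl'dl h0.
set u := fun s => tcoor k (@curve _ Om j s).
have cs i r : cl (@curve _ Om i r).
  by have [] : bdry (curve i r) by apply/bdryP; exists i, r.
have sub x : inbox k (curve j t) dl' ep x -> inbox k (curve j t) dl ep x.
  by move=> [h1 h2]; split => //; exact: lt_trans dl'dl.
have hc0 i s : (i != j) || (a < `|s - t|) -> `|s - t| <= 1 / 2 -> h (curve i s) = 0.
  move=> ne st; apply: h0 => // /sub /(iso _ _ st)[ij sa].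
  by move: ne; rewrite ij eqxx/= ltNge sa.
have zero i : i != j -> \int[mu]_(s in `[0, 1]) (h (curve i s) * (dsgn k * tcoor k (vel i s))) = 0.
  move=> ij; rewrite (@eq_Rintegral _ _ _ _ _ (fun=> 0)) ?Rintegral_cst ?mul0r// => s _.
  have [n n1] := shift_window s (t - 1 / 2).
  have st : `|s + n%:~R - t| <= 1 / 2 by rewrite ler_distl; case/andP: n1 => ? ?; itvlra.
  by rewrite -(curve_shiftz i s n) (hc0 i)// ?ij// mul0r.
rewrite /flux (bigD1 j)//= big1 ?addr0; last by move=> i; exact: zero.
pose F s := h (curve j s) * (dsgn k * tcoor k (vel j s)).
have cF : continuous F.
  move=> s; apply: cvgM; first exact: continuous_h_curve.
  by apply: cvgM; [exact: cvg_cst|exact: continuous_tcoor_vel].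
have pF s : F (s + 1) = F s.
  by rewrite /F curve_periodic (vel_shiftz j s 1).
have c1 : - 1 < t - 1 / 2 < 1 by case/andP: t01 => ? ?; itvlra.
(* The period is recentred at t, so that the window is interior to it even if t is close to 0 or
   1. *)
rewrite -/(F) (periodic_integral cF pF c1).
rewrite (@Rintegral_support _ `[t - a, t + a]); first last.
- move=> s; rewrite /= !in_itv/= => /andP[? ?] /negP; rewrite negb_and -!ltNge => /orP[?|?];
    by exfalso; case/andP: a01 => ? ?; lra.
- move=> s; rewrite /= !in_itv/= => /andP[h1 h2] sa; rewrite /F hc0 ?mul0r//.
    by rewrite eqxx/= ltNge ler_distl; apply/negP => /andP[? ?]; apply: sa; itvlra.
  by rewrite ler_distl; itvlra.
have inc : forall s s', _ -> _ -> _ -> c * (s' - s) <= (-1) ^+ b * (u s' - u s) := window_inc hc.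
have lip : forall s s', _ -> _ -> c * `|s - s'| <= `|u s - u s'| := window_lip hc.
have u' : derive1 u = fun s => tcoor k (vel j s).
  by apply/funext => s; rewrite derive1E; have D := is_derive_tcoor k j s; rewrite derive_val.
have cu : continuous u.
  by move=> s; apply/differentiable_continuous/derivable1_diffP; have := is_derive_tcoor k j s; case.
have LR : derivable_oo_LRcontinuous u (t - a) (t + a).
  split; [|exact: cvg_at_right_filter (cu _)|exact: cvg_at_left_filter (cu _)].
  by move=> s _; have := is_derive_tcoor k j s; case.
have ta : t - a <= t + a by case/andP: a01 => ? ?; lra.
have cu' : continuous (derive1 u) by rewrite u'; exact: continuous_tcoor_vel.
pose H r := h (curve j (inv r)).
have wt s : s \in `[t - a, t + a] = (`|s - t| <= a) by rewrite in_itv/= ler_distl.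
have cuI : {within `[t - a, t + a], continuous u} by exact: continuous_subspaceT.
have cH A : (forall r, A r -> exists2 s, `|s - t| <= a & u s = r) -> {within A, continuous H}.
  move=> rA; apply/subspace_continuousP => r Ar; have [s sa us] := rA r Ar.
  move=> B nB; have nB' : nbhs s [set x | B (h (curve j x))].
    have E : from_subspace A H r = h (curve j s) by rewrite /from_subspace /H -us /u hinv.
    by apply: (continuous_h_curve ch); rewrite E in nB.
  have /nbhs_ballP[e /= e0 eB] := nB'.
  have : nbhs r [set x | A x -> B (H x)].
    apply/nbhs_ballP; exists (c * e) => /=; first by rewrite mulr_gt0.
    move=> x; rewrite /ball/= => rx Ax; have [s' sa' us'] := rA x Ax.
    rewrite /H -us' hinv//; apply: eB; rewrite /ball/=.
    by rewrite -(ltr_pM2l c0); apply: le_lt_trans (lip s s' sa sa') _; rewrite us us'.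
  by [].
have rng (m M : R) : m = Num.min (u (t - a)) (u (t + a)) -> M = Num.max (u (t - a)) (u (t + a)) ->
    forall r, m <= r <= M -> exists2 s, `|s - t| <= a & u s = r.
  move=> -> -> r rm; have [s sI us] := IVT ta cuI rm.
  by exists s => //; rewrite -wt.
have a0 : 0 <= a by case/andP: a01 => /ltW.
have wl : `|t - a - t| <= a by rewrite addrAC subrr add0r normrN ger0_norm.
have wr : `|t + a - t| <= a by rewrite addrAC subrr add0r ger0_norm.
have wm : `|t - t| <= a by rewrite subrr normr0.
have e1 := inc _ _ wl wm ltac:(lra); have e2 := inc _ _ wm wr ltac:(lra).
have fin (m M : R) : (forall r, m <= r <= M -> exists2 s, `|s - t| <= a & u s = r) ->
    m <= u t - c * a -> u t + c * a <= M ->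
    \int[mu]_(r in `[m, M]) H r = \int[mu]_(r in `](u t - dl), (u t + dl)[) H r.
  move=> rM h1 h2; apply: Rintegral_support => r; rewrite /= !in_itv/=.
    move=> /rM[s sa us] nr; rewrite /H -us hinv// h0// => -[]; rewrite -/(u s) us ltr_distl => /andP[? ?] _.
    by apply: nr; rewrite /u; itvlra.
  by move=> /andP[? ?] nr; exfalso; apply: nr; itvlra.
have fin2 (m M : R) : (forall r, m <= r <= M -> exists2 s, `|s - t| <= a & u s = r) ->
    m <= u t - c * a -> u t + c * a <= M ->
    (\int[mu]_(r in `[m, M]) (H r)%:E = \int[mu]_(s in `[(t - a)%R, (t + a)%R]) (H (u s) * ((-1) ^+ b * tcoor k (vel j s)))%:E)%E ->
    \int[mu]_(s in `[t - a, t + a]) F s =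
    \int[mu]_(r in `](u t - dl), (u t + dl)[) (dsgn k * (-1) ^+ b * H r).
  move=> rM h1 h2 E.
  have iH : mu.-integrable `[m, M] (EFin \o H).
    by apply: cont_itv_integrable; apply: cH => r; rewrite /= in_itv/=; exact: rM.
  rewrite RintegralZl//; last first.
    apply: integrableS iH => // r; rewrite /= !in_itv/= => /andP[? ?]; itvlra.
  rewrite -(fin m M)//.
    have -> : \int[mu]_(r in `[m, M]) H r = \int[mu]_(s in `[t - a, t + a]) (H (u s) * ((-1) ^+ b * tcoor k (vel j s))).
      by rewrite /Rintegral E.
    rewrite -RintegralZl//.
      apply: eq_Rintegral => s; rewrite inE/= in_itv/= -ler_distl => sa.
      rewrite /F /H /u hinv// -[in LHS](mulr1 (h _)) -[X in h _ * X](signrMK b 1) mulr1.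
      by rewrite -mulrA; ring.
    apply: cont_itv_integrable; apply: (@subspace_eq_continuous _ _ _ (fun s => h (curve j s) * ((-1) ^+ b * tcoor k (vel j s)))).
      by move=> s; rewrite inE/= in_itv/= -ler_distl => sa; rewrite /from_subspace /H /u hinv.
    apply: continuous_subspaceT => s; apply: cvgM; first exact: continuous_h_curve.
    by apply: cvgM; [exact: cvg_cst|exact: continuous_tcoor_vel].
have ca0 : 0 <= c * a by nn.
have cr (f : R -> R) : continuous f -> forall x : R, cvg (f y @[y --> x^'+]).
  by move=> cf x; apply: (cvgP _ (cvg_at_right_filter (cf x))).
have cl' (f : R -> R) : continuous f -> forall x : R, cvg (f y @[y --> x^'-]).
  by move=> cf x; apply: (cvgP _ (cvg_at_left_filter (cf x))).
move: inc e1 e2 fin2; case: (b) => inc e1 e2 fin2.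
- rewrite expr1 !mulN1r in e1 e2.
  have dec : {in `[t - a, t + a]%R &, {homo u : x y /~ x < y}}.
    move=> s s'; rewrite !wt => hx hy xy; have := inc s' s hy hx (ltW xy); rewrite expr1 mulN1r; move: (u s) (u s') => y y' g.
    have : 0 < c * (s - s') by rewrite mulr_gt0// subr_gt0.
    lra.
  have ult : u (t + a) <= u (t - a) by clear -e1 e2 ca0; lra.
  have rM := rng (u (t + a)) (u (t - a)) ltac:(by rewrite min_r) ltac:(by rewrite max_l).
  apply: (fin2 _ _ rM); [by clear -e1 e2; lra|by clear -e1 e2; lra|].
  rewrite (integration_by_substitution_decreasing ta dec (fun s _ => cu' s) (cr _ cu' _) (cl' _ cu' _) LR).
    by apply: eq_integral => s _; rewrite /= u' expr1 mulN1r.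
  by apply: cH => r; rewrite /= in_itv/=; exact: rM.
- rewrite expr0 !mul1r in e1 e2.
  have dec : {in `[t - a, t + a]%R &, {homo u : x y / x < y}}.
    move=> s s'; rewrite !wt => hx hy xy; have := inc s s' hx hy (ltW xy); rewrite expr0 mul1r; move: (u s) (u s') => y y' g.
    have : 0 < c * (s' - s) by rewrite mulr_gt0// subr_gt0.
    lra.
  have ult : u (t - a) <= u (t + a) by clear -e1 e2 ca0; lra.
  have rM := rng (u (t - a)) (u (t + a)) ltac:(by rewrite min_l) ltac:(by rewrite max_r).
  apply: (fin2 _ _ rM); [by clear -e1 e2; lra|by clear -e1 e2; lra|].
  rewrite (integration_by_substitution_increasing ta dec (fun s _ => cu' s) (cr _ cu' _) (cl' _ cu' _) LR).
    by apply: eq_integral => s _; rewrite /= u' expr0 mul1r.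
  by apply: cH => r; rewrite /= in_itv/=; exact: rM.
Qed.

End curves.

(** * The boundary as a graph, with the domain on one side *)

Section charts.
Variables (R : realType) (Om : smooth_domain R).
Notation mu := (@lebesgue_measure R).
Notation cl := (clos Om).
Notation vel j := (velocity (@curve _ Om j)).
Notation bdry := (@bdry R Om).
Notation flux := (@flux R Om).
Implicit Types (k : 'I_3) (i j : 'I_(ncurves Om)) (h : R * R -> R) (x y z p : R * R).

Lemma window_range k j (t a c : R) (b : bool) : 0 < a -> 0 < c ->
  (forall s, `|s - t| <= a -> c <= (-1) ^+ b * tcoor k (vel j s)) ->
  forall r, `|r - tcoor k (curve j t)| <= c * a ->
  exists2 s, `|s - t| <= a & tcoor k (curve j s) = r.
Proof.
move=> a0 c0 hc r rt; pose u s := tcoor k (@curve _ Om j s).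
have inc : forall s s', _ -> _ -> _ -> c * (s' - s) <= (-1) ^+ b * (u s' - u s) := window_inc hc.
have wl : `|t - a - t| <= a by rewrite addrAC subrr add0r normrN ger0_norm// ltW.
have wr : `|t + a - t| <= a by rewrite addrAC subrr add0r ger0_norm// ltW.
have wm : `|t - t| <= a by rewrite subrr normr0 ltW.
have e1 := inc _ _ wl wm ltac:(lra); have e2 := inc _ _ wm wr ltac:(lra).
have cu : continuous u.
  by move=> s; apply/differentiable_continuous/derivable1_diffP; have := is_derive_tcoor k j s; case.
have ta : t - a <= t + a by lra.
have [|s sI us] := @IVT R u (t - a) (t + a) r ta (continuous_subspaceT cu).
  move: rt e1 e2; rewrite -/(u t) ler_distl ge_min le_max.
  case: (b); rewrite ?expr1 ?expr0 ?mulN1r ?mul1r => /andP[h1 h2] e1 e2.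
    by apply/andP; split; apply/orP; [right|left]; lra.
  by apply/andP; split; apply/orP; [left|right]; lra.
by exists s => //; move: sI; rewrite in_itv/= ler_distl.
Qed.

Lemma unit_le1 (n : R * R) : n.1 ^+ 2 + n.2 ^+ 2 = 1 -> `|n.1| <= 1 /\ `|n.2| <= 1.
Proof.
by move=> n1; split; rewrite -(@ler_pXn2r _ 2)// ?nnegrE// normr2// expr1n -n1 ?lerDl ?lerDr sqr_ge0.
Qed.

Lemma dot_shift (n p : R * R) (e : R) : n.1 ^+ 2 + n.2 ^+ 2 = 1 ->
  dot n (p.1 + e * n.1, p.2 + e * n.2) = dot n p + e.
Proof. by move=> n1; rewrite /dot/= -[e in RHS]mulr1 -n1; ring. Qed.

Lemma shift_half (s t : R) : exists m : int, `|s + m%:~R - t| <= 1 / 2.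
Proof.
have [m /andP[h1 h2]] := shift_window s (t - 1 / 2); exists m.
by rewrite ler_distl; itvlra.
Qed.

Lemma sign_lt (b c : bool) (e x y : R) : c = (0 < e) -> 0 < e * ((-1) ^+ (~~ b) * (x - y)) ->
  if b (+) c then x < y else y < x.
Proof.
move=> ->; have [e1|e1|->] := ltgtP e 0; last by rewrite mul0r ltxx.
  by rewrite nmulr_rgt0//; case: b; rewrite ?expr0 ?expr1 ?mul1r ?mulN1r /=; lra.
by rewrite pmulr_rgt0//; case: b; rewrite ?expr0 ?expr1 ?mul1r ?mulN1r /=; lra.
Qed.

Lemma half_sign (e th : R) : e != 0 -> `|th| <= `|e| / 2 -> 0 < e * (e - th).
Proof.
move=> e0; rewrite ler_norml => /andP[h1 h2].
have [e1|e1|e1] := ltgtP e 0; last by move: e0; rewrite e1 eqxx.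
  by rewrite (ltr0_norm e1) in h1 h2; rewrite nmulr_rgt0//; lra.
by rewrite (gtr0_norm e1) in h1 h2; rewrite pmulr_rgt0//; lra.
Qed.

Lemma small_prod (e r d : R) : 0 < e -> e < d / 4 -> `|r| <= 2 -> `|e * r| < d.
Proof. by move=> e0 ed r2; rewrite normrM gtr0_norm//; have := normr_ge0 r; nra. Qed.

Lemma quarter_half (kp e r : R) : 0 <= kp -> kp <= 1 / 4 -> 0 <= e -> 0 <= r -> r <= 2 -> kp * (e * r) <= e / 2.
Proof.
move=> h0 h1 h2 h3 h4; have : kp * (e * r) <= 1 / 4 * (e * 2) by apply: ler_pM => //; [exact: mulr_ge0|exact: ler_wpM2l].
lra.
Qed.

Lemma window_flat k j (t a c kappa : R) (b : bool) (n : R * R) : 0 <= kappa -> 0 < c ->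
  (forall s, `|s - t| <= a -> c <= (-1) ^+ b * tcoor k (vel j s)) ->
  (forall s, `|s - t| <= a -> `|dot n (vel j s)| <= kappa * c) ->
  forall s s', `|s - t| <= a -> `|s' - t| <= a ->
  `|dot n (curve j s) - dot n (curve j s')| <=
    kappa * `|tcoor k (curve j s) - tcoor k (curve j s')|.
Proof.
move=> k0 c0 hc hn s s' hs hs'.
apply: (@le_trans _ _ (kappa * (c * `|s - s'|))); last by apply: ler_wpM2l => //; exact: (window_lip hc).
rewrite mulrA; wlog ss : s s' hs hs' / s <= s' => [H|].
  have [ss|/ltW ss] := leP s s'; first exact: H.
  by rewrite distrC (distrC s); exact: H.
rewrite ler_distl in hs; rewrite ler_distl in hs'; move: hs hs' => /andP[h1 h2] /andP[h3 h4].
rewrite [leLHS]distrC [in leRHS]distrC (ger0_norm (_ : 0 <= s' - s)) ?subr_ge0//.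
apply: (MVT_upper (f := fun s : R => dot n (curve j s)) (f' := fun s => dot n (vel j s)) ss).
  move=> x _; have d1 := is_derive_curve1 j x; have d2 := is_derive_curve2 j x.
  exact: (is_deriveD (is_deriveZ n.1 d1) (is_deriveZ n.2 d2)).
by move=> x /andP[h5 h6]; apply: hn; rewrite ler_distl; itvlra.
Qed.

Lemma continuous_lin2 k (f g : R -> R) : continuous f -> continuous g ->
  continuous (fun s => lin k (f s) (g s)).
Proof.
move=> cf cg; elim/ord3P: k; rewrite /lin/=; apply: continuous_pairR => //.
by move=> s; apply: cvgD; [exact: cf|exact: cg].
Qed.

(** Any point of the box on one side of the graph is joined to a fixed base point by a path that
    does not cross the graph: first along [dirv k] to the level [s1], then across at that level. By
    [path_dom] both are inside or both outside. *)
Lemma graph_sides k p (dl ep : R) (G : R -> R) : 0 < dl -> 0 < ep ->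
  (forall r, `|r - tcoor k p| < dl -> `|G r - scoor k p| < ep / 2) ->
  (forall z, bdry z -> inbox k p dl ep z -> scoor k z = G (tcoor k z)) ->
  forall (sg : bool) z, inbox k p dl ep z ->
  (if sg then scoor k z < G (tcoor k z) else G (tcoor k z) < scoor k z) ->
  dom Om z <-> dom Om (lin k (scoor k p - (-1) ^+ (~~ sg) * (3 / 4 * ep)) (tcoor k p)).
Proof.
move=> dl0 ep0 hG hb sg z [zt zs] zG.
set s0 := scoor k p in hG zs *; set t0 := tcoor k p in hG zt *.
(* The depth 3/4 ep exceeds the bound ep/2 on the graph and stays within the box. *)
set s1 := s0 - _.
pose below (s r : R) := if sg then s < G r else G r < s.
have nb (s r : R) : `|s - s0| < ep -> `|r - t0| < dl -> below s r -> ~ bdry (lin k s r).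
  move=> h1 h2 h3 /hb; rewrite /inbox scoor_lin tcoor_lin => /(_ (conj h2 h1)) E.
  by move: h3; rewrite /below E; case: (sg); rewrite ltxx.
have s1b r : `|r - t0| < dl -> below s1 r.
  move=> /hG; rewrite ltr_distl /below /s1 => /andP[h1 h2].
  by case: (sg); rewrite ?expr0 ?expr1; lra.
have s1e : `|s1 - s0| < ep.
  by rewrite /s1 ltr_distl; case: (sg); rewrite ?expr0 ?expr1; itvlra.
have i01 (s : R) : 0 <= s -> s <= 1 -> forall u v lo hi : R, lo < u < hi -> lo < v < hi -> lo < u + s * (v - u) < hi.
  move=> h0 h1 u v lo hi /andP[h3 h4] /andP[h5 h6].
  have [->|s1'] := eqVneq s 1; first by rewrite mul1r subrKC h5.
  have h7 : 0 < 1 - s by rewrite subr_gt0 lt_neqAle s1'.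
  have m1 : 0 < (1 - s) * (u - lo) by rewrite mulr_gt0// subr_gt0.
  have m2 : 0 < (1 - s) * (hi - u) by rewrite mulr_gt0// subr_gt0.
  have m3 : 0 <= s * (v - lo) by rewrite mulr_ge0// subr_ge0 ltW.
  have m4 : 0 <= s * (hi - v) by rewrite mulr_ge0// subr_ge0 ltW.
  by apply/andP; split; nra.
have aff (u v : R) : continuous (fun s : R => u + s * (v - u)).
  by move=> s; apply: cvgD; [exact: cvg_cst|apply: cvgM; [exact: cvg_id|exact: cvg_cst]].
have cstc (u : R) : continuous (fun s : R => u) by move=> s; exact: cvg_cst.
have step1 : dom Om z <-> dom Om (lin k s1 (tcoor k z)).
  have := @path_dom R Om (fun s => lin k (scoor k z + s * (s1 - scoor k z)) (tcoor k z)) 0 1 ler01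
    (continuous_lin2 (k := k) (aff _ _) (cstc _)).
  rewrite mul0r addr0 mul1r subrKC lin_coor; apply=> s /andP[h0 h1].
  have H := i01 s h0 h1.
  apply: nb => //; first by rewrite ltr_distl; apply: H; rewrite -ltr_distl.
  have := s1b _ zt; rewrite /below; case: (sg) zG => zG s1G.
    have [m [mz ms]] : exists m : R, m < scoor k z /\ m < s1.
      exists (Num.min (scoor k z) s1 - 1); split; rewrite ltrBlDr gt_min ?ltrDl ltr01 ?orbT//.
    by have /andP[] := H (scoor k z) s1 m (G (tcoor k z)) ltac:(by rewrite mz) ltac:(by rewrite ms).
  have [m [mz ms]] : exists m : R, scoor k z < m /\ s1 < m.
    by exists (Num.max (scoor k z) s1 + 1); split; rewrite -ltrBlDr lt_max gtrBl ltr01 ?orbT.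
  by have /andP[] := H (scoor k z) s1 (G (tcoor k z)) m ltac:(by rewrite zG) ltac:(by rewrite s1G).
rewrite step1.
have := @path_dom R Om (fun s => lin k s1 (tcoor k z + s * (t0 - tcoor k z))) 0 1 ler01
  (continuous_lin2 (k := k) (cstc _) (aff _ _)).
rewrite mul0r addr0 mul1r subrKC; apply=> s /andP[h0 h1].
have H : `|tcoor k z + s * (t0 - tcoor k z) - t0| < dl.
  rewrite ltr_distl; apply: i01 => //; first by rewrite -ltr_distl.
  by itvlra.
by apply: nb => //; exact: s1b.
Qed.

(** The four clauses serve different purposes: the first Green's formula, the second the trace
    inequality, the third the flatness of curved edges and the last the identification of the local
    boundary term with [flux]. *)
Lemma chart k j (t kappa : R) (p := curve j t) (n := unit_normal (curve j) t) :
  0 <= t < 1 -> tcoor k (vel j t) != 0 -> 0 < kappa ->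
  exists dl ep sg G, [/\ halfbox Om k p dl ep sg G,
   exists2 c, 0 < c & forall i s, inbox k p dl ep (curve i s) -> c <= (-1) ^+ (~~ sg) * (dsgn R k * tcoor k (vel i s)),
   forall x y, bdry x -> bdry y -> inbox k p dl ep x -> inbox k p dl ep y ->
     `|dot n x - dot n y| <= kappa * `|tcoor k x - tcoor k y| &
   forall dl' h, dl' < dl -> {within cl, continuous h} ->
     (forall x, cl x -> ~ inbox k p dl' ep x -> h x = 0) ->
     flux k h = \int[mu]_(r in `](tcoor k p - dl), (tcoor k p + dl)[)
        ((-1) ^+ (~~ sg) * h (lin k (G r) r))].
Proof.
move=> t01 w0 k0.
have k'0 : 0 < Num.min kappa (1 / 4) by rewrite lt_min k0/= divr_gt0.
have [b [a [c [/andP[a0 a2] c0 bw hc hf]]]] := graph_window w0 k'0.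
set kp := Num.min kappa (1 / 4) in k'0 hf.
have k'1 : kp <= kappa by rewrite ge_min lexx.
have k'2 : kp <= 1 / 4 by rewrite ge_min lexx orbT.
pose u s := tcoor k (@curve _ Om j s).
have lip := window_lip hc.
pose inv r := xget t [set s | `|s - t| <= a /\ u s = r].
have hinv s : `|s - t| <= a -> inv (u s) = s.
  move=> sa; rewrite /inv; case: xgetP => [s' -> [sa' us']|/(_ s)]; last by case; split.
  move: sa' us'; set s2 := xget _ _ => sa' us'.
  have := lip _ _ sa sa'; rewrite -/(u s) -/(u s2) us' subrr normr0 pmulr_rle0// normr_le0 subr_eq0.
  by move/eqP.
have range := window_range a0 c0 hc.
have [ri ri0 Hri] := curve_isolated j t01 a0.
pose ep := ri / 2; have ep0 : 0 < ep by rewrite divr_gt0.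
have [e e0 He] : exists2 e : R, 0 < e & forall s, `|s - t| < e -> `|scoor k (curve j s) - scoor k p| < ep / 2.
  have c1 : continuous (fun s => - `|scoor k (@curve _ Om j s) - scoor k p|).
    by move=> s; apply: cvgN; apply: cvg_norm; apply: cvgB; [exact: continuous_scoor_curve|exact: cvg_cst].
  have [|e e0 He] := @near_gt R _ t (- (ep / 2)) c1.
    by rewrite subrr normr0 oppr0 oppr_lt0 divr_gt0.
  by exists e => // s /He; rewrite ltrN2.
(* [c * a] keeps r within the range of the window, [ep] makes the box small enough to contain no
   other arc, and [c * e] keeps the graph within ep/2 of the centre. *)
pose dl := Num.min (Num.min (c * a) ep) (c * e).
have ca0 : 0 < c * a by nn.
have dl0 : 0 < dl by rewrite !lt_min ca0 ep0 mulr_gt0.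
have dl1 : dl <= c * a by rewrite !ge_min lexx.
have dl2 : dl <= ep by rewrite !ge_min lexx orbT.
have dl3 : dl <= c * e by rewrite !ge_min lexx !orbT.
pose G r := scoor k (curve j (inv r)).
have inr r : `|r - tcoor k p| < dl -> `|inv r - t| <= a /\ u (inv r) = r.
  move=> rd; have [s sa us] := range r (ltW (lt_le_trans rd dl1)).
  by rewrite -us -/(u s) hinv.
have wt : `|t - t| <= a by rewrite subrr normr0 ltW.
have linG r : `|r - tcoor k p| < dl -> lin k (G r) r = curve j (inv r).
  by move=> /inr[_ h2]; rewrite -[RHS](lin_coor k) -/(u _) h2.
have iso i s : `|s - t| <= 1 / 2 -> inbox k p dl ep (curve i s) -> i = j /\ `|s - t| <= a.
  move=> st [h1 h2]; have [h3 h4] := coor_dist h2 (lt_le_trans h1 dl2).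
  have er : 2 * ep = ri by rewrite /ep; field.
  by rewrite er in h3 h4; have [-> /ltW] := Hri i s st h3 h4.
have inb z : bdry z -> inbox k p dl ep z ->
    exists2 s, `|s - t| <= a & z = curve j s.
  move=> /bdryP[i [s ->]] zin; have [m st] := shift_half s t.
  rewrite -(curve_shiftz i s m) in zin *.
  by have [ij sa] := iso i _ st zin; exists (s + m%:~R) => //; rewrite ij.
have hG r : `|r - tcoor k p| < dl -> `|G r - scoor k p| < ep / 2.
  move=> rd; have [h1 h2] := inr r rd; apply: He; rewrite -(ltr_pM2l c0).
  by apply: le_lt_trans (lip _ _ h1 wt) _; rewrite -/(u _) h2; exact: lt_le_trans dl3.
have hbd z : bdry z -> inbox k p dl ep z -> scoor k z = G (tcoor k z).
  by move=> bz /(inb z bz)[s sa ->]; rewrite /G -/(u s) hinv.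
pose sg := dsgn R k * (-1) ^+ b == 1.
have sgE : (-1) ^+ (~~ sg) = dsgn R k * (-1) ^+ b :> R.
  rewrite /sg; have n11 : (-1 == 1 :> R) = false by apply/negP => /eqP; lra.
  by case: (dsgn_cases R k) => ->; case: (b); rewrite ?expr0 ?expr1 ?mul1r ?mulN1r ?opprK ?eqxx ?n11.
have dsgn2 : dsgn R k * dsgn R k = 1 by case: (dsgn_cases R k) => ->; rewrite ?mulrNN mul1r.
have flat x y : bdry x -> bdry y -> inbox k p dl ep x -> inbox k p dl ep y ->
     `|dot n x - dot n y| <= kp * `|tcoor k x - tcoor k y|.
  move=> bx by' /(inb x bx)[s sa ->] /(inb y by')[s' sa' ->].
  exact: (window_flat (ltW k'0) c0 hc hf).
have bcurve i s : bdry (curve i s) by apply/bdryP; exists i, s.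
have pin : inbox k p dl ep p by split; rewrite subrr normr0.
have [n1 nv ev0 nd] := unit_normalE j t.
pose delta := dot (dirv R k) n.
have delta0 : 0 < (-1) ^+ (~~ sg) * delta.
  have : 0 < (-1) ^+ (~~ sg) * delta * enorm (vel j t).
    by rewrite -mulrA nd sgE mulrACA dsgn2 mul1r (lt_le_trans c0)// hc.
  by rewrite pmulr_lgt0.
have [h1n h2n] := unit_le1 n1.
have tn : `|tcoor k n| <= 2 by have := tcoor_le k n; rewrite -/n in h1n h2n; lra.
(* A displacement e' along the normal changes [dot n] by e', while the point of the curve on the
   same line of direction [dirv k] changes it by at most |e'|/2: the sign of e' decides the side of
   the graph. *)
have side (e' : R) : e' != 0 -> let q := (p.1 + e' * n.1, p.2 + e' * n.2) in inbox k p dl ep q ->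
    0 < e' * ((-1) ^+ (~~ sg) * (scoor k q - G (tcoor k q))).
  move=> e'0 q [qt qs].
  have [h1 h2] := inr _ qt; set g := curve j (inv (tcoor k q)) in h1 h2.
  have gE : lin k (G (tcoor k q)) (tcoor k q) = g by exact: linG.
  have gin : inbox k p dl ep g.
    rewrite -gE; split; rewrite ?tcoor_lin ?scoor_lin//.
    by apply: lt_trans (hG _ qt) _; clear -ep0; lra.
  have F := flat g p (bcurve _ _) (bcurve _ _) gin pin.
  have tg : tcoor k g - tcoor k p = e' * tcoor k n.
    by rewrite -/(u _) h2 /q; move: (k); apply: ord3P; rewrite /tcoor/=; ring.
  have F' : `|dot n g - dot n p| <= `|e'| / 2.
    apply: (le_trans F); rewrite tg normrM; apply: quarter_half => //; exact: ltW.
  have E : (scoor k q - G (tcoor k q)) * delta = dot n q - dot n g.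
    rewrite -gE -[in dot n q](lin_coor k q) /delta; move: (scoor k q) (tcoor k q) (G _) => s r g'.
    by move: (k); apply: ord3P; rewrite /dot/lin/dirv/=; ring.
  have E2 : dot n q = dot n p + e' by exact: dot_shift.
  rewrite -(pmulr_lgt0 _ delta0).
  have -> : e' * ((-1) ^+ (~~ sg) * (scoor k q - G (tcoor k q))) * ((-1) ^+ (~~ sg) * delta) =
     e' * ((scoor k q - G (tcoor k q)) * delta) * ((-1) ^+ (~~ sg) * (-1) ^+ (~~ sg)) by ring.
  rewrite E E2 -expr2 sqrr_sign mulr1.
  have -> : dot n p + e' - dot n g = e' - (dot n g - dot n p) by ring.
  exact: half_sign.
have [e1 [e10 e11 e12]] : exists e1 : R, [/\ 0 < e1,
    let q := (p.1 + - e1 * n.1, p.2 + - e1 * n.2) in inbox k p dl ep q /\ dom Om q &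
    let q := (p.1 + e1 * n.1, p.2 + e1 * n.2) in inbox k p dl ep q /\ ~ cl q].
  have O := curve_outward j t.
  have [e1 [e10 e1s h1 h2]] : exists e1 : R, [/\ 0 < e1, e1 < dl / 4,
     dom Om (p.1 - e1 * n.1, p.2 - e1 * n.2) & ~ cl (p.1 + e1 * n.1, p.2 + e1 * n.2)].
    have O' : \forall e \near (0 : R)^'+, dom Om (p.1 - e * n.1, p.2 - e * n.2) /\ ~ cl (p.1 + e * n.1, p.2 + e * n.2) by exact: O.
    near (0 : R)^'+ => e1; exists e1.
    have [h1 h2] : dom Om (p.1 - e1 * n.1, p.2 - e1 * n.2) /\ ~ cl (p.1 + e1 * n.1, p.2 + e1 * n.2) by near: e1.
    have h3 : 0 < e1 by [].
    have h4 : e1 < dl / 4 by near: e1; apply: nbhs_right_lt; exact: divr_gt0.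
    by [].
  have tq : `|e1 * tcoor k n| < dl by exact: small_prod.
  have sn : `|scoor k n| <= 1 by move: (k); apply: ord3P; rewrite /scoor/=.
  have sq : `|e1 * scoor k n| < ep.
    apply: (lt_le_trans (small_prod (d := dl) e10 e1s _) dl2).
    by apply: le_trans sn _; rewrite ler1n.
  have inq (e' : R) : `|e'| = e1 -> inbox k p dl ep (p.1 + e' * n.1, p.2 + e' * n.2).
    move=> ee; have tqE : tcoor k (p.1 + e' * n.1, p.2 + e' * n.2) = tcoor k p + e' * tcoor k n.
      by move: (k); apply: ord3P; rewrite /tcoor/=; ring.
    split; rewrite ?tqE; first by rewrite addrAC subrr add0r normrM ee -(gtr0_norm e10) -normrM.
    have -> : scoor k (p.1 + e' * n.1, p.2 + e' * n.2) = scoor k p + e' * scoor k n.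
      by move: (k); apply: ord3P; rewrite /scoor/=; ring.
    by rewrite addrAC subrr add0r normrM ee -(gtr0_norm e10) -normrM.
  exists e1; split => //; split => //; try (by apply: inq; rewrite ?normrN gtr0_norm).
  by rewrite !mulNr.
have sideE (e' : R) z : 0 < e' * ((-1) ^+ (~~ sg) * (scoor k z - G (tcoor k z))) ->
    if sg (+) (0 < e') then scoor k z < G (tcoor k z) else G (tcoor k z) < scoor k z.
  exact: sign_lt.
have sides := graph_sides dl0 ep0 hG hbd.
(* [curve_outward] provides one point of the domain and one point off its closure, on opposite
   sides; [graph_sides] extends this to the whole box. *)
have base1 : dom Om (lin k (scoor k p - (-1) ^+ (~~ sg) * (3 / 4 * ep)) (tcoor k p)).
  have [h1 h2] := e11; apply/(sides sg _ h1) => //.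
  have := sideE _ _ (side (- e1) _ h1); rewrite oppr_gt0 ltNge (ltW e10) addbF; apply.
  by rewrite oppr_eq0 gt_eqF.
have base2 : ~ dom Om (lin k (scoor k p - (-1) ^+ (~~ ~~ sg) * (3 / 4 * ep)) (tcoor k p)).
  have [h1 h2] := e12; move=> /(sides (~~ sg) _ h1) H; apply/h2/dom_cl/H.
  have := sideE _ _ (side e1 _ h1); rewrite e10 addbT; apply.
  by rewrite gt_eqF.
exists dl, ep, sg, G; split.
- split => //.
  + by move=> r /hG h; apply: ltW; apply: lt_trans h _; rewrite ltr_pdivrMr// ltr_pMr// ltr1n.
  + move=> z zin; split=> [Oz|/(sides sg _ zin) H]; last exact/H.
    apply: contrapT => nz; have [E|E] := eqVneq (scoor k z) (G (tcoor k z)).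
      have [zt _] := zin; have := bcurve j (inv (tcoor k z)).
      by rewrite -linG// -E lin_coor => -[].
    apply: base2; apply/(sides (~~ sg) _ zin) => //.
    by move: nz; case: (sg) => /= /negP; rewrite -leNgt le_eqVlt ?(negbTE E)//= eq_sym (negbTE E).
  + move=> r rd; have [h1 h2] := inr r rd.
    move=> B nB; have nB' : nbhs (inv r) [set s | B (scoor k (curve j s))].
      exact: (@continuous_scoor_curve _ _ k j _ _ nB).
    have /nbhs_ballP[d /= d0 dB] := nB'.
    apply/nbhs_ballP; exists (Num.min (c * d) (dl - `|r - tcoor k p|)) => /=.
      by rewrite lt_min mulr_gt0// subr_gt0.
    move=> r'; rewrite /ball/= lt_min => /andP[h3 h4].
    have rd' : `|r' - tcoor k p| < dl.
      have := ler_normD (r' - r) (r - tcoor k p); rewrite subrKA (distrC r' r) => /le_lt_trans; apply.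
      by rewrite -ltrBrDr.
    have [h5 h6] := inr r' rd'; apply: dB; rewrite /ball/= -(ltr_pM2l c0).
    by apply: le_lt_trans (lip _ _ h1 h5) _; rewrite -!/(u _) h2 h6.
  + by move=> r rd; rewrite linG//; have [] := bcurve j (inv r).
- exists c => // i s; have [m st] := shift_half s t.
  rewrite -(curve_shiftz i s m) -(vel_shiftz i s m) => /(iso i _ st)[-> sa].
  by rewrite sgE mulrACA dsgn2 mul1r hc.
- move=> x y bx by' xin yin; apply: le_trans (flat _ _ bx by' xin yin) _.
  exact: ler_wpM2r.
- move=> dl' h dl'dl ch h0.
  rewrite (@flux_window _ _ k j t a c b dl dl' ep inv h)//; last by rewrite a0.
  by apply: eq_Rintegral => r; rewrite inE/= in_itv/= -ltr_distl => rd; rewrite linG// sgE.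
Unshelve. all: by end_near. Qed.

End charts.

(** * Green's formula, the trace inequality and the embedding of W^{1,1} in L^2 *)

Section green.
Variables (R : realType) (Om : smooth_domain R).
Notation mu := (@lebesgue_measure R).
Notation cl := (clos Om).
Notation vel j := (velocity (@curve _ Om j)).
Notation bdry := (@bdry R Om).
Notation flux := (@flux R Om).
Notation I := (@I R Om).
Notation bm := (@bm R Om).
Notation PC1 := (@PC1 R Om).
Notation cont_cl g := {within cl, continuous g}.
Implicit Types (k : 'I_3) (i j : 'I_(ncurves Om)) (g h : R * R -> R) (x y z p : R * R).

Lemma I_add f g : bm f -> bm g -> I (fun x => f x + g x) = I f + I g.
Proof.
by move=> /bm_intg bf /bm_intg bg; rewrite /I RintegralD//; exact: measurable_dom.
Qed.

Lemma I_scale (c : R) f : bm f -> I (fun x => c * f x) = c * I f.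
Proof. by move=> /bm_intg bf; rewrite /I RintegralZl//; exact: measurable_dom. Qed.

Lemma I_opp f : bm f -> I (fun x => - f x) = - I f.
Proof.
by move=> bf; rewrite -mulN1r -I_scale//; congr (I _); apply/funext => x; rewrite mulN1r.
Qed.

Lemma I_sub f g : bm f -> bm g -> I (fun x => f x - g x) = I f - I g.
Proof. by move=> bf bg; rewrite I_add ?I_opp//; exact: bm_opp. Qed.

Lemma I_ext f g : (forall x, dom Om x -> f x = g x) -> I f = I g.
Proof. by move=> fg; apply: eq_Rintegral => x; rewrite inE; exact: fg. Qed.

Lemma I_le f g : bm f -> bm g -> (forall x, dom Om x -> f x <= g x) -> I f <= I g.
Proof.
by move=> /bm_intg bf /bm_intg bg fg; apply: le_Rintegral => //; exact: measurable_dom.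
Qed.

Lemma I_ge0 f : (forall x, dom Om x -> 0 <= f x) -> 0 <= I f.
Proof. by move=> f0; apply: Rintegral_ge0 => x; exact: f0. Qed.

Lemma I_sum (T : Type) (s : seq T) (F : T -> R * R -> R) : (forall a, bm (F a)) ->
  I (fun x => \sum_(a <- s) F a x) = \sum_(a <- s) I (F a).
Proof.
move=> bF; elim: s => [|a s IH].
  rewrite big_nil -[RHS](mul0r (I (fun=> 0))) -I_scale; last exact: bm_cst.
  by apply: I_ext => x _; rewrite big_nil mul0r.
by rewrite big_cons -IH -I_add//; [apply: I_ext => x _; rewrite big_cons|exact: bm_sum].
Qed.

Lemma PC1_sum (T : Type) (s : seq T) (F F1 F2 : T -> R * R -> R) :
  (forall a, PC1 (F a) (F1 a) (F2 a)) ->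
  PC1 (fun x => \sum_(a <- s) F a x) (fun x => \sum_(a <- s) F1 a x) (fun x => \sum_(a <- s) F2 a x).
Proof.
move=> pF; elim: s => [|a s IH].
  by apply: (PC1_ext (PC1_cst Om 0)) => x; rewrite big_nil.
by apply: (PC1_ext (PC1_add (pF a) IH)) => x; rewrite big_cons.
Qed.

Lemma is_derive_quad (f : R -> R) (x l K : R) :
  (forall d, `|f (x + d) - f x - l * d| <= K * d ^+ 2) -> is_derive x 1 f l.
Proof.
move=> H; have K0 : 0 <= K by have := le_trans (normr_ge0 _) (H 1); rewrite expr1n mulr1.
have L : (fun h : R => h^-1 *: ((f \o shift x) (h *: (1 : R)) - f x)) @ (0 : R)^' --> l.
  apply/cvgrPdist_le => e e0; rewrite near_withinE.
  have d0 : 0 < e / (K + 1) by rewrite divr_gt0// ltr_wpDl.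
  near=> h => h0.
  have -> : l - h^-1 *: ((f \o shift x) (h *: (1 : R)) - f x) = - (h^-1 * (f (x + h) - f x - l * h)).
    by rewrite /= /GRing.scale/= mulr1 (addrC h); field.
  rewrite normrN normrM normrV ?unitfE// mulrC ler_pdivrMr ?normr_gt0//.
  apply: (le_trans (H h)); rewrite -normr2// expr2 mulrA ler_wpM2r//.
  have h1 : `|h| <= e / (K + 1).
    by near: h; rewrite -nbhs_nearE; apply: (@nbhs0_le _ R).
  apply: (@le_trans _ _ (K * (e / (K + 1)))); first exact: ler_wpM2l.
  by rewrite mulrCA ger_pMr// ler_pdivrMr ?ltr_wpDl// mul1r lerDl.
by split; [apply/cvg_ex; exists l|exact: cvg_lim].
Unshelve. all: by end_near. Qed.

Lemma is_derive_pos2 (u : R) : is_derive u 1 (fun u => Num.max u 0 ^+ 2) (2 * Num.max u 0).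
Proof.
apply: (@is_derive_quad _ _ _ 1) => h; rewrite mul1r.
have := sqr_ge0 h; rewrite ler_norml /Num.max => h2.
by case: (ltP u 0) => u0; case: (ltP (u + h) 0) => v0; apply/andP; split; nra.
Qed.

Lemma continuous_pos : continuous (fun u : R => Num.max u 0).
Proof.
have -> : (fun u : R => Num.max u 0) = (fun u => (u + `|u|) / 2).
  apply/funext => u; rewrite /Num.max; case: ltP => h; first by rewrite ltr0_norm// subrr mul0r.
  by rewrite ger0_norm//; lra.
move=> u; apply: cvgM; last exact: cvg_cst.
by apply: cvgD; [exact: cvg_id|apply: cvg_norm; exact: cvg_id].
Qed.

Definition disc p (r : R) z : Prop := (z.1 - p.1) ^+ 2 + (z.2 - p.2) ^+ 2 < r ^+ 2.

Definition supp g g1 g2 p (r : R) : Prop :=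
  forall z, cl z -> ~ disc p r z -> [/\ g z = 0, g1 z = 0 & g2 z = 0].

(** A partition of unity need only be C^1 here, so the squared positive part of a quadratic
    polynomial is enough. *)
Definition bump p (r : R) z : R := Num.max (r ^+ 2 - ((z.1 - p.1) ^+ 2 + (z.2 - p.2) ^+ 2)) 0 ^+ 2.

Lemma bump_gt0 p r z : disc p r z -> 0 < bump p r z.
Proof. by rewrite /disc /bump => zd; rewrite exprn_gt0// lt_max subr_gt0 zd. Qed.

Lemma bump_ge0 p r z : 0 <= bump p r z. Proof. exact: sqr_ge0. Qed.

Lemma PC1_bump p r : exists g1 g2, PC1 (bump p r) g1 g2 /\ supp (bump p r) g1 g2 p r.
Proof.
have d1 := PC1_exp 1 (PC1_sub (PC1_fst Om) (PC1_cst Om p.1)).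
have d2 := PC1_exp 1 (PC1_sub (PC1_snd Om) (PC1_cst Om p.2)).
have d := PC1_sub (PC1_cst Om (r ^+ 2)) (PC1_add d1 d2).
have D := PC1_comp (phi := fun u => Num.max u 0 ^+ 2) (phi' := fun u => 2 * Num.max u 0) d
  (fun x _ => is_derive_pos2 _).
eexists; eexists; split.
  apply: D => x _; apply: cvgM; first exact: cvg_cst.
  by apply: continuous_pos.
move=> z _ /negP; rewrite /disc -leNgt /bump => h.
have -> : Num.max (r ^+ 2 - ((z.1 - p.1) ^+ 2 + (z.2 - p.2) ^+ 2)) 0 = 0 by rewrite max_r// subr_le0.
by rewrite expr0n mulr0 !mul0r.
Qed.

Lemma open_disc p r : open (disc p r).
Proof.
pose f z : R := (z.1 - p.1) * (z.1 - p.1) + (z.2 - p.2) * (z.2 - p.2).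
have cf : continuous f.
  have c1 : continuous (fun z : R * R => z.1 - p.1).
    by move=> z; apply: cvgB; [exact: cvg_fst|exact: cvg_cst].
  have c2 : continuous (fun z : R * R => z.2 - p.2).
    by move=> z; apply: cvgB; [exact: cvg_snd|exact: cvg_cst].
  by move=> z; apply: cvgD; apply: cvgM; by [exact: c1|exact: c2].
have -> : disc p r = f @^-1` [set u | u < r ^+ 2] by apply/seteqP; split => z; rewrite /disc /f/= !expr2.
by move/continuousP : cf; apply; exact: open_lt.
Qed.

Lemma disc_center p r : 0 < r -> disc p r p.
Proof. by move=> r0; rewrite /disc !subrr expr0n addr0 exprn_gt0. Qed.

Lemma disc_coor p r z : 0 < r -> disc p r z -> `|z.1 - p.1| < r /\ `|z.2 - p.2| < r.
Proof.
rewrite /disc => r0 h; have := sqr_ge0 (z.1 - p.1); have := sqr_ge0 (z.2 - p.2) => h1 h2.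
by split; rewrite -(@ltr_pXn2r _ 2)// ?nnegrE ?normr_ge0 ?(ltW r0)// normr2//; lra.
Qed.

Lemma disc_inbox k p r z : 0 < r -> disc p r z -> inbox k p (2 * r) r z.
Proof.
move=> r0 /(disc_coor r0)[]; rewrite /inbox !ltr_norml => /andP[h1 h2] /andP[h3 h4].
by elim/ord3P: k; rewrite /tcoor/scoor/=; split; itvlra.
Qed.

Lemma finite_disc_cover (r : R * R -> R) : (forall x, cl x -> 0 < r x) ->
  exists s : seq (R * R), (forall x, x \in s -> cl x) /\
    forall z, cl z -> exists2 x, x \in s & disc x (r x) z.
Proof.
move=> r0; pose P (s : seq (R * R)) := forall x, x \in s -> cl x.
(* The filter of finite lists of centres directed by inclusion: the near-covering form of
   compactness then yields a finite subcover. *)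
pose F : set_system (seq (R * R)) := [set A | exists s0, P s0 /\ forall s, P s -> {subset s0 <= s} -> A s].
have FF : Filter F.
  split; first by exists [::].
    move=> A B [s [Ps sA]] [s' [Ps' sB]]; exists (s ++ s'); split.
      by move=> x; rewrite mem_cat => /orP[/Ps|/Ps'].
    move=> t Pt st; split; [apply: sA => //|apply: sB => //] => x xs; apply: st;
      by rewrite mem_cat xs ?orbT.
  by move=> A B AB [s [Ps sA]]; exists s; split => // t Pt st; apply/AB/sA.
have /compact_near_coveringP cc := @compact_cl R Om.
have [x clx|s0 [Ps0 Hs0]] := cc _ F (fun (s : seq (R * R)) z => exists2 x : R * R, x \in s & disc x (r x) z) FF.
  exists (disc x (r x), [set s : seq (R * R) | x \in s]) => /=.
    split; first by apply: open_nbhs_nbhs; split; [exact: open_disc|apply: disc_center; exact: r0].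
    exists [:: x]; split; first by move=> y; rewrite inE => /eqP ->.
    by move=> s _; apply; exact: mem_head.
  by move=> [z s] /= [zd xs]; exists x.
by exists s0; split => // z clz; exact: (Hs0 s0).
Qed.

(** Bumps divided by their sum, which is positive on the closure. The vanishing sums of derivatives
    remove the terms where a derivative falls on a weight. *)
Lemma partition_of_unity (r : R * R -> R) : (forall x, cl x -> 0 < r x) ->
  exists (s : seq (R * R)) (be be1 be2 : R * R -> R * R -> R),
   [/\ (forall x, x \in s -> cl x),
       (forall x, PC1 (be x) (be1 x) (be2 x)),
       (forall x, supp (be x) (be1 x) (be2 x) x (r x)),
       (forall x z, cl z -> 0 <= be x z) &
       forall z, cl z -> [/\ \sum_(x <- s) be x z = 1, \sum_(x <- s) be1 x z = 0 &
         \sum_(x <- s) be2 x z = 0]].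
Proof.
move=> r0; have [s [scl scov]] := finite_disc_cover r0.
have [b1 Hb1] := choice (fun p => PC1_bump p (r p)).
have [b2 Hb2] := choice Hb1.
pose b p := bump p (r p).
have pb p : PC1 (b p) (b1 p) (b2 p) by have [] := Hb2 p.
have sb p : supp (b p) (b1 p) (b2 p) p (r p) by have [] := Hb2 p.
pose B z := \sum_(x <- s) b x z.
have pB := PC1_sum s pb.
have B0 z : cl z -> 0 < B z.
  move=> /scov[x xs zx]; rewrite /B (big_rem x)//= ltr_wpDr//; last exact: bump_gt0.
  by rewrite sumr_ge0// => y _; exact: bump_ge0.
have Bn z : cl z -> B z != 0 by move=> /B0 h; rewrite gt_eqF.
have pV := PC1_inv pB Bn.
exists s, (fun x z => b x z * (B z)^-1),
  (fun x z => b x z * (- (B z) ^- 2 * \sum_(a <- s) b1 a z) + (B z)^-1 * b1 x z),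
  (fun x z => b x z * (- (B z) ^- 2 * \sum_(a <- s) b2 a z) + (B z)^-1 * b2 x z); split => //.
- move=> x; exact: (PC1_mul (pb x) pV).
- by move=> x z clz zd /=; have [-> -> ->] := sb x z clz zd; rewrite !mul0r !mulr0 !addr0.
- by move=> x z clz /=; rewrite mulr_ge0 ?bump_ge0// invr_ge0 ltW// B0.
move=> z clz /=; rewrite -/(B z).
have h := Bn z clz.
rewrite -mulr_suml -/(B z) mulfV//; split => //.
  rewrite big_split/= -mulr_suml -mulr_sumr -/(B z) mulrA.
  by rewrite expr2 invfM mulrN mulrA mulfV// mul1r mulNr addNr.
rewrite big_split/= -mulr_suml -mulr_sumr -/(B z) mulrA.
by rewrite expr2 invfM mulrN mulrA mulfV// mul1r mulNr addNr.
Qed.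

Lemma flux_integrable g k j : cont_cl g ->
  mu.-integrable `[0, 1] (EFin \o (fun s => g (curve j s) * (dsgn R k * tcoor k (vel j s)))).
Proof.
move=> cg; apply: cont_itv_integrable; apply: continuous_subspaceT => s.
apply: cvgM; first exact: continuous_h_curve.
by apply: cvgM; [exact: cvg_cst|exact: continuous_tcoor_vel].
Qed.

Lemma flux_add g h k : cont_cl g -> cont_cl h -> flux k (fun z => g z + h z) = flux k g + flux k h.
Proof.
move=> cg ch; rewrite /flux -big_split/=; apply: eq_bigr => j _.
by rewrite -RintegralD//; [apply: eq_Rintegral => s _; rewrite mulrDl|exact: flux_integrable|exact: flux_integrable].
Qed.

Lemma flux_ext g h k : (forall z, bdry z -> g z = h z) -> flux k g = flux k h.
Proof.
move=> gh; apply: eq_bigr => j _; apply: eq_Rintegral => s _; rewrite gh//.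
by apply/bdryP; exists j, s.
Qed.

Lemma flux_zero g k : (forall z, bdry z -> g z = 0) -> flux k g = 0.
Proof.
move=> g0; rewrite /flux big1// => j _.
rewrite (@eq_Rintegral _ _ _ _ _ (fun=> 0)) ?Rintegral_cst ?mul0r// => s _.
by rewrite g0 ?mul0r//; apply/bdryP; exists j, s.
Qed.

Lemma flux_sum (T : Type) (s : seq T) (F : T -> R * R -> R) k : (forall a, cont_cl (F a)) ->
  flux k (fun z => \sum_(a <- s) F a z) = \sum_(a <- s) flux k (F a).
Proof.
move=> cF; elim: s => [|a s IH].
  by rewrite big_nil flux_zero// => z _; rewrite big_nil.
rewrite big_cons -IH -flux_add//; first by apply: flux_ext => z _; rewrite big_cons.
elim: s {IH} => [|c s IH]; first by under eq_fun do rewrite big_nil; move=> z; exact: cvg_cst.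
by under eq_fun do rewrite big_cons; move=> z; apply: cvgD; [exact: cF|exact: IH].
Qed.

Lemma flux_diag g : cont_cl g ->
  flux o3_2 g = flux o3_0 g + flux o3_1 g.
Proof.
move=> cg; rewrite /flux -big_split/=; apply: eq_bigr => j _.
rewrite -RintegralD//; [|exact: flux_integrable|exact: flux_integrable].
by apply: eq_Rintegral => s _; rewrite /dsgn/tcoor/=; ring.
Qed.

Lemma two_of_three (a b : 'I_3 -> R) k k' :
  a o3_2 = a o3_0 + a o3_1 ->
  b o3_2 = b o3_0 + b o3_1 ->
  k != k' -> a k = b k -> a k' = b k' -> forall l, a l = b l.
Proof.
move=> E F; have [E0 E1] : a o3_0 = a o3_2 - a o3_1 /\
    a o3_1 = a o3_2 - a o3_0 by rewrite E; split; ring.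
have [F0 F1] : b o3_0 = b o3_2 - b o3_1 /\
    b o3_1 = b o3_2 - b o3_0 by rewrite F; split; ring.
move: k k'; apply: ord3P; apply: ord3P => // _ h1 h2; apply: ord3P => //;
 by [rewrite E F h1 h2|rewrite E0 F0 h1 h2|rewrite E1 F1 h1 h2].
Qed.

(** The diagonal derivative is the sum of the two others and the diagonal flux likewise, so any two
    directions determine the third. *)
Lemma green_two k k' g g1 g2 : k != k' -> PC1 g g1 g2 ->
  I (dk k g1 g2) = flux k g -> I (dk k' g1 g2) = flux k' g ->
  forall l, I (dk l g1 g2) = flux l g.
Proof.
move=> kk' [cg b1 b2 _].
have E : I (dk o3_2 g1 g2) = I (dk o3_0 g1 g2) + I (dk o3_1 g1 g2).
  by rewrite -I_add; [apply: I_ext => x _; rewrite /dk/dirv/=; ring|exact: bm_dk|exact: bm_dk].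
have F := flux_diag cg.
exact: (two_of_three (a := fun k => I (dk k g1 g2)) (b := flux^~ g)) E F kk'.
Qed.

Definition green_ok g g1 g2 := forall k, I (dk k g1 g2) = flux k g.

Definition sup_ok g g1 g2 := exists k k', [/\ k != k', supbound Om k g g1 g2 & supbound Om k' g g1 g2].

(** An interior point is treated as a boundary point whose graph is the end face of the box, out of
    reach of the supports considered. *)
Lemma interior_halfbox x : dom Om x -> exists2 e : R, 0 < e &
  forall k, halfbox Om k x e e true (fun=> scoor k x + e).
Proof.
move=> Ox; have /nbhs_box[e e0 eO] : nbhs x (Om : set (R * R)).
  by apply: open_nbhs_nbhs; split => //; exact: dom_open.
have H k z : `|tcoor k z - tcoor k x| < e / 2 -> `|scoor k z - scoor k x| <= e / 4 -> dom Om z.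
  rewrite ltr_norml ler_norml => /andP[h1 h2] /andP[h3 h4].
  have [] : `|z.1 - x.1| < e /\ `|z.2 - x.2| < e.
    move: k h1 h2 h3 h4; apply: ord3P; rewrite /tcoor/scoor/= => h1 h2 h3 h4;
    by split; rewrite ltr_norml; itvlra.
  by rewrite distrC => h5; rewrite distrC => h6; exact: eO.
exists (e / 4); first by rewrite divr_gt0.
have e4 : 0 < e / 4 by rewrite divr_gt0.
move=> k; split => //.
- by move=> t _; rewrite addrAC subrr add0r gtr0_norm.
- move=> z [h1 h2]; split=> [_|_]; first by move: h2; rewrite ltr_norml => /andP[_]; rewrite ltrBlDl.
  by apply: (H k); [apply: lt_trans h1 _; lra|exact: ltW].
- by move=> t _; exact: cvg_cst.
- move=> t h1; apply/dom_cl/(H k); rewrite ?tcoor_lin ?scoor_lin.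
    by apply: lt_trans h1 _; lra.
  by rewrite addrAC subrr add0r gtr0_norm.
Qed.

Lemma interior_data x : dom Om x -> exists2 r : R, 0 < r &
  (forall g g1 g2, PC1 g g1 g2 -> supp g g1 g2 x r -> green_ok g g1 g2 /\ sup_ok g g1 g2) /\
  (forall i s, ~ disc x r (curve i s)).
Proof.
move=> Ox; have [e e0 he] := interior_halfbox Ox.
have e4 : 0 < e / 4 by rewrite divr_gt0.
exists (e / 4) => //; split; last first.
  move=> i s /(disc_inbox o3_0 e4)[h1 h2].
  have [_ nO] : bdry (curve i s) by apply/bdryP; exists i, s.
  have inb : inbox o3_0 x e e (curve i s) by split; lra.
  apply: nO; apply/(hb_dom (he _) inb).
  by move: h2; rewrite ltr_norml => /andP[_]; rewrite ltrBlDl; lra.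
move=> g g1 g2 pg sg.
have si k : supp_in Om k x (e / 2) (e / 2) g g1 g2.
  move=> z clz zn; apply: (sg z clz) => zd; apply: zn.
  by have [h1 h2] := disc_inbox k e4 zd; split; lra.
have e2 : e / 2 < e by lra.
split.
  move=> k; have := local_green (he k) e2 e2 pg (si k).
  rewrite integral0_eq => [[->]|t].
    rewrite flux_zero// => z [clz nz]; have [|//] := sg z clz.
    move=> zd; apply: nz; have [h1 h2] := disc_inbox k e4 zd.
    have inb : inbox k x e e z by split; lra.
    by apply/(hb_dom (he k) inb); move: h2; rewrite ltr_norml => /andP[_]; rewrite ltrBlDl; lra.
  rewrite /= in_itv/= -ltr_distl => te; have [|-> _ _] := si k _ (hb_cl (he k) te); last by rewrite mulr0.
  by case=> _; rewrite scoor_lin addrAC subrr add0r gtr0_norm//; lra.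
exists o3_0, o3_1.
by split => //; exact: (local_sup (he _) e2 e2 pg (si _)).
Qed.

Lemma boundary_data x : bdry x -> exists2 r : R, 0 < r &
  (forall g g1 g2, PC1 g g1 g2 -> supp g g1 g2 x r -> green_ok g g1 g2 /\ sup_ok g g1 g2) /\
  (exists k (sg : R) (c : R), 0 < c /\ forall i s, disc x r (curve i s) ->
     c <= sg * (dsgn R k * tcoor k (vel i s))).
Proof.
move=> /bdryP[j [t0 xE]].
have [t [t01 {t0 xE}->]] : exists t, 0 <= t < 1 /\ x = curve j t.
  have [m] := shift_window t0 0; rewrite add0r => h.
  by exists (t0 + m%:~R); rewrite curve_shiftz.
(* The tangent is parallel to at most one of the three directions. *)
have [k [k' [kk' w w']]] : exists k k', [/\ k != k', tcoor k (vel j t) != 0 & tcoor k' (vel j t) != 0].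
  have := @curve_regular _ Om j t; case: (vel j t) => a b ab.
  have [a0|a0] := eqVneq a 0.
    have b0 : b != 0 by apply/eqP => b0; apply: ab; rewrite a0 b0.
    exists o3_0, o3_2; split => //=.
    by rewrite /tcoor/= a0 subr0.
  have [b0|b0] := eqVneq b 0.
    exists o3_1, o3_2; split => //=.
    by rewrite /tcoor/= b0 sub0r oppr_eq0.
  by exists o3_0, o3_1.
have C k0 : tcoor k0 (vel j t) != 0 -> exists2 r : R, 0 < r &
  (forall g g1 g2, PC1 g g1 g2 -> supp g g1 g2 (curve j t) r -> I (dk k0 g1 g2) = flux k0 g /\ supbound Om k0 g g1 g2) /\
  (exists (sg : R) (c : R), 0 < c /\ forall i s, disc (curve j t) r (curve i s) ->
     c <= sg * (dsgn R k0 * tcoor k0 (vel i s))).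
  move=> w0; have [dl [ep [sg [G [hb [c c0 hc] _ hf]]]]] := chart t01 w0 (@ltr01 R).
  have dl0 := hb_dl hb; have ep0 := hb_ep hb.
  pose r := Num.min (dl / 4) (ep / 2).
  have r0 : 0 < r by rewrite lt_min !divr_gt0.
  have r1 : r <= dl / 4 by rewrite ge_min lexx.
  have r2 : r <= ep / 2 by rewrite ge_min lexx orbT.
  have inb z : disc (curve j t) r z -> inbox k0 (curve j t) (dl / 2) (ep / 2) z.
    by move=> /(disc_inbox k0 r0)[h1 h2]; split; lra.
  have dl2 : dl / 2 < dl by lra.
  have ep2 : ep / 2 < ep by lra.
  exists r => //; split; last first.
    exists ((-1) ^+ (~~ sg)), c; split => // i s /inb[h1 h2]; apply: hc; split; lra.
  move=> g g1 g2 pg sp.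
  have si : supp_in Om k0 (curve j t) (dl / 2) (ep / 2) g g1 g2.
    by move=> z clz zn; apply: sp => // /inb.
  split; last exact: (local_sup hb dl2 ep2 pg si).
  have := local_green hb dl2 ep2 pg si.
  rewrite (hf (dl / 2) g dl2 (pc_cont pg)); first by move=> E; rewrite /Rintegral -E.
  move=> z clz zn; have [|//] := si z clz.
  by move=> [h1 h2]; apply: zn; split => //; lra.
have [r r0 [H1 [sg [c [c0 Hc]]]]] := C k w; have [r' r'0 [H1' _]] := C k' w'.
exists (Num.min r r'); first by rewrite lt_min r0.
have sub (a : R) z : Num.min r r' <= a -> 0 < a -> disc (curve j t) (Num.min r r') z -> disc (curve j t) a z.
  rewrite /disc => h1 h2 /lt_le_trans; apply; rewrite lerXn2r// nnegrE ltW// lt_min.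
  by rewrite r0.
split; last first.
  by exists k, sg, c; split => // i s /(sub r) h; apply: Hc; apply: h => //; rewrite ge_min lexx.
move=> g g1 g2 pg sp.
have [G1 S1] : I (dk k g1 g2) = flux k g /\ supbound Om k g g1 g2.
  by apply: H1 => // z clz zn; apply: sp => // /(sub r) h; apply/zn/h => //; rewrite ge_min lexx.
have [G2 S2] : I (dk k' g1 g2) = flux k' g /\ supbound Om k' g g1 g2.
  by apply: H1' => // z clz zn; apply: sp => // /(sub r') h; apply/zn/h => //; rewrite ge_min lexx orbT.
by split; [exact: green_two kk' pg G1 G2|exists k, k'].
Qed.

Lemma continuous_enorm_vel j : continuous (fun s => enorm (vel j s)).
Proof.
have -> : (fun s => enorm (vel j s)) = Num.sqrt \o (fun s => (vel j s).1 * (vel j s).1 + (vel j s).2 * (vel j s).2).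
  by apply/funext => s; rewrite /= /enorm !expr2.
move=> s; apply: continuous_comp; last exact: sqrt_continuous.
have c1 := @continuous_vel1 _ _ j s; have c2 := @continuous_vel2 _ _ j s.
exact: (cvgD (cvgM c1 c1) (cvgM c2 c2)).
Qed.

Lemma enorm_vel_bounded : exists2 V : R, 0 < V & forall j s, enorm (vel j s) <= V.
Proof.
have ce j : continuous (fun s => - enorm (vel j s)).
  by move=> s; apply: cvgN; exact: continuous_enorm_vel.
have H j : exists V : R, 0 < V /\ forall s, enorm (vel j s) <= V.
  have [c _ Hc] := @EVT_min R (fun s => - enorm (vel j s)) 0 1 ler01 (continuous_subspaceT (ce j)).
  exists (enorm (vel j c) + 1); split; first by rewrite ltr_wpDl// sqrtr_ge0.
  move=> s; have [m] := shift_window s 0; rewrite add0r => /andP[h1 h2].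
  rewrite -(vel_shiftz j s m).
  have := Hc (s + m%:~R); rewrite in_itv/= h1 (ltW h2) lerN2 => /(_ isT); lra.
have [V HV] := choice H.
exists (1 + \sum_j V j) => [|j s].
  by rewrite ltr_wpDr// sumr_ge0// => j _; have [/ltW] := HV j.
rewrite (bigD1 j)//= addrCA (le_trans (proj2 (HV j) s))// lerDl addr_ge0// sumr_ge0// => i _.
by have [/ltW] := HV i.
Qed.

Lemma local_data x : cl x -> exists r : R, 0 < r /\
  (forall g g1 g2, PC1 g g1 g2 -> supp g g1 g2 x r -> green_ok g g1 g2 /\ sup_ok g g1 g2) /\
  (exists (k : 'I_3) (sg : R) (c : R), 0 < c /\ forall i s, disc x r (curve i s) ->
     c <= sg * (dsgn R k * tcoor k (vel i s))).
Proof.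
move=> clx; have [Ox|nO] := pselect (dom Om x).
  have [r r0 [H1 H2]] := interior_data Ox; exists r; split => //; split => //.
  by exists o3_0, 0, 1; split => // i s /H2.
by have [r r0 H] := boundary_data (conj clx nO); exists r.
Qed.

Lemma choice_on (A B : Type) (D : A -> Prop) (P : A -> B -> Prop) (b0 : B) :
  (forall a, D a -> exists b, P a b) -> exists f : A -> B, forall a, D a -> P a (f a).
Proof.
move=> H; have /choice[f Hf] : forall a, exists b, D a -> P a b.
  by move=> a; have [/H[b Hb]|na] := pselect (D a); [exists b|exists b0].
by exists f.
Qed.

Lemma local_radius : exists r : R * R -> R, forall x, cl x -> 0 < r x /\
  (forall g g1 g2, PC1 g g1 g2 -> supp g g1 g2 x (r x) -> green_ok g g1 g2 /\ sup_ok g g1 g2) /\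
  (exists (k : 'I_3) (sg : R) (c : R), 0 < c /\ forall i s, disc x (r x) (curve i s) ->
     c <= sg * (dsgn R k * tcoor k (vel i s))).
Proof.
exact: (choice_on 0 local_data).
Qed.

(** Each piece of the partition of unity is supported in a disc where the formula is known; the
    terms with derivatives of the weights cancel in the sum. *)
Lemma green g g1 g2 k : PC1 g g1 g2 -> I (dk k g1 g2) = flux k g.
Proof.
move=> pg; have [r Hr] := local_radius.
have [s [be [be1 [be2 [scl pb sb b0 b1]]]]] := partition_of_unity (fun x clx => proj1 (Hr x clx)).
pose F x z := be x z * g z.
pose F1 x z := be x z * g1 z + g z * be1 x z.
pose F2 x z := be x z * g2 z + g z * be2 x z.
have pF x : PC1 (F x) (F1 x) (F2 x) := PC1_mul (pb x) pg.
have sF x : supp (F x) (F1 x) (F2 x) x (r x).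
  by move=> z clz zd; rewrite /F/F1/F2; have [-> -> ->] := sb x z clz zd; rewrite !mul0r !mulr0 addr0.
have -> : flux k g = flux k (fun z => \sum_(x <- s) F x z).
  apply: flux_ext => z [clz _]; rewrite /F -mulr_suml.
  by have [-> _ _] := b1 z clz; rewrite mul1r.
rewrite flux_sum; last by move=> x; exact: pc_cont (pF x).
have -> : I (dk k g1 g2) = I (fun z => \sum_(x <- s) dk k (F1 x) (F2 x) z).
  apply: I_ext => z Oz; rewrite /dk big_split/= -!mulr_suml /F1 /F2 !big_split/= -!mulr_suml -!mulr_sumr.
  by have [-> -> ->] := b1 z (dom_cl Oz); rewrite !mul1r !mulr0 !addr0.
rewrite I_sum; last by move=> x; apply: bm_dk; [exact: pc_bm1 (pF x)|exact: pc_bm2 (pF x)].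
rewrite big_seq [RHS]big_seq; apply: eq_bigr => x xs.
by have [_ [H _]] := Hr x (scl x xs); have [-> _] := H _ _ _ (pF x) (sF x).
Qed.

Lemma dk_le k g1 g2 z : `|dk k g1 g2 z| <= `|g1 z| + `|g2 z|.
Proof.
rewrite /dk (le_trans (ler_normD _ _))// !normrM.
by elim/ord3P: k; rewrite /dirv/= ?normr1 ?normr0 ?mulr1 ?mulr0 ?addr0 ?add0r ?lerDl ?lerDr.
Qed.

Lemma bint_integrable g j : cont_cl g ->
  mu.-integrable `[0, 1] (EFin \o (fun s => g (curve j s) * enorm (vel j s))).
Proof.
move=> cg; apply: cont_itv_integrable; apply: continuous_subspaceT => s.
by apply: cvgM; [exact: continuous_h_curve|exact: continuous_enorm_vel].
Qed.

(** Gluing the constant transversal directions of the charts gives a vector field ([X1], [X2]) whose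
    outward component is bounded below on the boundary; Green's formula for g times this field
    bounds the boundary integral. No power of g is lost, so the inequality can be applied to powers
    of functions. *)
Lemma trace_ineq : exists2 C : R, 0 < C & forall g g1 g2, PC1 g g1 g2 -> (forall x, cl x -> 0 <= g x) ->
  bint Om g <= C * I (fun x => `|g x| + `|g1 x| + `|g2 x|).
Proof.
have [r Hr] := local_radius.
have [s [be [be1 [be2 [scl pb sb b0 b1]]]]] := partition_of_unity (fun x clx => proj1 (Hr x clx)).
have [k Hk] := choice_on o3_0 (fun x clx => proj2 (proj2 (Hr x clx))).
have [sg Hsg] := choice_on 0 Hk.
have [c [c0 Hc]] : exists c : R, 0 < c /\ forall x, x \in s -> forall i t, disc x (r x) (curve i t) ->
     c <= sg x * (dsgn R (k x) * tcoor (k x) (vel i t)).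
  elim: s scl {b1} => [|x s IH] scl; first by exists 1.
  have [|c [c0 Hc]] := IH; first by move=> y ys; apply: scl; rewrite inE ys orbT.
  have [c' [c'0 Hc']] := Hsg x (scl x (mem_head _ _)).
  exists (Num.min c c'); split; first by rewrite lt_min c0.
  move=> y; rewrite inE => /predU1P[->|ys] i t yd; rewrite ge_min.
    by rewrite Hc' ?orbT.
  by rewrite (Hc y ys).
have [V V0 HV] := enorm_vel_bounded.
pose X1 z := \sum_(x <- s) be x z * (sg x * (dirv R (k x)).1).
pose X2 z := \sum_(x <- s) be x z * (sg x * (dirv R (k x)).2).
have Xv z i t : z = curve i t -> c <= X1 z * (vel i t).2 - X2 z * (vel i t).1.
  move=> zE; have clz : cl z by have [] : bdry z by apply/bdryP; exists i, t.
  have -> : X1 z * (vel i t).2 - X2 z * (vel i t).1 =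
      \sum_(x <- s) be x z * (sg x * (dsgn R (k x) * tcoor (k x) (vel i t))).
    rewrite /X1 /X2 !mulr_suml -sumrB; apply: eq_bigr => x _; rewrite -dirv_normal; ring.
  have [e1 _ _] := b1 z clz; rewrite -[leLHS]mul1r -e1 mulr_suml.
  rewrite big_seq [leRHS]big_seq; apply: ler_sum => x xs.
  have [zd|zd] := pselect (disc x (r x) z).
    by apply: ler_wpM2l; [exact: b0|apply: Hc; rewrite -?zE].
  by have [-> _ _] := sb x z clz zd; rewrite !mul0r.
have pX1 := PC1_sum s (fun x => PC1_mul (pb x) (PC1_cst Om (sg x * (dirv R (k x)).1))).
have pX2 := PC1_sum s (fun x => PC1_mul (pb x) (PC1_cst Om (sg x * (dirv R (k x)).2))).
move: pX1 pX2; rewrite -/X1 -/X2.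
set X11 := (X in PC1 X1 X _); set X12 := (X in PC1 X1 _ X).
set X21 := (X in PC1 X2 X _); set X22 := (X in PC1 X2 _ X) => pX1 pX2.
have [M1 M10 HM1] := ext0_bounded (cont_cl_bm (pc_cont pX1)).
have [M2 M20 HM2] := ext0_bounded (cont_cl_bm (pc_cont pX2)).
have [M3 M30 HM3] := ext0_bounded (pc_bm1 pX1).
have [M4 M40 HM4] := ext0_bounded (pc_bm2 pX2).
pose M := M1 + M2 + M3 + M4.
exists (V / c * M); first by rewrite !mulr_gt0 ?invr_gt0// !addr_gt0.
move=> g g1 g2 pg g0.
have p1 := PC1_mul pg pX1; have p2 := PC1_mul pg pX2.
have G1 := green o3_0 p1; have G2 := green o3_1 p2.
apply: (@le_trans _ _ (V / c * (flux o3_0 (fun z => g z * X1 z) + flux o3_1 (fun z => g z * X2 z)))).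
  rewrite /flux -big_split/= mulr_sumr; apply: ler_sum => j _.
  rewrite -RintegralD//; [|exact: flux_integrable (pc_cont p1)|exact: flux_integrable (pc_cont p2)].
  rewrite -RintegralZl//; last first.
    by apply: (integrableD _ (flux_integrable o3_0 j (pc_cont p1)) (flux_integrable o3_1 j (pc_cont p2))).
  apply: le_Rintegral => //.
  - exact: bint_integrable (pc_cont pg).
  - have H := integrableD _ (flux_integrable o3_0 j (pc_cont p1)) (flux_integrable o3_1 j (pc_cont p2)).
    by apply: (@integrableZl _ _ _ mu `[0, 1]%classic _ (V / c) _ (H _)).
  - move=> t _; have h := Xv _ j t erefl.
    have clt : cl (curve j t) by have [] : bdry (curve j t) by apply/bdryP; exists j, t.
    have -> : g (curve j t) * X1 (curve j t) * (dsgn R o3_0 * tcoor o3_0 (vel j t)) +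
       g (curve j t) * X2 (curve j t) * (dsgn R o3_1 * tcoor o3_1 (vel j t)) =
       g (curve j t) * (X1 (curve j t) * (vel j t).2 - X2 (curve j t) * (vel j t).1).
      by rewrite /dsgn /tcoor/=; ring.
    rewrite mulrCA; apply: ler_wpM2l; first exact: g0.
    apply: (le_trans (HV j t)); rewrite mulrAC ler_pdivlMr//; exact: ler_wpM2l (ltW V0) _ _ h.
rewrite -[leRHS]mulrA; apply: ler_wpM2l; first by rewrite divr_ge0// ltW.
rewrite -G1 -G2 -I_add; [|by apply: bm_dk; bmt|by apply: bm_dk; bmt].
rewrite -I_scale; last by bmt.
apply: I_le; [by apply: bm_add; apply: bm_dk; bmt|by bmt|].
move=> z Oz; rewrite /dk /dirv/= !mulr0 !mulr1 addr0 add0r.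
have := HM1 z; have := HM2 z; have := HM3 z; have := HM4 z; rewrite !ext0_in// => h4 h3 h2 h1.
have B (a b m : R) : `|b| <= m -> a * b <= `|a| * m.
  by move=> bm'; rewrite (le_trans (ler_norm _))// normrM ler_wpM2l.
have := B (g z) _ _ h3; have := B (g z) _ _ h4; have := B (g1 z) _ _ h1; have := B (g2 z) _ _ h2.
rewrite /M -/X11 -/X22; have := normr_ge0 (g z); have := normr_ge0 (g1 z); have := normr_ge0 (g2 z).
rewrite [X1 z * _]mulrC [X2 z * _]mulrC.
clear -M10 M20 M30 M40.
move: (g z * X11 z) (g z * X22 z) (g1 z * X1 z) (g2 z * X2 z) `|g z| `|g1 z| `|g2 z| => p q u v a b d.
nra.
Qed.

(** Each piece is bounded by [local_sobolev] in two directions. The finite sum costs the factor n in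
    (a_1 + ... + a_n)^2 <= n (a_1^2 + ... + a_n^2). *)
Lemma sobolev_ineq : exists2 C : R, 0 < C & forall g g1 g2, PC1 g g1 g2 ->
  I (fun x => g x ^+ 2) <= C * I (fun x => `|g x| + `|g1 x| + `|g2 x|) ^+ 2.
Proof.
have [r Hr] := local_radius.
have [s [be [be1 [be2 [scl pb sb b0 b1]]]]] := partition_of_unity (fun x clx => proj1 (Hr x clx)).
have [M [M0 HM]] : exists M : R, 0 < M /\ forall x, x \in s -> forall z, dom Om z ->
    [/\ `|be x z| <= M, `|be1 x z| <= M & `|be2 x z| <= M].
  elim: s {scl b1} => [|x s [M [M0 IH]]]; first by exists 1.
  have [m1 m10 h1] := ext0_bounded (cont_cl_bm (pc_cont (pb x))).
  have [m2 m20 h2] := ext0_bounded (pc_bm1 (pb x)).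
  have [m3 m30 h3] := ext0_bounded (pc_bm2 (pb x)).
  exists (M + m1 + m2 + m3); split; first by rewrite !addr_gt0.
  move=> y; rewrite inE => /predU1P[->|ys] z Oz.
    have := h1 z; have := h2 z; have := h3 z; rewrite !ext0_in// => g3 g2 g1; split; lra.
  by have [] := IH y ys z Oz => g1 g2 g3; split; lra.
pose n := (size s)%:R : R.
have n0 : 0 <= n := ler0n _ _.
exists (n * n * (4 * M ^+ 2) + 1).
  by rewrite ltr_wpDl//; apply: mulr_ge0; [exact: mulr_ge0|rewrite mulr_ge0// sqr_ge0].
move=> g g1 g2 pg.
pose S := I (fun x => `|g x| + `|g1 x| + `|g2 x|).
have bS : bm (fun x => `|g x| + `|g1 x| + `|g2 x|) by bmt.
have S0 : 0 <= S by apply: I_ge0 => x _; rewrite !addr_ge0.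
pose F x z := be x z * g z.
pose F1 x z := be x z * g1 z + g z * be1 x z.
pose F2 x z := be x z * g2 z + g z * be2 x z.
have pF x : PC1 (F x) (F1 x) (F2 x) := PC1_mul (pb x) pg.
have sF x : supp (F x) (F1 x) (F2 x) x (r x).
  by move=> z clz zd; rewrite /F/F1/F2; have [-> -> ->] := sb x z clz zd; rewrite !mul0r !mulr0 addr0.
have bF x : bm (fun z => F x z ^+ 2) by apply: bm_exp; exact: cont_cl_bm (pc_cont (pF x)).
have loc x : x \in s -> I (fun z => F x z ^+ 2) <= 4 * M ^+ 2 * S ^+ 2.
  move=> xs; have [_ [H _]] := Hr x (scl x xs).
  have [_ [k [k' [kk' u1 u2]]]] := H _ _ _ (pF x) (sF x).
  apply: (le_trans (local_sobolev kk' (pF x) u1 u2)).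
  have B l : I (fun z => `|dk l (F1 x) (F2 x) z|) <= 2 * M * S.
    rewrite -I_scale//; apply: I_le => //.
    - by apply: bm_norm; apply: bm_dk; [exact: pc_bm1 (pF x)|exact: pc_bm2 (pF x)].
    - by bmt.
    move=> z Oz; apply: (le_trans (dk_le _ _ _ _)); have [h1 h2 h3] := HM x xs z Oz.
    rewrite /F1 /F2; apply: (le_trans (lerD (ler_normD _ _) (ler_normD _ _))); rewrite !normrM.
    have := ler_wpM2r (normr_ge0 (g1 z)) h1; have := ler_wpM2r (normr_ge0 (g2 z)) h1.
    have := ler_wpM2l (normr_ge0 (g z)) h2; have := ler_wpM2l (normr_ge0 (g z)) h3.
    have := mulr_ge0 (ltW M0) (normr_ge0 (g1 z)); have := mulr_ge0 (ltW M0) (normr_ge0 (g2 z)).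
    move: (`|be x z| * `|g1 z|) (`|be x z| * `|g2 z|) (`|g z| * `|be1 x z|) (`|g z| * `|be2 x z|) => p q u v.
    lra.
  have I0 l : 0 <= I (fun z => `|dk l (F1 x) (F2 x) z|) by apply: I_ge0.
  apply: (le_trans (ler_pM (I0 k) (I0 k') (B k) (B k'))).
  by apply: le_of_eq; ring.
have sq (l : seq (R * R)) (f : R * R -> R) : (\sum_(x <- l) f x) ^+ 2 <= (size l)%:R * \sum_(x <- l) f x ^+ 2.
  elim: l => [|x l IH]; first by rewrite !big_nil expr0n mul0r.
  rewrite !big_cons /= -natr1.
  have q0 : 0 <= \sum_(x <- l) f x ^+ 2 by apply: sumr_ge0 => y _; exact: sqr_ge0.
  have [l0|l0] := eqVneq (size l) 0%N.
    by move: IH; rewrite (size0nil l0) !big_nil !addr0 /= add0r mul1r.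
  have m0 : 0 < (size l)%:R :> R by rewrite ltr0n lt0n.
  have := sqr_ge0 ((size l)%:R * f x - \sum_(x <- l) f x).
  move: IH q0 m0; move: (\sum_(_ <- _) _) (\sum_(_ <- _) _ ^+ 2) (size l)%:R (f x) => a q m b IH q0 m0 h.
  rewrite -(ler_pM2l m0); nra.
apply: (@le_trans _ _ (I (fun z => n * \sum_(x <- s) F x z ^+ 2))).
  apply: I_le; [by bmt|apply: bm_mul; [exact: bm_cst|exact: bm_sum]|].
  move=> z Oz; have [e1 _ _] := b1 z (dom_cl Oz).
  have -> : g z = \sum_(x <- s) F x z by rewrite /F -mulr_suml e1 mul1r.
  exact: sq.
rewrite I_scale; last exact: bm_sum.
rewrite I_sum//; apply: (@le_trans _ _ (n * (n * (4 * M ^+ 2 * S ^+ 2)))).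
  apply: ler_wpM2l; first exact: ler0n.
  rewrite /n mulr_natl -[_ *+ _]addr0 -iter_addr -(count_predT s) -big_const_seq.
  by rewrite big_seq [leRHS]big_seq; apply: ler_sum.
have e : (n * n * (4 * M ^+ 2) + 1) * S ^+ 2 = n * (n * (4 * M ^+ 2 * S ^+ 2)) + S ^+ 2 by ring.
by apply: (@le_trans _ _ ((n * n * (4 * M ^+ 2) + 1) * S ^+ 2)) => //; rewrite e lerDl sqr_ge0.
Qed.

End green.

(** * Smooth test functions approximating indicators of rectangles *)

Section smooth_bumps.
Variable R : realType.
Implicit Types (u v : R -> R) (x y t : R) (p : {poly R}).

Fixpoint Cn (n : nat) u : Prop :=
  if n is m.+1 then exists u', (forall x, is_derive x 1 u (u' x)) /\ Cn m u' else True.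

Lemma Cn_weaken n u : Cn n.+1 u -> Cn n u.
Proof. by elim: n u => [//|n IH] u [u' [du cu]]; exists u'; split => //; exact: IH. Qed.

Lemma Cn_add n u v : Cn n u -> Cn n v -> Cn n (fun x => u x + v x).
Proof.
elim: n u v => [//|n IH] u v [u' [du cu]] [v' [dv cv]].
by exists (fun x => u' x + v' x); split; [move=> x; exact: (is_deriveD (du x) (dv x))|exact: IH].
Qed.

Lemma Cn_mul n u v : Cn n u -> Cn n v -> Cn n (fun x => u x * v x).
Proof.
elim: n u v => [//|n IH] u v cu0 cv0; have cu1 := Cn_weaken cu0; have cv1 := Cn_weaken cv0.
case: cu0 => u' [du cu]; case: cv0 => v' [dv cv].
exists (fun x => u x * v' x + v x * u' x); split; last by apply: Cn_add; exact: IH.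
by move=> x; have D := is_deriveM (du x) (dv x); apply: (is_derive_eq D); rewrite /GRing.scale.
Qed.

Lemma Cn_cst n (c : R) : Cn n (fun=> c).
Proof. by elim: n c => [//|n IH] c; exists (fun=> 0); split => // x; exact: is_derive_cst. Qed.

Lemma Cn_affine n u (c d : R) : Cn n u -> Cn n (fun x => u (c * x + d)).
Proof.
elim: n u => [//|n IH] u [u' [du cu]].
exists (fun x => c * u' (c * x + d)); split; last by apply: Cn_mul; [exact: Cn_cst|exact: IH].
move=> x; have da : is_derive x 1 (fun x : R => c * x + d) c.
  by apply: is_derive_eq; rewrite /GRing.scale/= mulr1 addr0.
have D := @is_derive1_comp R u (fun x : R => c * x + d) x _ _ (du (c * x + d)) da.
by apply: (is_derive_eq D); rewrite /GRing.scale/= mulrC.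
Qed.

Lemma Cn_smooth1 u : (forall n, Cn n u) -> smooth1 u.
Proof.
move=> cu n s; elim: n u cu => [|n IH] u cu.
  by have [u' [du _]] := cu 1%N; rewrite derive1n0; case: (du s).
rewrite derive1Sn; apply: IH => m; have [u' [du cu']] := cu m.+1.
have -> // : derive1 u = u'.
by apply/funext => x; rewrite derive1E; have D := du x; rewrite derive_val.
Qed.

(** The functions p(1/x) e^(-1/x), extended by 0, are closed under differentiation: the derivative
    corresponds to the polynomial X^2 (p - p'). Smoothness, including at 0, is then an induction. *)
Definition pexp p x : R := if 0 < x then p.[x^-1] * expR (- x^-1) else 0.

Lemma poly_exp_bound p (k : nat) : exists K : R, forall t, 0 < t -> `|p.[t]| * t ^+ k * expR (- t) <= K.
Proof.
elim/poly_ind: p k => [|p c IH] k; first by exists 0 => t _; rewrite horner0 normr0 !mul0r.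
have B : exists K : R, forall t, 0 < t -> t ^+ k * expR (- t) <= K.
  case: k => [|k].
    by exists 1 => t t0; rewrite expr0 mul1r expR_le1 oppr_le0 ltW.
  exists (k.+1)`!%:R => t t0; rewrite expRN ler_pdivrMr ?expR_gt0//.
  have f0 : 0 < (k.+1)`!%:R :> R by rewrite ltr0n fact_gt0.
  rewrite mulrC -ler_pdivrMr//; apply: le_trans (expR_ge1Dxn k (ltW t0)).
  by rewrite lerDr.
have [K1 H1] := IH k.+1; have [K2 H2] := B.
exists (K1 + `|c| * K2) => t t0; rewrite hornerMXaddC.
have h1 := H1 t t0; have h2 := ler_wpM2l (normr_ge0 c) (H2 t t0).
have h3 := ler_normD (p.[t] * t) c; rewrite normrM (gtr0_norm t0) in h3.
have e0 := expR_ge0 (- t); have t1 : 0 <= t ^+ k by rewrite exprn_ge0// ltW.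
have := ler_wpM2r e0 (ler_wpM2r t1 h3).
have -> : (`|p.[t]| * t + `|c|) * t ^+ k * expR (- t) =
  `|p.[t]| * t ^+ k.+1 * expR (- t) + `|c| * (t ^+ k * expR (- t)) by rewrite exprS; ring.
lra.
Qed.

Lemma is_derive_local (f g : R -> R) x l (e : R) : 0 < e -> is_derive x 1 g l ->
  (forall y, `|x - y| < e -> f y = g y) -> is_derive x 1 f l.
Proof.
move=> e0 dg fg; apply: (near_eq_is_derive _ dg).
by apply/nbhs_ballP; exists e => //= y xy; rewrite fg.
Qed.

Lemma is_derive_pexp p x : is_derive x 1 (pexp p) (pexp ('X^2 * (p - p^`())) x).
Proof.
have [x0|x0|->] := ltgtP x 0.
- apply: (@is_derive_local _ (fun=> 0) _ _ (- x)); first by rewrite oppr_gt0.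
    by apply: is_derive_eq; rewrite /pexp ltNge ltW.
  by move=> y; rewrite ltr_distlC => /andP[_]; rewrite addrN => y0; rewrite /pexp ltNge (ltW y0).
- apply: (@is_derive_local _ (fun x => p.[x^-1] * expR (- x^-1)) _ _ x) => //; last first.
    by move=> y; rewrite ltr_distlC subrr => /andP[y0 _]; rewrite /pexp y0.
  have xn : x != 0 by rewrite gt_eqF.
  have dV : is_derive x 1 (fun x : R => x^-1) (- x ^- 2).
    have D := is_deriveV (x := x) (v := 1 : R) (f := (id : R -> R)) xn (is_derive_id _ _).
    by apply: (is_derive_eq D); rewrite /GRing.scale/= mulr1.
  have dp := is_derive1_comp (is_derive_poly p x^-1) dV.
  have de := @is_derive1_comp R expR (fun x : R => - x^-1) x _ _ (is_derive_expR (- x^-1)) (is_deriveN dV).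
  have D := is_deriveM dp de; apply: (is_derive_eq D).
  by rewrite /pexp x0 /GRing.scale/= hornerM hornerXn hornerD hornerN -exprVn; ring.
- have [K HK] := poly_exp_bound p 2.
  have K0 : 0 <= K by have := HK 1 ltr01; apply: le_trans; rewrite !mulr_ge0// ?expR_ge0.
  rewrite {2}/pexp ltxx; apply: (is_derive_quad (K := K)) => d.
  rewrite add0r mul0r subr0 {2}/pexp ltxx subr0 /pexp; case: ifP => d0; last first.
    by rewrite normr0 mulr_ge0// sqr_ge0.
  have d1 : 0 < d^-1 by nn.
  have := HK _ d1; rewrite normrM (ger0_norm (expR_ge0 _)) exprVn mulrAC.
  by rewrite ler_pdivrMr ?exprn_gt0.
Qed.

Lemma Cn_pexp n p : Cn n (pexp p).
Proof. by elim: n p => [//|n IH] p; exists (pexp ('X^2 * (p - p^`()))); split => // x; exact: is_derive_pexp. Qed.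

Definition step (n : nat) x := pexp 1 (n%:R * x).

Lemma step_01 n x : 0 <= step n x <= 1.
Proof.
rewrite /step /pexp; case: ifP => h; last by rewrite lexx ler01.
by rewrite hornerC mul1r expR_ge0 expR_le1 oppr_le0 invr_ge0 ltW.
Qed.

Lemma step_out n x : x <= 0 -> step n x = 0.
Proof. by move=> x0; rewrite /step /pexp ltNge mulr_ge0_le0// ler0n. Qed.

Lemma step_cvg x : 0 < x -> (fun n => step n x) @ \oo --> (1 : R).
Proof.
move=> x0; rewrite -expR0.
have E : \forall n \near \oo, expR (- (n%:R * x)^-1) = step n x.
  near=> n; have n0 : (0 < n)%N by near: n; exists 1%N.
  by rewrite /step /pexp mulr_gt0 ?ltr0n// hornerC mul1r.
apply: cvg_trans (near_eq_cvg E) _.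
suff L : (fun n : nat => - (n%:R * x)^-1) @ \oo --> (0 : R) by exact: (cvg_comp _ _ L (@continuous_expR R 0)).
apply/cvgrPdist_le => e e0; near=> n.
have n1 : (e * x)^-1 <= n%:R by near: n; exact: nbhs_infty_ger.
have nx : 0 < n%:R * x by rewrite mulr_gt0// (lt_le_trans _ n1)// invr_gt0 mulr_gt0.
rewrite sub0r opprK gtr0_norm ?invr_gt0// -ler_pV2 ?inE ?unitfE ?gt_eqF ?invr_gt0//= invrK.
by rewrite -ler_pdivrMr// -invfM.
Unshelve. all: by end_near. Qed.

Definition hat n (a b : R) x := step n (x - a) * step n (b - x).

Lemma Cn_hat m n a b : Cn m (hat n a b).
Proof.
apply: Cn_mul.
  have := Cn_affine n%:R (- (n%:R * a)) (Cn_pexp m 1).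
  by congr Cn; apply/funext => x; rewrite /step mulrBr.
have := Cn_affine (- n%:R) (n%:R * b) (Cn_pexp m 1).
by congr Cn; apply/funext => x; rewrite /step mulrBr mulNr addrC.
Qed.

Lemma hat_01 n a b x : 0 <= hat n a b x <= 1.
Proof.
have /andP[h1 h2] := step_01 n (x - a); have /andP[h3 h4] := step_01 n (b - x).
by rewrite /hat mulr_ge0//= mulr_ile1.
Qed.

Lemma hat_out n a b x : ~~ (a < x < b) -> hat n a b x = 0.
Proof.
rewrite negb_and -!leNgt /hat => /orP[h|h].
  by rewrite step_out ?mul0r// subr_le0.
by rewrite [X in _ * X]step_out ?mulr0// subr_le0.
Qed.

Lemma hat_cvg a b x : (fun n => hat n a b x) @ \oo --> ((a < x < b)%R%:R : R).
Proof.
have [h|h] := boolP (a < x < b); last first.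
  by under eq_fun do rewrite hat_out//; exact: cvg_cst.
case/andP: h => h1 h2; rewrite -[X in _ --> X](mulr1 (1 : R)).
by apply: cvgM; apply: step_cvg; rewrite subr_gt0.
Qed.

Definition tensor u v : R * R -> R := fun z => u z.1 * v z.2.

Lemma differentiable_tensor u v (z : R * R) : derivable u z.1 1 -> derivable v z.2 1 ->
  differentiable (tensor u v) z.
Proof.
move=> /derivable1_diffP du /derivable1_diffP dv.
have d1 : differentiable (u \o (fst : R * R -> R)) z.
  by apply: differentiable_comp => //; apply: (linear_differentiable (f := fst)) => y; exact: cvg_fst.
have d2 : differentiable (v \o (snd : R * R -> R)) z.
  by apply: differentiable_comp => //; apply: (linear_differentiable (f := snd)) => y; exact: cvg_snd.
exact: (differentiableM d1 d2).
Qed.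

Lemma tensor_derive1 u v : (forall s, derivable u s 1) ->
  (fun z => 'D_((1, 0) : R * R) (tensor u v) z) = tensor (derive1 u) v.
Proof.
move=> du; apply/funext => z; rewrite /tensor.
pose F s := u s * v z.2.
have -> : 'D_((1, 0) : R * R) (fun z => u z.1 * v z.2) z = 'D_1 F z.1.
  have E : (fun r : R => r^-1 *: (((fun z : R * R => u z.1 * v z.2) \o shift z) (r *: ((1, 0) : R * R)) - u z.1 * v z.2)) =
      (fun r : R => r^-1 *: ((F \o shift z.1) (r *: (1 : R)) - F z.1)).
    by apply/funext => r; rewrite /F/= !scaler0 add0r.
  by rewrite /derive E.
have dz := du z.1; rewrite derive1E.
have D : is_derive z.1 1 u ('D_1 u z.1) by exact/derivableP.
have D2 := is_deriveM D (is_derive_cst (v z.2) z.1 1).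
have := @derive_val _ _ _ _ _ _ _ D2; rewrite -/F => ->.
by rewrite scaler0 add0r /GRing.scale/= mulrC.
Qed.

Lemma tensor_derive2 u v : (forall s, derivable v s 1) ->
  (fun z => 'D_((0, 1) : R * R) (tensor u v) z) = tensor u (derive1 v).
Proof.
move=> du; apply/funext => z; rewrite /tensor.
pose F s := u z.1 * v s.
have -> : 'D_((0, 1) : R * R) (fun z => u z.1 * v z.2) z = 'D_1 F z.2.
  have E : (fun r : R => r^-1 *: (((fun z : R * R => u z.1 * v z.2) \o shift z) (r *: ((0, 1) : R * R)) - u z.1 * v z.2)) =
      (fun r : R => r^-1 *: ((F \o shift z.2) (r *: (1 : R)) - F z.2)).
    by apply/funext => r; rewrite /F/= !scaler0 add0r.
  by rewrite /derive E.
have dz := du z.2; rewrite derive1E.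
have D : is_derive z.2 1 v ('D_1 v z.2) by exact/derivableP.
have D2 := is_deriveM (is_derive_cst (u z.1) z.2 1) D.
have := @derive_val _ _ _ _ _ _ _ D2; rewrite -/F => ->.
by rewrite scaler0 addr0 /GRing.scale/=.
Qed.

Lemma smooth_tensor u v : smooth1 u -> smooth1 v -> smooth (tensor u v).
Proof.
move=> su sv a b z; rewrite /pderiv.
have -> : iter b (fun g (x : R * R) => 'D_((0, 1) : R * R) g x) (tensor u v) = tensor u (derive1n b v).
  elim: b => [|b IH]; first by rewrite derive1n0.
  by rewrite iterS IH tensor_derive2 ?derive1nS// => s; exact: sv.
have -> : iter a (fun g (x : R * R) => 'D_((1, 0) : R * R) g x) (tensor u (derive1n b v)) = tensor (derive1n a u) (derive1n b v).
  elim: a => [|a IH]; first by rewrite derive1n0.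
  by rewrite iterS IH tensor_derive1 ?derive1nS// => s; exact: su.
by apply: differentiable_tensor; [exact: su|exact: sv].
Qed.

Definition box_hat n (a b c d : R) : R * R -> R := tensor (hat n a b) (hat n c d).

Lemma smooth_box_hat n a b c d : smooth (box_hat n a b c d).
Proof. by apply: smooth_tensor; apply: Cn_smooth1 => m; exact: Cn_hat. Qed.

Lemma box_hat_test (Om : smooth_domain R) n a b c d :
  (forall z : R * R, a <= z.1 <= b -> c <= z.2 <= d -> dom Om z) ->
  test_function Om (box_hat n a b c d).
Proof.
move=> sub; split; first exact: smooth_box_hat.
exists (`[a, b]%classic `*` `[c, d]%classic); split.
- by apply: compact_setX; exact: segment_compact.
- by move=> z [/=]; rewrite !in_itv/= => h1 h2; exact: sub.
move=> z nz; rewrite /box_hat /tensor.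
have [h|h] := boolP (a < z.1 < b); last by rewrite hat_out ?mul0r.
have [h'|h'] := boolP (c < z.2 < d); last by rewrite [X in _ * X]hat_out ?mulr0.
exfalso; apply: nz; split; rewrite /= in_itv/=; apply/andP; split; apply: ltW;
  by [case/andP: h|case/andP: h'].
Qed.

End smooth_bumps.

(** * The du Bois-Reymond lemma *)

Section du_bois_reymond.
Variables (R : realType) (Om : smooth_domain R).
Notation AR := (area_measure R).
Notation I := (@I R Om).
Notation intg := (@intg R Om).
Notation R2 := (measurableTypeR R * measurableTypeR R)%type.
Implicit Types (f h F : R * R -> R) (x y z p : R * R).

Lemma integrable_indic_comp d (T : measurableType d) (p : R2 -> T) F (A : set T) :
  measurable_fun setT p -> measurable A -> AR.-integrable setT (EFin \o F) ->
  AR.-integrable setT (EFin \o (fun z => F z * \1_A (p z))).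
Proof.
move=> mp mA iF; have iF0 := iF; apply: le_integrable iF => //.
  apply/measurable_EFinP; apply: measurable_funM.
    by apply/measurable_EFinP; exact: measurable_int iF0.
  by apply: measurableT_comp => //; exact: measurable_indic.
move=> z _ /=; rewrite lee_fin normrM indicE; case: (p z \in A) => /=; first by rewrite normr1 mulr1.
by rewrite normr0 mulr0.
Qed.

(** The sets over which F has zero integral form a lambda-system, increasing unions being handled by
    dominated convergence. The map [p] lets the same statement serve each coordinate and then the
    plane. *)
Lemma lambda_zero d (T : measurableType d) (p : R2 -> T) (G : set (set T)) F :
  measurable_fun setT p -> setI_closed G -> (forall A, measurable A -> <<s G >> A) ->
  (forall A, G A -> measurable A) ->
  AR.-integrable setT (EFin \o F) -> \int[AR]_z F z = 0 ->
  (forall A, G A -> \int[AR]_z (F z * \1_A (p z)) = 0) ->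
  forall A, measurable A -> \int[AR]_z (F z * \1_A (p z)) = 0.
Proof.
move=> mp GI gen Gm iF F0 G0 A /gen sA.
pose H := [set A : set T | measurable A /\ \int[AR]_z (F z * \1_A (p z)) = 0].
suff : H A by case.
have lam : lambda_system setT H.
  split.
  - by [].
  - split => //; rewrite -F0; apply: eq_Rintegral => z _; by rewrite indicE in_setT mulr1.
  - move=> B C CB [mB B0] [mC C0]; split; first exact: measurableD.
    rewrite (_ : (fun z : R2 => F z * \1_(B `\` C) (p z)) = (fun z => F z * \1_B (p z) - F z * \1_C (p z))).
      by rewrite RintegralB ?B0 ?C0 ?subrr//; exact: integrable_indic_comp.
    apply/funext => z; rewrite -mulrBr; congr (_ * _); rewrite !indicE in_setD.
    have [zC|zC] := boolP (p z \in C); last by rewrite andbT subr0.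
    by rewrite andbF; move: zC; rewrite !inE => /CB zB; rewrite (mem_set zB) subrr.
  - move=> E Ei HE; have mE n : measurable (E n) by have [] := HE n.
    have mU : measurable (\bigcup_i E i) by apply: bigcupT_measurable.
    split => //.
    pose fn n (z : R2) := (F z * \1_(E n) (p z))%:E.
    pose f0 (z : R2) := (F z * \1_(\bigcup_i E i) (p z))%:E.
    have iFn n : AR.-integrable setT (fn n) by exact: integrable_indic_comp.
    have if0 : AR.-integrable setT f0 by exact: integrable_indic_comp.
    have cv : (fun n => (\int[AR]_z fn n z)%E) @ \oo --> (\int[AR]_z f0 z)%E.
      apply: (@dominated_cvg _ _ _ AR setT measurableT fn f0 (fun z => `|F z|%:E)) => //.
      - by move=> n; exact: measurable_int (iFn n).
      - move=> z _; have [[k _ zk]|nz] := pselect ((\bigcup_i E i) (p z)).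
          apply: cvg_near_cst; exists k => // n /= kn; rewrite /fn /f0 !indicE.
          have zn : E n (p z) by move: zk; apply/subsetPset/Ei.
          by rewrite (mem_set zn) (@mem_set _ (\bigcup_i E i) (p z))//; exists k.
        apply: cvg_near_cst; exists 0%N => // n _; rewrite /fn /f0 !indicE.
        by rewrite (memNset nz) memNset// => zn; apply: nz; exists n.
      - exact: integrable_abse iF.
      - move=> n z _ /=; rewrite lee_fin normrM indicE; case: (p z \in E n) => /=; rewrite ?normr1 ?normr0 ?mulr1 ?mulr0//.
    have z0 n : (\int[AR]_z fn n z)%E = 0%E.
      have [_] := HE n; rewrite /Rintegral => /(congr1 (@EFin R)); rewrite fineK//.
      exact: (integrable_fin_num measurableT (iFn n)).
    rewrite (_ : (fun n => _) = (fun n : nat => 0%E)) in cv; last by apply/funext => n; rewrite z0.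
    rewrite /Rintegral -/f0.
    have /cvg_lim <- // := cv.
    by rewrite lim_cst.
apply: (@lambda_system_subset _ G GI setT H lam) => //.
by move=> B GB; split; [exact: Gm|exact: G0].
Qed.

Lemma opens_setI : setI_closed (@RGenOpens.G R).
Proof.
move=> A B [a [b ->]] [c [d ->]]; exists (Num.max a c), (Num.min b d).
apply/seteqP; split => x /=; rewrite !in_itv/= gt_max lt_min.
  by move=> [/andP[-> ->] /andP[-> ->]].
by move=> /andP[/andP[-> ->] /andP[-> ->]].
Qed.

Definition rect (a b c d : R) z : bool := (a < z.1 < b) && (c < z.2 < d).

Lemma measurable_rect a b c d : measurable ([set z | rect a b c d z] : set R2).
Proof.
rewrite (_ : [set z | rect a b c d z] = `]a, b[%classic `*` `]c, d[%classic).
  by apply: measurableX.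
by apply/seteqP; split => z; rewrite /rect /= !in_itv/=; [move=> /andP[]|move=> [-> ->]].
Qed.

Lemma intg_ext0 f : intg f -> AR.-integrable setT (EFin \o ext0 Om f).
Proof.
by rewrite /intg integrable_mkcond//; [rewrite restrict_EFin|exact: measurable_dom].
Qed.

Lemma I_mkcond f : I f = \int[AR]_z ext0 Om f z.
Proof. by rewrite /I Rintegral_mkcond. Qed.

(** The functions [box_hat n] are test functions in the rectangle and converge to its indicator,
    bounded by 1. *)
Lemma test_rect f a b c d : intg f -> (forall phi, test_function Om phi -> I (fun z => f z * phi z) = 0) ->
  (forall z : R * R, a <= z.1 <= b -> c <= z.2 <= d -> dom Om z) ->
  \int[AR]_z (ext0 Om f z * \1_([set z | rect a b c d z]) z) = 0.
Proof.
move=> jf H sub; have iF := intg_ext0 jf.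
pose fn n (z : R2) := (ext0 Om f z * box_hat n a b c d z)%:E.
pose f0 (z : R2) := (ext0 Om f z * \1_([set z | rect a b c d z]) z)%:E.
have b01 n z : 0 <= box_hat n a b c d z <= 1.
  have /andP[h1 h2] := hat_01 n a b z.1; have /andP[h3 h4] := hat_01 n c d z.2.
  by rewrite /box_hat /tensor mulr_ge0//= mulr_ile1.
have mfn n : measurable_fun setT (fn n).
  apply/measurable_EFinP; apply: measurable_funM; first by apply/measurable_EFinP; exact: measurable_int iF.
  apply: (@open_within_measurable R setT setT) => //; first exact: openT.
  apply: continuous_subspaceT => z; apply: differentiable_continuous.
  exact: (smooth_box_hat n a b c d 0%N 0%N).
have fle n z : (`|fn n z| <= `|ext0 Om f z|%:E)%E.
  by rewrite lee_fin normrM ler_piMr//; have /andP[h1 h2] := b01 n z; rewrite ger0_norm.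
have cv : (fun n => (\int[AR]_z fn n z)%E) @ \oo --> (\int[AR]_z f0 z)%E.
  apply: (@dominated_cvg _ _ _ AR setT measurableT fn f0 (fun z => `|ext0 Om f z|%:E)) => //.
  - move=> z _; rewrite /fn /f0; apply/fine_cvgP; split; first exact: nearW.
    apply: cvgM; first exact: cvg_cst.
    rewrite indicE (_ : (z \in _)%:R = ((a < z.1 < b)%R%:R * (c < z.2 < d)%R%:R) :> R).
      by apply: cvgM; exact: hat_cvg.
    rewrite -natrM mulnb; congr (nat_of_bool _)%:R.
    by apply/idP/idP; rewrite inE.
  - exact: integrable_abse iF.
have z0 n : (\int[AR]_z fn n z)%E = 0%E.
  have E : I (fun z => f z * box_hat n a b c d z) = fine (\int[AR]_z fn n z)%E.
    rewrite I_mkcond /Rintegral; congr fine; apply: eq_integral => z _; congr EFin.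
    by have [Oz|Oz] := pselect (dom Om z); [rewrite !ext0_in|rewrite !ext0_out ?mul0r].
  have := H _ (box_hat_test n sub); rewrite E => /(congr1 (@EFin R)); rewrite fineK//.
  by apply: integrable_fin_num => //; apply: (le_integrable _ (mfn n) _ iF) => // z _; exact: fle.
rewrite (_ : (fun n => _) = (fun n : nat => 0%E)) in cv; last by apply/funext => n; rewrite z0.
rewrite /Rintegral -/f0.
have /cvg_lim <- // := cv.
by rewrite lim_cst.
Qed.

(** Vanishing on open rectangles is extended to measurable sets in the first coordinate ([S1]), then
    in the second ([S2]), then to all measurable sets of the plane ([S3]). *)
Lemma rect_ae0 f a b c d : intg f -> (forall phi, test_function Om phi -> I (fun z => f z * phi z) = 0) ->
  (forall z : R * R, a <= z.1 <= b -> c <= z.2 <= d -> dom Om z) ->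
  AR.-negligible [set z | rect a b c d z /\ f z != 0].
Proof.
move=> jf H sub.
pose F (z : R2) := ext0 Om f z * \1_([set z | rect a b c d z]) z.
have iF : AR.-integrable setT (EFin \o F).
  by apply: (@integrable_indic_comp _ R2 id) => //; [exact: measurable_rect|exact: intg_ext0].
have m1 : measurable_fun setT (fst : R2 -> measurableTypeR R) by exact: measurable_fst.
have m2 : measurable_fun setT (snd : R2 -> measurableTypeR R) by exact: measurable_snd.
have sg A : (measurable A : Prop) -> <<s @RGenOpens.G R >> (A : set (measurableTypeR R)).
  by move=> mA; have := mA; rewrite RGenOpens.measurableE.
have mG (A : set (measurableTypeR R)) : RGenOpens.G A -> measurable A.
  by move=> [u [v ->]].
have R0 u v u' v' : \int[AR]_z (F z * \1_(`]u, v[%classic : set R) z.1 * \1_(`]u', v'[%classic : set R) z.2) = 0.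
  rewrite -(@test_rect f (Num.max a u) (Num.min b v) (Num.max c u') (Num.min d v'))//; last first.
    move=> z; rewrite !ge_max !le_min => /andP[/andP[h1 _] /andP[h2 _]] /andP[/andP[h3 _] /andP[h4 _]].
    by apply: sub; apply/andP.
  apply: eq_Rintegral => z _; rewrite /F -!mulrA; congr (_ * _).
  rewrite !indicE -!natrM !mulnb; congr (nat_of_bool _)%:R.
  apply/idP/idP.
    move=> /and3P[/set_mem h1 /set_mem h2 /set_mem h3]; apply/mem_set; move: h1 h2 h3.
    rewrite /rect /= !in_itv/= !gt_max !lt_min.
    by move=> /andP[/andP[-> ->] /andP[-> ->]] /andP[-> ->] /andP[-> ->].
  move=> /set_mem; rewrite /rect /= !gt_max !lt_min.
  move=> /andP[/andP[/andP[h1 h2] /andP[h3 h4]] /andP[/andP[h5 h6] /andP[h7 h8]]].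
  by rewrite !mem_set//= ?in_itv/= ?h1 ?h2 ?h3 ?h4 ?h5 ?h6 ?h7.
have F0 : \int[AR]_z F z = 0 by exact: test_rect.
have Fs (z : R2) : F z * \1_(`]a, b[%classic : set R) z.1 = F z /\ F z * \1_(`]c, d[%classic : set R) z.2 = F z.
  rewrite /F; have [h|h] := boolP (rect a b c d z); last by rewrite indicE memNset ?mulr0 ?mul0r//; exact/negP.
  by rewrite !indicE !mem_set ?mulr1//= ?in_itv/=; case/andP: h.
have S1 A u v : measurable A -> \int[AR]_z (F z * \1_(`]u, v[%classic : set R) z.2 * \1_A z.1) = 0.
  apply: (lambda_zero m1 opens_setI sg mG).
  - exact: integrable_indic_comp.
  - by rewrite -[RHS](R0 a b u v); apply: eq_Rintegral => z _; rewrite (Fs z).1.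
  - by move=> B [u' [v' ->]]; rewrite -[RHS](R0 u' v' u v); apply: eq_Rintegral => z _; rewrite mulrAC.
have S2 A B : measurable A -> measurable B -> \int[AR]_z (F z * \1_A z.1 * \1_B z.2) = 0.
  move=> mA; apply: (lambda_zero m2 opens_setI sg mG).
  - exact: integrable_indic_comp.
  - by rewrite -[RHS](S1 A c d mA); apply: eq_Rintegral => z _; rewrite (Fs z).2.
  - by move=> C [u' [v' ->]]; rewrite -[RHS](S1 A u' v' mA); apply: eq_Rintegral => z _; rewrite mulrAC.
have S3 (E : set R2) : measurable E -> \int[AR]_z (F z * \1_E z) = 0.
  apply: (@lambda_zero _ R2 id [set A `*` B | A in measurable & B in measurable]) => //.
  - move=> X Y [A mA [B mB <-]] [A' mA' [B' mB' <-]].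
    exists (A `&` A'); first exact: measurableI.
    exists (B `&` B'); first exact: measurableI.
    by rewrite setXI.
  - by move=> A mA; rewrite -measurable_prod_measurableType.
  - by move=> _ [A mA [B mB <-]]; exact: measurableX.
  - move=> _ [A mA [B mB <-]]; rewrite -[RHS](S2 A B mA mB); apply: eq_Rintegral => z _.
    rewrite -mulrA; congr (_ * _); rewrite !indicE -natrM mulnb; congr (nat_of_bool _)%:R.
    apply/idP/idP; first by move=> /set_mem[h1 h2]; rewrite !mem_set.
    by move=> /andP[/set_mem h1 /set_mem h2]; apply/mem_set.
have : ae_eq AR setT (EFin \o F) (fun=> 0%E).
  apply: integral_ae_eq => // E _ mE; rewrite integral0.
  have := S3 E mE; rewrite /Rintegral => /(congr1 (@EFin R)); rewrite fineK; last first.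
    by apply: integrable_fin_num => //; exact: (@integrable_indic_comp _ R2 id).
  move=> E0; apply: (etrans _ E0); rewrite [LHS]integral_mkcond; apply: eq_integral => z _.
  rewrite patchE /= indicE; case: ifP => _; by rewrite ?mulr1 ?mulr0.
move=> [N [mN N0 sN]]; exists N; split => // z [zr fz].
apply: sN => /= /(_ Logic.I) [] Fz.
move: fz; rewrite -(@ext0_in R Om f z); last by case/andP: zr => /andP[/ltW h1 /ltW h2] /andP[/ltW h3 /ltW h4]; apply: sub; apply/andP.
by move: Fz; rewrite /F indicE mem_set// mulr1 => ->; rewrite eqxx.
Qed.

Lemma bigcup_unpickle (T : countType) (U : Type) (N : option T -> set U) (q : T) (u : U) :
  N (Some q) u -> (\bigcup_k N (unpickle k)) u.
Proof. by move=> Nq; exists (pickle q) => //; rewrite pickleK. Qed.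

(** The open rational rectangles whose closure lies in the domain are countably many and cover
    it. *)
Lemma du_bois_reymond f : intg f ->
  (forall phi, test_function Om phi -> I (fun z => f z * phi z) = 0) ->
  {ae AR, forall z, dom Om z -> f z = 0}.
Proof.
move=> jf H.
pose N (q : option (rat * rat * (rat * rat))) : set R2 :=
  if q is Some (a, b, (c, d)) then
    [set z | (forall z : R * R, ratr a <= z.1 <= ratr b -> ratr c <= z.2 <= ratr d -> dom Om z) /\
       rect (ratr a) (ratr b) (ratr c) (ratr d) z /\ f z != 0]
  else set0.
have nN n : AR.-negligible (N (unpickle n)).
  rewrite /N; case: (unpickle n) => [[[a b] [c d]]|]; last exact: negligible_set0.
  have [sub|nsub] := pselect (forall z : R * R, ratr a <= z.1 <= ratr b -> ratr c <= z.2 <= ratr d -> dom Om z).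
    by apply: negligibleS (rect_ae0 jf H sub) => z [].
  rewrite (_ : [set z | _] = set0); first exact: negligible_set0.
  by apply/seteqP; split => z // [].
apply: negligibleS (negligible_bigcup nN) => z /= nz.
have [Oz fz] : dom Om z /\ f z != 0.
  by split; [apply: contrapT => nO; apply: nz|apply/eqP => f0; apply: nz].
have /nbhs_box[e e0 eO] : nbhs z (Om : set (R * R)).
  by apply: open_nbhs_nbhs; split => //; exact: dom_open.
have q (u v : R) : u < v -> exists r : rat, u < ratr r < v.
  by move=> uv; have [r] := rat_in_itvoo uv; rewrite in_itv/= => h; exists r.
have [a /andP[a1 a2]] := q (z.1 - e) z.1 ltac:(lra).
have [b /andP[b1 b2]] := q z.1 (z.1 + e) ltac:(lra).
have [c /andP[c1 c2]] := q (z.2 - e) z.2 ltac:(lra).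
have [d /andP[d1 d2]] := q z.2 (z.2 + e) ltac:(lra).
apply: (@bigcup_unpickle _ _ N (a, b, (c, d))); split; last first.
  by split => //; rewrite /rect a2 b1 c2 d1.
move=> y /andP[h1 h2] /andP[h3 h4]; apply: eO; rewrite ltr_distlC; itvlra.
Qed.

End du_bois_reymond.

(** * Square integrable functions, weak derivatives and the forms of the problem *)

Section square_integrable.
Variables (R : realType) (Om : smooth_domain R).
Notation AR := (area_measure R).
Notation I := (@I R Om).
Notation intg := (@intg R Om).
Notation bm := (@bm R Om).
Notation PC1 := (@PC1 R Om).
Notation R2 := (measurableTypeR R * measurableTypeR R)%type.
Notation mf f := (measurable_fun (Om : set (R * R)) f).
Implicit Types (f g h u v w : R * R -> R) (x y z p : R * R).

Lemma innerE u v : inner Om u v = I (fun x => u x * v x).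
Proof. by []. Qed.

Lemma ae_filter : Filter (nbhs (almost_everywhere (@area R : set R2 -> \bar R))).
Proof. exact: (@ae_filter_ringOfSetsType _ _ _ AR). Qed.

Definition lsq f : Prop := mf f /\ intg (fun x => f x ^+ 2).

Lemma intgP f : mf f -> intg f <-> (\int[AR]_(x in (Om : set (R * R))) `|f x|%:E < +oo)%E.
Proof.
move=> m; split; first by move=> /integrableP[].
by move=> H; apply/integrableP; split => //; exact/measurable_EFinP.
Qed.

(** The integral in [L2] and the one over [AR] differ in the way the plane is made a measurable
    space; the pushforward by the identity map [phi] reconciles them. *)
Lemma L2P f : L2 Om f <-> lsq f.
Proof.
have E : mf f -> (\int[@area R]_(x in Om) ((f x ^+ 2)%:E) =
    \int[AR]_(x in (Om : set (R * R))) ((f x ^+ 2)%:E))%E.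
  move=> m; pose phi (x : R2) : R * R := x.
  have mphi : measurable_fun setT phi by move=> _ Y mY; rewrite setTI.
  have m2 : measurable_fun (Om : set (R * R)) (fun x => (f x ^+ 2)%:E).
    by apply/measurable_EFinP; exact: measurable_funX.
  have := @ge0_integral_pushforward _ _ _ _ R phi mphi AR _ _ (measurable_dom Om) m2.
  apply; by move=> x _; rewrite lee_fin sqr_ge0.
have A : (fun x => `|f x ^+ 2|%:E) = (fun x => (f x ^+ 2)%:E) by apply/funext => x; rewrite ger0_norm// sqr_ge0.
split=> [[m lt]|[m i]]; split => //.
  by apply/(intgP (measurable_funX 2 m)); rewrite A -E.
by rewrite E//; move/(intgP (measurable_funX 2 m)) : i; rewrite A.
Qed.

Lemma intg_le f g : mf f -> intg g -> (forall x, dom Om x -> `|f x| <= g x) -> intg f.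
Proof.
move=> m ig fg; rewrite /intg; apply: (le_integrable _ _ _ ig); first exact: measurable_dom.
  exact/measurable_EFinP.
by move=> x Ox; rewrite lee_fin; apply: le_trans (fg x Ox) (ler_norm _).
Qed.

Lemma intg_mf f : intg f -> mf f.
Proof. by move=> /integrableP[/measurable_EFinP]. Qed.

Lemma intg_add f g : intg f -> intg g -> intg (fun x => f x + g x).
Proof. by rewrite /intg => jf jg; apply: (integrableD _ jf jg); exact: measurable_dom. Qed.

Lemma intg_scale (c : R) f : intg f -> intg (fun x => c * f x).
Proof. by rewrite /intg => jf; apply: (integrableZl _ c jf); exact: measurable_dom. Qed.

Lemma J_add f g : intg f -> intg g -> I (fun x => f x + g x) = I f + I g.
Proof. by move=> jf jg; rewrite /I RintegralD//; exact: measurable_dom. Qed.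

Lemma J_scale (c : R) f : intg f -> I (fun x => c * f x) = c * I f.
Proof. by move=> jf; rewrite /I RintegralZl//; exact: measurable_dom. Qed.

Lemma bm_lsq f : bm f -> lsq f.
Proof. by move=> bf; split; [case: bf|apply: bm_intg; exact: bm_exp]. Qed.

Lemma lsq_mul f g : lsq f -> lsq g -> intg (fun x => f x * g x).
Proof.
move=> [m1 i1] [m2 i2]; apply: (intg_le _ (intg_add i1 i2)); first exact: measurable_funM.
move=> x _; rewrite normrM; have := sqr_ge0 (`|f x| - `|g x|).
rewrite -(real_normK (num_real (f x))) -(real_normK (num_real (g x))).
have := normr_ge0 (f x); have := normr_ge0 (g x); nra.
Qed.

Lemma lsq_add f g : lsq f -> lsq g -> lsq (fun x => f x + g x).
Proof.
move=> [m1 i1] [m2 i2]; split; first exact: measurable_funD.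
apply: (intg_le _ (intg_scale 2 (intg_add i1 i2))).
  by apply: measurable_funX; exact: measurable_funD.
by move=> x _; rewrite ger0_norm ?sqr_ge0//; have := sqr_ge0 (f x - g x); nra.
Qed.

Lemma lsq_scale (c : R) f : lsq f -> lsq (fun x => c * f x).
Proof.
move=> [m1 i1]; split; first by apply: measurable_funM => //; exact: measurable_cst.
by under eq_fun do rewrite exprMn; exact: intg_scale.
Qed.

Lemma lsq_intg f : lsq f -> intg f.
Proof.
move=> lf; have := lsq_mul lf (bm_lsq (bm_cst Om 1)).
by under eq_fun do rewrite mulr1.
Qed.

Definition sqn f : R := I (fun x => f x ^+ 2).

Lemma sqn_ge0 f : 0 <= sqn f.
Proof. by apply: I_ge0 => x _; exact: sqr_ge0. Qed.

Lemma sqnD f g (c : R) : lsq f -> lsq g ->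
  sqn (fun x => f x + c * g x) = sqn f + 2 * c * I (fun x => f x * g x) + c ^+ 2 * sqn g.
Proof.
move=> lf lg; have ifg := lsq_mul lf lg; case: (lf) => _ i1; case: (lg) => _ i2.
rewrite /sqn -J_scale// -J_scale// -J_add//; last exact: intg_scale.
rewrite -J_add//; [|by apply: intg_add => //; exact: intg_scale|exact: intg_scale].
by apply: I_ext => x _; ring.
Qed.

(** The discriminant of a nonnegative quadratic polynomial. If c = 0 the polynomial is affine and
    would be -1 at t = -(a + 1)/(2 b). *)
Lemma quad_disc (a b c : R) : 0 <= a -> 0 <= c -> (forall t : R, 0 <= a + 2 * t * b + t ^+ 2 * c) -> b ^+ 2 <= a * c.
Proof.
move=> a0 c0 H; have [c1|c1] := eqVneq c 0.
  suff -> : b = 0 by rewrite c1 expr0n mulr0.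
  apply/eqP; apply/negPn/negP => b0.
  have := H (- (a + 1) / (2 * b)); rewrite c1 mulr0 addr0.
  rewrite (_ : a + 2 * (- (a + 1) / (2 * b)) * b = - 1) ?oppr_ge0 ?ler10//; by field.
have cp : 0 < c by rewrite lt_neqAle eq_sym c1.
have := H (- b / c); rewrite (_ : a + 2 * (- b / c) * b + (- b / c) ^+ 2 * c = (a * c - b ^+ 2) / c); last by field.
by rewrite pmulr_lge0 ?invr_gt0// subr_ge0.
Qed.

Lemma CS f g : lsq f -> lsq g -> I (fun x => f x * g x) ^+ 2 <= sqn f * sqn g.
Proof.
move=> lf lg; apply: quad_disc; [exact: sqn_ge0|exact: sqn_ge0|].
by move=> t; rewrite -sqnD//; exact: sqn_ge0.
Qed.

Definition aeq f g : Prop := {ae AR, forall x, dom Om x -> f x = g x}.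

Lemma aeq_lift2 (F : R * R -> R -> R -> R) f f' g g' : aeq f f' -> aeq g g' ->
  aeq (fun x => F x (f x) (g x)) (fun x => F x (f' x) (g' x)).
Proof. by apply: (@filterS2 _ _ ae_filter) => x H H' Ox; rewrite H// H'. Qed.

Lemma I_aeq f g : mf f -> mf g -> aeq f g -> I f = I g.
Proof.
move=> m1 m2 fg; rewrite /I /Rintegral; congr fine; apply: ae_eq_integral.
- exact: measurable_dom.
- exact/measurable_EFinP.
- exact/measurable_EFinP.
- by apply: (@filterS _ _ ae_filter) fg => x H Ox; rewrite H.
Qed.

Lemma bm_pderiv a b phi : smooth phi -> bm (pderiv a b phi).
Proof.
move=> s; apply: cont_cl_bm; apply: continuous_subspaceT => x.
by apply: differentiable_continuous; exact: s.
Qed.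

Lemma bm_smooth phi : smooth phi -> bm phi.
Proof. exact: (@bm_pderiv 0%N 0%N). Qed.

Lemma weak_lsq a b u g : is_weak_deriv Om a b u g -> lsq g.
Proof. by move=> [/L2P]. Qed.

(** Makes the derivative chosen by [xget] known up to a null set, so that integrals involving it can
    be computed with any weak derivative at hand. *)
Lemma weak_unique a b u g h : is_weak_deriv Om a b u g -> is_weak_deriv Om a b u h -> aeq g h.
Proof.
move=> [/L2P lg Hg] [/L2P lh Hh].
have ld : lsq (fun x => g x + - 1 * h x) by apply: lsq_add => //; exact: lsq_scale.
have : {ae AR, forall z, dom Om z -> g z + - 1 * h z = 0}.
  apply: (du_bois_reymond (lsq_intg ld)) => phi tphi.
  have bp := bm_smooth (proj1 tphi).
  have := Hg phi tphi; rewrite (Hh phi tphi) => /(congr1 (fun r => (-1) ^+ (a + b) * r)).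
  rewrite !signrMK !innerE => E.
  under (@eq_fun (R * R)) do rewrite mulrDl -mulrA.
  rewrite J_add ?J_scale; [by rewrite E mulN1r addrC addNr| | |].
  - exact: lsq_mul lh (bm_lsq bp).
  - exact: lsq_mul lg (bm_lsq bp).
  - by apply: intg_scale; exact: lsq_mul lh (bm_lsq bp).
by apply: (@filterS _ _ ae_filter) => x H /H/eqP; rewrite mulN1r subr_eq0 => /eqP.
Qed.

Lemma wderivP a b u g : is_weak_deriv Om a b u g ->
  [/\ is_weak_deriv Om a b u (wderiv Om a b u), lsq (wderiv Om a b u) & aeq (wderiv Om a b u) g].
Proof.
move=> H; have W : is_weak_deriv Om a b u (wderiv Om a b u).
  by rewrite /wderiv; case: xgetP => [y _ //|/(_ g)/=]; case.
by split => //; [exact: weak_lsq W|exact: weak_unique W H].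
Qed.

(* An opaque copy of [wderiv]: conversion must never compare two weak derivatives. *)
Lemma wd_key : {w : nat -> nat -> (R * R -> R) -> R * R -> R | w = wderiv Om}.
Proof. by exists (wderiv Om). Qed.

Definition wd := sval wd_key.

Lemma wdE : wderiv Om = wd.
Proof. by rewrite /wd (svalP wd_key). Qed.

Lemma wdP a b u g : is_weak_deriv Om a b u g ->
  [/\ is_weak_deriv Om a b u (wd a b u), lsq (wd a b u) & aeq (wd a b u) g].
Proof. by rewrite -wdE; exact: wderivP. Qed.

Lemma grad_innerE u v : grad_inner Om u v =
  I (fun x => wd 1 0 u x * wd 1 0 v x) + I (fun x => wd 0 1 u x * wd 0 1 v x).
Proof. by rewrite /grad_inner wdE. Qed.

Lemma trilinearE u v w : trilinear Om u v w = I (fun x => u x * (wd 1 0 v x + wd 0 1 v x) * w x).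
Proof. by rewrite -wdE. Qed.

Lemma weak00 u : lsq u -> is_weak_deriv Om 0 0 u u.
Proof. by move=> lu; split; [exact/L2P|move=> phi _; rewrite expr0 mul1r]. Qed.

Lemma weak_lin a b (c : R) u v g h : lsq u -> lsq v ->
  is_weak_deriv Om a b u g -> is_weak_deriv Om a b v h ->
  is_weak_deriv Om a b (fun x => u x + c * v x) (fun x => g x + c * h x).
Proof.
move=> lu lv [/L2P lg Hg] [/L2P lh Hh]; split.
  by apply/L2P/lsq_add => //; exact: lsq_scale.
move=> phi tphi; have bp := bm_lsq (bm_smooth (proj1 tphi)).
have bq := bm_lsq (bm_pderiv a b (proj1 tphi)).
have L (u' v' p : R * R -> R) : lsq u' -> lsq v' -> lsq p ->
    inner Om (fun x => u' x + c * v' x) p = inner Om u' p + c * inner Om v' p.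
  move=> l1 l2 l3; rewrite !innerE -J_scale; last exact: lsq_mul.
  rewrite -J_add; [|exact: lsq_mul|by apply: intg_scale; exact: lsq_mul].
  by apply: I_ext => x _; rewrite mulrDl mulrA.
by rewrite !L// Hg// Hh//; ring.
Qed.

(** Green's formula for g times a test function: its flux is zero since the test function vanishes
    on the boundary. *)
Lemma PC1_weak g g1 g2 : PC1 g g1 g2 -> is_weak_deriv Om 1 0 g g1 /\ is_weak_deriv Om 0 1 g g2.
Proof.
move=> pg; have bg := cont_cl_bm (pc_cont pg).
have K phi k : test_function Om phi ->
    I (dk k (fun x => g x * pderiv 1 0 phi x + phi x * g1 x) (fun x => g x * pderiv 0 1 phi x + phi x * g2 x)) = 0.
  move=> [sphi [K [cK KO Kphi]]].
  rewrite (green k (PC1_mul pg (smooth_PC1 Om sphi))).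
  apply: flux_zero => z [_ nO]; rewrite Kphi ?mulr0// => Kz; exact/nO/KO.
split; split; try (by apply/L2P/bm_lsq; [exact: pc_bm1 pg || exact: pc_bm2 pg]).
  move=> phi tphi; have := K phi o3_0 tphi.
  have bp := bm_smooth (proj1 tphi); have bq := bm_pderiv 1 0 (proj1 tphi).
  rewrite /dk /dirv/=; under (@eq_fun (R * R)) do rewrite mulr1 mulr0 addr0.
  rewrite I_add; [|exact: bm_mul|by apply: bm_mul => //; exact: pc_bm1 pg].
  rewrite !innerE addn0 expr1 mulN1r => /eqP; rewrite addr_eq0 => /eqP ->.
  by congr (- _); apply: I_ext => x _; rewrite mulrC.
move=> phi tphi; have := K phi o3_1 tphi.
have bp := bm_smooth (proj1 tphi); have bq := bm_pderiv 0 1 (proj1 tphi).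
rewrite /dk /dirv/=; under (@eq_fun (R * R)) do rewrite mulr1 mulr0 add0r.
rewrite I_add; [|exact: bm_mul|by apply: bm_mul => //; exact: pc_bm2 pg].
rewrite !innerE add0n expr1 mulN1r => /eqP; rewrite addr_eq0 => /eqP ->.
by congr (- _); apply: I_ext => x _; rewrite mulrC.
Qed.

Lemma sobolev1P u : sobolev Om 1 u <-> [/\ lsq u,
  exists g, is_weak_deriv Om 1 0 u g & exists g, is_weak_deriv Om 0 1 u g].
Proof.
split=> [[/L2P lu H]|[lu [g Hg] [h Hh]]].
  by split => //; exact: H.
split; first exact/L2P.
move=> [|[|a]] [|[|b]] //= _; [exists u; exact: weak00|by exists h|by exists g].
Qed.

Lemma PC1_sobolev g g1 g2 : PC1 g g1 g2 -> sobolev Om 1 g.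
Proof.
move=> pg; have [h1 h2] := PC1_weak pg; apply/sobolev1P; split.
- by apply: bm_lsq; apply: cont_cl_bm; exact: pc_cont pg.
- by exists g1.
- by exists g2.
Qed.

Lemma sobolev1_wderiv u : sobolev Om 1 u -> [/\ lsq u,
  is_weak_deriv Om 1 0 u (wd 1 0 u), is_weak_deriv Om 0 1 u (wd 0 1 u),
  lsq (wd 1 0 u) & lsq (wd 0 1 u)].
Proof.
by move=> /sobolev1P[lu [g Hg] [h Hh]]; have [? ? _] := wdP Hg; have [? ? _] := wdP Hh.
Qed.

Lemma PC1_wderiv g g1 g2 : PC1 g g1 g2 -> aeq (wd 1 0 g) g1 /\ aeq (wd 0 1 g) g2.
Proof. by move=> /PC1_weak[h1 h2]; have [_ _ ?] := wdP h1; have [_ _ ?] := wdP h2. Qed.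

Lemma sobolev_lin (c : R) u v : sobolev Om 1 u -> sobolev Om 1 v ->
  let w := fun x => u x + c * v x in
  [/\ sobolev Om 1 w, aeq (wd 1 0 w) (fun x => wd 1 0 u x + c * wd 1 0 v x) &
      aeq (wd 0 1 w) (fun x => wd 0 1 u x + c * wd 0 1 v x)].
Proof.
move=> /sobolev1_wderiv[lu a1 a2 l1 l2] /sobolev1_wderiv[lv b1 b2 l3 l4] w.
have h1 := weak_lin c lu lv a1 b1; have h2 := weak_lin c lu lv a2 b2.
have [_ _ e1] := wdP h1; have [_ _ e2] := wdP h2; split; [|exact: e1|exact: e2].
apply/sobolev1P; split; [by apply: lsq_add => //; exact: lsq_scale|by eexists; exact: h1|by eexists; exact: h2].
Qed.

Definition gsq u : R := sqn (wd 1 0 u) + sqn (wd 0 1 u).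

Lemma gsq_ge0 u : 0 <= gsq u. Proof. by rewrite addr_ge0// sqn_ge0. Qed.

Lemma inner_sqn u : inner Om u u = sqn u.
Proof. by rewrite innerE; apply: I_ext => x _; rewrite expr2. Qed.

Lemma grad_inner_gsq u : grad_inner Om u u = gsq u.
Proof. by rewrite grad_innerE; congr (_ + _); apply: I_ext => x _; rewrite expr2. Qed.

Lemma grad_norm_sq u : grad_norm Om u ^+ 2 = gsq u.
Proof. by rewrite /grad_norm grad_inner_gsq sqr_sqrtr// gsq_ge0. Qed.

Lemma grad_norm_ge0 u : 0 <= grad_norm Om u. Proof. exact: sqrtr_ge0. Qed.

Lemma sqn_aeq f g : mf f -> mf g -> aeq f g -> sqn f = sqn g.
Proof.
move=> m1 m2 fg; apply: I_aeq; [exact: measurable_funX|exact: measurable_funX|].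
exact: (aeq_lift2 (fun _ a _ => a ^+ 2) fg fg).
Qed.

Lemma gsq_lin (c : R) u v : sobolev Om 1 u -> sobolev Om 1 v ->
  gsq (fun x => u x + c * v x) = gsq u + 2 * c * grad_inner Om u v + c ^+ 2 * gsq v.
Proof.
move=> su sv; have [sw e1 e2] := sobolev_lin c su sv.
have [lu _ _ l1 l2] := sobolev1_wderiv su; have [lv _ _ l3 l4] := sobolev1_wderiv sv.
have [lw _ _ l5 l6] := sobolev1_wderiv sw.
have S f g h : lsq f -> lsq g -> lsq h -> aeq h (fun x => f x + c * g x) ->
    sqn h = sqn f + 2 * c * inner Om f g + c ^+ 2 * sqn g.
  move=> a1 a2 a3 e; rewrite -sqnD//; apply: sqn_aeq => //; [by case: a3|].
  by have [] := lsq_add a1 (lsq_scale c a2).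
by rewrite /gsq (S _ _ _ l1 l3 l5 e1) (S _ _ _ l2 l4 l6 e2) grad_innerE !innerE; ring.
Qed.

Lemma PC1_inner_l u g g1 g2 : sobolev Om 1 u -> PC1 g g1 g2 ->
  grad_inner Om u g = I (fun x => wd 1 0 u x * g1 x + wd 0 1 u x * g2 x).
Proof.
move=> su pg; have [lu _ _ l1 l2] := sobolev1_wderiv su.
have [lg _ _ l3 l4] := sobolev1_wderiv (PC1_sobolev pg).
have [e1 e2] := PC1_wderiv pg.
have b1 := bm_lsq (pc_bm1 pg); have b2 := bm_lsq (pc_bm2 pg).
rewrite J_add; [|exact: lsq_mul|exact: lsq_mul].
rewrite grad_innerE.
have E f g' h' : lsq f -> lsq g' -> lsq h' -> aeq g' h' -> I (fun x => f x * g' x) = I (fun x => f x * h' x).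
  move=> a1 a2 a3 e; apply: I_aeq; [exact: intg_mf (lsq_mul a1 a2)|exact: intg_mf (lsq_mul a1 a3)|].
  exact: (aeq_lift2 (fun x a _ => f x * a) e e).
by rewrite (E _ _ _ l1 l3 b1 e1) (E _ _ _ l2 l4 b2 e2).
Qed.

Lemma PC1_grad_inner f f1 f2 g g1 g2 : PC1 f f1 f2 -> PC1 g g1 g2 ->
  grad_inner Om f g = I (fun x => f1 x * g1 x + f2 x * g2 x).
Proof.
move=> pf pg; rewrite (PC1_inner_l (PC1_sobolev pf) pg).
have [lu _ _ [l1 _] [l2 _]] := sobolev1_wderiv (PC1_sobolev pf); have [e1 e2] := PC1_wderiv pf.
have [m1 _] := pc_bm1 pg; have [m2 _] := pc_bm2 pg.
have [n1 _] := pc_bm1 pf; have [n2 _] := pc_bm2 pf.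
apply: I_aeq; [by apply: measurable_funD; exact: measurable_funM|by apply: measurable_funD; exact: measurable_funM|].
exact: (aeq_lift2 (fun x a b => a * g1 x + b * g2 x) e1 e2).
Qed.

Lemma PC1_gsq g g1 g2 : PC1 g g1 g2 -> gsq g = I (fun x => g1 x ^+ 2 + g2 x ^+ 2).
Proof.
by move=> pg; rewrite -grad_inner_gsq (PC1_grad_inner pg pg); apply: I_ext => x _; rewrite !expr2.
Qed.

Lemma PC1_trilinear v w w1 w2 phi : mf v -> mf phi -> PC1 w w1 w2 ->
  trilinear Om v w phi = I (fun x => v x * (w1 x + w2 x) * phi x).
Proof.
move=> mv mp pw; have [_ _ _ [l1 _] [l2 _]] := sobolev1_wderiv (PC1_sobolev pw).
have [e1 e2] := PC1_wderiv pw; have [m1 _] := pc_bm1 pw; have [m2 _] := pc_bm2 pw.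
rewrite trilinearE; apply: I_aeq.
- by apply: measurable_funM => //; apply: measurable_funM => //; exact: measurable_funD.
- by apply: measurable_funM => //; apply: measurable_funM => //; exact: measurable_funD.
exact: (aeq_lift2 (fun x a b => v x * (a + b) * phi x) e1 e2).
Qed.

Lemma Hnorm_sq (m : nat) u : Hnorm Om m u ^+ 2 =
  \sum_(a < m.+1) \sum_(b < m.+1 | (a + b <= m)%N) sqn (wd a b u).
Proof.
rewrite /Hnorm wdE sqr_sqrtr; last first.
  by rewrite sumr_ge0// => a _; rewrite sumr_ge0// => b _; rewrite inner_sqn sqn_ge0.
by apply: eq_bigr => a _; apply: eq_bigr => b _; rewrite inner_sqn.
Qed.

Lemma sum_order1 (F : nat -> nat -> R) :
  \sum_(a < 2) \sum_(b < 2 | (a + b <= 1)%N) F a b = F 0 0 + F 0 1 + F 1 0.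
Proof.
rewrite big_ord_recl big_ord1; congr (_ + _).
  by rewrite big_mkcond big_ord_recl big_ord1.
by rewrite big_mkcond big_ord_recl big_ord1 /= addr0.
Qed.

Lemma sum_order3 (F : nat -> nat -> R) : (forall a b, 0 <= F a b) ->
  F 0 0 + F 0 1 + F 1 0 <= \sum_(a < 4) \sum_(b < 4 | (a + b <= 3)%N) F a b.
Proof.
move=> F0; have S a : 0 <= \sum_(b < 4 | (a + b <= 3)%N) F a b by rewrite sumr_ge0.
rewrite big_ord_recl big_ord_recl /= addrA.
apply: (@le_trans _ _ (\sum_(b < 4 | (0 + b <= 3)%N) F 0 b + \sum_(b < 4 | (1 + b <= 3)%N) F 1 b)); last first.
  by rewrite lerDl sumr_ge0.
apply: lerD; rewrite big_mkcond big_ord_recl/= ?add0r.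
  by rewrite lerD2l big_ord_recl/= lerDl sumr_ge0// => i _; case: ifP.
by rewrite lerDl sumr_ge0// => i _; case: ifP.
Qed.

Lemma Hnorm1_sq u : sobolev Om 1 u -> Hnorm Om 1 u ^+ 2 = sqn u + gsq u.
Proof.
move=> su; have [lu _ _ l1 l2] := sobolev1_wderiv su.
rewrite Hnorm_sq (sum_order1 (fun a b => sqn (wd a b u))).
have [_ [m0 _] e] := wdP (weak00 lu).
rewrite (_ : sqn (wd 0 0 u) = sqn u); last by apply: sqn_aeq => //; case: lu.
by rewrite /gsq -addrA [X in _ + X]addrC.
Qed.

(** The initial energy is estimated through the H^1 norm; this expresses the bound by the norm on
    which the final constant depends. *)
Lemma Hnorm13 u : Hnorm Om 1 u ^+ 2 <= Hnorm Om 3 u ^+ 2.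
Proof.
rewrite !Hnorm_sq (sum_order1 (fun a b => sqn (wd a b u))).
by apply: (sum_order3 (F := fun a b => sqn (wd a b u))) => a b; exact: sqn_ge0.
Qed.

End square_integrable.

Ltac nn_atom ::= first [exact: sqn_ge0 | exact: gsq_ge0].

(* Real arithmetic must not compare integrals up to conversion: they are first
   replaced by variables. *)
Ltac gen_real t := let x := fresh "r" in set (x := t) in *; clearbody x.

Ltac gen_integrals := cbv beta in *; repeat match goal with
  | |- context [@sqn ?R ?O ?f] => gen_real (@sqn R O f)
  | |- context [@gsq ?R ?O ?f] => gen_real (@gsq R O f)
  | |- context [@I ?R ?O ?f] => gen_real (@I R O f)
  | |- context [@grad_norm ?R ?O ?f] => gen_real (@grad_norm R O f)
  | |- context [@triple_norm ?R ?O ?f] => gen_real (@triple_norm R O f)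
  | |- context [@grad_inner ?R ?O ?f ?g] => gen_real (@grad_inner R O f g)
  | |- context [@inner ?R ?O ?f ?g] => gen_real (@inner R O f g)
  | |- context [@trilinear ?R ?O ?f ?g ?h] => gen_real (@trilinear R O f g h)
  | |- context [@bint ?R ?O ?f] => gen_real (@bint R O f)
  | H : context [@sqn ?R ?O ?f] |- _ => gen_real (@sqn R O f)
  | H : context [@gsq ?R ?O ?f] |- _ => gen_real (@gsq R O f)
  | H : context [@I ?R ?O ?f] |- _ => gen_real (@I R O f)
  | H : context [@grad_norm ?R ?O ?f] |- _ => gen_real (@grad_norm R O f)
  | H : context [@triple_norm ?R ?O ?f] |- _ => gen_real (@triple_norm R O f)
  | H : context [@grad_inner ?R ?O ?f ?g] |- _ => gen_real (@grad_inner R O f g)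
  | H : context [@inner ?R ?O ?f ?g] |- _ => gen_real (@inner R O f g)
  | H : context [@trilinear ?R ?O ?f ?g ?h] |- _ => gen_real (@trilinear R O f g h)
  | H : context [@bint ?R ?O ?f] |- _ => gen_real (@bint R O f)
  end.

Ltac ilra := gen_integrals; lra.
Ltac iring := gen_integrals; ring.

(** * Poincare's inequality, boundary integrals and traces *)

Section poincare_trace.
Variables (R : realType) (Om : smooth_domain R).
Notation mu := (@lebesgue_measure R).
Notation AR := (area_measure R).
Notation cl := (clos Om).
Notation vel j := (velocity (@curve _ Om j)).
Notation I := (@I R Om).
Notation bm := (@bm R Om).
Notation PC1 := (@PC1 R Om).
Notation lsq := (@lsq R Om).
Notation sqn := (@sqn R Om).
Notation gsq := (@gsq R Om).
Notation wd := (@wd R Om).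
Notation bdry := (@bdry R Om).
Implicit Types (f g h u v w : R * R -> R) (x y z : R * R).

Lemma area_pos : 0 < I (fun=> 1).
Proof.
have [x Ox] := @dom_nonempty _ Om.
have /nbhs_box[e e0 eO] : nbhs x (Om : set (R * R)).
  by apply: open_nbhs_nbhs; split => //; exact: dom_open.
rewrite lt_neqAle eq_sym I_ge0 ?andbT//; apply/negP => /eqP I0.
pose Q : set (R * R) := `[x.1 - e / 2, x.1 + e / 2]%classic `*` `[x.2 - e / 2, x.2 + e / 2]%classic.
have QO : Q `<=` (Om : set (R * R)).
  move=> y [/=]; rewrite !in_itv/= => /andP[h1 h2] /andP[h3 h4].
  by apply: eO; rewrite ltr_distlC; itvlra.
have mQ : measurable Q by apply: measurableX.
have AE : AR (Om : set (R * R)) = (I (fun=> 1))%:E.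
  rewrite /I /Rintegral integral_cst ?mul1e; [|exact: measurable_dom].
  by rewrite fineK// ge0_fin_numE// area_dom_lty.
have : (AR Q <= AR (Om : set (R * R)))%E.
  by apply: le_measure => //; rewrite inE; [exact: mQ|exact: measurable_dom].
rewrite AE I0 => h0.
have := h0; rewrite [X in (X <= _)%E](_ : _ = ((x.1 + e / 2 - (x.1 - e / 2)) * (x.2 + e / 2 - (x.2 - e / 2)))%:E); last by apply: area_rect; lra.
rewrite lee_fin => h; have : 0 < (x.1 + e / 2 - (x.1 - e / 2)) * (x.2 + e / 2 - (x.2 - e / 2)) by apply: mulr_gt0; lra.
by lra.
Qed.

Lemma sobolev1_lsq u : sobolev Om 1 u -> [/\ lsq u, lsq (wd 1 0 u) & lsq (wd 0 1 u)].
Proof. by move=> /sobolev1_wderiv[]. Qed.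

Lemma grad_CS u v : sobolev Om 1 u -> sobolev Om 1 v -> grad_inner Om u v ^+ 2 <= gsq u * gsq v.
Proof.
move=> su sv; apply: quad_disc; [exact: gsq_ge0|exact: gsq_ge0|].
by move=> t; rewrite -gsq_lin//; exact: gsq_ge0.
Qed.

Definition centered x : R := x.1 - I (fun x => x.1) / I (fun=> 1).

Lemma PC1_centered : PC1 centered (fun=> 1) (fun=> 0).
Proof.
by apply: (PC1_ext (PC1_sub (PC1_fst Om) (PC1_cst Om (I (fun x => x.1) / I (fun=> 1))))) => x //=; rewrite subr0.
Qed.

Lemma H1quot_centered : H1quot Om centered.
Proof.
split; first exact: PC1_sobolev PC1_centered.
change (I centered = 0); rewrite I_sub; [|exact: cont_cl_bm (pc_cont (PC1_fst Om))|exact: bm_cst].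
have -> : I (fun=> I (fun x => x.1) / I (fun=> 1)) = I (fun x => x.1) / I (fun=> 1) * I (fun=> 1).
  by rewrite -I_scale; [apply: I_ext => x _; rewrite mulr1|exact: bm_cst].
by rewrite divfK ?subrr// gt_eqF// area_pos.
Qed.

Lemma gsq_centered : gsq centered = I (fun=> 1).
Proof. by rewrite (PC1_gsq PC1_centered); apply: I_ext => x _; rewrite expr1n expr0n addr0. Qed.

(** The gradient of [centered] is (1, 0), so the trilinear form reduces to the L^2 norm and the
    finiteness of N becomes a Poincare inequality. *)
Lemma trilinear_centered v : lsq v -> trilinear Om v centered v = sqn v.
Proof.
move=> [m _]; rewrite (PC1_trilinear m m PC1_centered); apply: I_ext => x _.
by rewrite addr0 mulr1 expr2.
Qed.

Lemma norm_gt0 u : (grad_norm Om u != 0) = (0 < grad_norm Om u).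
Proof. by rewrite lt_neqAle sqrtr_ge0 andbT eq_sym. Qed.

Lemma N1_bound (N : R) v (z phi : R * R -> R) : N%:E = maxe (N1 Om) (N2 Om) ->
  H1quot Om v -> H1quot Om z -> H1quot Om phi ->
  grad_norm Om v != 0 -> grad_norm Om z != 0 -> grad_norm Om phi != 0 ->
  trilinear Om v z phi <= N * (grad_norm Om v * grad_norm Om z * grad_norm Om phi).
Proof.
move=> hN hv hz hp nv nz np.
rewrite -ler_pdivrMr; last by rewrite !mulr_gt0// -norm_gt0.
rewrite -lee_fin hN le_max; apply/orP; left.
by apply: ereal_sup_ubound; exists v, z, phi.
Qed.

Lemma triple_ge0 u : 0 <= triple_norm Om u. Proof. exact: sqrtr_ge0. Qed.

Lemma pos_neq (r : R) : 0 <= r -> r != 0 -> 0 < r.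
Proof. by move=> r0 rn; rewrite lt_neqAle eq_sym rn. Qed.

Lemma N2_bound (N : R) v (z phi : R * R -> R) : N%:E = maxe (N1 Om) (N2 Om) ->
  H1quot Om v -> sobolev Om 1 z -> sobolev Om 1 phi ->
  grad_norm Om v != 0 -> triple_norm Om z != 0 -> triple_norm Om phi != 0 ->
  trilinear Om v z phi <= N * (grad_norm Om v * triple_norm Om z * triple_norm Om phi).
Proof.
move=> hN hv hz hp nv nz np.
rewrite -ler_pdivrMr; last first.
  apply: mulr_gt0; first apply: mulr_gt0; first by rewrite -norm_gt0.
    exact: pos_neq (triple_ge0 z) nz.
  exact: pos_neq (triple_ge0 phi) np.
rewrite -lee_fin hN le_max; apply/orP; right.
by apply: ereal_sup_ubound; exists v, z, phi.
Qed.

Lemma H1quot_lin (c : R) u v : H1quot Om u -> H1quot Om v -> H1quot Om (fun x => u x + c * v x).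
Proof.
move=> [su u0] [sv v0]; have [sw _ _] := sobolev_lin c su sv; split; first exact: sw.
have [lu _ _] := sobolev1_lsq su; have [lv _ _] := sobolev1_lsq sv.
change (I (fun x => u x + c * v x) = 0).
rewrite J_add ?J_scale; [|exact: lsq_intg|exact: lsq_intg|by apply: intg_scale; exact: lsq_intg].
by change (I u = 0) in u0; change (I v = 0) in v0; rewrite u0 v0 mulr0 addr0.
Qed.

Lemma poincare (N : R) : N%:E = maxe (N1 Om) (N2 Om) -> 0 < N /\
  exists2 C : R, 0 < C & forall v, H1quot Om v -> sqn v <= C * gsq v.
Proof.
move=> hN; have hz := H1quot_centered; have lz := bm_lsq (cont_cl_bm (pc_cont PC1_centered)).
set A := I (fun=> 1); have A0 : 0 < A := area_pos.
have zn : grad_norm Om centered != 0.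
  by rewrite norm_gt0 -(@ltr_pXn2r _ 2)// ?nnegrE ?grad_norm_ge0// expr0n grad_norm_sq gsq_centered.
have zn2 : grad_norm Om centered ^+ 2 = A by rewrite grad_norm_sq gsq_centered.
have P v : H1quot Om v -> grad_norm Om v != 0 -> sqn v <= N * grad_norm Om centered * gsq v.
  move=> hv nv; have [lv _ _] := sobolev1_lsq (proj1 hv).
  rewrite -trilinear_centered//; apply: le_trans (N1_bound hN hv hz hv nv zn nv) _.
  by rewrite -grad_norm_sq le_eqVlt; apply/orP; left; apply/eqP; iring.
have N0 : 0 < N.
  have := P _ hz zn; rewrite gsq_centered -/A => h.
  (* Otherwise 0 would also be a weak derivative of [centered], hence equal to 1 almost everywhere,
     and the domain would have zero area. *)
  have q0 : 0 < sqn centered.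
    rewrite lt_neqAle sqn_ge0 andbT eq_sym; apply/negP => /eqP q0.
    have C0 f : lsq f -> I (fun x => centered x * f x) = 0.
      move=> lf; have := CS lz lf; rewrite q0 mul0r => h'.
      by apply/eqP; rewrite -sqrf_eq0 eq_le h' sqr_ge0.
    have [W _] := PC1_weak PC1_centered.
    have W0 : is_weak_deriv Om 1 0 centered (fun=> 0).
      split; first by apply/L2P; exact: bm_lsq (bm_cst Om 0).
      move=> phi tphi; rewrite !innerE C0; last by apply: bm_lsq; exact: bm_pderiv (proj1 tphi).
      rewrite (@I_ext _ _ _ (fun x => 0 * phi x)); last by [].
      rewrite I_scale ?mul0r ?mulr0//; exact: bm_smooth (proj1 tphi).
    have := I_aeq _ _ (weak_unique W W0) => /(_ (measurable_cst _) (measurable_cst _)).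
    rewrite -/A (_ : I (fun=> 0) = 0); first by move=> A00; rewrite A00 ltxx in A0.
    rewrite -[RHS](mul0r (I (fun=> 1))) -(I_scale 0 (bm_cst Om 1)).
    by apply: I_ext => x _; rewrite mul0r.
  have : 0 < N * (grad_norm Om centered * A) by rewrite mulrA (lt_le_trans q0).
  by rewrite pmulr_lgt0// mulr_gt0// -norm_gt0.
split => //; exists (N * grad_norm Om centered); first by rewrite mulr_gt0// -norm_gt0.
move=> v hv; have [nv|nv] := eqVneq (grad_norm Om v) 0; last exact: P.
have gv : gsq v = 0 by rewrite -grad_norm_sq nv expr0n.
rewrite gv mulr0; have [lv _ _] := sobolev1_lsq (proj1 hv).
have gz : grad_inner Om v centered = 0.
  have := grad_CS (proj1 hv) (proj1 hz); rewrite gv mul0r => h.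
  by apply/eqP; rewrite -sqrf_eq0 eq_le h sqr_ge0.
pose K := 2 * (N * grad_norm Om centered * A) + 2 * sqn centered.
have K0 : 0 <= K by rewrite addr_ge0// mulr_ge0// ?sqn_ge0// !mulr_ge0// ?(ltW N0)// ?grad_norm_ge0 ?(ltW A0).
(* Functions with zero gradient are excluded from the supremum defining N. Adding e times [centered]
   makes v admissible, and letting e tend to 0 shows that v is zero in L^2. *)
have E (e : R) : 0 < e -> sqn v <= e ^+ 2 * K.
  move=> e0; have hw := H1quot_lin e hv hz.
  have gw : gsq (fun x => v x + e * centered x) = e ^+ 2 * A.
    by rewrite gsq_lin ?gv ?gz ?gsq_centered -/A; [ring|case: hv|case: hz].
  have nw : grad_norm Om (fun x => v x + e * centered x) != 0.
    rewrite norm_gt0 -(@ltr_pXn2r _ 2)// ?nnegrE ?grad_norm_ge0// expr0n grad_norm_sq gw.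
    by rewrite mulr_gt0// exprn_gt0.
  have := P _ hw nw; rewrite gw.
  have lw := lsq_add lv (lsq_scale e lz).
  have := sqnD (- e) lw lz; rewrite (_ : (fun x => _) = v); last by apply/funext => x; ring.
  have q := sqn_ge0 Om (fun x => (v x + e * centered x) + e * centered x).
  rewrite sqnD// in q.
  rewrite sqrrN /K => h1 h2; clear K0; clear K; ilra.
rewrite leNgt; apply/negP => s0.
have := E (Num.sqrt (sqn v / (2 * (K + 1)))).
rewrite sqr_sqrtr ?sqrtr_gt0 => [H|]; last by rewrite divr_ge0// ?sqn_ge0// mulr_ge0// addr_ge0.
have K1 : 0 < K + 1 by nn.
have := H (divr_gt0 s0 (mulr_gt0 (ltr0n R 2) K1)).
rewrite mulrAC ler_pdivlMr ?mulr_gt0// => h.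
have := mulr_ge0 (ltW s0) K0; clearbody K; ilra.
Qed.

Notation bint := (@bint R Om).
Notation cont_cl g := {within cl, continuous g}.

Lemma bint_ge0 f : (forall x, bdry x -> 0 <= f x) -> 0 <= bint f.
Proof.
move=> f0; apply: sumr_ge0 => j _; apply: Rintegral_ge0 => s _.
by rewrite mulr_ge0 ?sqrtr_ge0// f0//; apply/bdryP; exists j, s.
Qed.

Lemma bint_ext f g : (forall x, bdry x -> f x = g x) -> bint f = bint g.
Proof.
move=> fg; apply: eq_bigr => j _; apply: eq_Rintegral => s _; rewrite fg//.
by apply/bdryP; exists j, s.
Qed.

Definition bintg f : Prop := forall j,
  mu.-integrable `[0, 1] (EFin \o (fun s => f (@curve _ Om j s) * enorm (vel j s))).

Lemma cont_bintg f : cont_cl f -> bintg f.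
Proof. by move=> cf j; exact: bint_integrable. Qed.

Lemma bint_add f g : bintg f -> bintg g -> bint (fun x => f x + g x) = bint f + bint g.
Proof.
move=> jf jg; rewrite /Defs.bint -big_split/=; apply: eq_bigr => j _.
rewrite -RintegralD; [|exact: measurable_itv|exact: jf|exact: jg].
by apply: eq_Rintegral => s _; rewrite mulrDl.
Qed.

Lemma bintg_add f g : bintg f -> bintg g -> bintg (fun x => f x + g x).
Proof.
move=> jf jg j; have := integrableD _ (jf j) (jg j) => /(_ (measurable_itv _)).
by apply: eq_integrable => // s _ /=; rewrite -EFinD mulrDl.
Qed.

Lemma bintg_scale (c : R) f : bintg f -> bintg (fun x => c * f x).
Proof.
move=> jf j; have := integrableZl _ c (jf j) => /(_ (measurable_itv _)).
by apply: eq_integrable => // s _ /=; rewrite -EFinM mulrA.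
Qed.

Lemma bint_scale (c : R) f : bintg f -> bint (fun x => c * f x) = c * bint f.
Proof.
move=> jf; rewrite /Defs.bint mulr_sumr; apply: eq_bigr => j _.
rewrite -RintegralZl; [|exact: measurable_itv|exact: jf].
by apply: eq_Rintegral => s _; rewrite mulrA.
Qed.

Lemma bint_le f g : bintg f -> bintg g -> (forall x, bdry x -> f x <= g x) -> bint f <= bint g.
Proof.
move=> jf jg fg; apply: ler_sum => j _; apply: le_Rintegral; [exact: measurable_itv|exact: jf|exact: jg|].
move=> s _; apply: ler_wpM2r; first exact: sqrtr_ge0.
by apply: fg; apply/bdryP; exists j, s.
Qed.

Lemma bintg_le f g : (forall j, measurable_fun `[(0 : R), 1] (fun s => f (@curve _ Om j s))) -> bintg g ->
  (forall x, bdry x -> `|f x| <= g x) -> bintg f.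
Proof.
move=> m jg fg j; apply: (le_integrable _ _ _ (jg j)) => //.
  apply/measurable_EFinP; apply: measurable_funM; first exact: m.
  by apply: measurable_funTS; apply: continuous_measurable_fun; exact: continuous_enorm_vel.
move=> s _ /=; rewrite lee_fin normrM [leRHS]normrM ler_wpM2r//.
by apply: le_trans (fg _ _) (ler_norm _); apply/bdryP; exists j, s.
Qed.

Lemma L2bdryP g : L2bdry Om g -> (forall j, measurable_fun `[(0 : R), 1] (fun s => g (@curve _ Om j s))) /\
  bintg (fun x => g x ^+ 2).
Proof.
move=> H; split=> j; first by have [] := H j.
have [m lt] := H j.
have mm : measurable_fun (`[0%R, 1%R]%classic : set R) (fun s => g (curve j s) ^+ 2 * enorm (vel j s)).
  apply: measurable_funM; first exact: measurable_funX.
  by apply: measurable_funTS; apply: continuous_measurable_fun; exact: continuous_enorm_vel.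
apply/integrableP; split; first exact/measurable_EFinP.
apply: le_lt_trans lt.
have E (s : R) : (`|((EFin \o (fun s => g (curve j s) ^+ 2 * enorm (vel j s))%R) s)|)%E = (g (curve j s) ^+ 2 * enorm (vel j s))%:E.
  by rewrite /= ger0_norm// mulr_ge0 ?sqr_ge0 ?sqrtr_ge0.
under eq_integral => s _ do rewrite E.
exact: lexx.
Qed.

Lemma PC1_cont2 f f1 f2 : PC1 f f1 f2 -> cont_cl (fun x => f x ^+ 2).
Proof. by move=> pf; exact: pc_cont (PC1_exp 1 pf). Qed.

(** The trace inequality applied to f^2, whose gradient is 2 f times that of f. *)
Lemma trace_H1 : exists2 C : R, 0 < C & forall f f1 f2, PC1 f f1 f2 ->
  bint (fun x => f x ^+ 2) <= C * (sqn f + gsq f).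
Proof.
have [C C0 HC] := trace_ineq Om; exists (3 * C); first by rewrite mulr_gt0.
move=> f f1 f2 pf; have p2 := PC1_exp 1 pf.
apply: le_trans (HC _ _ _ p2 (fun x _ => sqr_ge0 _)) _.
have bf := cont_cl_bm (pc_cont pf); have b1 := pc_bm1 pf; have b2 := pc_bm2 pf.
have b3 : bm (fun x => f1 x ^+ 2 + f2 x ^+ 2) by apply: bm_add; exact: bm_exp.
rewrite (PC1_gsq pf) /sqn -I_add//; last exact: bm_exp.
rewrite -mulrA [leRHS]mulrCA ler_pM2l// -I_scale; last by apply: bm_add => //; exact: bm_exp.
apply: I_le.
- by apply: bm_add; [apply: bm_add|]; apply: bm_norm; [exact: bm_exp|exact: pc_bm1 p2|exact: pc_bm2 p2].
- by apply: bm_mul; [exact: bm_cst|apply: bm_add => //; exact: bm_exp].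
move=> x _; rewrite expr1 ger0_norm ?sqr_ge0// !normrM.
rewrite -(real_normK (num_real (f x))) -(real_normK (num_real (f1 x))) -(real_normK (num_real (f2 x))).
have -> : `|2%:R : R| = 2 by rewrite ger0_norm.
have := sqr_ge0 (`|f x| - `|f1 x|); have := sqr_ge0 (`|f x| - `|f2 x|).
move: `|f x| `|f1 x| `|f2 x| => a b c; clear; nra.
Qed.

(** With the smooth functions phi n that define the trace, g - w = (phi n - w) - (phi n - g) on the
    boundary, and both differences tend to 0, the first one by [trace_H1]. The weights 1 + e and 1 +
    1/e play the role of the triangle inequality. *)
Lemma is_trace_le w w1 w2 g : PC1 w w1 w2 -> is_trace Om w g ->
  bint (fun x => g x ^+ 2) <= bint (fun x => w x ^+ 2).
Proof.
move=> pw [sw /L2bdryP[mg jg] [phi [sphi Hphi bphi]]].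
have [C C0 HC] := trace_H1.
have jw : bintg (fun x => w x ^+ 2) by apply: cont_bintg; exact: PC1_cont2 pw.
have pp n := smooth_PC1 Om (sphi n).
have cw j : measurable_fun (`[0%R, 1%R]%classic : set R) (fun s => w (@curve _ Om j s)).
  by apply: measurable_funTS; apply: continuous_measurable_fun; exact: continuous_h_curve (pc_cont pw).
have cp n j : measurable_fun (`[0%R, 1%R]%classic : set R) (fun s => phi n (@curve _ Om j s)).
  by apply: measurable_funTS; apply: continuous_measurable_fun; exact: continuous_h_curve (pc_cont (pp n)).
have sq (a b : R) : (a - b) ^+ 2 <= 2 * a ^+ 2 + 2 * b ^+ 2 by have := sqr_ge0 (a + b); nra.
have jD f h : (forall j, measurable_fun `[(0 : R), 1] (fun s => f (@curve _ Om j s))) ->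
    (forall j, measurable_fun `[(0 : R), 1] (fun s => h (@curve _ Om j s))) ->
    bintg (fun x => f x ^+ 2) -> bintg (fun x => h x ^+ 2) -> bintg (fun x => (f x - h x) ^+ 2).
  move=> m1 m2 j1 j2; apply: (bintg_le _ (bintg_add (bintg_scale 2 j1) (bintg_scale 2 j2))).
    by move=> j; apply: measurable_funX; apply: measurable_funB; [exact: m1|exact: m2].
  by move=> x _; rewrite ger0_norm ?sqr_ge0.
have jp n : bintg (fun x => phi n x ^+ 2) by apply: cont_bintg; exact: PC1_cont2 (pp n).
pose an n := bint (fun x => (phi n x - g x) ^+ 2).
pose bn n := Hnorm Om 1 (fun x => phi n x - w x).
have K n e : 0 < e -> bint (fun x => g x ^+ 2) <= (1 + e) * bint (fun x => w x ^+ 2) +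
    (1 + e^-1) * (2 * (C * bn n ^+ 2) + 2 * an n).
  move=> e0; have pd := PC1_sub (pp n) pw.
  have Hb : bint (fun x => (phi n x - w x) ^+ 2) <= C * bn n ^+ 2.
    by rewrite /bn Hnorm1_sq; [exact: HC pd|exact: PC1_sobolev pd].
  have j1 : bintg (fun x => (phi n x - w x) ^+ 2) by exact: jD.
  have j2 : bintg (fun x => (phi n x - g x) ^+ 2) by exact: jD.
  have e1 : 0 < e^-1 by nn.
  apply: (@le_trans _ _ (bint (fun x => (1 + e) * w x ^+ 2 + (1 + e^-1) * (2 * (phi n x - w x) ^+ 2 + 2 * (phi n x - g x) ^+ 2)))).
    apply: bint_le => //.
      apply: bintg_add; first exact: bintg_scale.
      by apply: bintg_scale; apply: bintg_add; exact: bintg_scale.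
    move=> x _; have h := sq (phi n x - w x) (phi n x - g x).
    rewrite (_ : phi n x - w x - (phi n x - g x) = g x - w x) in h; last by ring.
    apply: le_trans (lerD (lexx _) (ler_wpM2l (addr_ge0 ler01 (ltW e1)) h)).
    have := sqr_ge0 (e * w x - (g x - w x)).
    have ee : e * e^-1 = 1 by rewrite mulfV// gt_eqF.
    move=> h2; have := mulr_ge0 (ltW e1) h2.
    rewrite (_ : e^-1 * (e * w x - (g x - w x)) ^+ 2 = (e * e^-1) * (e * w x ^+ 2) - 2 * (e * e^-1) * w x * (g x - w x) + e^-1 * (g x - w x) ^+ 2); last by ring.
    rewrite ee; nra.
  rewrite bint_add; [|exact: bintg_scale|by apply: bintg_scale; apply: bintg_add; exact: bintg_scale].
  rewrite !bint_scale//; [|by apply: bintg_add; exact: bintg_scale].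
  rewrite bint_add; [|exact: bintg_scale|exact: bintg_scale].
  rewrite !bint_scale// lerD2l ler_pM2l ?addr_gt0// lerD2r ler_pM2l//.
have lim e : 0 < e -> bint (fun x => g x ^+ 2) <= (1 + e) * bint (fun x => w x ^+ 2).
  move=> e0; have cv : (fun n => (1 + e) * bint (fun x => w x ^+ 2) + (1 + e^-1) * (2 * (C * bn n ^+ 2) + 2 * an n)) @ \oo -->
     ((1 + e) * bint (fun x => w x ^+ 2) + (1 + e^-1) * (2 * (C * (0 * 0)) + 2 * 0)).
    apply: cvgD; first exact: cvg_cst.
    apply: cvgM; first exact: cvg_cst.
    apply: cvgD; apply: cvgM; try exact: cvg_cst; last exact: bphi.
    by apply: cvgM; [exact: cvg_cst|apply: cvgM; exact: Hphi].
  rewrite !mulr0 addr0 mulr0 addr0 in cv.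
  apply: (@limr_ge_near _ _ _ _ _ (cvgP _ cv)) || idtac.
  have -> := esym (cvg_lim (@Rhausdorff R) cv).
  apply: limr_ge; first exact: cvgP cv.
  by apply: nearW => n; exact: K.
apply/ler_addgt0Pr => e e0.
have b0 : 0 <= bint (fun x => w x ^+ 2) by apply: bint_ge0 => x _; exact: sqr_ge0.
have := lim (e / (bint (fun x => w x ^+ 2) + 1)) (divr_gt0 e0 (ltr_wpDl b0 ltr01)).
move/le_trans; apply; rewrite mulrDl mul1r lerD2l mulrAC ler_pdivrMr ?ltr_wpDl//.
by rewrite ler_pM2l// lerDl.
Qed.

(** An upper bound is all that Friedrichs's inequality and N2 require, and the default value 0 of
    [trace] satisfies it as well: the existence of a trace need not be shown. *)
Lemma trace_le w w1 w2 : PC1 w w1 w2 ->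
  bint (fun x => Defs.trace Om w x ^+ 2) <= bint (fun x => w x ^+ 2).
Proof.
move=> pw; rewrite /Defs.trace; case: xgetP => [g _ tg|_]; first exact: is_trace_le pw tg.
have j2 : bintg (fun x => w x ^+ 2) by apply: cont_bintg; exact: PC1_cont2 pw.
apply: bint_le => // [|x _]; last by rewrite expr0n sqr_ge0.
by apply: cont_bintg; apply: continuous_subspaceT => x; exact: cvg_cst.
Qed.

Lemma H1_parallelogram (c : R) u v : sobolev Om 1 u -> sobolev Om 1 v -> c ^+ 2 = 1 ->
  sqn (fun x => u x + c * v x) + gsq (fun x => u x + c * v x) <= 2 * (sqn u + gsq u) + 2 * (sqn v + gsq v).
Proof.
move=> su sv c2; have [lu _ _] := sobolev1_lsq su; have [lv _ _] := sobolev1_lsq sv.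
have := sqn_ge0 Om (fun x => u x + - c * v x); have := gsq_ge0 Om (fun x => u x + - c * v x).
rewrite !sqnD// !gsq_lin// sqrrN c2.
by move: (sqn u) (sqn v) (gsq u) (gsq v) (I _) (grad_inner Om u v) => a b d e i j h1 h2; lra.
Qed.

End poincare_trace.

(** * Elements, piecewise affine functions and the geometry of edges *)

Section finite_elements.
Variables (R : realType) (Om : smooth_domain R) (Th : triangulation Om).
Notation AR := (area_measure R).
Notation cl := (clos Om).
Notation I := (@I R Om).
Notation bm := (@bm R Om).
Notation PC1 := (@PC1 R Om).
Notation sqn := (@sqn R Om).
Notation gsq := (@gsq R Om).
Notation bdry := (@bdry R Om).
Notation K i := (@element R Om Th i).
Notation vel j := (velocity (@curve _ Om j)).
Implicit Types (i j : 'I_(nelem Th)) (k l : 'I_3) (u v : R * R -> R) (x y z p : R * R).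

Lemma continuous_bary k : continuous (@bary R k).
Proof.
elim/ord3P: k; rewrite /bary/=; move=> x.
- by apply: cvgB; [apply: cvgB; [exact: cvg_cst|exact: cvg_fst]|exact: cvg_snd].
- exact: cvg_fst.
- exact: cvg_snd.
Qed.

Lemma compact_ref : compact (@ref_triangle R).
Proof.
apply: (@subclosed_compact _ _ (`[0 : R, 1]%classic `*` `[0 : R, 1]%classic)).
- have -> : @ref_triangle R = \bigcap_(k in [set: 'I_3]) (bary k @^-1` [set r : R | 0 <= r]).
    by apply/seteqP; split => x /= H k; [move=> _; exact: H|exact: (H k Logic.I)].
  apply: closed_bigI => k _; have /continuous_closedP := @continuous_bary k; apply; exact: closed_ge.
- by apply: compact_setX; exact: segment_compact.
- move=> x H; have := H o3_0; have := H o3_1; have := H o3_2.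
  by rewrite /bary/= => h2 h1 h0; split; rewrite /= in_itv/=; itvlra.
Qed.

Lemma compact_element i : compact (K i).
Proof. by apply: continuous_compact; [exact: emap_continuous|exact: compact_ref]. Qed.

Lemma closed_element i : closed (K i).
Proof. by apply: compact_closed; [exact: (@norm_hausdorff R (R * R)%type)|exact: compact_element]. Qed.

Lemma element_cl i x : K i x -> cl x.
Proof. by move=> Kx; rewrite (emap_cover Th); exists i. Qed.

Lemma cl_element x : cl x -> exists i, K i x.
Proof. by rewrite (emap_cover Th) => -[i _ Kx]; exists i. Qed.

Lemma measurable_closed2 (A : set (R * R)) : closed A -> (default_measure_display, default_measure_display).-prod.-measurable (A : set (measurableTypeR R * measurableTypeR R)).
Proof.
move=> /closed_openC oA; rewrite -(setCK A); apply: measurableC; exact: open_measurable2.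
Qed.

(** Elements overlap along edges; giving each point to the element of lowest index makes a
    measurable partition of the closure, on which piecewise constants are well defined. *)
Definition first_in i : set (R * R) := K i `\` \bigcup_(j in [set j : 'I_(nelem Th) | (j < i)%N]) K j.

Lemma measurable_first_in i : measurable (first_in i).
Proof.
apply: measurableD; first by apply: measurable_closed2; exact: closed_element.
apply: fin_bigcup_measurable; first exact: finite_finset.
by move=> j _; apply: measurable_closed2; exact: closed_element.
Qed.

Lemma first_in_cover x : cl x -> exists i, first_in i x.
Proof.
move=> clx; have ex : exists n : nat, `[< exists i, (i : nat) = n /\ K i x >].
  by have [i Ki] := cl_element clx; exists i; apply/asboolP; exists i.
have := ex_minnP ex; case=> n /asboolP[i [<- Ki]] H; exists i; split => // -[j /= ji Kj].
have := H j; rewrite leqNgt ji => /(_ _)/negP; apply => //.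
by apply/asboolP; exists j.
Qed.

Lemma first_in_inj i j x : first_in i x -> first_in j x -> i = j.
Proof.
move=> [Ki ni] [Kj nj]; apply/val_inj/eqP; rewrite eqn_leq; apply/andP; split.
  by rewrite leqNgt; apply/negP => h; apply: ni; exists j.
by rewrite leqNgt; apply/negP => h; apply: nj; exists i.
Qed.

Definition pw (b : 'I_(nelem Th) -> R) x : R := \sum_i b i * \1_(first_in i) x.

Lemma pwE b i x : first_in i x -> pw b x = b i.
Proof.
move=> fx; rewrite /pw (bigD1 i)//= indicE mem_set// mulr1 big1 ?addr0// => j ji.
rewrite indicE memNset ?mulr0// => fj; move: ji; by rewrite (first_in_inj fx fj) eqxx.
Qed.

Lemma measurable_pw b : measurable_fun (Om : set (R * R)) (pw b).
Proof.
apply: measurable_funTS; apply: measurable_sum => i.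
apply: measurable_funM; first exact: measurable_cst.
exact: (measurable_indic (measurable_first_in i)).
Qed.

Definition affine_on v (a b c : 'I_(nelem Th) -> R) : Prop :=
  forall i x, K i x -> v x = a i + b i * x.1 + c i * x.2.

Lemma Vh_affine v : Vh Th v -> exists a b c, affine_on v a b c.
Proof.
move=> [_ H]; have [a Ha] := choice H; have [b Hb] := choice Ha; have [c Hc] := choice Hb.
by exists a, b, c.
Qed.

Lemma near_elements x : \forall y \near x, forall i, K i y -> K i x.
Proof.
suff H : forall i, \forall y \near x, K i y -> K i x.
  have : \forall y \near x, forall i, i \in enum 'I_(nelem Th) -> K i y -> K i x.
    elim: (enum _) => [|i s IH]; first by apply: filterE => y k; rewrite in_nil.
    apply: filterS2 (H i) IH => y h1 h2 j; rewrite inE => /orP[/eqP -> //|]; exact: h2.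
  by apply: filterS => y h i; apply: h; rewrite mem_enum.
move=> i; have [Kx|nKx] := pselect (K i x); first by apply: filterE => y _.
have : nbhs x (~` K i) by apply: open_nbhs_nbhs; split => //; apply: closed_openC; exact: closed_element.
by apply: filterS => y /= nKy /nKy.
Qed.

Lemma bounded_coef (b : 'I_(nelem Th) -> R) : exists M : R, forall i, `|b i| <= M.
Proof.
exists (\sum_i `|b i|) => i; rewrite (bigD1 i)//= lerDl sumr_ge0// => j _; exact: normr_ge0.
Qed.

(** Any measurable choice among the gradients of the elements containing a point will do. This needs
    nothing about the shape of the edges: off the lines of [Z] all elements at x share one gradient,
    and nearby points belong only to elements that contain x. *)
Lemma Vh_PC1_rep v a b c g1 g2 : Vh Th v -> affine_on v a b c ->
  measurable_fun (Om : set (R * R)) g1 -> measurable_fun (Om : set (R * R)) g2 ->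
  (forall x, cl x -> exists i, [/\ K i x, g1 x = b i & g2 x = c i]) -> PC1 v g1 g2.
Proof.
move=> [cv _] av m1 m2 H.
have [M1 HM1] := bounded_coef b; have [M2 HM2] := bounded_coef c.
split => //.
- by split => //; exists M1 => x /dom_cl/H[i [_ -> _]].
- by split => //; exists M2 => x /dom_cl/H[i [_ _ ->]].
(* The lines on which two affine expressions with different gradients agree; a point common to two
   such elements lies on one of them, as v has a single value there. *)
pose Z := [seq ((b (ij : 'I_(nelem Th) * 'I_(nelem Th)).1 - b ij.2, c ij.1 - c ij.2), a ij.2 - a ij.1) | ij <- enum {: 'I_(nelem Th) * 'I_(nelem Th)} &
  ((b ij.1 - b ij.2, c ij.1 - c ij.2) != (0, 0))].
exists Z; split; first by move=> l /mapP[ij]; rewrite mem_filter => /andP[h _] ->.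
move=> x Ox oZ.
have same i j : K i x -> K j x -> b i = b j /\ c i = c j.
  move=> Ki Kj; have E := av i x Ki; rewrite (av j x Kj) in E.
  have [bc|bc] := eqVneq (b i - b j, c i - c j) (0, 0).
    by case: bc => /eqP; rewrite subr_eq0 => /eqP -> /eqP; rewrite subr_eq0 => /eqP ->.
  have := oZ ((b i - b j, c i - c j), a j - a i) => /(_ _)/eqP; case.
    by apply/mapP; exists (i, j) => //; rewrite mem_filter bc/= mem_enum.
  rewrite /=; have := E; lra.
have [i0 [K0 g10 g20]] := H x (dom_cl Ox).
have near1 : \forall y \near x, [/\ cl y, g1 y = b i0, g2 y = c i0 & v y = a i0 + b i0 * y.1 + c i0 * y.2].
  have nO : nbhs x (Om : set (R * R)) by apply: open_nbhs_nbhs; split => //; exact: dom_open.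
  apply: filterS2 nO (near_elements x) => y Oy yK.
  have cly := dom_cl Oy; have [i [Kiy e1 e2]] := H y cly.
  have Kix := yK i Kiy; have [h1 h2] := same i i0 Kix K0.
  have ai : a i = a i0.
    by have := av i x Kix; rewrite (av i0 x K0) h1 h2 => /addIr/addIr.
  by rewrite e1 e2 (av i y Kiy) h1 h2 ai.
have x1 := nbhs_singleton near1.
split.
- move=> d; have [_ -> -> _] := x1.
  pose l (s : R) := a i0 + b i0 * (x.1 + s * d.1) + c i0 * (x.2 + s * d.2).
  have dl : is_derive (0 : R) 1 l (b i0 * d.1 + c i0 * d.2).
    by apply: is_derive_eq; rewrite /GRing.scale/=; ring.
  apply: (near_eq_is_derive _ dl).
  have cs : {for (0 : R), continuous (fun s : R => (x.1 + s * d.1, x.2 + s * d.2))}.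
    by apply: continuous_pairR => s; apply: cvgD; [exact: cvg_cst|apply: cvgM; [exact: cvg_id|exact: cvg_cst]|exact: cvg_cst|apply: cvgM; [exact: cvg_id|exact: cvg_cst]].
  have : \forall s \near (0 : R), v (x.1 + s * d.1, x.2 + s * d.2) = l s.
    apply: (cs (fun y => v y = a i0 + b i0 * y.1 + c i0 * y.2)).
    rewrite /= !mul0r !addr0 -surjective_pairing.
    by apply: filterS near1 => y [].
  by apply: filterS => s ->.
- rewrite /prop_for /continuous_at; have [_ -> _ _] := x1.
  by apply: cvg_near_cst; apply: filterS near1 => y [].
- rewrite /prop_for /continuous_at; have [_ _ -> _] := x1.
  by apply: cvg_near_cst; apply: filterS near1 => y [].
Qed.

Lemma Vh_PC1 v a b c : Vh Th v -> affine_on v a b c -> PC1 v (pw b) (pw c).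
Proof.
move=> Vv av; apply: (Vh_PC1_rep Vv av); [exact: measurable_pw|exact: measurable_pw|].
by move=> x /first_in_cover[i fi]; exists i; rewrite !(pwE _ fi); case: fi.
Qed.

Lemma Vh_PC1_ex v : Vh Th v -> exists g1 g2, PC1 v g1 g2.
Proof. by move=> Vv; have [a [b [c av]]] := Vh_affine Vv; exists (pw b), (pw c); exact: Vh_PC1 Vv av. Qed.

Lemma Vh_lin (c : R) u v : Vh Th u -> Vh Th v -> Vh Th (fun x => u x + c * v x).
Proof.
move=> [cu au] [cv av]; split.
  by move=> x; apply: cvgD; [exact: cu|apply: cvgM; [exact: cvg_cst|exact: cv]].
move=> i; have [a1 [b1 [c1 h1]]] := au i; have [a2 [b2 [c2 h2]]] := av i.
exists (a1 + c * a2), (b1 + c * b2), (c1 + c * c2) => x Kx.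
by rewrite h1// h2//; ring.
Qed.

Lemma Vh_cst (c : R) : Vh Th (fun=> c).
Proof.
split; first by move=> x; exact: cvg_cst.
by move=> i; exists c, 0, 0 => x _; rewrite !mul0r !addr0.
Qed.

(** The boundary has no slits: at a boundary point the outward normal leaves the closure at once, by
    [curve_outward]. *)
Lemma interior_cl_dom x (e : R) : 0 < e -> (forall y, `|y.1 - x.1| < e -> `|y.2 - x.2| < e -> cl y) -> dom Om x.
Proof.
move=> e0 H; apply: contrapT => nO.
have clx : cl x by apply: H; rewrite subrr normr0.
have /bdryP[j [s xE]] : bdry x by [].
have O := curve_outward j s.
have O' : \forall d \near (0 : R)^'+, ~ cl ((curve j s).1 + d * (unit_normal (curve j) s).1, (curve j s).2 + d * (unit_normal (curve j) s).2).
  by apply: filterS O => d [].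
near (0 : R)^'+ => d.
have : ~ cl ((curve j s).1 + d * (unit_normal (curve j) s).1, (curve j s).2 + d * (unit_normal (curve j) s).2).
  by near: d.
have [n1 _ _ _] := unit_normalE j s; have [h1 h2] := unit_le1 n1.
have d0 : 0 < d by [].
have de : d < e by near: d; apply: nbhs_right_lt.
apply; apply: H; rewrite /= xE addrAC subrr add0r normrM gtr0_norm//; apply: le_lt_trans de;
  by rewrite ger_pMr.
Unshelve. all: by end_near. Qed.

Lemma ball_element_dom i p (rho : R) : 0 < rho -> [set x | enorm (x - p) <= rho] `<=` K i ->
  forall x, `|x.1 - p.1| <= rho / 2 -> `|x.2 - p.2| <= rho / 2 -> dom Om x /\ K i x.
Proof.
move=> r0 sub x h1 h2.
(* The square of half-side 2/3 rho lies in the disc because 2 (2/3)^2 < 1; it leaves the margin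
   rho/6 around the square of half-side rho/2. *)
have sq (y : R * R) : `|y.1 - p.1| <= 2 / 3 * rho -> `|y.2 - p.2| <= 2 / 3 * rho -> K i y.
  move=> g1 g2; apply: sub => /=; rewrite /enorm -[leRHS]ger0_norm ?(ltW r0)// -sqrtr_sqr ler_wsqrtr//=.
  have q1 : (y.1 - p.1) ^+ 2 <= (2 / 3 * rho) ^+ 2 by rewrite -normr2// lerXn2r ?nnegrE// mulr_ge0// ltW.
  have q2 : (y.2 - p.2) ^+ 2 <= (2 / 3 * rho) ^+ 2 by rewrite -normr2// lerXn2r ?nnegrE// mulr_ge0// ltW.
  have := sqr_ge0 rho; nra.
split; last by apply: sq; lra.
apply: (@interior_cl_dom x (rho / 6)); first by rewrite divr_gt0.
move=> y g1 g2; apply: (@element_cl i); apply: sq.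
  by have := ler_normD (y.1 - x.1) (x.1 - p.1); rewrite subrKA; lra.
by have := ler_normD (y.2 - x.2) (x.2 - p.2); rewrite subrKA; lra.
Qed.

Lemma square_bound f p (r m : R) : 0 < r -> bm f -> (forall x, dom Om x -> 0 <= f x) ->
  (forall x, `|x.1 - p.1| <= r -> `|x.2 - p.2| <= r -> dom Om x /\ m <= f x) ->
  m * (4 * r ^+ 2) <= I f.
Proof.
move=> r0 bf f0 H.
pose Q : set (R * R) := `[p.1 - r, p.1 + r]%classic `*` `[p.2 - r, p.2 + r]%classic.
have mQ : measurable Q by apply: measurableX.
have QE x : Q x <-> `|x.1 - p.1| <= r /\ `|x.2 - p.2| <= r.
  by rewrite /Q /= !in_itv/= -!ler_distl.
have bQ : bm (\1_Q : R * R -> R).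
  split; first by apply: measurable_funTS; exact: (measurable_indic mQ).
  by exists 1 => x _; rewrite indicE; case: (x \in Q); rewrite ?normr1 ?normr0.
have AQ : I (\1_Q : R * R -> R) = 4 * r ^+ 2.
  rewrite /I /Rintegral.
  have E := @integral_indic _ _ _ AR (Om : set (R * R)) (measurable_dom Om) Q mQ.
  rewrite [X in fine X]E (_ : Q `&` _ = Q); last first.
    by apply/seteqP; split => x; [case|move=> Qx; split => //; have /QE[h1 h2] := Qx; have [] := H x h1 h2].
  rewrite (_ : AR Q = ((p.1 + r - (p.1 - r)) * (p.2 + r - (p.2 - r)))%:E); last by apply: area_rect; lra.
  by rewrite /=; ring.
rewrite -AQ -I_scale//; apply: I_le => //.
  by apply: bm_mul => //; exact: bm_cst.
move=> x Ox; rewrite indicE; have [xQ|xQ] := boolP (x \in Q); last by rewrite mulr0 f0.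
by rewrite mulr1; move: xQ; rewrite inE => /QE[h1 h2]; have [] := H x h1 h2.
Qed.

(** The gradient is constant on a square of side rho inside the element. *)
Lemma gradient_bound i p (rho : R) v a b c : 0 < rho -> [set x | enorm (x - p) <= rho] `<=` K i ->
  Vh Th v -> affine_on v a b c -> rho ^+ 2 * (b i ^+ 2 + c i ^+ 2) <= gsq v.
Proof.
move=> r0 sub Vv av.
(* A representative of the gradient that takes the value of element i on all of it, even at points
   that [first_in] gives to another element. *)
pose G (b : 'I_(nelem Th) -> R) x := if `[< K i x >] then b i else pw b x.
have mG b' : measurable_fun (Om : set (R * R)) (G b').
  have -> : G b' = fun x => b' i * \1_(K i) x + (1 - \1_(K i) x) * pw b' x.
    apply/funext => x; rewrite /G indicE; case: asboolP => Kx; first by rewrite mem_set// mulr1 subrr mul0r addr0.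
    by rewrite memNset// mulr0 add0r subr0 mul1r.
  have m1 : measurable_fun (Om : set (R * R)) (\1_(K i) : R * R -> R).
    by apply: measurable_funTS; apply: measurable_indic; apply: measurable_closed2; exact: closed_element.
  apply: measurable_funD; apply: measurable_funM => //; [exact: measurable_funB|exact: measurable_pw].
have pv : PC1 v (G b) (G c).
  apply: (Vh_PC1_rep Vv av) => //.
  move=> x clx; rewrite /G; case: asboolP => Kx; first by exists i.
  by have [j fj] := first_in_cover clx; exists j; rewrite !(pwE _ fj); case: fj.
rewrite (PC1_gsq pv).
have r2 : 0 < rho / 2 by rewrite divr_gt0.
have -> : rho ^+ 2 * (b i ^+ 2 + c i ^+ 2) = (b i ^+ 2 + c i ^+ 2) * (4 * (rho / 2) ^+ 2) by field.
apply: (@square_bound _ p) => //.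
- by apply: bm_add; apply: bm_exp; [exact: pc_bm1 pv|exact: pc_bm2 pv].
- by move=> x _; rewrite addr_ge0// sqr_ge0.
move=> x h1 h2; have [Ox Kx] := ball_element_dom r0 sub h1 h2; split => //.
by rewrite /G; case: asboolP.
Qed.

Lemma value_bound i p (rho e : R) v : 0 < rho -> [set x | enorm (x - p) <= rho] `<=` K i ->
  Vh Th v -> 0 < e -> exists2 x, K i x & rho ^+ 2 * v x ^+ 2 <= sqn v + e.
Proof.
move=> r0 sub Vv e0.
have r2 : 0 < rho / 2 by rewrite divr_gt0.
apply: contrapT => nex.
have H x : K i x -> (sqn v + e) / rho ^+ 2 <= v x ^+ 2.
  move=> Kx; rewrite leNgt; apply/negP => h; apply: nex; exists x => //.
  by rewrite mulrC -ler_pdivlMr ?exprn_gt0// ltW.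
have [g1 [g2 pg]] := Vh_PC1_ex Vv.
have Hq x : `|x.1 - p.1| <= rho / 2 -> `|x.2 - p.2| <= rho / 2 -> dom Om x /\ (sqn v + e) / rho ^+ 2 <= v x ^+ 2.
  by move=> h1 h2; have [Ox Kx] := ball_element_dom r0 sub h1 h2; split => //; exact: H.
have := square_bound r2 (bm_exp 2 (cont_cl_bm (pc_cont pg))) (fun x _ => sqr_ge0 (v x)) Hq.
have -> : (sqn v + e) / rho ^+ 2 * (4 * (rho / 2) ^+ 2) = sqn v + e by field; rewrite gt_eqF.
change (sqn v + e <= sqn v -> False); move=> h; clear -h e0; gen_integrals; lra.
Qed.

Definition vpt k : R * R := nth (0, 0) [:: (0, 0); (1, 0); (0, 1)] k.

Definition vert i k : R * R := emap i (vpt k).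

Definition edge i k : set (R * R) := emap i @` @ref_edge R k.

Lemma bary0 x : bary o3_0 x = 1 - x.1 - x.2. Proof. by []. Qed.
Lemma bary1 x : bary o3_1 x = x.1. Proof. by []. Qed.
Lemma bary2 x : bary o3_2 x = x.2. Proof. by []. Qed.

Lemma refE x : @ref_triangle R x <-> [/\ 0 <= x.1, 0 <= x.2 & x.1 + x.2 <= 1].
Proof.
split.
  move=> H; have := H o3_0; have := H o3_1; have := H o3_2.
  by rewrite bary0 bary1 bary2 => h2 h1 h0; split => //; lra.
by move=> [h1 h2 h3]; apply: ord3P; rewrite ?bary0 ?bary1 ?bary2 //; lra.
Qed.

Lemma ref_vpt k : @ref_triangle R (vpt k).
Proof. by apply/refE; elim/ord3P: k; rewrite /vpt/=; split; rewrite ?addr0 ?add0r. Qed.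

Lemma ref_vertexE k x : @ref_vertex R k x <-> x = vpt k.
Proof.
split; last first.
  by move=> ->; split; [exact: ref_vpt|]; elim/ord3P: k; rewrite ?bary0 ?bary1 ?bary2 /vpt/= ?subr0.
case=> /refE[h1 h2 h3]; case: x h1 h2 h3 => a b /= h1 h2 h3.
by elim/ord3P: k; rewrite ?bary0 ?bary1 ?bary2 /vpt/= => h; congr pair; lra.
Qed.

Definition edge_pt k (r : R) : R * R := nth (0, 0) [:: (1 - r, r); (0, r); (r, 0)] k.

Lemma ref_edgeE k x : @ref_edge R k x <-> exists2 r : R, 0 <= r <= 1 & x = edge_pt k r.
Proof.
split.
  case=> /refE[h1 h2 h3]; case: x h1 h2 h3 => a b /= h1 h2 h3.
  elim/ord3P: k; rewrite ?bary0 ?bary1 ?bary2 /edge_pt/= => h.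
  - by exists b; [itvlra|congr pair; lra].
  - by exists b; [itvlra|congr pair; lra].
  - by exists a; [itvlra|congr pair; lra].
move=> [r /andP[r0 r1] ->]; split.
  by apply/refE; elim/ord3P: k; rewrite /edge_pt/=; split; lra.
by elim/ord3P: k; rewrite ?bary0 ?bary1 ?bary2 /edge_pt/=; lra.
Qed.

Lemma edge_pt_inj k (r s : R) : edge_pt k r = edge_pt k s -> r = s.
Proof. by elim/ord3P: k; rewrite /edge_pt/= => -[]. Qed.

Lemma edge_pt01 k : exists k1 k2, edge_pt k 0 = vpt k1 /\ edge_pt k 1 = vpt k2.
Proof.
elim/ord3P: k; rewrite /edge_pt/vpt/=.
- by exists o3_1, o3_2; rewrite /= subr0 subrr.
- by exists o3_0, o3_2.
- by exists o3_0, o3_1.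
Qed.

Lemma ref_edge_pt k (r : R) : 0 <= r <= 1 -> @ref_triangle R (edge_pt k r).
Proof. by move=> r01; have /ref_edgeE[] : exists2 r' : R, 0 <= r' <= 1 & edge_pt k r = edge_pt k r' by exists r. Qed.

Lemma edgeE i k x : edge i k x <-> exists2 r : R, 0 <= r <= 1 & x = emap i (edge_pt k r).
Proof.
split; first by move=> [y /ref_edgeE[r r01 ->] <-]; exists r.
by move=> [r r01 ->]; exists (edge_pt k r) => //; apply/ref_edgeE; exists r.
Qed.

Lemma edge_element i k x : edge i k x -> K i x.
Proof. by move=> [y [ry _] <-]; exists y. Qed.

Lemma vert_element i k : K i (vert i k).
Proof. by exists (vpt k) => //; exact: ref_vpt. Qed.

Lemma vert_edge i k : exists l, edge i l (vert i k).
Proof.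
exists (nth k [:: o3_1; o3_0; o3_0] k); exists (vpt k) => //.
split; first exact: ref_vpt.
by elim/ord3P: k; rewrite /= /bary/vpt/=; rewrite ?subr0 ?subrr ?oppr0.
Qed.

Lemma within_comp_path (A : set (R * R)) (f : R * R -> R * R) (phi : R -> R * R) (B : set R) :
  {within A, continuous f} -> continuous phi -> (forall s, B s -> A (phi s)) ->
  {within B, continuous (f \o phi)}.
Proof.
move=> cf cphi BA; apply/subspace_continuousP => s Bs.
have := (subspace_continuousP _ _).1 cf (phi s) (BA s Bs).
apply: cvg_trans => U /= nU.
have nU' : nbhs (phi s) [set y | A y -> U (f y)] := nU.
have nB : nbhs s [set r | A (phi r) -> U (f (phi r))] := cphi s _ nU'.
by apply: filterS nB => r /= Hr Br; apply: Hr; exact: BA.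
Qed.

Lemma continuous_edge_pt k : continuous (edge_pt k).
Proof.
elim/ord3P: k; rewrite /edge_pt/=; apply: continuous_pairR => r;
  by [exact: cvg_cst|exact: cvg_id|apply: cvgB; [exact: cvg_cst|exact: cvg_id]].
Qed.

Definition segp x y (s : R) : R * R := (x.1 + s * (y.1 - x.1), x.2 + s * (y.2 - x.2)).

Lemma continuous_segp x y : continuous (segp x y).
Proof.
apply: continuous_pairR => s; (apply: cvgD; [exact: cvg_cst|apply: cvgM; [exact: cvg_id|exact: cvg_cst]]).
Qed.

Lemma continuous_dot (n : R * R) : continuous (dot n).
Proof.
move=> x; apply: cvgD; apply: cvgM; [exact: cvg_cst|exact: cvg_fst|exact: cvg_cst|exact: cvg_snd].
Qed.

Lemma within_dot (B : set R) (f : R -> R * R) (n : R * R) :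
  {within B, continuous f} -> {within B, continuous (fun s => dot n (f s))}.
Proof. by move=> cf s; apply: cvg_comp; [exact: cf|exact: continuous_dot]. Qed.

Lemma within_sub (A B : set R) (f : R -> R) : A `<=` B -> {within B, continuous f} -> {within A, continuous f}.
Proof. exact: continuous_subspaceW. Qed.

(* An injective path cannot pass through the value [c] of an extremity of its
   range in the middle, since it would take nearby values on both sides. *)
Lemma range_end (f : R -> R) (r c : R) (sg : bool) : {within `[0, 1], continuous f} ->
  (forall s t, 0 <= s <= 1 -> 0 <= t <= 1 -> f s = f t -> s = t) ->
  0 <= r <= 1 -> (forall s, 0 <= s <= 1 -> 0 <= (-1) ^+ sg * (f s - f r)) -> r = 0 \/ r = 1.
Proof.
move=> cf inj /andP[r0 r1] H.
pose h s := (-1) ^+ sg * (f s - f r).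
have ch : {within `[0, 1], continuous h}.
  by move=> s; apply: cvgM; [exact: cvg_cst|apply: cvgB; [exact: cf|exact: cvg_cst]].
have hinj s t : 0 <= s <= 1 -> 0 <= t <= 1 -> h s = h t -> s = t.
  move=> s01 t01 /(congr1 (fun q => (-1) ^+ sg * q)); rewrite /h !mulrA -!expr2 !sqrr_sign !mul1r => /addIr.
  exact: inj.
have hr : h r = 0 by rewrite /h subrr mulr0.
have [->|rn0] := eqVneq r 0; first by left.
have [->|rn1] := eqVneq r 1; first by right.
have z01 : 0 <= (0 : R) <= 1 by rewrite lexx ler01.
have o01 : 0 <= (1 : R) <= 1 by rewrite lexx ler01.
have r01 : 0 <= r <= 1 by rewrite r0.
have h0 : 0 < h 0.
  by rewrite lt_neqAle (H 0 z01) andbT eq_sym; apply: contraNneq rn0 => e; rewrite -(hinj _ _ z01 r01) ?hr.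
have h1 : 0 < h 1.
  by rewrite lt_neqAle (H 1 o01) andbT eq_sym; apply: contraNneq rn1 => e; rewrite -(hinj _ _ o01 r01) ?hr.
pose m := Num.min (h 0) (h 1) / 2.
have m0 : 0 < m by rewrite divr_gt0// lt_min h0.
have mh0 : m <= h 0 by rewrite ler_pdivrMr//; apply: (@le_trans _ _ (h 0)); [rewrite ge_min lexx|lra].
have mh1 : m <= h 1 by rewrite ler_pdivrMr//; apply: (@le_trans _ _ (h 1)); [rewrite ge_min lexx orbT|lra].
have s1 : `[0, r]%classic `<=` `[0, 1]%classic by apply: subset_itvl; rewrite bnd_simp.
have s2 : `[r, 1]%classic `<=` `[0, 1]%classic by apply: subset_itvr; rewrite bnd_simp.
have [|a a1 ha] := @IVT R h 0 r m r0 (within_sub s1 ch).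
  by rewrite hr ge_min le_max mh0 (ltW m0) orbT.
have [|b b1 hb] := @IVT R h r 1 m r1 (within_sub s2 ch).
  by rewrite hr ge_min le_max mh1 (ltW m0) orbT.
move: a1 b1; rewrite !in_itv/= => /andP[a0 ar] /andP[rb b1].
have ab : a = b by apply: hinj; rewrite ?ha ?hb//; clear -a0 ar rb b1; itvlra.
have ra : a = r by apply/eqP; rewrite eq_le ar ab rb.
by move: m0; rewrite -ha ra hr ltxx.
Qed.

(** The component along b - a is injective on the edge and extremal at a and b. By [range_end] the
    parameters of these two points are 0 and 1, that is, vertices. *)
Lemma segment_ends i k a b : edge i k = [set x | exists s : R, 0 <= s <= 1 /\
    x = (a.1 + s * (b.1 - a.1), a.2 + s * (b.2 - a.2))] ->
  exists k1 k2, a = vert i k1 /\ b = vert i k2.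
Proof.
move=> E.
have [k1 [k2 [v1 v2]]] := edge_pt01 k.
have z01 : 0 <= (0 : R) <= 1 by rewrite lexx ler01.
have o01 : 0 <= (1 : R) <= 1 by rewrite lexx ler01.
have onE (r : R) : 0 <= r <= 1 -> exists s : R, 0 <= s <= 1 /\
    emap i (edge_pt k r) = (a.1 + s * (b.1 - a.1), a.2 + s * (b.2 - a.2)).
  by move=> r01; have : edge i k (emap i (edge_pt k r)) by [apply/edgeE; exists r]; rewrite E.
have [ra ra01 Ea] : exists2 r : R, 0 <= r <= 1 & a = emap i (edge_pt k r).
  by apply/edgeE; rewrite E /=; exists 0; rewrite !mul0r !addr0 -surjective_pairing.
have [rb rb01 Eb] : exists2 r : R, 0 <= r <= 1 & b = emap i (edge_pt k r).
  by apply/edgeE; rewrite E /=; exists 1; rewrite !mul1r !subrKC -surjective_pairing.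
have inj (s t : R) : 0 <= s <= 1 -> 0 <= t <= 1 -> emap i (edge_pt k s) = emap i (edge_pt k t) -> s = t.
  by move=> s01 t01 /emap_injective e; apply: (@edge_pt_inj k); apply: e; exact: ref_edge_pt.
pose d : R * R := (b.1 - a.1, b.2 - a.2).
have d0 : 0 < d.1 ^+ 2 + d.2 ^+ 2.
  rewrite lt_neqAle addr_ge0 ?sqr_ge0// andbT eq_sym paddr_eq0 ?sqr_ge0// !sqrf_eq0 !subr_eq0.
  apply/negP => /andP[/eqP e1 /eqP e2].
  have all_a (r : R) : 0 <= r <= 1 -> emap i (edge_pt k r) = a.
    by move=> /onE[s [_ ->]]; rewrite e1 e2 !subrr !mulr0 !addr0 -surjective_pairing.
  have := inj 0 1 z01 o01; rewrite !all_a// => /(_ erefl)/eqP.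
  by rewrite eq_sym oner_eq0.
pose f (r : R) := dot d (emap i (edge_pt k r)).
have cf : {within `[0, 1], continuous f}.
  apply: within_dot; apply: (within_comp_path (@emap_continuous _ _ Th i) (@continuous_edge_pt k)).
  by move=> s /=; rewrite in_itv/= => s01; exact: ref_edge_pt.
have fE (s : R) : dot d (a.1 + s * (b.1 - a.1), a.2 + s * (b.2 - a.2)) = dot d a + s * (d.1 ^+ 2 + d.2 ^+ 2).
  by rewrite /dot /d /=; ring.
have finj (s t : R) : 0 <= s <= 1 -> 0 <= t <= 1 -> f s = f t -> s = t.
  move=> s01 t01 e; apply: inj => //; move: e; rewrite /f.
  have [s' [_ ->]] := onE s s01; have [t' [_ ->]] := onE t t01.
  by rewrite !fE => /addrI/(mulIf (lt0r_neq0 d0)) ->.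
have hb : rb = 0 \/ rb = 1.
  apply: (@range_end f rb 0 true cf finj rb01) => s s01; rewrite expr1 mulN1r /f -Eb.
  have [s' [/andP[_ h] ->]] := onE s s01; rewrite fE opprB.
  have -> : dot d b = dot d a + 1 * (d.1 ^+ 2 + d.2 ^+ 2) by rewrite /dot /d /=; ring.
  by rewrite opprD addrACA subrr add0r -mulrBl; apply: mulr_ge0; [rewrite subr_ge0|exact: ltW].
have [ea|ea] : ra = 0 \/ ra = 1.
- apply: (@range_end f ra 0 false cf finj ra01) => s s01; rewrite expr0 mul1r /f -Ea.
  have [s' [/andP[h _] ->]] := onE s s01; rewrite fE addrAC subrr add0r; apply: mulr_ge0 => //; exact: ltW.
- have [eb|eb] := hb.
  + by exfalso; move: d0; rewrite /d Ea Eb ea eb !subrr expr0n/= addr0 ltxx.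
  + by exists k1, k2; rewrite Ea Eb ea eb v1 v2.
- have [eb|eb] := hb.
  + by exists k2, k1; rewrite Ea Eb ea eb v1 v2.
  + by exfalso; move: d0; rewrite /d Ea Eb ea eb !subrr expr0n/= addr0 ltxx.
Qed.

(** By conformity a point of the element off its edges belongs to no other element, and the others,
    being closed and finite in number, stay away from it. *)
Lemma element_nbhs i x : dom Om x -> K i x -> (forall k, ~ edge i k x) -> nbhs x (K i).
Proof.
move=> Ox Kx ne.
have only j : K j x -> j = i.
  move=> Kj; apply/eqP; apply/negP => /negP ji; rewrite eq_sym in ji.
  case: (emap_conforming ji) => [E|[k [l [E _]]]|[k [l [E _]]]].
  - have : (K i `&` K j) x by []. by rewrite /element E.
  - have : (K i `&` K j) x by []. rewrite /element E => -[y /ref_vertexE -> e].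
    have [m hm] := vert_edge i k; apply: (ne m); by rewrite -e.
  - have : (K i `&` K j) x by []. by rewrite /element E; exact: ne.
have nO : nbhs x (Om : set (R * R)) by apply: open_nbhs_nbhs; split => //; exact: dom_open.
apply: filterS2 nO (near_elements x) => y Oy Hy.
by have [j Kj] := @cl_element y (dom_cl Oy); rewrite -(only j (Hy j Kj)).
Qed.

(** An element can be left only through an edge or the boundary: the parameters whose points lie in
    the element form an open and closed subset of [0, 1]. *)
Lemma segp_element i x y : (forall s, 0 <= s <= 1 -> K i (segp x y s) ->
    dom Om (segp x y s) /\ forall k, ~ edge i k (segp x y s)) ->
  K i x -> K i y.
Proof.
move=> H Kx.
have -> : y = segp x y 1 by rewrite /segp !mul1r !subrKC -surjective_pairing.
have Kx0 : K i (segp x y 0) by rewrite /segp !mul0r !addr0 -surjective_pairing.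
have c := @segment_connected R 0 1.
have Ki s : 0 <= s <= 1 -> K i (segp x y s) -> nbhs (segp x y s) (K i).
  by move=> s01 h3; have [h1 h2] := H s s01 h3; exact: element_nbhs.
have cs := @continuous_segp x y.
have E : [set s : R | 0 <= s <= 1 /\ K i (segp x y s)] = `[0, 1]%classic.
  apply: c.
  - by exists 0; rewrite /= lexx ler01.
  - exists (segp x y @^-1` (K i)°); first by move/continuousP : cs; apply; exact: open_interior.
    apply/seteqP; split => s /=; rewrite in_itv/=; first by move=> [s01 Ks]; split => //; exact: Ki.
    by move=> [s01 /interior_subset].
  - exists (segp x y @^-1` (K i)); first by move/continuous_closedP : cs; apply; exact: closed_element.
    by apply/seteqP; split => s /=; rewrite in_itv/=.
have : `[0, 1]%classic (1 : R) by rewrite /= in_itv/= lexx ler01.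
by rewrite -E => -[].
Qed.

Lemma ref_convex x y (s : R) : @ref_triangle R x -> @ref_triangle R y -> 0 <= s <= 1 -> @ref_triangle R (segp x y s).
Proof.
move=> /refE[+ + +] /refE[+ + +] /andP[s0 s1]; case: x y => [b1 b2] [c1 c2] /= p1 p2 p3 q1 q2 q3.
by apply/refE; rewrite /segp/=; split; nra.
Qed.

(** Of the three vertex values one lies between the two others, and by the intermediate value
    theorem it is also taken on the opposite side. *)
Lemma no_injection (f : R * R -> R) :
  (forall x y, @ref_triangle R x -> @ref_triangle R y -> {within `[0, 1], continuous (fun s => f (segp x y s))}) ->
  (forall x y, @ref_triangle R x -> @ref_triangle R y -> f x = f y -> x = y) -> False.
Proof.
move=> cf inj.
have between (a b c : 'I_3) : f (vpt b) <= f (vpt a) <= f (vpt c) ->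
    (forall s : R, 0 <= s <= 1 -> segp (vpt b) (vpt c) s <> vpt a) -> False.
  move=> /andP[h1 h2] ne.
  have [|s] := @IVT R _ 0 1 (f (vpt a)) ler01 (cf _ _ (ref_vpt b) (ref_vpt c)).
    rewrite /segp !mul0r !addr0 !mul1r !subrKC -!surjective_pairing.
    by rewrite ge_min le_max h1 h2 orbT.
  rewrite in_itv/= => s01 e; apply: (ne s s01); apply: inj => //; last exact: ref_vpt.
  by apply: ref_convex => //; exact: ref_vpt.
have N (a b c : 'I_3) (s : R) : a != b -> a != c -> segp (vpt b) (vpt c) s <> vpt a.
  move: a b c; apply: ord3P; apply: ord3P; apply: ord3P => //= _ _; rewrite /segp/vpt/= => -[]; lra.
pose A := o3_0; pose B := o3_1; pose C := o3_2.
have [ab|ab] := leP (f (vpt A)) (f (vpt B)); have [bc|bc] := leP (f (vpt B)) (f (vpt C));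
 have [ac|ac] := leP (f (vpt A)) (f (vpt C)).
- by apply: (between B A C); [rewrite ab bc|move=> s _; exact: N].
- by apply: (between B A C); [rewrite ab bc|move=> s _; exact: N].
- by apply: (between C A B); [rewrite ac (ltW bc)|move=> s _; exact: N].
- by apply: (between A C B); [rewrite ab (ltW ac)|move=> s _; exact: N].
- by apply: (between A B C); [rewrite ac (ltW ab)|move=> s _; exact: N].
- by apply: (between C B A); [rewrite bc (ltW ac)|move=> s _; exact: N].
- by apply: (between B C A); [rewrite (ltW ab) (ltW bc)|move=> s _; exact: N].
- by apply: (between B C A); [rewrite (ltW ab) (ltW bc)|move=> s _; exact: N].
Qed.

Lemma tcoor_dot k : exists m : R * R, forall z, tcoor k z = dot m z.
Proof.
exists (nth (0, 0) [:: (0, 1); (1, 0); (-1, 1)] k) => z.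
by elim/ord3P: k; rewrite /tcoor/dot/=; ring.
Qed.

Lemma box_nbhs x (e : R) : 0 < e -> nbhs x [set z : R * R | `|z.1 - x.1| < e /\ `|z.2 - x.2| < e].
Proof.
move=> e0; have : nbhs x (ball x e) by exact: nbhsx_ballx.
by apply: filterS => z [] /=; rewrite /ball/= => h1 h2; rewrite distrC h1 distrC h2.
Qed.

Lemma inbox_nbhs k x (d e : R) : 0 < d -> 0 < e -> nbhs x (inbox k x d e).
Proof.
move=> d0 e0; have m0 : 0 < Num.min d e / 2 by rewrite divr_gt0// lt_min d0.
apply: filterS (box_nbhs x m0) => z /=.
have m1 : Num.min d e <= d by rewrite ge_min lexx.
have m2 : Num.min d e <= e by rewrite ge_min lexx orbT.
rewrite /inbox; elim/ord3P: k; rewrite /tcoor/scoor/= => -[h1 h2]; split; try lra.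
rewrite (_ : z.2 - z.1 - (x.2 - x.1) = (z.2 - x.2) - (z.1 - x.1)); last by ring.
by apply: le_lt_trans (ler_normB _ _) _; lra.
Qed.

Lemma bdry_chart x (kappa : R) : bdry x -> 0 < kappa ->
  exists k n dl ep sg G, [/\ halfbox Om k x dl ep sg G, n.1 ^+ 2 + n.2 ^+ 2 = 1, dot (dirv R k) n != 0 &
   forall y z, bdry y -> bdry z -> inbox k x dl ep y -> inbox k x dl ep z ->
     `|dot n y - dot n z| <= kappa * `|tcoor k y - tcoor k z|].
Proof.
move=> /bdryP[j [t0 xE]] k0.
have [t [t01 {t0 xE}->]] : exists t, 0 <= t < 1 /\ x = curve j t.
  have [m] := shift_window t0 0; rewrite add0r => h.
  by exists (t0 + m%:~R); rewrite curve_shiftz.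
have [k w] : exists k, tcoor k (vel j t) != 0.
  have := @curve_regular _ Om j t; case: (vel j t) => a b ab.
  have [b0|b0] := eqVneq b 0; last by exists o3_0.
  by exists o3_1 => /=; apply/eqP => a0; apply: ab; rewrite b0; congr pair.
have [dl [ep [sg [G [hb _ hf _]]]]] := chart t01 w k0.
have [n1 _ e0 E] := unit_normalE j t.
exists k, (unit_normal (curve j) t), dl, ep, sg, G; split => //.
have := E k; apply: contra_eq_neq => ->; rewrite mul0r eq_sym mulf_neq0//.
by have [->|->] := dsgn_cases R k; rewrite ?oppr_eq0 oner_eq0.
Qed.

Lemma tcoor_inj k (n : R * R) (kappa : R) y z : dot (dirv R k) n != 0 ->
  `|dot n y - dot n z| <= kappa * `|tcoor k y - tcoor k z| -> tcoor k y = tcoor k z -> y = z.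
Proof.
move=> dn H e; move: H; rewrite e subrr normr0 mulr0 normr_le0 subr_eq0 => /eqP.
have -> : y = lin k (scoor k y) (tcoor k y) by rewrite lin_coor.
rewrite -[z](lin_coor k z) e; move: (scoor k y) (scoor k z) (tcoor k z) => a b t E.
have : (a - b) * dot (dirv R k) n = 0.
  have <- : dot n (lin k a t) - dot n (lin k b t) = (a - b) * dot (dirv R k) n.
    by move: k {dn E e}; apply: ord3P; rewrite /lin/dot/dirv/=; ring.
  by rewrite E subrr.
by move/eqP; rewrite mulf_eq0 (negbTE dn) orbF subr_eq0 => /eqP ->.
Qed.

(** Otherwise the image of a small triangle near the preimage of x would lie in the boundary. There
    [tcoor k] is injective, so composing would give a continuous injection of a triangle into the
    line. *)
Lemma element_dom_near i x (U : set (R * R)) : K i x -> nbhs x U -> exists z, [/\ K i z, U z & dom Om z].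
Proof.
move=> Kx nU; have [Ox|nO] := pselect (dom Om x).
  by exists x; split => //; exact: nbhs_singleton nU.
have bx : bdry x by split => //; exact: element_cl Kx.
have [k [n [dl [ep [sg [G [hb n1 dn hf]]]]]]] := bdry_chart bx (@ltr01 R).
have nB := inbox_nbhs k x (hb_dl hb) (hb_ep hb).
apply: contrapT => nex.
move: Kx => [y ry yx].
have := (subspace_continuousP _ _).1 (@emap_continuous _ _ Th i) y ry.
move=> cy.
have nW : nbhs (emap i y) (U `&` inbox k x dl ep) by rewrite yx; apply: filterI.
have /nbhs_box[e e0 eW] : nbhs y [set z | @ref_triangle R z -> (U `&` inbox k x dl ep) (emap i z)] := cy _ nW.
pose h := Num.min e 1 / 2.
have h0 : 0 < h by rewrite divr_gt0// lt_min e0 ltr01.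
have h1 : h <= 1.
  by rewrite ler_pdivrMr// ge_min; apply/orP; right; lra.
have he : h < e.
  by rewrite ltr_pdivrMr// gt_min; apply/orP; left; lra.
have h01 : 0 <= h <= 1 by rewrite ltW.
have rh z : @ref_triangle R z -> @ref_triangle R (segp y z h) by move=> rz; exact: ref_convex.
have W z : @ref_triangle R z -> bdry (emap i (segp y z h)) /\ inbox k x dl ep (emap i (segp y z h)).
  move=> rz; have q1 : `|y.1 - (segp y z h).1| < e.
    rewrite /segp/= opprD addrA subrr sub0r normrN normrM gtr0_norm//; apply: le_lt_trans he.
    by rewrite ger_pMr//; move/refE: ry => [? ? ?]; move/refE: rz => [? ? ?]; rewrite ler_norml; itvlra.
  have q2 : `|y.2 - (segp y z h).2| < e.
    rewrite /segp/= opprD addrA subrr sub0r normrN normrM gtr0_norm//; apply: le_lt_trans he.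
    by rewrite ger_pMr//; move/refE: ry => [? ? ?]; move/refE: rz => [? ? ?]; rewrite ler_norml; itvlra.
  have [Uz Bz] := eW (segp y z h) q1 q2 (rh z rz).
  split => //; split; first by apply: (@element_cl i); exists (segp y z h) => //; exact: rh.
  by move=> O; apply: nex; exists (emap i (segp y z h)); split => //; exists (segp y z h) => //; exact: rh.
have [m tm] := tcoor_dot k.
apply: (@no_injection (fun z => dot m (emap i (segp y z h)))).
  move=> a b ra rb.
  apply: (@within_dot _ (fun s => emap i (segp y (segp a b s) h))).
  apply: (within_comp_path (phi := fun s => segp y (segp a b s) h) (@emap_continuous _ _ Th i)).
    have -> : (fun s => segp y (segp a b s) h) = segp (segp y a h) (segp y b h).
      by apply/funext => s; rewrite /segp/=; congr pair; ring.
    exact: continuous_segp.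
  by move=> s; rewrite /= in_itv/= => s01; apply: rh; exact: ref_convex.
move=> a b ra rb; rewrite -!tm => eab.
have [ba ia] := W a ra; have [bb ib] := W b rb.
have /emap_injective E := tcoor_inj dn (hf _ _ ba bb ia ib) eab.
have := E (rh a ra) (rh b rb); rewrite /segp => -[/addrI/(mulfI (lt0r_neq0 h0))/addIr e1 /addrI/(mulfI (lt0r_neq0 h0))/addIr e2].
by rewrite [a]surjective_pairing e1 e2 -surjective_pairing.
Qed.

Lemma segp_lin k (s t s' t' r : R) :
  segp (lin k s t) (lin k s' t') r = lin k (s + r * (s' - s)) (t + r * (t' - t)).
Proof. by elim/ord3P: k; rewrite /segp/lin/=; congr pair; ring. Qed.

Lemma closed_edge i k : closed (edge i k).
Proof.
apply: compact_closed; first exact: (@norm_hausdorff R (R * R)%type).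
apply: continuous_compact.
  by apply: continuous_subspaceW (@emap_continuous _ _ Th i) => x [].
apply: (subclosed_compact _ compact_ref); last by move=> x [].
have -> : @ref_edge R k = @ref_triangle R `&` (bary k @^-1` [set 0]).
  by apply/seteqP; split => x [].
apply: closedI; first by apply: compact_closed; [exact: (@norm_hausdorff R (R * R)%type)|exact: compact_ref].
by have /continuous_closedP := @continuous_bary k; apply; exact: closed_eq.
Qed.

Lemma bary_edge_mid k l : l != k -> bary l (edge_pt k (1 / 2)) != 0.
Proof.
by move: l k; apply: ord3P; apply: ord3P => //= _; rewrite ?bary0 ?bary1 ?bary2 /edge_pt/=; apply/eqP; lra.
Qed.

Lemma convex_lt (a b c s : R) : 0 <= s <= 1 -> a < c -> b < c -> a + s * (b - a) < c.
Proof.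
move=> /andP[s0 s1] ac bc; apply: (@le_lt_trans _ _ (Num.max a b)); last by rewrite gt_max ac.
have h1 : a <= Num.max a b by rewrite le_max lexx.
have h2 : b <= Num.max a b by rewrite le_max lexx orbT.
nra.
Qed.

Lemma convex_gt (a b c s : R) : 0 <= s <= 1 -> c < a -> c < b -> c < a + s * (b - a).
Proof.
move=> s01 ac bc; have := @convex_lt (- a) (- b) (- c) s s01; rewrite !ltrN2 => /(_ ac bc).
by have -> : - a + s * (- b - - a) = - (a + s * (b - a)); [ring|rewrite ltrN2].
Qed.

(** Near the midpoint image q of such an edge the domain is the region on one side of a graph, which
    is connected, and the only edge of element i nearby lies in the boundary. Hence element i
    contains all points of the domain near q, among them points of element j; but these would lie in
    the shared edge, that is, in the boundary. *)
Lemma shared_edge_inside i j k : i != j -> K i `&` K j = edge i k -> ~ (edge i k `<=` bdry).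
Proof.
move=> ij IE Eb.
have h01 : 0 <= (1 / 2 : R) <= 1 by itvlra.
pose q := emap i (edge_pt k (1 / 2)).
have Eq : edge i k q by apply/edgeE; exists (1 / 2).
have bq : bdry q := Eb _ Eq.
have Kiq : K i q := edge_element Eq.
have Kjq : K j q by have : (K i `&` K j) q by [rewrite IE]; case.
have [k0 [n [dl [ep [sg [G [hb n1 dn hf]]]]]]] := bdry_chart bq (@ltr01 R).
have dl0 := hb_dl hb; have ep0 := hb_ep hb.
have nq l : l != k -> nbhs q (~` edge i l).
  move=> lk; apply: open_nbhs_nbhs; split; first by apply: closed_openC; exact: closed_edge.
  move=> [y [ry yl] /emap_injective e]; move: yl; rewrite (e ry (ref_edge_pt k h01)).
  exact/eqP/bary_edge_mid.
have : nbhs q [set z | forall l, l != k -> ~ edge i l z].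
  have [l1 [l2 H]] : exists l1 l2 : 'I_3, forall l, l != k -> l = l1 \/ l = l2.
    clear; elim/ord3P: k.
    - by exists o3_1, o3_2; apply: ord3P => //; [left|right].
    - by exists o3_0, o3_2; apply: ord3P => //; [left|right].
    - by exists o3_0, o3_1; apply: ord3P => //; [left|right].
  have nn l : nbhs q [set z | l != k -> ~ edge i l z].
    have [lk|lk] := eqVneq l k.
      by have := inbox_nbhs k0 q dl0 ep0; apply: filterS => z _ /=.
    by apply: filterS (nq l lk) => z h _.
  by apply: filterS2 (nn l1) (nn l2) => z z1 z2 l lk; have [e|e] := H l lk; rewrite e in lk *; [exact: z1|exact: z2].
move=> /nbhs_box[e e0 eE].
(* Multiplying by [tau] treats both orientations of the graph at once: the domain is where
   [tau * scoor] is below [g]. *)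
pose tau : R := if sg then 1 else -1.
have tau2 : tau * tau = 1 by rewrite /tau; case: (sg); rewrite ?mulrNN mulr1.
pose g t := tau * G t.
have Og z : inbox k0 q dl ep z -> dom Om z <-> tau * scoor k0 z < g (tcoor k0 z).
  move=> hz; have := hb_dom hb hz; rewrite /g /tau; case: (sg) => ->; first by rewrite !mul1r.
  by rewrite !mulN1r ltrN2.
have cg : {for tcoor k0 q, continuous g}.
  by apply: cvgM; [exact: cvg_cst|apply: (hb_cont hb); rewrite subrr normr0].
have gq : g (tcoor k0 q) = tau * scoor k0 q.
  have bq' : inbox k0 q dl ep q by rewrite /inbox !subrr normr0.
  apply/eqP; rewrite eq_le; apply/andP; split; rewrite leNgt; apply/negP => h.
    by case: bq => _; apply; apply/(Og q bq').
  pose eta := (tau * scoor k0 q - g (tcoor k0 q)) / 2.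
  have eta0 : 0 < eta by rewrite divr_gt0// subr_gt0.
  have /nbhs_ballP[d /= d0 Hd] := cg _ (nbhsx_ballx (g (tcoor k0 q)) eta eta0).
  have nI : nbhs q (inbox k0 q (Num.min d dl) (Num.min eta ep)).
    by apply: inbox_nbhs; rewrite lt_min; apply/andP.
  case: bq => clq _; have [z [Oz [z1 z2]]] := clq _ nI.
  move: z1 z2; rewrite !lt_min => /andP[zd zdl] /andP[ze zep].
  have := (Og z (conj zdl zep)).1 Oz.
  have := Hd (tcoor k0 z); rewrite /= /ball/= distrC => /(_ zd).
  have : `|tau * scoor k0 z - tau * scoor k0 q| < eta.
    by rewrite -mulrBr normrM (_ : `|tau| = 1) ?mul1r// /tau; case: (sg); rewrite ?normrN normr1.
  rewrite !ltr_norml /eta => /andP[a1 a2] /andP[b1 b2]; lra.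
pose e2 := Num.min ep (e / 2).
have e20 : 0 < e2 by rewrite lt_min ep0 divr_gt0.
have e2ep : e2 <= ep by rewrite ge_min lexx.
have e2e : e2 <= e / 2 by rewrite ge_min lexx orbT.
have e22 : 0 < e2 / 2 by nn.
have /nbhs_ballP[d /= d0 Hd] := cg _ (nbhsx_ballx (g (tcoor k0 q)) _ e22).
pose d1 := Num.min d (Num.min dl (e / 2)).
have d10 : 0 < d1 by rewrite !lt_min d0 dl0 divr_gt0.
have d1d : d1 <= d by rewrite ge_min lexx.
have d1dl : d1 <= dl by rewrite !ge_min lexx orbT.
have d1e : d1 <= e / 2 by rewrite !ge_min lexx !orbT.
pose sq := tau * scoor k0 q.
have gt t : `|t - tcoor k0 q| < d1 -> sq - e2 / 2 < g t.
  move=> ht; have := Hd t; rewrite /= /ball/= distrC (lt_le_trans ht d1d) => /(_ isT).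
  by rewrite gq ltr_norml -/sq => /andP[_]; lra.
have good s t : `|t - tcoor k0 q| < d1 -> `|tau * s - sq| < e2 -> tau * s < g t ->
    dom Om (lin k0 s t) /\ forall l, ~ edge i l (lin k0 s t).
  move=> ht hs hg.
  have hs' : `|s - scoor k0 q| < e2.
    by move: hs; rewrite /sq -mulrBr normrM (_ : `|tau| = 1) ?mul1r// /tau; case: (sg); rewrite ?normrN normr1.
  have O : dom Om (lin k0 s t).
    by apply/Og; rewrite /inbox ?scoor_lin ?tcoor_lin//; split; lra.
  split => // l; have [->|lk] := eqVneq l k; first by move=> /Eb[_].
  have s1 : `|scoor k0 (lin k0 s t) - scoor k0 q| < e / 2 by rewrite scoor_lin; lra.
  have t1 : `|tcoor k0 (lin k0 s t) - tcoor k0 q| < e / 2 by rewrite tcoor_lin; lra.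
  have [h1 h2] := coor_dist s1 t1.
  by apply: (eE _ _ _ l lk); rewrite distrC; [clear -h1|clear -h2]; lra.
(* A level that stays below the graph throughout the small box; two points of the domain are joined
   by going down to it, across, and up again. *)
pose L := tau * (sq - 3 / 4 * e2).
have tL : tau * L = sq - 3 / 4 * e2 by rewrite /L mulrA tau2 mul1r.
have down z : inbox k0 q d1 e2 z -> dom Om z -> forall r, 0 <= r <= 1 ->
    dom Om (lin k0 (scoor k0 z + r * (L - scoor k0 z)) (tcoor k0 z)) /\
    forall l, ~ edge i l (lin k0 (scoor k0 z + r * (L - scoor k0 z)) (tcoor k0 z)).
  move=> [zt zs] Oz r r01; apply: good => //.
    have : `|tau * scoor k0 z - sq| < e2.
      by rewrite /sq -mulrBr normrM (_ : `|tau| = 1) ?mul1r// /tau; case: (sg); rewrite ?normrN normr1.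
    rewrite mulrDr mulrCA mulrBr tL !ltr_distl => /andP[h1 h2].
    by apply/andP; split; [apply: convex_gt|apply: convex_lt] => //; lra.
  have iz : inbox k0 q dl ep z by split; lra.
  have := (Og z iz).1 Oz; have := gt _ zt; rewrite mulrDr mulrCA mulrBr tL => h1 h2.
  by apply: convex_lt => //; lra.
have conn z1 z2 : inbox k0 q d1 e2 z1 -> inbox k0 q d1 e2 z2 -> dom Om z1 -> dom Om z2 -> K i z1 -> K i z2.
  move=> b1 b2 O1 O2 K1.
  have K1' : K i (lin k0 L (tcoor k0 z1)).
    apply: segp_element K1 => s s01 _; rewrite -[in segp z1](lin_coor k0 z1) segp_lin subrr mulr0 addr0.
    exact: down.
  have K2' : K i (lin k0 L (tcoor k0 z2)).
    apply: segp_element K1' => s s01 _; rewrite segp_lin subrr mulr0 addr0.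
    have ht : `|tcoor k0 z1 + s * (tcoor k0 z2 - tcoor k0 z1) - tcoor k0 q| < d1.
      move: b1 b2 => [+ _] [+ _]; rewrite !ltr_distl => /andP[h1 h2] /andP[h3 h4].
      by apply/andP; split; [apply: convex_gt|apply: convex_lt].
    apply: good => //; rewrite tL.
      by rewrite addrAC subrr add0r normrN ger0_norm; lra.
    by have := gt _ ht; lra.
  apply: segp_element K2' => s s01 _; rewrite -[in X in segp _ X](lin_coor k0 z2) segp_lin subrr mulr0 addr0.
  have s01' : 0 <= 1 - s <= 1 by case/andP: s01 => h1 h2; itvlra.
  have := down z2 b2 O2 (1 - s) s01'.
  by rewrite (_ : scoor k0 z2 + (1 - s) * (L - scoor k0 z2) = L + s * (scoor k0 z2 - L)); last by ring.
have nI := inbox_nbhs k0 q d10 e20.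
have [z1 [K1 b1 O1]] := element_dom_near Kiq nI.
have [z2 [K2 b2 O2]] := element_dom_near Kjq nI.
have : edge i k z2 by rewrite -IE; split => //; exact: conn K1.
by move=> /Eb[].
Qed.

End finite_elements.

(** * Flatness of the boundary at small scale and elements caught in strips *)

Section interpolation.
Variables (R : realType) (Om : smooth_domain R).
Notation cl := (clos Om).
Notation bdry := (@bdry R Om).
Implicit Types (k l : 'I_3) (x y z p n : R * R).

Lemma enormZ (c : R) x : enorm (c * x.1, c * x.2) = `|c| * enorm x.
Proof. by rewrite /enorm/= !exprMn -mulrDr sqrtrM ?sqr_ge0// sqrtr_sqr. Qed.

Lemma enorm_sqr x : enorm x ^+ 2 = x.1 ^+ 2 + x.2 ^+ 2.
Proof. by rewrite /enorm sqr_sqrtr// addr_ge0// sqr_ge0. Qed.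

Lemma dot_le n x : `|dot n x| <= enorm n * enorm x.
Proof.
rewrite -(@ler_pXn2r _ 2)// ?nnegrE ?mulr_ge0 ?sqrtr_ge0// exprMn !enorm_sqr normr2// /dot.
have := sqr_ge0 (n.1 * x.2 - n.2 * x.1); nra.
Qed.

Lemma enormD x y : enorm (x + y) <= enorm x + enorm y.
Proof.
rewrite -(@ler_pXn2r _ 2)// ?nnegrE ?addr_ge0 ?sqrtr_ge0// sqrrD !enorm_sqr /=.
have := dot_le x y; have := ler_norm (dot x y); rewrite /dot; lra.
Qed.

Lemma enormB_tri x y z : enorm (x - z) <= enorm (x - y) + enorm (y - z).
Proof. by have -> : x - z = (x - y) + (y - z); [rewrite addrA subrK|exact: enormD]. Qed.

Lemma discP p x (r : R) : 0 < r -> disc p r x <-> enorm (x - p) < r.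
Proof.
move=> r0; rewrite /disc -[X in X < _ <-> _](enorm_sqr (x - p)).
by rewrite ltr_pXn2r// ?nnegrE ?sqrtr_ge0// ltW.
Qed.

(** Near a boundary point the charts give a normal with the required slope; near an interior point
    there is no boundary at all. A finite cover by discs of half the local radius makes h
    uniform. *)
Lemma boundary_flat (kappa : R) : 0 < kappa -> exists2 h : R, 0 < h & forall x, cl x ->
  exists2 n, n.1 ^+ 2 + n.2 ^+ 2 = 1 & forall y z, bdry y -> bdry z ->
    enorm (y - x) < h -> enorm (z - x) < h -> `|dot n y - dot n z| <= kappa * enorm (y - z).
Proof.
move=> k0; pose P x (r : R) := 0 < r /\ exists2 n, n.1 ^+ 2 + n.2 ^+ 2 = 1 & forall y z, bdry y -> bdry z ->
    disc x r y -> disc x r z -> `|dot n y - dot n z| <= kappa * enorm (y - z).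
have loc x : cl x -> exists r : R, P x r.
  move=> clx; have [Ox|nO] := pselect (dom Om x).
    have nO : nbhs x (Om : set (R * R)) by apply: open_nbhs_nbhs; split => //; exact: dom_open.
    have /nbhs_box[e e0 eO] := nO; exists e; split => //; exists (1, 0); first by rewrite /= expr1n expr0n addr0.
    move=> y z [_ ny] _ /(disc_coor e0)[h1 h2]; exfalso; apply: ny; apply: eO; by rewrite distrC.
  have k2 : 0 < kappa / 2 by nn.
  have [k [n [dl [ep [sg [G [hb n1 _ hf]]]]]]] := bdry_chart (conj clx nO) k2.
  pose r := Num.min (dl / 2) ep.
  have r0 : 0 < r by rewrite lt_min (hb_ep hb) divr_gt0// (hb_dl hb).
  have r1 : 2 * r <= dl by rewrite mulrC -ler_pdivlMr// ge_min lexx.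
  have r2 : r <= ep by rewrite ge_min lexx orbT.
  exists r; split => //; exists n => // y z bY bz /(disc_inbox k r0)[a1 a2] /(disc_inbox k r0)[b1 b2].
  have i1 : inbox k x dl ep y by split; apply: lt_le_trans; eassumption.
  have i2 : inbox k x dl ep z by split; apply: lt_le_trans; eassumption.
  apply: le_trans (hf y z bY bz i1 i2) _.
  have [h1 h2] := enorm_ge (y - z).
  have : `|tcoor k y - tcoor k z| <= 2 * enorm (y - z).
    move: h1 h2; rewrite /= => h1 h2; have e0 : 0 <= enorm (y - z) := sqrtr_ge0 _.
    clear -h1 h2 e0; elim/ord3P: k; rewrite /tcoor/=; try lra.
    rewrite (_ : y.2 - y.1 - (z.2 - z.1) = (y.2 - z.2) - (y.1 - z.1)); last by ring.
    by apply: le_trans (ler_normB _ _) _; lra.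
  by move=> h; apply: le_trans (ler_wpM2l (ltW k2) h) _; rewrite mulrA divfK.
have [r Hr] := choice_on 0 loc.
have [s [scl Hs]] := finite_disc_cover (fun x clx => (fun H : 0 < r x => divr_gt0 H (@ltr0Sn R 1)) (proj1 (Hr x clx))).
have [h [h0 hs]] : exists h : R, 0 < h /\ forall x, x \in s -> h <= r x / 2.
  elim: s scl {Hs} => [|x s IH] scl; first by exists 1.
  have [|h [h0 hs]] := IH; first by move=> y ys; apply: scl; rewrite inE ys orbT.
  exists (Num.min h (r x / 2)); split.
    by rewrite lt_min h0 divr_gt0//; have [] := Hr x (scl x (mem_head _ _)).
  move=> y; rewrite inE ge_min => /predU1P[->|ys]; first by rewrite lexx orbT.
  by rewrite hs.
exists h => // x /Hs[c cs cd]; have [rc [n n1 H]] := Hr c (scl c cs).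
have rc2 : 0 < r c / 2 by nn.
exists n => // y z bY bz yx zx; have hc := hs c cs; move/(discP _ _ rc2): cd => cd.
by apply: H => //; apply/discP => //; apply: le_lt_trans (enormB_tri _ x _) _; lra.
Qed.

Variable Th : triangulation Om.
Notation K i := (@element R Om Th i).
Implicit Types (i j : 'I_(nelem Th)).

Lemma element_bounded i : exists M : R, forall x y, K i x -> K i y -> enorm (x - y) <= M.
Proof.
have [M M0 HM] := @cl_bounded R Om; exists (4 * M) => x y /element_cl/HM[a1 a2] /element_cl/HM[b1 b2].
apply: (@le_trans _ _ (Num.sqrt ((4 * M) ^+ 2))); last by rewrite sqrtr_sqr ger0_norm// mulr_ge0// ltW.
apply: ler_wsqrtr => /=.
move: a1 a2 b1 b2; rewrite !ler_norml => /andP[? ?] /andP[? ?] /andP[? ?] /andP[? ?].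
have sq (u : R) : - (2 * M) <= u -> u <= 2 * M -> u ^+ 2 <= (2 * M) ^+ 2.
  by move=> h1 h2; have : 0 <= (2 * M - u) * (2 * M + u) by [rewrite mulr_ge0//; lra]; lra.
have := sq (x.1 - y.1); have := sq (x.2 - y.2) => /(_ ltac:(lra) ltac:(lra)) s2 /(_ ltac:(lra) ltac:(lra)) s1.
nra.
Qed.

Lemma diam_ge i x y : K i x -> K i y -> enorm (x - y) <= diam (K i).
Proof.
move=> Kx Ky; apply: ub_le_sup; last by exists x, y.
by have [M HM] := element_bounded i; exists M => _ [a [b [Ka Kb ->]]]; exact: HM.
Qed.

(** Among c = -1, 0, 1 each condition fails for one value at most, since the values are spaced by W
    >= 4 q; two conditions cannot exclude all three. *)
Lemma three_points (a b W q : R) : 0 < q -> 4 * q <= W ->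
  exists c : R, [/\ `|c| <= 1, q < `|a + c * W| & q < `|b + c * W|].
Proof.
move=> q0 W4; wlog : a b / `|a| <= q => [H|].
  have [a1|a1] := leP `|a| q; first exact: H.
  have [b1|b1] := leP `|b| q; last by exists 0; rewrite normr0 ler01 !mul0r !addr0.
  by have [c [c1 ca cb]] := H b a b1; exists c.
rewrite ler_norml => /andP[h1 h2]; have [b2|b2] := ltP q `|b + 1 * W|.
  by exists 1; rewrite normr1; split => //; rewrite mul1r; apply: lt_le_trans (ler_norm _); lra.
exists (-1); rewrite normrN normr1 mulN1r -[`|a - W|]normrN -[`|b - W|]normrN.
move: b2; rewrite mul1r ler_norml => /andP[_ h]; split => //; apply: lt_le_trans (ler_norm _); lra.
Qed.

(** If the vertices lie in a thin strip with normal n and the boundary points of the element in a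
    thin strip with normal m, the disc contains a point off both. Moving from it parallel to the
    first strip and away from the second meets no edge: straight edges stay in the first strip with
    their ends, the others are on the boundary. The element would then contain a segment longer than
    its diameter. *)
Lemma strip_escape i p (rho al be : R) n m : 0 < rho -> [set x | enorm (x - p) <= rho] `<=` K i ->
  n.1 ^+ 2 + n.2 ^+ 2 = 1 -> m.1 ^+ 2 + m.2 ^+ 2 = 1 -> 0 <= dot n m ->
  (forall k, `|dot n (vert i k) - al| <= rho / 8) ->
  (forall x, K i x -> bdry x -> `|dot m x - be| <= rho / 8) -> False.
Proof.
move=> r0 sub n1 m1 nm hal hbe.
(* The half-sum [e] of n and m has the same component w >= 1/2 along both, so a displacement along
   it shifts both strip coordinates equally and [three_points] applies. *)
pose w := (1 + dot n m) / 2.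
have nm1 : dot n m <= 1.
  by rewrite /dot; have := sqr_ge0 (n.1 - m.1); have := sqr_ge0 (n.2 - m.2); lra.
pose e : R * R := ((n.1 + m.1) / 2, (n.2 + m.2) / 2).
have ne : dot n e = w by rewrite /dot/e/w/dot/=; lra.
have me : dot m e = w by rewrite /dot/e/w/dot/=; lra.
have q0 : 0 < rho / 8 by rewrite divr_gt0.
have W4 : 4 * (rho / 8) <= rho * w by rewrite /w; nra.
have [c [c1 ca cb]] := three_points (dot n p - al) (dot m p - be) q0 W4.
pose x0 : R * R := (p.1 + c * rho * e.1, p.2 + c * rho * e.2).
have K0 : K i x0.
  apply: sub; rewrite /= (_ : x0 - p = (c * rho * e.1, c * rho * e.2)); last first.
    by apply/pair_eqP; rewrite /= ![_ + _ * _ * _]addrC !addrK !eqxx.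
  rewrite enormZ normrM (gtr0_norm r0) -mulrA mulrCA ger_pMr//.
  have e1 : enorm e <= 1.
    rewrite -(@ler_pXn2r _ 2)// ?nnegrE ?sqrtr_ge0// enorm_sqr expr1n /e/=.
    by move: nm1; rewrite /dot; lra.
  by rewrite -[leRHS]mulr1; apply: ler_pM => //; exact: sqrtr_ge0.
have n0E : dot n x0 - al = dot n p - al + c * (rho * w) by rewrite -ne /x0 /dot/=; ring.
have m0E : dot m x0 - be = dot m p - be + c * (rho * w) by rewrite -me /x0 /dot/=; ring.
(* Orthogonal to n, so that [dot n] is constant along the path; the sign [sg] is such that the
   distance to the second strip does not decrease. *)
pose d0 : R * R := (- n.2, n.1).
pose sg : R := if 0 <= (dot m x0 - be) * dot m d0 then 1 else -1.
have sg2 : sg ^+ 2 = 1 by rewrite /sg; case: ifP => _; rewrite ?sqrrN expr1n.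
have sgm : 0 <= (dot m x0 - be) * (sg * dot m d0).
  rewrite mulrCA /sg; case: ifP => [h|/negbT]; first by rewrite mul1r.
  by rewrite -ltNge mulN1r oppr_ge0 => /ltW.
pose T := diam (K i) + 1.
have T0 : 0 < T.
  rewrite ltr_wpDl//; apply: le_trans (diam_ge K0 K0); exact: sqrtr_ge0.
pose y0 : R * R := (x0.1 + T * (sg * d0.1), x0.2 + T * (sg * d0.2)).
have segE (s : R) : segp x0 y0 s = (x0.1 + s * T * sg * d0.1, x0.2 + s * T * sg * d0.2).
  by rewrite /segp/y0/=; congr pair; ring.
have nE (s : R) : dot n (segp x0 y0 s) - al = dot n x0 - al by rewrite segE /dot/d0/=; ring.
have mE (s : R) : dot m (segp x0 y0 s) - be = dot m x0 - be + (s * T) * (sg * dot m d0).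
  by rewrite segE /dot/=; ring.
have mfar (s : R) : 0 <= s -> rho / 8 < `|dot m (segp x0 y0 s) - be|.
  move=> s0; apply: (@lt_le_trans _ _ `|dot m x0 - be|); first by rewrite m0E.
  rewrite mE -ler_sqr ?nnegrE// !normr2//.
  have : 0 <= s * T by nn.
  move: sgm; move: (s * T) (dot m x0 - be) (sg * dot m d0) => S u v h S0.
  by have := mulr_ge0 S0 h; have := sqr_ge0 (S * v); lra.
have Ky : K i y0.
  apply: segp_element K0 => s /andP[s0 s1] Ks.
  have nb : ~ bdry (segp x0 y0 s).
    by move=> b; have := hbe _ Ks b; rewrite leNgt mfar.
  split.
    by apply: contrapT => nO; apply: nb; split => //; exact: element_cl Ks.
  move=> k Ek; have [[a [b E]]|Eb] := @emap_edges _ _ Th i k; last first.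
    by apply: nb; have : (cl `\` Om) (segp x0 y0 s) := Eb _ Ek.
  have [k1 [k2 [ak bk]]] := @segment_ends _ _ _ i k a b E.
  have : [set x | exists s : R, 0 <= s <= 1 /\ x = (a.1 + s * (b.1 - a.1), a.2 + s * (b.2 - a.2))] (segp x0 y0 s).
    by rewrite -E.
  move=> [r [/andP[r1 r2] e2]].
  have : rho / 8 < `|dot n (segp x0 y0 s) - al| by rewrite nE n0E.
  rewrite e2; have := hal k1; have := hal k2; rewrite -ak -bk.
  rewrite (_ : dot n (a.1 + r * (b.1 - a.1), a.2 + r * (b.2 - a.2)) - al = (dot n a - al) + r * ((dot n b - al) - (dot n a - al))); last by rewrite /dot/=; ring.
  rewrite ltNge !ler_norml => /andP[b1 b2] /andP[a1 a2] /negP; apply.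
  apply/andP; clear -r1 r2 a1 a2 b1 b2; move: (dot n a - al) (dot n b - al) a1 a2 b1 b2 => A B; split; nra.
have := diam_ge Ky K0.
have -> : y0 - x0 = ((T * sg) * d0.1, (T * sg) * d0.2).
  by apply/pair_eqP; rewrite /= ![_ + _ * (_ * _)]addrC !addrK !mulrA !eqxx.
rewrite enormZ (_ : enorm d0 = 1); last first.
  by rewrite /enorm/d0/= sqrrN addrC n1 sqrtr1.
rewrite mulr1 normrM (gtr0_norm T0) (_ : `|sg| = 1) ?mulr1 /T; first lra.
by rewrite /sg; case: ifP => _; rewrite ?normrN normr1.
Qed.

End interpolation.

(** * Gradient of an affine function from its vertex values *)

Section nodal.
Variables (R : realType) (Om : smooth_domain R).
Implicit Types (k l : 'I_3) (x y p n : R * R).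
Notation bdry := (@bdry R Om).

(** Says that the vertices of a small curved element are not nearly aligned. If the bound failed,
    with n = g/|g| the vertices would lie in a strip of half-width rho/8; the boundary part of the
    element lies in another by flatness, and [strip_escape] excludes this. The size [h0] depends on
    the domain and [sigma] only. *)
Lemma nodal_gradient (sigma : R) : exists2 h0 : R, 0 < h0 & forall (Th : triangulation Om) (i : 'I_(nelem Th)) p (rho D : R) (g : R * R),
  0 < rho -> [set x | enorm (x - p) <= rho] `<=` element i -> diam (element i) <= sigma * rho -> diam (element i) < h0 ->
  (forall k l, `|dot g (vert i k) - dot g (vert i l)| <= D) -> rho * enorm g <= 8 * D.
Proof.
(* With this slope, boundary points of one element, at most (|sigma| + 1) rho apart, deviate from a
   straight strip by at most rho/8. *)
have k0 : 0 < 1 / (8 * (`|sigma| + 1)) by nn.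
have [h0 h00 flat] := boundary_flat Om k0; exists h0 => // Th i p rho D g r0 sub dsig dh hD.
rewrite leNgt; apply/negP => big.
have D0 : 0 <= D by apply: le_trans (hD ord0 ord0).
have g0 : 0 < enorm g.
  rewrite lt_neqAle sqrtr_ge0 andbT; apply/negP => /eqP e; move: big; rewrite -e mulr0; lra.
pose n : R * R := (g.1 / enorm g, g.2 / enorm g).
have n1 : n.1 ^+ 2 + n.2 ^+ 2 = 1.
  by rewrite /n/= !exprMn -mulrDl -enorm_sqr exprVn mulfV// sqrf_eq0 gt_eqF.
have ndot x y : dot n x - dot n y = (dot g x - dot g y) / enorm g.
  by rewrite /dot/n/=; field; rewrite gt_eqF.
have Kp : element i p by apply: sub; rewrite /= subrr /enorm/= expr0n/= addr0 sqrtr0 ltW.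
have [m m1 Hm] := flat p (element_cl Kp).
have hal k : `|dot n (vert i k) - dot n (vert i ord0)| <= rho / 8.
  rewrite ndot normrM normfV (gtr0_norm g0) ler_pdivrMr//; apply: (le_trans (hD k ord0)); lra.
have mflat x y : element i x -> element i y -> bdry x -> bdry y -> `|dot m x - dot m y| <= rho / 8.
  move=> Kx Ky bx bY; apply: (le_trans (Hm x y bx bY _ _)).
  - by apply: le_lt_trans dh; exact: diam_ge.
  - by apply: le_lt_trans dh; exact: diam_ge.
  have h1 : enorm (x - y) <= (`|sigma| + 1) * rho.
    apply: (le_trans (diam_ge Kx Ky)); apply: (le_trans dsig); rewrite ler_wpM2r ?ltW//.
    by have := ler_norm sigma; lra.
  have s0 : 0 < `|sigma| + 1 by nn.
  apply: (@le_trans _ _ (1 / (8 * (`|sigma| + 1)) * ((`|sigma| + 1) * rho))).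
    by rewrite ler_wpM2l// ltW.
  by apply: le_of_eq; field; rewrite gt_eqF.
have [[y [Ky bY]]|nb] := pselect (exists y, element i y /\ bdry y); last first.
  apply: (@strip_escape _ _ Th i p rho (dot n (vert i ord0)) 0 n n r0 sub n1 n1) => //.
    by rewrite /dot -!expr2 n1.
  by move=> x Kx bx; exfalso; apply: nb; exists x.
have [h|h] := leP 0 (dot n m).
  apply: (@strip_escape _ _ Th i p rho (dot n (vert i ord0)) (dot m y) n m r0 sub n1 m1 h hal) => x Kx bx.
  exact: mflat.
pose m' : R * R := (- m.1, - m.2).
have m'E x : dot m' x = - dot m x by rewrite /dot/m'/=; ring.
apply: (@strip_escape _ _ Th i p rho (dot n (vert i ord0)) (dot m' y) n m' r0 sub n1) => //.
- by rewrite /m'/= !sqrrN.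
- by rewrite (_ : dot n m' = - dot n m); [lra|rewrite /dot/m'/=; ring].
- by move=> x Kx bx; rewrite !m'E -opprD normrN; exact: mflat.
Qed.

End nodal.

(** * Gluing affine pieces and nodal interpolation *)

Section gluing.
Variables (R : realType) (Om : smooth_domain R) (Th : triangulation Om).
Implicit Types (i j : 'I_(nelem Th)) (k l : 'I_3) (x y z p : R * R).
Notation K i := (@element R Om Th i).

Lemma glue (a b c : 'I_(nelem Th) -> R) :
  (forall i j x, K i x -> K j x -> a i + b i * x.1 + c i * x.2 = a j + b j * x.1 + c j * x.2) ->
  exists2 v, Vh Th v & affine_on v a b c.
Proof.
move=> H; pose v x := pw a x + pw b x * x.1 + pw c x * x.2.
have av : affine_on v a b c.
  move=> i x Kx; have [j fj] := first_in_cover Th (element_cl Kx).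
  by rewrite /v !(pwE _ fj); apply: H => //; case: fj.
exists v => //; split; last by move=> i; exists (a i), (b i), (c i); exact: av.
apply/subspace_continuousP => x clx; apply/cvgrPdist_lt => e e0.
have near1 i : \forall y \near x, K i x -> `|(a i + b i * x.1 + c i * x.2) - (a i + b i * y.1 + c i * y.2)| < e.
  have cc : continuous (fun y : R * R => a i + b i * y.1 + c i * y.2).
    move=> y; apply: cvgD; [apply: cvgD; [exact: cvg_cst|]|]; apply: cvgM;
      [exact: cvg_cst|exact: cvg_fst|exact: cvg_cst|exact: cvg_snd].
  have /cvgrPdist_lt/(_ e e0) := cc x.
  by apply: filterS => y h _.
have near2 : \forall y \near x, forall i, i \in enum 'I_(nelem Th) -> K i x ->
    `|(a i + b i * x.1 + c i * x.2) - (a i + b i * y.1 + c i * y.2)| < e.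
  elim: (enum _) => [|i s IH]; first by apply: filterE => y k; rewrite in_nil.
  apply: filterS2 (near1 i) IH => y h1 h2 j; rewrite inE => /orP[/eqP -> //|]; exact: h2.
apply: filterS2 near2 (near_elements Th x) => y h1 h2 cly.
have [i Ky] := @cl_element _ _ Th y cly; have Kx := h2 i Ky.
by change (`|v x - v y| < e); rewrite (av i x Kx) (av i y Ky); apply: h1 => //; rewrite mem_enum.
Qed.

(* On a straight edge two affine functions agree as soon as they agree at the
   two ends, and edges lying in the boundary are not shared. *)
Lemma interpolant (a b c : 'I_(nelem Th) -> R) (psi : R * R -> R) :
  (forall i k, a i + b i * (vert i k).1 + c i * (vert i k).2 = psi (vert i k)) ->
  exists2 v, Vh Th v & affine_on v a b c.
Proof.
move=> H; apply: glue => i j x Ki Kj.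
have [<-//|ij] := eqVneq i j.
have IK : (K i `&` K j) x by [].
case: (emap_conforming ij) => [E|[k [l [E E']]]|[k [l [E E']]]].
- by have : (K i `&` K j) x by []; rewrite /element E.
- have [y /ref_vertexE -> e] : (emap i @` @ref_vertex R k) x by rewrite -E.
  have [z /ref_vertexE -> e'] : (emap j @` @ref_vertex R l) x by rewrite -E'.
  have := H i k; have := H j l; rewrite /vert e e' => <- <-; by [].
have [[p [q Es]]|Eb] := @emap_edges _ _ Th i k; last first.
  by exfalso; apply: (shared_edge_inside ij E) => y /Eb.
have [k1 [k2 [p1 q1]]] := @segment_ends _ _ _ i k p q Es.
have [l1 [l2 [p2 q2]]] := @segment_ends _ _ _ j l p q (etrans (etrans (esym E') E) Es).
have : (emap i @` @ref_edge R k) x by rewrite -E.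
rewrite Es => -[s [_ ->]] /=.
have := H i k1; have := H j l1; have := H i k2; have := H j l2.
rewrite -p1 -p2 -q1 -q2 => <- e1 <- e2.
have -> : a i + b i * (p.1 + s * (q.1 - p.1)) + c i * (p.2 + s * (q.2 - p.2)) =
  (1 - s) * (a i + b i * p.1 + c i * p.2) + s * (a i + b i * q.1 + c i * q.2) by ring.
by rewrite e1 e2; ring.
Qed.

End gluing.

(** * Soft thresholding and inequalities for cubes *)

Section shrink.
Variable R : realType.
Implicit Types (M S H K r s t o : R).

(** Soft thresholding, sgn(s) (|s| - M)_+. *)
Definition shrink M s : R := if M < s then s - M else if s < - M then s + M else 0.

Lemma shrinkN M s : 0 < M -> shrink M (- s) = - shrink M s.
Proof. by move=> M0; rewrite /shrink; repeat case: ltP => ?; lra. Qed.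

Lemma shrink_lip M s t : 0 < M -> `|shrink M s - shrink M t| <= `|s - t|.
Proof.
move=> M0; rewrite ler_norml /shrink; have := ler_norm (s - t); have := ler_norm (- (s - t)); rewrite normrN => h1 h2.
move: `|s - t| h1 h2 => z h1 h2; repeat case: ltP => ?; itvlra.
Qed.

Lemma shrink_le M s : 0 < M -> `|s| <= 3 * M -> `|shrink M s| <= 2 * M.
Proof. by move=> M0; rewrite !ler_norml /shrink => /andP[? ?]; repeat case: ltP => ?; itvlra. Qed.

Lemma shrink_small M s : 0 < M -> `|s| <= M -> shrink M s = 0.
Proof. by move=> M0; rewrite !ler_norml /shrink => /andP[? ?]; repeat case: ltP => ?; lra. Qed.

Lemma shrink_le_norm M s : 0 < M -> `|shrink M s| <= `|s|.
Proof. by move=> M0; have := shrink_lip s 0 M0; rewrite {2}/shrink ltNge (ltW M0)/= oppr_gt0 ltNge (ltW M0)/= !subr0. Qed.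

Lemma cube_lip x y (m : R) : `|x| <= m -> `|y| <= m -> `|x ^+ 3 - y ^+ 3| <= 3 * m ^+ 2 * `|x - y :> R|.
Proof.
move=> hx hy; have m0 : 0 <= m := le_trans (normr_ge0 _) hx.
have -> : x ^+ 3 - y ^+ 3 = (x ^+ 2 + x * y + y ^+ 2) * (x - y) by ring.
rewrite normrM ler_wpM2r//; have q (u w : R) : `|u| <= m -> `|w| <= m -> `|u * w| <= m ^+ 2.
  by move=> hu hw; rewrite normrM expr2 ler_pM.
have := q _ _ hx hx; have := q _ _ hx hy; have := q _ _ hy hy; rewrite -!expr2 => a1 a2 a3.
by apply: (le_trans (ler_normD _ _)); have := ler_normD (x ^+ 2) (x * y); lra.
Qed.

Lemma cube_secant r s t o : 0 <= o <= r -> `|s - r| <= o -> `|t - r| <= o ->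
  `|s ^+ 3 - t ^+ 3 - 3 * r ^+ 2 * (s - t)| <= 9 * r * o * `|s - t|.
Proof.
move=> /andP[ho0 rO]; rewrite !(ler_distl _ r) => /andP[s1 s2] /andP[t1 t2].
have -> : s ^+ 3 - t ^+ 3 - 3 * r ^+ 2 * (s - t) = (s ^+ 2 + s * t + t ^+ 2 - 3 * r ^+ 2) * (s - t) by ring.
rewrite normrM ler_wpM2r//.
have q (u w : R) : r - o <= u <= r + o -> r - o <= w <= r + o -> `|u * w - r ^+ 2| <= 3 * r * o.
  move=> /andP[u1 u2] /andP[w1 w2]; have ro0 : 0 <= r - o by lra.
  have h1 : u * w <= (r + o) * (r + o) by apply: ler_pM => //; lra.
  have h2 : (r - o) * (r - o) <= u * w by apply: ler_pM => //; lra.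
  have h3 : o * o <= r * o by rewrite ler_wpM2r.
  have h4 : 0 <= r * o by rewrite mulr_ge0//; lra.
  have h5 : 0 <= o * o by nn.
  by rewrite ler_norml; itvlra.
have hs : r - o <= s <= r + o by rewrite s1.
have ht : r - o <= t <= r + o by rewrite t1.
have := q _ _ hs hs; have := q _ _ hs ht; have := q _ _ ht ht => a1 a2 a3.
have -> : s ^+ 2 + s * t + t ^+ 2 - 3 * r ^+ 2 = (s * s - r ^+ 2) + (s * t - r ^+ 2) + (t * t - r ^+ 2) by ring.
apply: (le_trans (ler_normD _ _)).
by have := ler_normD (s * s - r ^+ 2) (s * t - r ^+ 2); lra.
Qed.

(** Here r is the thresholded value at one vertex, d the variation of w from that vertex and e the
    deviation of the interpolant from the linearized cube, while (r + M + d)^3 is w^3. Every term of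
    the difference carries a factor M, d or e of order H, and the rest is at most of order r^2. *)
Lemma cubic_value (c : R) S K H M o r d e : 1000 <= c -> 1 <= S -> 2 * S <= K -> 0 < H -> M = K * H -> o <= S * H -> M <= r ->
  `|d| <= o -> `|e| <= 72 * S ^+ 3 * H ^+ 2 * r ->
  `|r ^+ 3 + 3 * r ^+ 2 * d + e - (r + M + d) ^+ 3| <= c * S ^+ 4 * K ^+ 3 * H * (r + M + d) ^+ 2.
Proof.
move=> hc S1 KS H0 ME oS Mr dO eO.
have oM : 2 * o <= M by rewrite ME; have := ler_wpM2r (ltW H0) KS; lra.
have o0 : 0 <= o by apply: le_trans dO.
have M0 : 0 < M by rewrite ME mulr_gt0//; lra.
have r0 : 0 < r by lra.
move: (dO); rewrite ler_norml => /andP[d1 d2].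
have HM : H <= M by rewrite ME ler_peMl// ?ltW//; lra.
have -> : r ^+ 3 + 3 * r ^+ 2 * d + e - (r + M + d) ^+ 3 =
  - (M * (3 * r * r + 3 * r * M + M * M)) - 3 * (2 * r * M + M * M) * d - 3 * (r + M) * (d * d) - d * d * d + e by ring.
have Mr2 : r * M <= r * r by rewrite ler_wpM2l// ltW.
have MM : M * M <= r * r by apply: ler_pM => //; exact: ltW.
have rO : o * o <= r * o by rewrite ler_wpM2r//; lra.
have rr0 : 0 <= r * r by nn.
have p1 : `|M * (3 * r * r + 3 * r * M + M * M)| <= 7 * K * H * (r * r).
  rewrite ger0_norm; last by rewrite mulr_ge0 ?ltW// !addr_gt0// !mulr_gt0.
  rewrite -(mulrA 7) -ME (_ : 7 * M * (r * r) = M * (7 * (r * r))); last by ring.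
  by apply: ler_wpM2l; [exact: ltW|lra].
have p2 : `|3 * (2 * r * M + M * M) * d| <= 9 * S * H * (r * r).
  rewrite normrM ger0_norm; last by rewrite mulr_ge0// ltW// addr_gt0// !mulr_gt0.
  apply: (@le_trans _ _ (9 * (r * r) * (S * H))); last by apply: le_of_eq; ring.
  apply: ler_pM => //; [rewrite mulr_ge0// ltW// addr_gt0// !mulr_gt0//|lra|lra].
have dd : d * d <= r * o.
  apply: le_trans rO; rewrite -expr2 -normr2// -expr2 lerXn2r// nnegrE//.
have dd0 : 0 <= d * d by nn.
have p3 : `|3 * (r + M) * (d * d)| <= 6 * S * H * (r * r).
  rewrite ger0_norm; last by rewrite mulr_ge0// mulr_ge0// ltW// addr_gt0.
  apply: (@le_trans _ _ (6 * r * (r * (S * H)))); last by apply: le_of_eq; ring.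
  apply: ler_pM => //; [rewrite mulr_ge0// ltW// addr_gt0//|lra|].
  by apply: le_trans dd _; rewrite ler_wpM2l// ltW.
have p4 : `|d * d * d| <= S * H * (r * r).
  rewrite normrM (ger0_norm dd0).
  apply: (@le_trans _ _ (r * r * (S * H))); last by rewrite mulrC.
  apply: ler_pM => //; last by lra.
  by apply: le_trans dd _; rewrite ler_wpM2l//; lra.
have p5 : `|e| <= 72 * S ^+ 3 * H * (r * r).
  apply: (le_trans eO); rewrite (_ : 72 * S ^+ 3 * H ^+ 2 * r = 72 * S ^+ 3 * H * (H * r)); last by ring.
  apply: ler_wpM2l; first by rewrite mulr_ge0 ?(ltW H0)// mulr_ge0// exprn_ge0// (le_trans ler01 S1).
  by apply: ler_wpM2r; [exact: ltW|exact: le_trans Mr].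
have S0 : 0 < S := lt_le_trans ltr01 S1.
have K1 : 1 <= K by clear -S1 KS; lra.
have K0 : 0 < K := lt_le_trans ltr01 K1.
have S4 : S ^+ 3 <= S ^+ 4 * K ^+ 3.
  rewrite -[leLHS]mulr1; apply: ler_pM => //; [by rewrite exprn_ge0 ?ltW|by apply: ler_weXn2l|by apply: exprn_ege1].
have S1' : S <= S ^+ 4 * K ^+ 3.
  rewrite -[leLHS]mulr1; apply: ler_pM => //; [by rewrite ltW|by rewrite -{1}[S]expr1; apply: ler_weXn2l|by apply: exprn_ege1].
have K1' : K <= S ^+ 4 * K ^+ 3.
  rewrite -[leLHS]mul1r; apply: ler_pM => //; [by rewrite ltW|by apply: exprn_ege1|by rewrite -{1}[K]expr1; apply: ler_weXn2l].
have fin : 7 * K * H * (r * r) + 9 * S * H * (r * r) + 6 * S * H * (r * r) + S * H * (r * r) + 72 * S ^+ 3 * H * (r * r)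
    <= c * S ^+ 4 * K ^+ 3 * H * (r * r).
  rewrite -!mulrDl -![_ * H * (r * r)]mulrA; apply: ler_wpM2r; first by rewrite mulr_ge0// ltW.
  rewrite -(mulrA c); move: (S ^+ 4 * K ^+ 3) (S ^+ 3) S4 S1' K1' => T U u1 u2 u3.
  have T0 : 0 <= T by clear -S0 u2; lra.
  have := ler_wpM2r T0 hc; clear -u1 u2 u3 T0; lra.
apply: (@le_trans _ _ (c * S ^+ 4 * K ^+ 3 * H * (r * r))); last first.
  have c0 : 0 <= c := le_trans (ler0n _ 1000) hc.
  apply: ler_wpM2l; first by apply: mulr_ge0 (ltW H0); apply: mulr_ge0 (exprn_ge0 _ (ltW K0)); apply: mulr_ge0 c0 (exprn_ge0 _ (ltW S0)).
  by rewrite -expr2; apply: lerXn2r; rewrite ?nnegrE; clear -r0 M0 d1 oM; lra.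
apply: le_trans fin.
apply: (le_trans (ler_normD _ _)); apply: lerD p5; apply: (le_trans (ler_normB _ _)); apply: lerD p4.
apply: (le_trans (ler_normB _ _)); apply: lerD p3; apply: (le_trans (ler_normB _ _)); apply: lerD p2.
by rewrite normrN.
Qed.

(** The gradient of the cube brings 3 r^2 while w^2 <= (r + 2 M)^2. The surplus 2 r^2 absorbs the
    terms linear in r by completing the square, at the price of a multiple of H^2. *)
Lemma cubic_gradient (c : R) S K H M r w : 1000 <= c -> 1 <= S -> 2 * S <= K -> 0 < H -> M = K * H -> 0 <= w <= r + 2 * M -> M <= r ->
  w ^+ 2 - c * S ^+ 4 * K ^+ 3 * H ^+ 2 <= 3 * r ^+ 2 - 72 * S ^+ 2 * H * r.
Proof.
move=> hc S1 KS H0 ME /andP[w0 wr] Mr.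
have K1 : 1 <= K by lra.
have M0 : 0 < M by rewrite ME mulr_gt0//; lra.
have w2 : w ^+ 2 <= (r + 2 * M) ^+ 2 by rewrite lerXn2r// nnegrE//; lra.
have S2 : 1 <= S ^+ 2 by apply: exprn_ege1.
pose be := 2 * M + 36 * S ^+ 2 * H.
have sq := sqr_ge0 (2 * r - be).
have KS4 : K ^+ 2 * S ^+ 4 <= S ^+ 4 * K ^+ 3.
  rewrite mulrC ler_wpM2l ?exprn_ge0//; first lra.
  by apply: ler_weXn2l.
have bb : be <= 38 * S ^+ 2 * M.
  have : H <= M by rewrite ME ler_peMl// ltW.
  rewrite /be; nra.
have b0 : 0 <= be by nn.
have b2 : be ^+ 2 <= 1444 * (S ^+ 4 * K ^+ 3) * H ^+ 2.
  apply: (@le_trans _ _ ((38 * S ^+ 2 * M) ^+ 2)); first by rewrite lerXn2r// nnegrE; lra.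
  rewrite ME (_ : (38 * S ^+ 2 * (K * H)) ^+ 2 = 1444 * (K ^+ 2 * S ^+ 4) * H ^+ 2); last by ring.
  by have := ler_wpM2r (sqr_ge0 H) KS4; move: (K ^+ 2 * S ^+ 4) (S ^+ 4 * K ^+ 3) (H ^+ 2) => u1 u2 u3; clear; lra.
have m2 : M ^+ 2 <= (S ^+ 4 * K ^+ 3) * H ^+ 2.
  rewrite ME exprMn ler_wpM2r ?sqr_ge0//; apply: le_trans KS4; rewrite ler_peMr ?sqr_ge0//; exact: exprn_ege1.
rewrite (_ : c * S ^+ 4 * K ^+ 3 * H ^+ 2 = c * (S ^+ 4 * K ^+ 3 * H ^+ 2)); last by ring.
rewrite -(mulrA 1444) in b2.
move: w2 sq b2 m2; rewrite /be -!(mulrA _ (S ^+ 2) H).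
move: (S ^+ 4 * K ^+ 3 * H ^+ 2) (w ^+ 2) (S ^+ 2 * H) => T W h w2' sq' b2' m2.
have T0 : 0 <= T := le_trans (sqr_ge0 M) m2.
have cT := ler_wpM2r T0 hc.
have E : 3 * r ^+ 2 - 72 * h * r = (r + 2 * M) ^+ 2 + (2 * r - (2 * M + 36 * h)) ^+ 2 / 2 - (2 * M + 36 * h) ^+ 2 / 2 - 4 * M ^+ 2 by field.
rewrite E; move: w2' sq' b2' m2 cT T0; clear.
move: ((r + 2 * M) ^+ 2) ((2 * r - (2 * M + 36 * h)) ^+ 2) ((2 * M + 36 * h) ^+ 2) (M ^+ 2) (c * T) => u1 u2 u3 u4 u5; lra.
Qed.

End shrink.

(** * The thresholded cube interpolated on one element *)

Section local_cubic.
Variables (R : realType) (V : 'I_3 -> R * R) (Kset : set (R * R)).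
Variables (c S K H M rho G : R) (g : R * R) (a : R).
Implicit Types (k l : 'I_3) (q x : R * R).
Hypothesis hc : 1000 <= c.
Hypothesis S1 : 1 <= S.
Hypothesis KS : 2 * S <= K.
Hypothesis H0 : 0 < H.
Hypothesis ME : M = K * H.
Hypothesis rho0 : 0 < rho.
Hypothesis VK : forall k, Kset (V k).
Hypothesis diamK : forall x y, Kset x -> Kset y -> enorm (x - y) <= S * rho.
Hypothesis GE : G = enorm g.
Hypothesis rG : rho * G <= H.
Hypothesis nodal : forall q (D : R), (forall k l, `|dot q (V k) - dot q (V l)| <= D) -> rho * enorm q <= 8 * D.

Let w x := a + dot g x.
Let C := c * S ^+ 4 * K ^+ 3.

(** The bound [nodal] with D = 0 says that a linear form constant on the vertices is zero, so the
    vertices are not aligned and the determinant in Cramer's rule is nonzero. *)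
Lemma nodal_solve (r : 'I_3 -> R) : exists a' q, forall k, a' + dot q (V k) = r k.
Proof.
pose i0 := o3_0; pose i1 := o3_1; pose i2 := o3_2.
pose A : R * R := ((V i1).1 - (V i0).1, (V i1).2 - (V i0).2).
pose B : R * R := ((V i2).1 - (V i0).1, (V i2).2 - (V i0).2).
have zero q : dot q A = 0 -> dot q B = 0 -> q.1 = 0 /\ q.2 = 0.
  move=> qA qB; have : rho * enorm q <= 8 * 0.
    apply: nodal => k l; suff E m : dot q (V m) = dot q (V i0) by rewrite E (E l) subrr normr0.
    move: qA qB; rewrite /A /B /dot/=; move: m; apply: ord3P => h1 h2 //; apply/eqP; rewrite -subr_eq0; apply/eqP.
      by rewrite -[RHS]h1; ring.
    by rewrite -[RHS]h2; ring.
  rewrite mulr0 pmulr_rle0// => q0; have [h1 h2] := enorm_ge q.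
  by split; apply/eqP; rewrite -normr_le0; exact: le_trans q0.
have det : A.1 * B.2 - A.2 * B.1 != 0.
  apply/eqP => d0.
  have [||h1 h2] := @zero (- A.2, A.1); [by rewrite /dot/=; ring|by rewrite -[RHS]d0 /dot/=; ring|].
  have [||h3 h4] := @zero (- B.2, B.1); [by apply/eqP; rewrite -oppr_eq0; apply/eqP; rewrite -[RHS]d0 /dot/=; ring|by rewrite /dot/=; ring|].
  move: h1 h2 h3 h4 => /= /eqP; rewrite oppr_eq0 => /eqP h1 h2 /eqP; rewrite oppr_eq0 => /eqP h3 h4.
  have [||+ _] := @zero (1, 0); rewrite /dot/= ?h1 ?h2 ?h3 ?h4 ?mulr0 ?addr0//.
  by move/eqP; rewrite oner_eq0.
pose q1 := ((r i1 - r i0) * B.2 - (r i2 - r i0) * A.2) / (A.1 * B.2 - A.2 * B.1).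
pose q2 := ((r i2 - r i0) * A.1 - (r i1 - r i0) * B.1) / (A.1 * B.2 - A.2 * B.1).
exists (r i0 - dot (q1, q2) (V i0)), (q1, q2).
have e1 : dot (q1, q2) A = r i1 - r i0 by rewrite /dot/q1/q2/=; field.
have e2 : dot (q1, q2) B = r i2 - r i0 by rewrite /dot/q1/q2/=; field.
apply: ord3P; first by rewrite subrK.
  by rewrite -/i1 -[RHS](subrK (r i0)) -e1 /dot/A/=; ring.
by rewrite -/i2 -[RHS](subrK (r i0)) -e2 /dot/B/=; ring.
Qed.

Lemma S0 : 0 < S. Proof. by move: S1; lra. Qed.
Lemma K0 : 0 < K. Proof. by move: S1 KS; lra. Qed.
Lemma M0 : 0 < M. Proof. by rewrite ME mulr_gt0// K0. Qed.
Lemma G0 : 0 <= G. Proof. by rewrite GE sqrtr_ge0. Qed.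

Lemma dot_subr q x y : dot q x - dot q y = dot q (x - y).
Proof. by rewrite /dot/=; ring. Qed.

Lemma osc x y : Kset x -> Kset y -> `|dot g x - dot g y| <= S * rho * G.
Proof.
move=> Kx Ky; rewrite dot_subr; apply: (le_trans (dot_le _ _)).
by rewrite -GE [leRHS]mulrC; apply: ler_wpM2l; [exact: G0|exact: diamK].
Qed.

Lemma osc_le : S * rho * G <= S * H.
Proof. by rewrite -mulrA ler_wpM2l// ltW// S0. Qed.

Lemma C_ge (T : R) : T <= c * (S ^+ 2 * K ^+ 3) -> T <= C.
Proof.
move=> h; have K0 := K0; have u : S ^+ 2 * K ^+ 3 <= S ^+ 4 * K ^+ 3.
  by apply: ler_wpM2r; [exact: exprn_ge0 (ltW K0)|exact: ler_weXn2l].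
have c0 : 0 <= c by move: hc; lra.
by apply: (le_trans h); rewrite /C -mulrA; apply: ler_wpM2l.
Qed.

(** One small vertex value makes |w| <= 3 M on the whole element, so both cubes are of order H^3. If
    all vertex values are at most M the interpolant is zero; otherwise |w| >= M/2 throughout, and
    H^2 is bounded by a multiple of w^2. *)
Lemma local_caseA a' q : (forall k, a' + dot q (V k) = shrink M (w (V k)) ^+ 3) ->
  (exists k, `|w (V k)| <= 2 * M) -> forall x, Kset x ->
  `|a' + dot q x - w x ^+ 3| <= C * H * w x ^+ 2 /\ w x ^+ 2 * G ^+ 2 - C * H ^+ 2 * G ^+ 2 <= dot g q.
Proof.
have S0 := S0; have K0 := K0; have M0 := M0; have G0 := G0.
move=> nq [k0 hk0].
have oM : 2 * (S * H) <= M by rewrite ME mulrA ler_wpM2r// ltW.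
have K1 : 1 <= K by move: S1 KS; lra.
have S2 : 1 <= S ^+ 2 by apply: exprn_ege1.
have K2 : K <= K ^+ 2 by rewrite -{1}[K]expr1; apply: ler_weXn2l.
have K3 : K ^+ 2 <= K ^+ 3 by apply: ler_weXn2l.
have K0' : 0 <= K by nn.
have SK2 : K ^+ 3 <= S ^+ 2 * K ^+ 3 by rewrite ler_peMl// exprn_ge0.
have SS2 : S <= S ^+ 2 by rewrite -{1}[S]expr1; apply: ler_weXn2l.
have SK1 : S * K ^+ 2 <= S ^+ 2 * K ^+ 3 by apply: ler_pM => //; rewrite ?exprn_ge0// ltW.
have SK3 : S ^+ 2 * K ^+ 2 <= S ^+ 2 * K ^+ 3 by rewrite ler_wpM2l// exprn_ge0// ltW.
have H20 : 0 <= H ^+ 2 := sqr_ge0 _.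
have T0 : 0 <= S ^+ 2 * K ^+ 3 by nn.
have w3 x : Kset x -> `|w x| <= 3 * M.
  move=> Kx; have := osc Kx (VK k0); have := osc_le; move: hk0; rewrite /w => h1 h2 h3.
  have -> : a + dot g x = (a + dot g (V k0)) + (dot g x - dot g (V k0)) by ring.
  by apply: (le_trans (ler_normD _ _)); lra.
have qG : enorm q <= 96 * S * M ^+ 2 * G.
  have : rho * enorm q <= 8 * (12 * M ^+ 2 * (S * rho * G)).
    apply: nodal => k l; rewrite (_ : dot q (V k) - dot q (V l) = shrink M (w (V k)) ^+ 3 - shrink M (w (V l)) ^+ 3); last first.
      by rewrite -!nq; ring.
    apply: (le_trans (cube_lip (shrink_le M0 (w3 _ (VK k))) (shrink_le M0 (w3 _ (VK l))))).
    rewrite (_ : 3 * (2 * M) ^+ 2 = 12 * M ^+ 2); last by ring.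
    apply: ler_wpM2l; first by apply: mulr_ge0 (sqr_ge0 _).
    apply: (le_trans (shrink_lip _ _ M0)).
    by rewrite /w opprD addrACA subrr add0r; exact: osc.
  rewrite (_ : 8 * _ = rho * (96 * S * M ^+ 2 * G)); last by ring.
  by rewrite ler_pM2l.
move=> x Kx; split; last first.
  have wx := w3 x Kx.
  have h1 : w x ^+ 2 <= 9 * M ^+ 2.
    by rewrite -normr2// (_ : 9 * M ^+ 2 = (3 * M) ^+ 2); [rewrite lerXn2r// nnegrE ?mulr_ge0// ltW|ring].
  have h2 : - (96 * S * M ^+ 2 * G * G) <= dot g q.
    have := dot_le g q; rewrite -GE ler_norml => /andP[+ _]; apply: le_trans; rewrite lerN2 mulrC ler_wpM2r//.
  apply: le_trans h2; rewrite (_ : - (96 * S * M ^+ 2 * G * G) = - (96 * S * M ^+ 2) * G ^+ 2); last by ring.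
  rewrite -mulrBl; apply: ler_wpM2r; first exact: sqr_ge0.
  have : (9 * K ^+ 2 + 96 * S * K ^+ 2) * H ^+ 2 <= C * H ^+ 2.
    by rewrite ler_wpM2r//; apply: C_ge; have := ler_wpM2r T0 hc; move: SK2 SK1 K3 SK3; lra.
  by move: h1; rewrite ME exprMn; move: (w x ^+ 2) (H ^+ 2) C => W h c'; lra.
have [small|/existsNP[k1 /negP]] := pselect (forall k, `|w (V k)| <= M).
  have z k : a' + dot q (V k) = 0 by rewrite nq shrink_small// expr0n.
  have q0 : enorm q <= 0.
    have : rho * enorm q <= 8 * 0.
      apply: nodal => k l; rewrite (_ : dot q (V k) - dot q (V l) = (a' + dot q (V k)) - (a' + dot q (V l))); last by ring.
      by rewrite !z subrr normr0.
    by rewrite mulr0 pmulr_rle0.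
  have zx : a' + dot q x = 0.
    have := dot_le q (x - V k0); rewrite -dot_subr => h.
    have : `|dot q x - dot q (V k0)| <= 0.
      by apply: (le_trans h); rewrite mulr_le0_ge0// sqrtr_ge0.
    by rewrite normr_le0 subr_eq0 => /eqP ->.
  rewrite zx sub0r normrN normrX exprS normr2// ler_wpM2r ?sqr_ge0//.
  apply: (le_trans (w3 x Kx)); rewrite ME mulrA ler_wpM2r ?(ltW H0)//.
  by apply: C_ge; have := ler_wpM2r T0 hc; move: SK2 K3 K2 K0'; lra.
rewrite -ltNge => hk1.
have wM : M / 2 <= `|w x|.
  have := osc (VK k1) Kx; have := osc_le; move: hk1; rewrite /w => h1 h2 h3.
  have : `|a + dot g (V k1)| <= `|a + dot g x| + `|dot g (V k1) - dot g x|.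
    by have -> : a + dot g (V k1) = (a + dot g x) + (dot g (V k1) - dot g x); [ring|exact: ler_normD].
  by lra.
have w2M : M ^+ 2 <= 4 * w x ^+ 2.
  rewrite -[w x ^+ 2]normr2// (_ : 4 * `|w x| ^+ 2 = (2 * `|w x|) ^+ 2); last by ring.
  by rewrite lerXn2r// ?nnegrE ?mulr_ge0// ?(ltW M0)//; lra.
have cub y : Kset y -> `|w y ^+ 3| <= 27 * M ^+ 3.
  move=> Ky; rewrite normrX (_ : 27 * M ^+ 3 = (3 * M) ^+ 3); last by ring.
  by rewrite lerXn2r// ?nnegrE ?mulr_ge0// ?(ltW M0)// w3.
have vk : `|a' + dot q (V k0)| <= 27 * M ^+ 3.
  rewrite nq normrX (_ : 27 * M ^+ 3 = (3 * M) ^+ 3); last by ring.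
  rewrite lerXn2r// ?nnegrE ?mulr_ge0// ?(ltW M0)//.
  by apply: (le_trans (shrink_le_norm _ M0)); exact: w3.
have dq : `|dot q x - dot q (V k0)| <= 96 * S ^+ 2 * M ^+ 2 * H.
  rewrite dot_subr; apply: (le_trans (dot_le _ _)).
  apply: (@le_trans _ _ (96 * S * M ^+ 2 * G * (S * rho))).
    by apply: ler_pM; rewrite ?sqrtr_ge0// diamK.
  rewrite (_ : _ * (S * rho) = 96 * S ^+ 2 * M ^+ 2 * (rho * G)); last by ring.
  by apply: ler_wpM2l rG; apply: mulr_ge0 (sqr_ge0 _); apply: mulr_ge0 (sqr_ge0 _).
have := cub x Kx => cx.
have : `|a' + dot q x - w x ^+ 3| <= (54 * K + 96 * S ^+ 2) * H * M ^+ 2.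
  have -> : a' + dot q x - w x ^+ 3 = (a' + dot q (V k0)) + (dot q x - dot q (V k0)) - w x ^+ 3 by ring.
  apply: (le_trans (ler_normB _ _)); have := ler_normD (a' + dot q (V k0)) (dot q x - dot q (V k0)).
  have -> : (54 * K + 96 * S ^+ 2) * H * M ^+ 2 = 27 * M ^+ 3 + 96 * S ^+ 2 * M ^+ 2 * H + 27 * M ^+ 3.
    by rewrite exprSr ME; ring.
  by move: vk dq cx; lra.
move=> h; apply: (le_trans h); apply: (@le_trans _ _ ((54 * K + 96 * S ^+ 2) * H * (4 * w x ^+ 2))).
  by apply: ler_wpM2l w2M; apply: mulr_ge0 (ltW H0); apply: addr_ge0; apply: mulr_ge0 => //; exact: sqr_ge0.
rewrite mulrA ler_wpM2r ?sqr_ge0// mulrAC ler_wpM2r ?(ltW H0)//; apply: C_ge.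
have : S ^+ 2 <= S ^+ 2 * K ^+ 3 by rewrite ler_peMr ?sqr_ge0//; exact: exprn_ege1.
by have := ler_wpM2r T0 hc; move: SK2 K3 K2; lra.
Qed.

(** Here thresholding only subtracts the constant M, so the gradient of the interpolant is 3 r^2 g
    up to the error [e], controlled by [cube_secant] at the vertices. *)
Lemma local_caseB a' q : (forall k, a' + dot q (V k) = shrink M (w (V k)) ^+ 3) ->
  (forall k, 2 * M < w (V k)) -> forall x, Kset x ->
  `|a' + dot q x - w x ^+ 3| <= C * H * w x ^+ 2 /\ w x ^+ 2 * G ^+ 2 - C * H ^+ 2 * G ^+ 2 <= dot g q.
Proof.
have S0 := S0; have K0 := K0; have M0 := M0; have G0 := G0.
move=> nq big x Kx.
pose V0 := V o3_0.
have oM : 2 * (S * H) <= M by rewrite ME mulrA ler_wpM2r// ltW.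
pose o := S * rho * G.
have ho : o <= S * H := osc_le.
have o0 : 0 <= o by apply: mulr_ge0 G0; exact: mulr_ge0 (ltW S0) (ltW rho0).
pose r := w V0 - M.
have Mr : M <= r by rewrite /r; have := big o3_0; rewrite -/V0; lra.
have r0 : 0 < r := lt_le_trans M0 Mr.
have sh k : shrink M (w (V k)) = w (V k) - M.
  by rewrite /shrink ifT //; have := big k; lra.
have near_r k : `|w (V k) - M - r| <= o.
  rewrite /r /w (_ : _ - _ - _ = dot g (V k) - dot g V0); last by ring.
  by apply: osc; exact: VK.
pose e : R * R := (q.1 - 3 * r ^+ 2 * g.1, q.2 - 3 * r ^+ 2 * g.2).
have eE y : dot e y = dot q y - 3 * r ^+ 2 * dot g y by rewrite /dot/e/=; ring.
have eG : enorm e <= 72 * S ^+ 2 * H * r * G.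
  have : rho * enorm e <= 8 * (9 * r * o * o).
    apply: nodal => k l; rewrite !eE.
    rewrite (_ : _ - _ = (a' + dot q (V k)) - (a' + dot q (V l)) - 3 * r ^+ 2 * (w (V k) - M - (w (V l) - M))); last by rewrite /w; ring.
    rewrite !nq !sh.
    have oor : 0 <= o <= r by rewrite o0/=; have := mulr_gt0 S0 H0; lra.
    apply: (le_trans (cube_secant oor (near_r k) (near_r l))).
    apply: ler_wpM2l; first by apply: mulr_ge0 o0; exact: mulr_ge0 (ler0n _ _) (ltW r0).
    by rewrite /w (_ : _ - _ - _ = dot g (V k) - dot g (V l)); [apply: osc; exact: VK|ring].
  have : 8 * (9 * r * o * o) <= rho * (72 * S ^+ 2 * H * r * G).
    rewrite (_ : 8 * (9 * r * o * o) = 72 * r * o * o); last by ring.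
    rewrite (_ : rho * (72 * S ^+ 2 * H * r * G) = 72 * r * o * (S * H)); last by rewrite /o; ring.
    by apply: ler_wpM2l ho; apply: mulr_ge0 o0; exact: mulr_ge0 (ler0n _ _) (ltW r0).
  move=> h1 h2; have := le_trans h2 h1; by rewrite ler_pM2l.
pose d := dot g x - dot g V0.
have dO : `|d| <= o by apply: osc => //; exact: VK.
have wE : w x = r + M + d by rewrite /r /w /d; ring.
split.
  pose ee := dot e (x - V0).
  have eO : `|ee| <= 72 * S ^+ 3 * H ^+ 2 * r.
    apply: (le_trans (dot_le _ _)).
    apply: (@le_trans _ _ (72 * S ^+ 2 * H * r * G * (S * rho))).
      by apply: ler_pM; rewrite ?sqrtr_ge0// diamK//; exact: VK.
    rewrite (_ : 72 * S ^+ 2 * H * r * G * (S * rho) = 72 * S ^+ 3 * H * r * (rho * G)); last by ring.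
    rewrite (_ : 72 * S ^+ 3 * H ^+ 2 * r = 72 * S ^+ 3 * H * r * H); last by ring.
    apply: ler_wpM2l rG; apply: mulr_ge0 (ltW r0); apply: mulr_ge0 (ltW H0).
    exact: mulr_ge0 (ler0n _ _) (exprn_ge0 _ (ltW S0)).
  have := cubic_value hc S1 KS H0 ME ho Mr dO eO.
  rewrite -wE; congr (`|_| <= _); congr (_ - _).
  have h0 := nq o3_0; rewrite sh -/V0 -/r in h0.
  by rewrite /ee -dot_subr !eE /d -[r ^+ 3]h0; ring.
have w0 : 0 <= w x <= r + 2 * M.
  by move: dO; rewrite ler_norml wE => /andP[d1 d2]; apply/andP; split; have := mulr_gt0 S0 H0; lra.
have cg := cubic_gradient hc S1 KS H0 ME w0 Mr.
have -> : dot g q = 3 * r ^+ 2 * G ^+ 2 + dot g e.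
  by rewrite GE enorm_sqr /dot/e/=; ring.
have : - (72 * S ^+ 2 * H * r * G * G) <= dot g e.
  have := dot_le g e; rewrite -GE ler_norml => /andP[+ _]; apply: le_trans; rewrite lerN2 mulrC.
  exact: ler_wpM2r.
have := ler_wpM2r (sqr_ge0 G) cg; rewrite -/C; move: (w x ^+ 2) (C * H ^+ 2) => W T.
by rewrite !mulrBl; move: (dot g e) => D; lra.
Qed.

End local_cubic.

(** If no vertex value is small, they all have the same sign since the oscillation is at most M;
    negative values are reduced to positive ones by oddness. *)
Lemma local_cubic (R : realType) (V : 'I_3 -> R * R) (Kset : set (R * R)) (c S K H M rho G : R) (g : R * R) (a : R) :
  1000 <= c -> 1 <= S -> 2 * S <= K -> 0 < H -> M = K * H -> 0 < rho -> (forall k, Kset (V k)) ->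
  (forall x y : R * R, Kset x -> Kset y -> enorm (x - y) <= S * rho) -> G = enorm g -> rho * G <= H ->
  (forall (q : R * R) (D : R), (forall k l, `|dot q (V k) - dot q (V l)| <= D) -> rho * enorm q <= 8 * D) ->
  exists (a' : R) (q : R * R), (forall k, a' + dot q (V k) = shrink M (a + dot g (V k)) ^+ 3) /\
  forall x, Kset x ->
  `|a' + dot q x - (a + dot g x) ^+ 3| <= c * S ^+ 4 * K ^+ 3 * H * (a + dot g x) ^+ 2 /\
  (a + dot g x) ^+ 2 * G ^+ 2 - c * S ^+ 4 * K ^+ 3 * H ^+ 2 * G ^+ 2 <= dot g q.
Proof.
move=> hc S1 KS H0 ME rho0 VK diamK GE rG nodal.
have [a' [q nq]] := nodal_solve rho0 nodal (fun k => shrink M (a + dot g (V k)) ^+ 3).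
exists a', q; split => //.
have M0 : 0 < M := M0 S1 KS H0 ME.
have [small|nsmall] := pselect (exists k, `|a + dot g (V k)| <= 2 * M).
  exact: (local_caseA hc S1 KS H0 ME rho0 VK diamK GE rG nodal nq small).
have big k : 2 * M < `|a + dot g (V k)| by rewrite ltNge; apply/negP => h; apply: nsmall; exists k.
have oM : 2 * (S * H) <= M by rewrite ME mulrA ler_wpM2r// ltW.
have osck k l : `|dot g (V k) - dot g (V l)| <= M.
  apply: (le_trans (osc diamK GE (VK k) (VK l))); apply: (le_trans (osc_le S1 rG)).
  by have := M0; lra.
have sgn k l : 0 < a + dot g (V k) -> 0 < a + dot g (V l).
  move=> h; have := big k; have := big l; rewrite (gtr0_norm h); have := osck k l.
  rewrite ler_norml => /andP[h1 h2] h3 h4; clear -h1 h2 h3 h4 M0.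
  by move: h3; rewrite ltNge => /negP h3; rewrite ltNge; apply/negP => h5; apply: h3; rewrite ler0_norm//; lra.
have [pos|neg] := ltP 0 (a + dot g (V o3_0)).
  have bigp k : 2 * M < a + dot g (V k) by have := big k; rewrite gtr0_norm//; exact: sgn pos.
  exact: (local_caseB hc S1 KS H0 ME rho0 VK diamK GE rG nodal nq bigp).
have neg' k : a + dot g (V k) < 0.
  rewrite lt_neqAle; apply/andP; split.
    by apply/eqP => e; have := big k; rewrite e normr0; have := M0; lra.
  by rewrite leNgt; apply/negP => /(sgn _ o3_0); rewrite ltNge neg.
pose g' : R * R := (- g.1, - g.2); pose q' : R * R := (- q.1, - q.2).
have dN (u y : R * R) : dot (- u.1, - u.2) y = - dot u y by rewrite /dot/=; ring.
have GE' : G = enorm g' by rewrite GE /enorm/g'/= !sqrrN.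
have nq' k : - a' + dot q' (V k) = shrink M (- a + dot g' (V k)) ^+ 3.
  by rewrite !dN -!opprD nq shrinkN// exprNn -signr_odd/= expr1 mulN1r.
have bigp k : 2 * M < - a + dot g' (V k).
  by rewrite dN -opprD; have := big k; rewrite ltr0_norm.
move=> x Kx; have := local_caseB hc S1 KS H0 ME rho0 VK diamK GE' rG nodal nq' bigp Kx.
rewrite !dN -!opprD exprNn -signr_odd/= expr1 mulN1r sqrrN -opprB opprK normrN addrC.
have -> : dot g q' = - dot g q by rewrite /dot/=; ring.
rewrite opprK.
done.
Qed.

(** * The discrete cube on the whole mesh *)

Section cubic_test.
Variables (R : realType) (Om : smooth_domain R).
Notation cl := (clos Om).
Notation sqn := (@sqn R Om).
Notation gsq := (@gsq R Om).

(** The mesh need not be fine: on elements of diameter at least [h0] the disc alone bounds v by the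
    threshold, the interpolant is zero there and the estimates are trivial. The vertex values of
    both kinds of elements come from the same function of v, so they can be glued. *)
Lemma cubic_test (sigma : R) : exists2 C : R, 0 < C & forall (Th : triangulation Om), regular Th sigma ->
  forall (v : R * R -> R) a b c, Vh Th v -> affine_on (Th := Th) v a b c -> forall H : R, 0 < H -> sqn v + gsq v <= H ^+ 2 ->
  exists (chi : R * R -> R) a' b' c', [/\ Vh Th chi, affine_on (Th := Th) chi a' b' c',
    forall x, cl x -> `|chi x - v x ^+ 3| <= C * H * v x ^+ 2 &
    forall i x, element (i : 'I_(nelem Th)) x ->
      v x ^+ 2 * (b i ^+ 2 + c i ^+ 2) - C * H ^+ 2 * (b i ^+ 2 + c i ^+ 2) <= b i * b' i + c i * c' i].
Proof.
have [h0 h00 nod] := nodal_gradient Om sigma.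
pose S := `|sigma| + 1.
have S1 : 1 <= S by rewrite /S lerDr.
have S0 : 0 < S := lt_le_trans ltr01 S1.
(* 2 S makes the threshold dominate twice the oscillation S H on an element. With the term 2 S / h0
   it also exceeds |v| on every element of diameter at least [h0]. *)
pose K := 2 * S / h0 + 2 * S.
have K2 : 2 * S <= K by rewrite /K lerDr divr_ge0 ?mulr_ge0 ?ltW.
have K1 : 1 <= K by lra.
pose C := 1000 * S ^+ 4 * K ^+ 3.
have SK1 : 1 <= S ^+ 4 * K ^+ 3 by apply: mulr_ege1; exact: exprn_ege1.
have KC : K ^+ 3 <= S ^+ 4 * K ^+ 3.
  by rewrite ler_peMl//; [apply: exprn_ge0; lra|exact: exprn_ege1].
exists C; first by rewrite /C -mulrA; lra.
move=> Th reg v a b c Vv av H H0 vH.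
pose M := K * H.
have s0 : 0 <= sqn v by nn.
have g0 : 0 <= gsq v by nn.
pose P (i : 'I_(nelem Th)) (acq : R * (R * R)) :=
  (forall k, acq.1 + dot acq.2 (vert i k) = shrink M (v (vert i k)) ^+ 3) /\
  forall x, element i x -> `|acq.1 + dot acq.2 x - v x ^+ 3| <= C * H * v x ^+ 2 /\
    v x ^+ 2 * (b i ^+ 2 + c i ^+ 2) - C * H ^+ 2 * (b i ^+ 2 + c i ^+ 2) <= b i * acq.2.1 + c i * acq.2.2.
have ex i : exists acq, P i acq.
  have [p [rho [r0 sub dsig]]] := reg i.
  pose g : R * R := (b i, c i).
  have rG : rho * enorm g <= H.
    rewrite -(@ler_pXn2r _ 2) ?nnegrE ?mulr_ge0 ?sqrtr_ge0 ?(ltW r0) ?(ltW H0)// exprMn enorm_sqr /g/=.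
    by apply: (le_trans (gradient_bound r0 sub Vv av)); lra.
  have diamS x y : element i x -> element i y -> enorm (x - y) <= S * rho.
    move=> Kx Ky; apply: (le_trans (diam_ge Kx Ky)); apply: (le_trans dsig); rewrite ler_wpM2r ?(ltW r0)//.
    by rewrite /S; have := ler_norm sigma; lra.
  have vE x : element i x -> v x = a i + dot g x by move=> Kx; rewrite (av i x Kx) /dot/g/= addrA.
  have [small|big] := ltP (diam (element i)) h0.
    have := @local_cubic R (vert i) (element i) 1000 S K H M rho (enorm g) g (a i) (lexx _) S1 K2 H0 erefl r0
      (vert_element i) diamS erefl rG (fun q D => nod _ i p rho D q r0 sub dsig small).
    move=> [a' [q [h1 h2]]]; exists (a', q); split.
      by move=> k; rewrite /= h1 vE//; exact: vert_element.
    by move=> x Kx; rewrite /= (vE x Kx); have := h2 x Kx; rewrite enorm_sqr.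
  have rho1 : h0 <= S * rho.
    apply: (le_trans big); apply: (le_trans dsig); rewrite ler_wpM2r ?(ltW r0)//.
    by rewrite /S; have := ler_norm sigma; lra.
  have H20 : 0 < H ^+ 2 := exprn_gt0 _ H0.
  have [y Ky hy] := value_bound r0 sub Vv H20.
  have vy : rho * `|v y| <= 2 * H.
    rewrite -(@ler_pXn2r _ 2) ?nnegrE ?mulr_ge0 ?(ltW r0) ?(ltW H0)// exprMn normr2//.
    by apply: (le_trans hy); lra.
  have vM x : element i x -> `|v x| <= M.
    move=> Kx; have d1 : `|v x - v y| <= S * H.
      rewrite (vE x Kx) (vE y Ky) opprD addrACA subrr add0r.
      have -> : dot g x - dot g y = dot g (x - y) by rewrite /dot/=; ring.
      apply: (le_trans (dot_le _ _)); apply: (@le_trans _ _ (enorm g * (S * rho))).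
        by rewrite ler_wpM2l ?sqrtr_ge0// diamS.
      by rewrite (_ : enorm g * (S * rho) = S * (rho * enorm g)); [rewrite ler_wpM2l// ltW|ring].
    have d2 : `|v y| <= 2 * S / h0 * H.
      rewrite -(ler_pM2l h00) (_ : h0 * (2 * S / h0 * H) = S * (2 * H)); last by field; rewrite gt_eqF.
      apply: (@le_trans _ _ (S * rho * `|v y|)); first by rewrite ler_wpM2r.
      by rewrite -mulrA ler_wpM2l// ltW.
    have := ler_normD (v x - v y) (v y); rewrite subrK /M /K mulrDl => h.
    have := mulr_gt0 S0 H0; lra.
  exists (0, (0, 0)); split.
    by move=> k; rewrite /= shrink_small ?expr0n/= ?mulr_gt0 ?vM//; [rewrite /dot/= !mul0r !addr0|lra|exact: vert_element].
  move=> x Kx; have := vM x Kx => vx.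
  have T0 : 0 <= S ^+ 4 * K ^+ 3 by lra.
  have KC1 : K <= C.
    by rewrite /C -mulrA; have : K <= K ^+ 3; [rewrite -{1}[K]expr1; apply: ler_weXn2l|lra].
  split; rewrite /= /dot/=.
    rewrite !mul0r !addr0 sub0r normrN normrX exprS normr2// ler_wpM2r ?sqr_ge0//.
    by apply: (le_trans vx); rewrite /M ler_wpM2r ?(ltW H0).
  rewrite !mulr0 addr0 -mulrBl mulr_le0_ge0 ?addr_ge0 ?sqr_ge0// subr_le0.
  rewrite -normr2//; apply: (@le_trans _ _ (M ^+ 2)); first by rewrite lerXn2r// nnegrE mulr_ge0// ltW// (lt_le_trans ltr01).
  rewrite /M exprMn ler_wpM2r ?sqr_ge0// /C -mulrA.
  have : K ^+ 2 <= K ^+ 3 by apply: ler_weXn2l.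
  by lra.
have [F HF] := choice ex.
have [|chi Vc ac] := @interpolant _ _ Th (fun i => (F i).1) (fun i => (F i).2.1) (fun i => (F i).2.2) (fun x => shrink M (v x) ^+ 3).
  by move=> i k; have [+ _] := HF i; move=> /(_ k); rewrite /dot addrA.
exists chi, (fun i => (F i).1), (fun i => (F i).2.1), (fun i => (F i).2.2); split => //.
  move=> x /(@cl_element _ _ Th)[i Kx]; rewrite (ac i x Kx) -[X in `|X - _|]addrA.
  by have [_ /(_ x Kx)[]] := HF i.
by move=> i x Kx; have [_ /(_ x Kx)[]] := HF i.
Qed.

End cubic_test.

(** * Moments, boundary powers and bounds for the steady state *)

Section moments.
Variables (R : realType) (Om : smooth_domain R).
Notation cl := (clos Om).
Notation vel j := (velocity (@curve _ Om j)).
Notation I := (@I R Om).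
Notation bm := (@bm R Om).
Notation PC1 := (@PC1 R Om).
Notation sqn := (@sqn R Om).
Notation gsq := (@gsq R Om).
Notation bint := (@bint R Om).
Notation cont_cl g := {within cl, continuous g}.
Implicit Types (f g h u v w : R * R -> R) (x p : R * R).

Lemma young (a b c e : R) : a ^+ 2 <= b * c -> 0 <= b -> 0 <= c -> 0 < e -> `|a| <= e * b + c / (4 * e).
Proof.
move=> abc b0 c0 e0; have s0 : 0 <= e * b + c / (4 * e) by nn.
rewrite -(@ler_pXn2r _ 2) ?nnegrE// normr2//; apply: (le_trans abc).
rewrite -subr_ge0 (_ : _ - _ = (e * b - c / (4 * e)) ^+ 2); first exact: sqr_ge0.
by field; rewrite gt_eqF.
Qed.

Lemma lem_l (a b c : R) : 0 <= a -> b <= c -> a * b <= a * c.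
Proof. by move=> a0 bc; apply: ler_wpM2l. Qed.

Lemma lem_r (a b c : R) : 0 <= a -> b <= c -> b * a <= c * a.
Proof. by move=> a0 bc; apply: ler_wpM2r. Qed.

Lemma PC1_bm v v1 v2 : PC1 v v1 v2 -> [/\ bm v, bm v1 & bm v2].
Proof. by move=> pv; split; [exact: cont_cl_bm (pc_cont pv)|exact: pc_bm1 pv|exact: pc_bm2 pv]. Qed.

Lemma sq3_le (c a b d : R) : 1 <= c -> (`|a| + c * (`|b| + `|d|)) ^+ 2 <= 3 * c ^+ 2 * (a ^+ 2 + (b ^+ 2 + d ^+ 2)).
Proof.
move=> c1; rewrite -(real_normK (num_real a)) -(real_normK (num_real b)) -(real_normK (num_real d)).
have : `|a| <= c * `|a| by rewrite ler_peMl.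
move: (normr_ge0 a) (normr_ge0 b) (normr_ge0 d); move: `|a| `|b| `|d| => A B D A0 B0 D0 h.
have c0 : 0 <= c by lra.
apply: (@le_trans _ _ ((c * A + c * (B + D)) ^+ 2)).
  by rewrite lerXn2r ?nnegrE ?addr_ge0 ?mulr_ge0 ?addr_ge0// lerD2r.
rewrite -mulrDr exprMn (_ : 3 * c ^+ 2 * (A ^+ 2 + (B ^+ 2 + D ^+ 2)) = c ^+ 2 * (3 * (A ^+ 2 + (B ^+ 2 + D ^+ 2)))); last by ring.
apply: ler_wpM2l; first exact: sqr_ge0.
have := sqr_ge0 (A - B); have := sqr_ge0 (A - D); have := sqr_ge0 (B - D); lra.
Qed.

Lemma grad_weight v v1 v2 (c : R) (k : nat) : PC1 v v1 v2 -> 1 <= c ->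
  I (fun x => `|v x| ^+ k * (`|v x| + c * (`|v1 x| + `|v2 x|))) ^+ 2 <=
  3 * c ^+ 2 * (sqn v + gsq v) * I (fun x => v x ^+ (2 * k)).
Proof.
move=> pv c1; have [bv b1 b2] := PC1_bm pv.
have bf : bm (fun x => `|v x| ^+ k) by bmt.
have bg : bm (fun x => `|v x| + c * (`|v1 x| + `|v2 x|)) by bmt.
apply: (le_trans (CS (bm_lsq bf) (bm_lsq bg))); rewrite mulrC.
have -> : sqn (fun x => `|v x| ^+ k) = I (fun x => v x ^+ (2 * k)).
  by apply: I_ext => x _; rewrite -exprM mulnC exprM normr2// -exprM.
apply: ler_wpM2r; first by apply: I_ge0 => x _; rewrite exprM exprn_ge0// sqr_ge0.
rewrite (PC1_gsq pv) -I_add; [|by bmt|by bmt].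
rewrite -I_scale; last by bmt.
by apply: I_le; [by bmt|by bmt|move=> x _; exact: sq3_le].
Qed.

(** The W^{1,1} inequality for v^(k+2): the Cauchy-Schwarz inequality separates the factor v^(k+1)
    from the gradient. *)
Lemma pow_step (k : nat) : exists2 C : R, 0 < C & forall v v1 v2, PC1 v v1 v2 ->
  I (fun x => v x ^+ (2 * k.+2)) <= C * (sqn v + gsq v) * I (fun x => v x ^+ (2 * k.+1)).
Proof.
have [C C0 HC] := sobolev_ineq Om.
have c1 : 1 <= (k.+2%:R : R) by rewrite ler1n.
exists (C * (3 * k.+2%:R ^+ 2)); first by rewrite !mulr_gt0// exprn_gt0// (lt_le_trans ltr01).
move=> v v1 v2 pv; have [bv b1 b2] := PC1_bm pv.
have := HC _ _ _ (PC1_exp k.+1 pv).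
have -> : I (fun x => (v x ^+ k.+2) ^+ 2) = I (fun x => v x ^+ (2 * k.+2)).
  by apply: I_ext => x _; rewrite -exprM mulnC.
have -> : I (fun x => `|v x ^+ k.+2| + `|k.+2%:R * v x ^+ k.+1 * v1 x| + `|k.+2%:R * v x ^+ k.+1 * v2 x|) =
    I (fun x => `|v x| ^+ k.+1 * (`|v x| + k.+2%:R * (`|v1 x| + `|v2 x|))).
  have nt (e a b : R) : 0 <= e -> `|e * a ^+ k.+1 * b| = e * `|a| ^+ k.+1 * `|b|.
    by move=> e0; rewrite normrM (normrM e) (ger0_norm e0) normrX.
  apply: I_ext => x _; rewrite !nt ?ler0n// normrX (exprSr `|v x| k.+1).
  by move: (`|v x| ^+ k.+1) (k.+2%:R : R) => a b; ring.
move=> h; apply: (le_trans h); rewrite -[leRHS]mulrA -[leRHS]mulrA ler_wpM2l ?(ltW C0)//.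
by rewrite mulrA; exact: grad_weight.
Qed.

Lemma moment (k : nat) : exists2 C : R, 0 < C & forall v v1 v2, PC1 v v1 v2 ->
  I (fun x => v x ^+ (2 * k.+1)) <= C * (sqn v + gsq v) ^+ k * sqn v.
Proof.
elim: k => [|k [C C0 HC]].
  by exists 1 => // v v1 v2 pv; rewrite expr0 !mul1r muln1.
have [D D0 HD] := pow_step k; exists (D * C); first by rewrite mulr_gt0.
move=> v v1 v2 pv; apply: (le_trans (HD _ _ _ pv)).
have s0 : 0 <= sqn v + gsq v by rewrite addr_ge0 ?sqn_ge0 ?gsq_ge0.
rewrite (_ : D * C * _ * _ = D * (sqn v + gsq v) * (C * (sqn v + gsq v) ^+ k * sqn v)); last by rewrite exprS; iring.
by apply: ler_wpM2l; [exact: mulr_ge0 (ltW D0) s0|exact: HC pv].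
Qed.

Lemma trace_pow_arith (C c S s J X : R) (m : nat) : 0 < C -> 0 <= S -> s <= S -> 0 <= X ->
  J <= C * S ^+ (2 * m) * s -> X ^+ 2 <= 3 * c ^+ 2 * S * J -> X <= (3 * c ^+ 2 * C + 1) * S ^+ m.+1.
Proof.
move=> C0 S0 sS X0 hJ hX.
have K0 : 0 <= 3 * c ^+ 2 * C by nn.
have h2 : X ^+ 2 <= (3 * c ^+ 2 * C) * (S ^+ m.+1) ^+ 2.
  apply: (le_trans hX); apply: (@le_trans _ _ (3 * c ^+ 2 * S * (C * S ^+ (2 * m) * S))).
    apply: ler_wpM2l; first by apply: mulr_ge0 S0; apply: mulr_ge0 => //; exact: sqr_ge0.
    by apply: (le_trans hJ); apply: ler_wpM2l => //; apply: mulr_ge0 (ltW C0) _; exact: exprn_ge0.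
  rewrite le_eqVlt; apply/orP; left; apply/eqP.
  by rewrite -exprM (_ : (m.+1 * 2)%N = (2 * m).+2); [rewrite !exprS; ring|rewrite mulnC mulnS].
have P0 : 0 <= S ^+ m.+1 by nn.
have K1 : 0 <= 3 * c ^+ 2 * C + 1 by nn.
rewrite -(@ler_pXn2r _ 2) ?nnegrE//; last exact: mulr_ge0.
apply: (le_trans h2); rewrite exprMn; apply: ler_wpM2r; first exact: sqr_ge0.
by move: (3 * c ^+ 2 * C) K0 => K K0; have := sqr_ge0 K; rewrite sqrrD; lra.
Qed.

(** The trace inequality for an even power of v, whose volume term is split as in [grad_weight] and
    bounded by [moment]. *)
Lemma trace_pow (m : nat) : exists2 C : R, 0 < C & forall v v1 v2, PC1 v v1 v2 ->
  bint (fun x => v x ^+ (2 * m.+1)) <= C * (sqn v + gsq v) ^+ m.+1.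
Proof.
have [T T0 HT] := trace_ineq Om; have [C C0 HC] := moment (2 * m)%N.
pose c : R := (2 * m.+1)%:R.
have c1 : 1 <= c by rewrite /c ler1n.
exists (T * (3 * c ^+ 2 * C + 1)); first by rewrite mulr_gt0// ltr_wpDl// !mulr_ge0 ?sqr_ge0 ?(ltW C0).
move=> v v1 v2 pv; have [bv b1 b2] := PC1_bm pv.
have s0 : 0 <= sqn v + gsq v by rewrite addr_ge0 ?sqn_ge0 ?gsq_ge0.
have e0 x : 0 <= v x ^+ (2 * m.+1) by rewrite exprM exprn_ge0// sqr_ge0.
have pw : PC1 (fun x => v x ^+ (2 * m.+1)) (fun x => c * v x ^+ (2 * m).+1 * v1 x) (fun x => c * v x ^+ (2 * m).+1 * v2 x).
  have := PC1_exp (2 * m).+1 pv; rewrite (_ : (2 * m).+2 = (2 * m.+1)%N); last by rewrite mulnS.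
  by [].
apply: (le_trans (HT _ _ _ pw (fun x _ => e0 x))); rewrite -mulrA; apply: ler_wpM2l; first exact: ltW.
have -> : I (fun x => `|v x ^+ (2 * m.+1)| + `|c * v x ^+ (2 * m).+1 * v1 x| + `|c * v x ^+ (2 * m).+1 * v2 x|) =
    I (fun x => `|v x| ^+ (2 * m).+1 * (`|v x| + c * (`|v1 x| + `|v2 x|))).
  apply: I_ext => x _; rewrite !normrM !normrX (ger0_norm (le_trans ler01 c1)) mulnS add2n (exprSr `|v x| (2 * m).+1).
  by move: (`|v x| ^+ (2 * m).+1) => a; ring.
set X := I _; have X0 : 0 <= X by apply: I_ge0 => x _; rewrite mulr_ge0 ?exprn_ge0// addr_ge0 ?mulr_ge0 ?addr_ge0// (le_trans ler01).
have := grad_weight (2 * m).+1 pv c1; rewrite -/X.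
have := HC _ _ _ pv; move: (I (fun x => v x ^+ (2 * (2 * m).+1))) => J hJ hX.
have sE : sqn v <= sqn v + gsq v by rewrite lerDl gsq_ge0.
exact: trace_pow_arith C0 s0 sE X0 hJ hX.
Qed.

(** 3/2 is a rational bound for sqrt 2, the length of (1, 1). *)
Lemma flux_bound g : cont_cl g -> `|flux Om o3_2 g| <= 3 / 2 * bint (fun x => `|g x|).
Proof.
move=> cg; rewrite /flux /Defs.bint mulr_sumr; apply: (le_trans (ler_norm_sum _ _ _)); apply: ler_sum => j _.
have cn : cont_cl (fun x => `|g x|) by move=> x; apply: cvg_norm; exact: cg.
have ia := bint_integrable j cn.
have ig := flux_integrable o3_2 j cg.
rewrite -RintegralZl; [|exact: measurable_itv|exact: ia].
apply: (le_trans (le_normr_Rintegral _ ig)) => //; apply: le_Rintegral => //.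
- exact: integrable_norm ig.
- exact: (integrableZl _ (3 / 2) ia).
move=> s _; rewrite normrM [leRHS]mulrCA; apply: ler_wpM2l => //.
move: (vel j s) => V; rewrite /tcoor/dsgn/= mul1r; have e0 : 0 <= enorm V := sqrtr_ge0 _.
rewrite -(@ler_pXn2r _ 2) ?nnegrE ?mulr_ge0// exprMn normr2// enorm_sqr.
by have := sqr_ge0 (V.2 + V.1); have := sqr_ge0 V.1; have := sqr_ge0 V.2; lra.
Qed.

Lemma green_bound g g1 g2 : PC1 g g1 g2 -> `|I (fun x => g1 x + g2 x)| <= 3 / 2 * bint (fun x => `|g x|).
Proof.
move=> pg; rewrite (_ : I _ = I (dk o3_2 g1 g2)); last by apply: I_ext => x _; rewrite /dk/dirv/= !mulr1.
by rewrite (green _ pg); exact: flux_bound (pc_cont pg).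
Qed.

Lemma PC1_sq_gsq v v1 v2 : PC1 v v1 v2 -> gsq (fun x => v x ^+ 2) = 4 * I (fun x => v x ^+ 2 * (v1 x ^+ 2 + v2 x ^+ 2)).
Proof.
move=> pv; have [bv b1 b2] := PC1_bm pv; rewrite (PC1_gsq (PC1_exp 1 pv)) -I_scale; last by bmt.
by apply: I_ext => x _; rewrite expr1; ring.
Qed.

Lemma sqn_le f g : bm f -> bm g -> (forall x, dom Om x -> f x ^+ 2 <= g x) -> sqn f <= I g.
Proof. by move=> bf bg fg; apply: I_le => //; bmt. Qed.

Lemma sqn_sub f g : bm f -> bm g -> sqn (fun x => f x - g x) <= 2 * sqn f + 2 * sqn g.
Proof.
move=> bf bg; rewrite -I_scale; [|by bmt]; rewrite -I_scale; [|by bmt]; rewrite -I_add; [|by bmt|by bmt].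
by apply: sqn_le; [by bmt|by bmt|move=> x _; have := sqr_ge0 (f x + g x); lra].
Qed.

Lemma gsq_ext u v : (forall x, dom Om x -> u x = v x) -> wd Om 1 0 u = wd Om 1 0 v /\ wd Om 0 1 u = wd Om 0 1 v.
Proof.
move=> uv; have H a b : wd Om a b u = wd Om a b v.
  rewrite -wdE /wderiv; congr (xget _ _); apply/seteqP; split => g [l2 h]; split => // phi tp.
    by rewrite -h// !innerE; apply: I_ext => x Ox; rewrite uv.
  by rewrite -h// !innerE; apply: I_ext => x Ox; rewrite uv.
by [].
Qed.

Variables (sigma : R).

(** The gradient of v^2 carries the weight 4 v^2, so the elementwise bound of [cubic_test]
    integrates to an estimate of w grad w by a single test of the equation. *)
Lemma quartic_test : exists2 C : R, 0 < C & forall (Th : triangulation Om), regular Th sigma ->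
  forall v, Vh Th v -> forall H : R, 0 < H -> sqn v + gsq v <= H ^+ 2 ->
  exists chi, [/\ Vh Th chi, gsq (fun x => v x ^+ 2) <= 4 * grad_inner Om v chi + C * H ^+ 2 * gsq v,
    sqn chi <= C * H ^+ 4 * sqn v, sqn (fun x => chi x - v x ^+ 3) <= C * H ^+ 4 * sqn v &
    forall x, cl x -> `|chi x - v x ^+ 3| <= C * H * v x ^+ 2].
Proof.
have [C C0 HC] := cubic_test Om sigma.
have [C2 C20 H2] := moment 1; have [C3 C30 H3] := moment 2.
pose c2 := C ^+ 2 * C2; have cc : 0 < c2 by rewrite mulr_gt0// exprn_gt0.
pose D := 5 * C + 3 * c2 + 2 * C3.
have D0 : 0 < D by nn.
have D1 : 4 * C <= D by rewrite /D; clearbody c2; lra.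
have D2 : 2 * c2 + 2 * C3 <= D by rewrite /D; clearbody c2; lra.
have D3 : c2 <= D by rewrite /D; clearbody c2; lra.
have D4 : C <= D by rewrite /D; clearbody c2; lra.
exists D => //; clearbody D.
move=> Th reg v Vv H H0 vH; have [a [b [c av]]] := Vh_affine Vv.
have [chi [a' [b' [c' [Vc ac vc gc]]]]] := HC Th reg v a b c Vv av H H0 vH.
have pv := Vh_PC1 Vv av; have pc := Vh_PC1 Vc ac.
have [bv b1 b2] := PC1_bm pv; have [bc b3 b4] := PC1_bm pc.
have s0 : 0 <= sqn v := sqn_ge0 _ _; have g0 : 0 <= gsq v := gsq_ge0 _ _.
have S0 : 0 <= sqn v + gsq v by rewrite addr_ge0.
have J2 : I (fun x => v x ^+ 4) <= C2 * H ^+ 2 * sqn v.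
  apply: (le_trans (H2 _ _ _ pv)); rewrite expr1; apply: lem_r => //; exact: lem_l (ltW C20) vH.
have J3 : I (fun x => v x ^+ 6) <= C3 * H ^+ 4 * sqn v.
  apply: (le_trans (H3 _ _ _ pv)); apply: lem_r => //; apply: lem_l (ltW C30) _.
  by rewrite (exprM H 2 2) lerXn2r// nnegrE// sqr_ge0.
have r3 : sqn (fun x => chi x - v x ^+ 3) <= C ^+ 2 * H ^+ 2 * I (fun x => v x ^+ 4).
  rewrite -I_scale; last by bmt.
  apply: sqn_le; [by bmt|by bmt|move=> x Ox; have := vc x (dom_cl Ox) => h].
  rewrite -[leLHS]normr2// (_ : C ^+ 2 * H ^+ 2 * v x ^+ 4 = (C * H * v x ^+ 2) ^+ 2); last by ring.
  by rewrite lerXn2r// nnegrE; apply: mulr_ge0 (sqr_ge0 _); exact: mulr_ge0 (ltW C0) (ltW H0).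
have HH : 0 <= H ^+ 4 * sqn v by nn.
have r4 : sqn (fun x => chi x - v x ^+ 3) <= C ^+ 2 * C2 * (H ^+ 4 * sqn v).
  apply: (le_trans r3); rewrite (_ : C ^+ 2 * C2 * _ = C ^+ 2 * H ^+ 2 * (C2 * H ^+ 2 * sqn v)); last by iring.
  by apply: ler_wpM2l J2; rewrite mulr_ge0 ?sqr_ge0.
exists chi; split => //.
- rewrite (PC1_sq_gsq pv) (PC1_grad_inner pv pc) (PC1_gsq pv).
  have : I (fun x => v x ^+ 2 * (pw b x ^+ 2 + pw c x ^+ 2)) <=
      I (fun x => (pw b x * pw b' x + pw c x * pw c' x) + C * H ^+ 2 * (pw b x ^+ 2 + pw c x ^+ 2)).
    apply: I_le; [by bmt|by bmt|move=> x Ox].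
    have [i fi] := first_in_cover Th (dom_cl Ox); rewrite !(pwE _ fi).
    by have [Kx _] := fi; have := gc i x Kx; lra.
  rewrite I_add; [|by bmt|by bmt]; rewrite I_scale; last by bmt.
  have g0' : 0 <= H ^+ 2 * I (fun x => pw b x ^+ 2 + pw c x ^+ 2).
    by rewrite mulr_ge0 ?sqr_ge0// -(PC1_gsq pv).
  rewrite -(mulrA C) -(mulrA D); move: g0'; move: (H ^+ 2 * I _) => G G0 h.
  by have h1 := ler_wpM2r G0 D1; clear -h h1; ilra.
- have : sqn chi <= 2 * sqn (fun x => chi x - v x ^+ 3) + 2 * I (fun x => v x ^+ 6).
    rewrite -I_scale; [|by bmt]; rewrite -I_scale; [|by bmt]; rewrite -I_add; [|by bmt|by bmt].
    by apply: sqn_le; [by bmt|by bmt|move=> x _; have := sqr_ge0 (chi x - 2 * v x ^+ 3); lra].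
  rewrite -(mulrA D); rewrite -(mulrA C3) in J3; have h1 := ler_wpM2r HH D2.
  rewrite -/c2 in r4; clearbody c2; move: J3 r4 HH h1; clear; move: (H ^+ 4 * sqn v) => X J3 r4 HH h1 h; ilra.
- by apply: (le_trans r4); rewrite -(mulrA D); exact: ler_wpM2r.
- move=> x clx; apply: (le_trans (vc x clx)); apply: lem_r (sqr_ge0 _) _.
  by apply: lem_r D4; exact: ltW.
Qed.

Lemma mean_split f : bm f -> sqn (fun x => f x - I f / I (fun=> 1)) = sqn f - (I f / I (fun=> 1)) ^+ 2 * I (fun=> 1).
Proof.
move=> bf; set m := _ / _; have A0 := area_pos Om.
have mE : I f = m * I (fun=> 1) by rewrite /m divfK// gt_eqF.
have -> : sqn (fun x => f x - m) = I (fun x => f x ^+ 2 + (- 2 * m) * f x + m ^+ 2 * 1).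
  by apply: I_ext => x _; ring.
rewrite I_add; [|by bmt|by bmt]; rewrite I_add; [|by bmt|by bmt]; rewrite I_scale; [|by bmt].
rewrite I_scale; [|by bmt]; rewrite mE -/(sqn f) /=; move: (sqn f) (I (fun=> 1)) => a b; ring.
Qed.

(* The trilinear term of a steady state tested with u^3 is a boundary integral. *)
Lemma steady_bounds (N nu : R) f : N%:E = maxe (N1 Om) (N2 Om) -> 0 < nu -> L2 Om f ->
  exists2 Q : R, 1 <= Q & forall (Th : triangulation Om) uh, regular Th sigma ->
  disc_steady_state Th nu f uh -> grad_norm Om uh <= nu / (4 * N) ->
  [/\ sqn uh + gsq uh <= Q, gsq (fun x => uh x ^+ 2) <= Q &
    forall chi, Vh Th chi -> grad_inner Om uh chi ^+ 2 <= Q * sqn chi].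
Proof.
move=> hN nu0 /L2P lf; have [N0 [P P0 HP]] := poincare hN.
have [C C0 HC] := quartic_test; have [T2 T20 HT2] := trace_pow 1; have [T3 T30 HT3] := trace_pow 2.
pose G := (nu / (4 * N)) ^+ 2; have G0 : 0 <= G := sqr_ge0 _.
pose H2 := P * G + G + 1; have H21 : 1 <= H2 by rewrite /H2 lerDr addr_ge0// mulr_ge0// ltW.
have H20 : 0 <= H2 by nn.
pose Hr := Num.sqrt H2; have Hr0 : 0 < Hr by rewrite sqrtr_gt0 (lt_le_trans ltr01).
have HrE : Hr ^+ 2 = H2 by rewrite sqr_sqrtr.
have F0 : 0 <= sqn f := sqn_ge0 _ _.
pose B := T2 * H2 ^+ 2 + T3 * H2 ^+ 3.
pose c3 := C * H2 ^+ 2 * H2.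
pose X0 := 2 / nu * (4 * (sqn f + c3) + 4 * B + 16 / nu * c3 + nu * (C * H2 ^+ 2)).
have c30 : 0 <= c3 by nn.
have B0 : 0 <= B by nn.
have cH0 : 0 <= C * H2 ^+ 2 := mulr_ge0 (ltW C0) (sqr_ge0 _).
have X00 : 0 <= X0.
  apply: mulr_ge0; first by apply: divr_ge0 => //; exact: ltW.
  have h1 : 0 <= 16 / nu * c3 by nn.
  have h2 := mulr_ge0 (ltW nu0) cH0; have h3 : 0 <= 4 * (sqn f + c3) by apply: mulr_ge0 => //; exact: addr_ge0.
  by apply: addr_ge0 => //; apply: addr_ge0 => //; apply: addr_ge0 => //; exact: mulr_ge0.
pose Q1 := (2 * sqn f + X0) / nu ^+ 2.
have Q10 : 0 <= Q1 by nn.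
exists (H2 + Q1 + X0); first by clearbody H2 Q1 X0; lra.
move=> Th uh reg [Vu [su u0] st] gu.
have [a [b [c au]]] := Vh_affine Vu; have pu := Vh_PC1 Vu au.
move: (pw b) (pw c) pu => g1 g2 pu {a b c au}; have [bu b1 b2] := PC1_bm pu.
have gG : gsq uh <= G.
  by rewrite -grad_norm_sq /G lerXn2r ?nnegrE ?grad_norm_ge0// divr_ge0 ?mulr_ge0// ltW.
have sG : sqn uh <= P * G by apply: (le_trans (HP _ (conj su u0))); exact: lem_l (ltW P0) gG.
have s0 : 0 <= sqn uh := sqn_ge0 _ _; have g0 : 0 <= gsq uh := gsq_ge0 _ _.
have uH : sqn uh + gsq uh <= H2 by rewrite /H2; move: (P * G) sG => PG sG; ilra.
have uS : 0 <= sqn uh + gsq uh by rewrite addr_ge0.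
have sH : sqn uh <= H2 by apply: le_trans uH; rewrite lerDl.
have gH : gsq uh <= H2 by apply: le_trans uH; rewrite lerDr.
have lf1 := lf; have [mf _] := lf.
(* The steady equation is tested with functions of zero mean only; subtracting the mean leaves the
   gradient unchanged and does not increase the L^2 norm. *)
pose m chi := I chi / I (fun=> 1); pose chi0 (chi : R * R -> R) x := chi x - m chi.
have A0 := area_pos Om.
have test chi : Vh Th chi -> nu * grad_inner Om uh chi = I (fun x => f x * chi0 chi x) - I (fun x => uh x * (g1 x + g2 x) * chi0 chi x).
  move=> Vc; have [h1 [h2 pc]] := Vh_PC1_ex Vc; have pc0 := PC1_sub pc (PC1_cst Om (m chi)).
  have [bc _ _] := PC1_bm pc.
  have V0 : Vh Th (chi0 chi).
    have := Vh_lin (- m chi) Vc (Vh_cst Th 1); congr Vh; by apply/funext => x; rewrite mulr1.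
  have Q0 : H1quot Om (chi0 chi).
    split; first exact: PC1_sobolev pc0.
    change (I (chi0 chi) = 0); rewrite /chi0 I_sub; [|by bmt|by bmt].
    rewrite (_ : I (fun=> m chi) = m chi * I (fun=> 1)); first by rewrite /m divfK ?subrr// gt_eqF.
    by rewrite -I_scale; [apply: I_ext => x _; rewrite mulr1|by bmt].
  have := st _ V0 Q0; rewrite innerE => <-.
  rewrite (PC1_trilinear _ _ pu); [|by case: bu|by have [[]] := PC1_bm pc0].
  have E1 := PC1_grad_inner pu pc.
  have E2 : grad_inner Om uh (chi0 chi) = I (fun x => g1 x * (h1 x - 0) + g2 x * (h2 x - 0)) := PC1_grad_inner pu pc0.
  rewrite addrK E1 E2; congr (_ * _); apply: I_ext => x _; by rewrite !subr0.
have bc0 chi : Vh Th chi -> bm (chi0 chi).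
  by move=> [cc _]; have := cont_cl_bm cc => bc; rewrite /chi0; bmt.
have sc0 chi : Vh Th chi -> sqn (chi0 chi) <= sqn chi.
  move=> [cc _]; have bc := cont_cl_bm cc; rewrite /chi0 /m mean_split// lerBlDr lerDl.
  by apply: mulr_ge0 (sqr_ge0 _) (ltW A0).
pose X := gsq (fun x => uh x ^+ 2).
have bug : bm (fun x => uh x * (g1 x + g2 x)) by bmt.
have sX : sqn (fun x => uh x * (g1 x + g2 x)) <= X / 2.
  rewrite /X (PC1_sq_gsq pu) (_ : 4 * I _ / 2 = 2 * I (fun x => uh x ^+ 2 * (g1 x ^+ 2 + g2 x ^+ 2))); last by gen_integrals; field.
  rewrite -I_scale; last by bmt.
  apply: sqn_le; [by bmt|by bmt|move=> x _].
  rewrite exprMn [leRHS]mulrCA; apply: lem_l (sqr_ge0 _) _; have := sqr_ge0 (g1 x - g2 x); lra.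
have Xge : 0 <= X := gsq_ge0 _ _.
have XX0 : X <= X0.
  have [|chi [Vc t1 t2 t3 _]] := HC Th reg uh Vu Hr Hr0; first by rewrite HrE.
  rewrite HrE in t1; rewrite (exprM Hr 2 2) HrE in t2 t3.
  have [h1 [h2 pc]] := Vh_PC1_ex Vc; have [bc _ _] := PC1_bm pc.
  have sc3 : sqn chi <= c3 by apply: (le_trans t2); exact: lem_l.
  have sr3 : sqn (fun x => chi x - uh x ^+ 3) <= c3 by apply: (le_trans t3); exact: lem_l.
  have T := test chi Vc.
  have i1 : `|I (fun x => f x * chi0 chi x)| <= sqn f + c3.
    have l0 := bm_lsq (bc0 _ Vc).
    have h := CS lf1 l0; have := young h (sqn_ge0 _ _) (sqn_ge0 _ _) ltr01; rewrite mul1r mulr1 => h'.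
    by apply: (le_trans h'); rewrite lerD2l; have := sc0 chi Vc; have := sqn_ge0 Om (chi0 chi); clear -sc3; ilra.
  (* The test function is u^3 plus a remainder. Against u^3 the convection is a derivative of u^5/5,
     hence a boundary term; the remainder is of lower order. *)
  have E : I (fun x => uh x * (g1 x + g2 x) * chi0 chi x) =
     I (fun x => uh x ^+ 4 * (g1 x + g2 x)) + I (fun x => (uh x * (g1 x + g2 x)) * ((chi x - uh x ^+ 3) - m chi)).
    by rewrite -I_add; [apply: I_ext => x _; rewrite /chi0; ring|by bmt|by bmt].
  have i2 : `|I (fun x => uh x ^+ 4 * (g1 x + g2 x))| <= B.
    have p5 := PC1_exp 4 pu; have := green_bound p5.
    have -> : I (fun x => 5%:R * uh x ^+ 4 * g1 x + 5%:R * uh x ^+ 4 * g2 x) = 5 * I (fun x => uh x ^+ 4 * (g1 x + g2 x)).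
      by rewrite -I_scale; [apply: I_ext => x _; ring|by bmt].
    rewrite normrM (ger0_norm (ler0n _ 5)) => h.
    have c2 := pc_cont (PC1_exp 3 pu); have c4 := pc_cont (PC1_exp 5 pu).
    have cn : cont_cl (fun x => `|uh x ^+ 5|) by move=> x; apply: cvg_norm; exact: (pc_cont p5).
    have h2' : bint (fun x => `|uh x ^+ 5|) <= bint (fun x => uh x ^+ 4) + bint (fun x => uh x ^+ 6).
      rewrite -bint_add; [|exact: cont_bintg|exact: cont_bintg].
      apply: bint_le; [exact: cont_bintg|apply: bintg_add; exact: cont_bintg|move=> x _].
      have h3 : 0 <= (uh x ^+ 2) ^+ 2 * (1 - `|uh x|) ^+ 2 by nn.
      have := sqr_ge0 (uh x ^+ 2); have := sqr_ge0 (uh x ^+ 3).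
      rewrite normrX; move: h3; have -> : uh x ^+ 6 = (uh x ^+ 2) ^+ 3 by ring.
      have -> : (uh x ^+ 3) ^+ 2 = (uh x ^+ 2) ^+ 3 by ring.
      have -> : uh x ^+ 4 = (uh x ^+ 2) ^+ 2 by ring.
      by rewrite -(real_normK (num_real (uh x))); move: `|uh x| => t; lra.
    have b4 : bint (fun x => uh x ^+ 4) <= T2 * H2 ^+ 2.
      by apply: (le_trans (HT2 _ _ _ pu)); apply: lem_l (ltW T20) _; rewrite lerXn2r ?nnegrE.
    have b6 : bint (fun x => uh x ^+ 6) <= T3 * H2 ^+ 3.
      by apply: (le_trans (HT3 _ _ _ pu)); apply: lem_l (ltW T30) _; rewrite lerXn2r ?nnegrE.
    rewrite /B; move: (T2 * H2 ^+ 2) (T3 * H2 ^+ 3) b4 b6 => B4 B6 b4 b6.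
    have n0 := normr_ge0 (I (fun x => uh x ^+ 4 * (g1 x + g2 x))).
    have n1 : 0 <= bint (fun x => `|uh x ^+ 5|) by apply: bint_ge0 => x _.
    have h3 : 5 * `|I (fun x => uh x ^+ 4 * (g1 x + g2 x))| <= 3 / 2 * bint (fun x => `|uh x ^+ 5|) := h.
    clear -h3 h2' b4 b6 n0 n1; gen_integrals; lra.
  have i3 : `|I (fun x => (uh x * (g1 x + g2 x)) * ((chi x - uh x ^+ 3) - m chi))| <= nu / 8 * X + 4 / nu * c3.
    have br : bm (fun x => (chi x - uh x ^+ 3) - m chi) by bmt.
    have h := CS (bm_lsq bug) (bm_lsq br).
    have sr : sqn (fun x => (chi x - uh x ^+ 3) - m chi) <= 4 * c3.
      have := @sqn_sub (fun x => chi x - uh x ^+ 3) (fun=> m chi) ltac:(bmt) ltac:(bmt).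
      have -> : sqn (fun=> m chi) = m chi ^+ 2 * I (fun=> 1) by rewrite -I_scale; [apply: I_ext => x _; rewrite mulr1|bmt].
      have : m chi ^+ 2 * I (fun=> 1) <= sqn chi.
        by have := mean_split bc; have := sqn_ge0 Om (fun x => chi x - I chi / I (fun=> 1)); rewrite /m => q1 q2; rewrite q2 subr_ge0 in q1.
      by move=> q1 q2; clear -q1 q2 sc3 sr3; move: (m chi ^+ 2 * _) q1 q2 => M q1 q2; ilra.
    have h2' : I (fun x => (uh x * (g1 x + g2 x)) * ((chi x - uh x ^+ 3) - m chi)) ^+ 2 <= X * (2 * c3).
      apply: (le_trans h); rewrite (_ : X * (2 * c3) = X / 2 * (4 * c3)); last by field.
      by apply: ler_pM => //; exact: sqn_ge0.
    have e0 : 0 < nu / 8 by nn.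
    have := young h2' Xge (mulr_ge0 (ler0n _ _) c30) e0; rewrite (_ : 2 * c3 / (4 * (nu / 8)) = 4 / nu * c3)//.
    by field; rewrite gt_eqF.
  have Cg : C * H2 * gsq uh <= C * H2 ^+ 2.
    by rewrite expr2 mulrA; apply: lem_l gH; exact: mulr_ge0 (ltW C0) H20.
  rewrite E in T; rewrite -/X in t1.
  (* Half of [nu * X] is absorbed on the left, and solving for X gives the constant [X0]. *)
  have nX : nu * X <= 4 * (sqn f + c3) + 4 * B + nu / 2 * X + 16 / nu * c3 + nu * (C * H2 ^+ 2).
    have t1' := lem_l (ltW nu0) t1.
    rewrite (_ : nu * (4 * grad_inner Om uh chi + C * H2 * gsq uh) = 4 * (nu * grad_inner Om uh chi) + nu * (C * H2 * gsq uh)) in t1'; last by iring.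
    rewrite T in t1'; move: t1'.
    have := lem_l (ltW nu0) Cg.
    rewrite (_ : 16 / nu * c3 = 4 * (4 / nu * c3)); last by ring.
    rewrite (_ : nu / 2 * X = 4 * (nu / 8 * X)); last by field.
    move: i1 i2 i3; rewrite !ler_norml => /andP[_ i1] /andP[i2 _] /andP[i3 _].
    move: (nu * (C * H2 ^+ 2)) (nu * (C * H2 * gsq uh)) (nu / 8 * X) (4 / nu * c3) (nu * X) i3 => q1 q2 q3 q4 q5 i3 q6 q7.
    clear -i1 i2 i3 q6 q7; clearbody c3 B; gen_integrals; lra.
  rewrite /X0 -(@ler_pM2l _ (nu / 2)) ?divr_gt0//.
  set Z := (X in 2 / nu * X); rewrite (_ : nu / 2 * (2 / nu * Z) = Z); last by field; rewrite gt_eqF.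
  rewrite /Z.
  rewrite (_ : nu / 2 * X = nu * X - nu / 2 * X); last by field.
  by clear -nX; move: (nu / 2 * X) (16 / nu * c3) (nu * (C * H2 ^+ 2)) (nu * X) nX => q1 q2 q3 q4 nX; clearbody c3 B; gen_integrals; lra.
split.
- by clear -uH Q10 X00; clearbody Q1 X0; ilra.
- by apply: (le_trans XX0); clear -Q10 H20; clearbody Q1 X0 H2; lra.
move=> chi Vc; have T := test chi Vc.
have l0 := bm_lsq (bc0 _ Vc).
have q1 := CS lf1 l0; have q2 := CS (bm_lsq bug) l0.
have sc := sc0 chi Vc; have sc1 : 0 <= sqn (chi0 chi) := sqn_ge0 _ _.
have k1 : I (fun x => f x * chi0 chi x) ^+ 2 <= sqn f * sqn chi by apply: (le_trans q1); exact: lem_l.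
have k2 : I (fun x => uh x * (g1 x + g2 x) * chi0 chi x) ^+ 2 <= X0 / 2 * sqn chi.
  apply: (le_trans q2); apply: ler_pM => //; first exact: sqn_ge0.
  by apply: (le_trans sX); apply: lem_r.
have : (nu * grad_inner Om uh chi) ^+ 2 <= (2 * sqn f + X0) * sqn chi.
  rewrite T; move: k1 k2; move: (I (fun x => f x * chi0 chi x)) (I (fun x => uh x * _ * chi0 chi x)) => p q k1 k2.
  have := sqr_ge0 (p + q); clear -k1 k2; clearbody X0; gen_integrals; lra.
rewrite exprMn mulrC -ler_pdivlMr ?exprn_gt0// => h.
apply: (le_trans h); rewrite mulrAC -/Q1; apply: lem_r; first exact: sqn_ge0.
by clear -X00 H20; clearbody Q1 X0 H2; lra.
Qed.

End moments.

(* A record, so that unification does not unfold the subspace topology. *)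
Record CC (R : realType) (A : set (R * R)) (g : R * R -> R) : Prop := MkCC { CCc : {within A, continuous g} }.

Section continuity.
Variables (R : realType) (A : set (R * R)).
Notation cc := (@CC R A).
Implicit Types f g : R * R -> R.

Lemma cc_cst (c : R) : cc (fun=> c).
Proof. by split => x; exact: cvg_cst. Qed.

Lemma cc_add f g : cc f -> cc g -> cc (fun x => f x + g x).
Proof. by move=> [cf] [cg]; split => x; apply: cvgD; [exact: cf|exact: cg]. Qed.

Lemma cc_mul f g : cc f -> cc g -> cc (fun x => f x * g x).
Proof. by move=> [cf] [cg]; split => x; apply: cvgM; [exact: cf|exact: cg]. Qed.

Lemma cc_norm f : cc f -> cc (fun x => `|f x|).
Proof. by move=> [cf]; split => x; apply: cvg_norm; exact: cf. Qed.

Lemma cc_opp f : cc f -> cc (fun x => - f x).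
Proof. by move=> [cf]; split => x; apply: cvgN; exact: cf. Qed.

Lemma cc_exp f n : cc f -> cc (fun x => f x ^+ n).
Proof.
move=> cf; elim: n => [|n IH]; first exact: cc_cst.
by under eq_fun do rewrite exprS; exact: cc_mul.
Qed.

Lemma cc_feedback (c0 nu : R) f g : cc f -> cc g -> cc (fun x => feedback c0 nu (f x) (g x)).
Proof.
move=> cf cg; rewrite /feedback; apply: cc_add; apply: cc_mul => //; last exact: cc_exp.
- by apply: cc_add; [exact: cc_cst|apply: cc_mul; [exact: cc_cst|exact: cc_norm]].
- exact: cc_cst.
Qed.

End continuity.

Lemma cc_bintg (R : realType) (Om : smooth_domain R) (g : R * R -> R) : CC (closure (Om : set (R * R))) g -> bintg Om g.
Proof. by move=> [cg]; exact: cont_bintg. Qed.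

Ltac cct := repeat first [assumption | apply: cc_cst | apply: cc_feedback | apply: cc_add | apply: cc_mul | apply: cc_exp | apply: cc_norm | apply: cc_opp].
Ltac cbt := apply: cc_bintg; cct.

(** * Pointwise inequalities for the feedback *)

Section pointwise.
Variable R : realType.
Implicit Types a b c d k t w r : R.

Lemma sixth a b : 0 <= a -> 0 <= b -> (a + b) ^+ 6 <= 2 ^+ 6 * (a ^+ 6 + b ^+ 6).
Proof.
move=> a0 b0; pose m := Num.max a b.
have m0 : 0 <= m by rewrite le_max a0.
apply: (@le_trans _ _ ((2 * m) ^+ 6)).
  rewrite lerXn2r// ?nnegrE ?addr_ge0 ?mulr_ge0//.
  have : a <= m by rewrite le_max lexx. have : b <= m by rewrite le_max lexx orbT. lra.
rewrite exprMn; apply: lem_l; first exact: exprn_ge0.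
have a6 : 0 <= a ^+ 6 by nn.
have b6 : 0 <= b ^+ 6 by nn.
rewrite /m; case: (leP a b) => _; lra.
Qed.

(** The feedback factors as (A + c w^2) w, and - w^4 - w r <= (k^2/4) w^2 by completing the square
    in |w|. *)
Lemma self_pointwise (A c k w r : R) : 0 <= A -> 0 <= c -> 0 <= k -> `|r| <= k * w ^+ 2 ->
  - ((A * w + c * w ^+ 3) * (w ^+ 3 + r)) <= k ^+ 2 / 4 * (A * w ^+ 2 + c * w ^+ 4).
Proof.
move=> A0 c0 k0 hr; pose s := `|w|; have s0 : 0 <= s by exact: normr_ge0.
have w2 : w ^+ 2 = s ^+ 2 by rewrite real_normK ?num_real.
have h1 : - (w * r) <= k * s ^+ 3.
  have : `|w * r| <= s * (k * s ^+ 2) by rewrite normrM -w2; exact: lem_l.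
  rewrite ler_norml => /andP[h _]; rewrite exprS; lra.
have h2 : - w ^+ 4 - w * r <= k ^+ 2 / 4 * w ^+ 2.
  have -> : w ^+ 4 = s ^+ 4 by rewrite (exprM w 2 2) w2 -exprM.
  rewrite w2; have : 0 <= s ^+ 2 * (s - k / 2) ^+ 2 by rewrite mulr_ge0 ?sqr_ge0.
  lra.
have -> : - ((A * w + c * w ^+ 3) * (w ^+ 3 + r)) = (A + c * w ^+ 2) * (- w ^+ 4 - w * r) by ring.
have -> : k ^+ 2 / 4 * (A * w ^+ 2 + c * w ^+ 4) = (A + c * w ^+ 2) * (k ^+ 2 / 4 * w ^+ 2) by ring.
by apply: lem_l h2; rewrite addr_ge0// mulr_ge0// sqr_ge0.
Qed.

(** Both factors are at most cubic in 1 + |u| + |q| + |v|, so the product is controlled by sixth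
    powers, which [trace_pow] bounds. *)
Lemma mixed_pointwise (A c D u q v chi : R) : 0 <= A -> 0 <= c -> 0 <= D -> `|chi| <= `|v| ^+ 3 + D * v ^+ 2 ->
  `|((A + 2 * `|u|) * q + c * q ^+ 3) * chi| <=
  (A + 2 + c) * (1 + D) * (2 ^+ 6 * 2 ^+ 6) * ((1 + u ^+ 6) + (q ^+ 6 + v ^+ 6)).
Proof.
move=> A0 c0 D0 hc; have e6 (y : R) : y ^+ 6 = `|y| ^+ 6 by rewrite (exprM y 2 3) -[y ^+ 2]normr2// -exprM.
rewrite (e6 u) (e6 q) (e6 v); have v2 : v ^+ 2 = `|v| ^+ 2 by rewrite real_normK ?num_real.
rewrite v2 in hc; rewrite normrM.
have fb0 := normr_ge0 ((A + 2 * `|u|) * q + c * q ^+ 3).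
have h1 : `|(A + 2 * `|u|) * q + c * q ^+ 3| <= (A + 2 * `|u|) * `|q| + c * `|q| ^+ 3.
  apply: (le_trans (ler_normD _ _)); rewrite normrM [X in _ + X]normrM normrX (ger0_norm c0) ger0_norm//.
  by rewrite addr_ge0// mulr_ge0.
move: hc h1 fb0 (normr_ge0 u) (normr_ge0 q) (normr_ge0 v); move: `|_ + _| => fb.
move: `|u| `|q| `|v| => U Q V hc h1 fb0 U0 Q0 V0; pose t := (1 + U) + (Q + V).
have t1 : 1 <= t by rewrite /t; lra.
have t0 : 0 <= t by lra.
have Ut : U <= t by rewrite /t; lra.
have Qt : Q <= t by rewrite /t; lra.
have Vt : V <= t by rewrite /t; lra.
have tp (n m : nat) : (n <= m)%N -> t ^+ n <= t ^+ m by move=> nm; exact: ler_weXn2l.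
have h2 : (A + 2 * U) * Q + c * Q ^+ 3 <= (A + 2 + c) * t ^+ 3.
  have q1 : A * Q <= A * t ^+ 3 by apply: lem_l => //; apply: (le_trans Qt); rewrite -{1}[t]expr1 tp.
  have q2 : U * Q <= t ^+ 3 by apply: (@le_trans _ _ (t * t)); [exact: ler_pM|rewrite -expr2 tp].
  have q3 : c * Q ^+ 3 <= c * t ^+ 3 by apply: lem_l => //; rewrite lerXn2r.
  lra.
have h3 : V ^+ 3 + D * V ^+ 2 <= (1 + D) * t ^+ 3.
  have q1 : V ^+ 3 <= t ^+ 3 by rewrite lerXn2r.
  have q2 : D * V ^+ 2 <= D * t ^+ 3.
    by apply: lem_l => //; apply: (@le_trans _ _ (t ^+ 2)); [rewrite lerXn2r|exact: tp].
  lra.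
apply: (@le_trans _ _ ((A + 2 + c) * t ^+ 3 * ((1 + D) * t ^+ 3))).
  by apply: ler_pM; [exact: fb0|exact: normr_ge0|exact: le_trans h2|exact: le_trans h3].
have -> : (A + 2 + c) * t ^+ 3 * ((1 + D) * t ^+ 3) = (A + 2 + c) * (1 + D) * t ^+ 6 by ring.
rewrite -[leRHS]mulrA; apply: lem_l; first by apply: mulr_ge0; lra.
have s1 := @sixth (1 + U) (Q + V) ltac:(lra) ltac:(lra).
have s2 := @sixth 1 U ler01 U0; have s3 := @sixth Q V Q0 V0.
have p0 : 0 <= (2 : R) ^+ 6 by nn.
apply: (le_trans s1); rewrite -mulrA; apply: lem_l => //; rewrite mulrDr.
by rewrite expr1n in s2; exact: lerD.
Qed.

End pointwise.

(** * Control of the nonlinear terms by the discrete Laplacian *)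

Section discrete_regularity.
Variables (R : realType) (Om : smooth_domain R) (c0 CF N sigma nu : R) (f : R * R -> R).
Notation cl := (clos Om).
Notation I := (@I R Om).
Notation bm := (@bm R Om).
Notation PC1 := (@PC1 R Om).
Notation sqn := (@sqn R Om).
Notation gsq := (@gsq R Om).
Notation bint := (@bint R Om).
Implicit Types (u uh v w L chi : R * R -> R) (x y p : R * R).
Hypothesis c00 : 0 < c0.
Hypothesis hCF : friedrichs Om CF.
Hypothesis hN : N%:E = maxe (N1 Om) (N2 Om).
Hypothesis nu0 : 0 < nu.
Hypothesis lf : L2 Om f.

Definition energy uh w : R := gsq w + bint (fun x => (c0 + nu + 2 * `|uh x|) / nu * w x ^+ 2)
  + 1 / (9 * nu * c0) * bint (fun x => w x ^+ 4).

Lemma friedrichs_PC1 w w1 w2 : PC1 w w1 w2 -> sqn w <= CF * (gsq w + bint (fun x => w x ^+ 2)).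
Proof.
move=> pw; have [CF0 H] := hCF; have := H w (PC1_sobolev pw).
rewrite /L2norm sqr_sqrtr inner_sqn ?sqn_ge0// grad_norm_sq => h; apply: (le_trans h).
by apply: lem_l (ltW CF0) _; rewrite lerD2l; exact: trace_le pw.
Qed.

Lemma energy_parts uh w T : CC cl uh -> CC cl w -> energy uh w <= T ->
  [/\ gsq w + bint (fun x => w x ^+ 2) <= T, gsq w <= T,
      bint (fun x => (c0 + nu + 2 * `|uh x|) * w x ^+ 2) <= nu * T &
      bint (fun x => w x ^+ 4) <= 9 * nu * c0 * T].
Proof.
have c0' := c00; have nu0' := nu0; move=> cu cw; rewrite /energy => hT.
have g0 : 0 <= gsq w := gsq_ge0 _ _.
have b4 : 0 <= bint (fun x => w x ^+ 4) by apply: bint_ge0 => x _; rewrite (exprM _ 2 2) sqr_ge0.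
have A0 x : 0 <= c0 + nu + 2 * `|uh x| by have := normr_ge0 (uh x); lra.
have bA : 0 <= bint (fun x => (c0 + nu + 2 * `|uh x|) * w x ^+ 2).
  by apply: bint_ge0 => x _; rewrite mulr_ge0// sqr_ge0.
have bE : bint (fun x => (c0 + nu + 2 * `|uh x|) / nu * w x ^+ 2) = nu^-1 * bint (fun x => (c0 + nu + 2 * `|uh x|) * w x ^+ 2).
  rewrite -bint_scale; last by cbt.
  by apply: bint_ext => x _; rewrite mulrAC mulrC.
have b2 : nu * bint (fun x => w x ^+ 2) <= bint (fun x => (c0 + nu + 2 * `|uh x|) * w x ^+ 2).
  rewrite -bint_scale; last by cbt.
  apply: bint_le; [by cbt|by cbt|move=> x _].
  by apply: lem_r (sqr_ge0 _) _; have := normr_ge0 (uh x); lra.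
rewrite bE in hT; move: hT b4 bA b2 g0; clear bE A0.
move: (gsq w) (bint (fun x => w x ^+ 4)) (bint (fun x => (c0 + nu + 2 * `|uh x|) * w x ^+ 2)) (bint (fun x => w x ^+ 2)).
move=> g b a b' hT b0 a0 ab g0.
have c9 : 0 < 9 * nu * c0 by nn.
have q1 : 0 <= 1 / (9 * nu * c0) * b by nn.
have q2 : 0 <= nu^-1 * a by nn.
have q3 : b' <= nu^-1 * a by rewrite mulrC ler_pdivlMr// mulrC.
split; [lra|lra| |].
  by rewrite -ler_pdivrMl//; lra.
by rewrite -ler_pdivrMl// -[X in X * b]mul1r; lra.
Qed.

Lemma laplacian_test (Th : triangulation Om) uh w L : is_disc_laplacian Th nu c0 uh w L ->
  forall chi, Vh Th chi -> CC cl uh -> CC cl w ->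
  grad_inner Om w chi = - I (fun x => L x * chi x) - nu^-1 * bint (fun x => feedback c0 nu (uh x) (w x) * chi x).
Proof.
move=> [VL H] chi Vc cu cw; have := H chi Vc; rewrite innerE.
have cL := MkCC VL.1; have cc := MkCC Vc.1.
have bL := cont_cl_bm (CCc cL); have bc := cont_cl_bm (CCc cc).
have -> : I (fun x => - L x * chi x) = - I (fun x => L x * chi x).
  by rewrite -I_opp; [apply: I_ext => x _; rewrite mulNr|bmt].
have -> : bint (fun x => - nu^-1 * feedback c0 nu (uh x) (w x) * chi x) = - nu^-1 * bint (fun x => feedback c0 nu (uh x) (w x) * chi x).
  rewrite -bint_scale; first by apply: bint_ext => x _; rewrite mulrA.
  by cbt.
by move=> ->; rewrite mulNr opprK addrK.
Qed.

(* On the boundary the leading part of the test function has the sign of w, so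
   that the cubic feedback only contributes with its good sign. *)
Lemma self_bound : exists2 K : R, 0 < K & forall (Th : triangulation Om), regular Th sigma -> forall uh w L,
  CC cl uh -> Vh Th w -> is_disc_laplacian Th nu c0 uh w L ->
  forall S T : R, 0 < S -> energy uh w <= T -> sqn w + gsq w <= S ^+ 2 ->
  exists2 J : R, J ^+ 2 <= K * (sqn L * sqn w) & gsq (fun x => w x ^+ 2) <= S ^+ 2 * J + K * S ^+ 2 * T.
Proof.
have c0' := c00; have nu0' := nu0; have [C C0 HC] := quartic_test Om sigma.
exists (16 * C + 3 * C ^+ 2 + C); first by rewrite addr_gt0// addr_gt0// mulr_gt0// exprn_gt0.
move=> Th reg uh w L cu Vw isL S T S0 ET wS.
have [chi [Vc t1 t2 _ t4]] := HC Th reg w Vw S S0 wS.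
have cw := MkCC Vw.1; have cc := MkCC Vc.1; have cL := MkCC isL.1.1.
have [_ gT aT bT] := energy_parts cu cw ET.
have bL := cont_cl_bm (CCc cL); have bc := cont_cl_bm (CCc cc).
have T0 : 0 <= T by apply: le_trans gT; exact: gsq_ge0.
have S20 : 0 < S ^+ 2 by nn.
pose P := I (fun x => L x * chi x).
have hP : P ^+ 2 <= sqn L * (C * S ^+ 4 * sqn w).
  by apply: (le_trans (CS (bm_lsq bL) (bm_lsq bc))); apply: lem_l t2; exact: sqn_ge0.
have hb : - nu^-1 * bint (fun x => feedback c0 nu (uh x) (w x) * chi x) <= 3 / 4 * C ^+ 2 * S ^+ 2 * T.
  have cf : CC cl (fun x => feedback c0 nu (uh x) (w x)) by cct.
  have h1 : bint (fun x => - 1 * (feedback c0 nu (uh x) (w x) * chi x)) <=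
      bint (fun x => ((C * S) ^+ 2 / 4) * ((c0 + nu + 2 * `|uh x|) * w x ^+ 2 + 2 / (9 * c0) * w x ^+ 4)).
    apply: bint_le; [by cbt|by cbt|move=> x [clx _]].
    rewrite mulN1r /feedback; have -> : chi x = w x ^+ 3 + (chi x - w x ^+ 3) by rewrite subrKC.
    apply: self_pointwise; [by have := normr_ge0 (uh x); lra|by rewrite divr_ge0// mulr_ge0// ltW|by rewrite mulr_ge0// ltW|exact: t4].
  rewrite bint_scale in h1; last by cbt.
  rewrite bint_scale in h1; last by cbt.
  rewrite bint_add in h1; [|by cbt|by cbt].
  rewrite bint_scale in h1; last by cbt.
  have h2 : bint (fun x => (c0 + nu + 2 * `|uh x|) * w x ^+ 2) + 2 / (9 * c0) * bint (fun x => w x ^+ 4) <= 3 * (nu * T).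
    have k0 : 0 <= 2 / (9 * c0) by nn.
    have := lem_l k0 bT; rewrite (_ : 2 / (9 * c0) * (9 * nu * c0 * T) = 2 * (nu * T)); last by field; rewrite gt_eqF.
    by move: (nu * T) aT => nT aT h; gen_integrals; lra.
  have k1 : 0 <= (C * S) ^+ 2 / 4 by nn.
  have h3 := le_trans h1 (lem_l k1 h2).
  have k2 : 0 <= nu^-1 by nn.
  have := lem_l k2 h3; rewrite (_ : nu^-1 * ((C * S) ^+ 2 / 4 * (3 * (nu * T))) = 3 / 4 * C ^+ 2 * S ^+ 2 * T); last by field; rewrite gt_eqF.
  by rewrite mulN1r mulrN mulNr.
have E := laplacian_test isL Vc cu cw; rewrite -/P in E.
(* The test function is of order S^2 times w in L^2, so dividing by S^2 leaves a J whose bound is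
   free of S. *)
exists (- (4 * P) / S ^+ 2).
  rewrite expr_div_n sqrrN ler_pdivrMr ?exprn_gt0//.
  have -> : (4 * P) ^+ 2 = 16 * P ^+ 2 by ring.
  apply: (le_trans (lem_l (ler0n _ 16) hP)).
  rewrite (_ : 16 * (sqn L * (C * S ^+ 4 * sqn w)) = 16 * C * (sqn L * sqn w * (S ^+ 2) ^+ 2)); last by gen_integrals; ring.
  rewrite -[leRHS]mulrA; apply: lem_r; first by apply: mulr_ge0 (sqr_ge0 _); apply: mulr_ge0; exact: sqn_ge0.
  by have := exprn_gt0 2 C0; lra.
rewrite [S ^+ 2 * _]mulrC divfK ?gt_eqF//.
have h5 : C * S ^+ 2 * gsq w <= C * S ^+ 2 * T by apply: lem_l gT; rewrite mulr_ge0 ?(ltW C0)// ltW.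
have ST : 0 <= S ^+ 2 * T by nn.
apply: (le_trans t1); rewrite E.
have -> : (16 * C + 3 * C ^+ 2 + C) * S ^+ 2 * T = 16 * C * (S ^+ 2 * T) + 4 * (3 / 4 * C ^+ 2 * S ^+ 2 * T) + C * S ^+ 2 * T by field.
have h6 : 0 <= 16 * C * (S ^+ 2 * T) by nn.
rewrite mulNr in hb.
move: (C * S ^+ 2 * gsq w) (C * S ^+ 2 * T) (3 / 4 * C ^+ 2 * S ^+ 2 * T) (nu^-1 * bint _) (16 * C * _) h5 h6 hb.
by move=> a b c d e h5 h6 hb; clearbody P; clear E hP isL t1 t2 t4; lra.
Qed.

Lemma PC1_scaled v v1 v2 (S : R) : PC1 v v1 v2 -> PC1 (fun x => S * v x) (fun x => S * v1 x) (fun x => S * v2 x).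
Proof. by move=> pv; exact: PC1_scale. Qed.

Lemma sqn_scale (S : R) v : bm v -> sqn (fun x => S * v x) = S ^+ 2 * sqn v.
Proof. by move=> bv; rewrite -I_scale; [apply: I_ext => x _; rewrite exprMn|bmt]. Qed.

Lemma gsq_scale (S : R) v v1 v2 : PC1 v v1 v2 -> gsq (fun x => S * v x) = S ^+ 2 * gsq v.
Proof.
move=> pv; have [bv b1 b2] := PC1_bm pv; rewrite (PC1_gsq (PC1_scaled S pv)) (PC1_gsq pv) -I_scale; last by bmt.
by apply: I_ext => x _; ring.
Qed.

(** Polarization, 2 u v = (v + u)^2 - v^2 - u^2; the factor is 3/4 because three terms are squared
    and the 2 is divided out. *)
Lemma gsq_prod u u1 u2 v v1 v2 : PC1 u u1 u2 -> PC1 v v1 v2 ->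
  gsq (fun x => u x * v x) <= 3 / 4 * (gsq (fun x => (v x + u x) ^+ 2) + gsq (fun x => v x ^+ 2) + gsq (fun x => u x ^+ 2)).
Proof.
move=> pu pv; have ps := PC1_add pv pu.
have [bu b1 b2] := PC1_bm pu; have [bv b3 b4] := PC1_bm pv.
rewrite (PC1_sq_gsq ps) (PC1_sq_gsq pu) (PC1_sq_gsq pv) (PC1_gsq (PC1_mul pu pv)).
rewrite (_ : 3 / 4 * _ = 3 * (I (fun x => (v x + u x) ^+ 2 * ((v1 x + u1 x) ^+ 2 + (v2 x + u2 x) ^+ 2)) +
  I (fun x => v x ^+ 2 * (v1 x ^+ 2 + v2 x ^+ 2)) + I (fun x => u x ^+ 2 * (u1 x ^+ 2 + u2 x ^+ 2)))); last by gen_integrals; field.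
rewrite -I_add; [|by bmt|by bmt]; rewrite -I_add; [|by bmt|by bmt]; rewrite -I_scale; [|by bmt].
apply: I_le; [by bmt|by bmt|move=> x _].
move: (u x) (u1 x) (u2 x) (v x) (v1 x) (v2 x) => a a1 a2 b c1 c2.
have key (s p q : R) : (s - p - q) ^+ 2 <= 3 * (s ^+ 2 + p ^+ 2 + q ^+ 2).
  by have := sqr_ge0 (s + p); have := sqr_ge0 (s + q); have := sqr_ge0 (p - q); lra.
have k1 := key ((b + a) * (c1 + a1)) (b * c1) (a * a1); have k2 := key ((b + a) * (c2 + a2)) (b * c2) (a * a2).
rewrite !exprMn in k1 k2; rewrite (_ : a * c1 + b * a1 = (b + a) * (c1 + a1) - b * c1 - a * a1); last by ring.
rewrite (_ : a * c2 + b * a2 = (b + a) * (c2 + a2) - b * c2 - a * a2); last by ring.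
by rewrite !mulrDr; move: k1 k2; rewrite !mulrDr; lra.
Qed.

Lemma sum4_le (p q a b d g k : R) : - q <= k -> a <= g -> b <= d ->
  - p + 4 * - q + 4 * a + b <= - p + 4 * k + 4 * g + d.
Proof. lra. Qed.

Lemma sqD_le (a b : R) : (a + b) ^+ 2 <= 2 * (a ^+ 2 + b ^+ 2).
Proof. by have := sqr_ge0 (a - b); lra. Qed.

(** W and M stand for the squared gradients of w^2 and of uh w, l for the squared norm of the
    discrete Laplacian, T for the energy. W is bounded twice: with s <= Y, which gives T^2 where s
    <= F T would give T^3, and after division by S^2 with s <= F T, which gives T. A cubic power of
    the energy could not be absorbed later. *)
Lemma nonlinear_arith (T F K1 K2 Y l s S J W J' M b1 b2 : R) (n := nu)
  (a1 := 2 / n ^+ 2 * (K1 * F ^+ 2 * Y) + K1 * F) (a2 := 16 / n ^+ 2 * (K2 * F) + K2 * F + 16 / n ^+ 2 * (K1 * F) + K1) :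
  0 < n -> 0 < T -> 0 < F -> 0 < K1 -> 0 < K2 -> 0 <= Y -> 0 <= l -> 0 <= s -> s <= F * T -> s <= Y -> 0 < S -> S ^+ 2 = F * T ->
  J ^+ 2 <= K1 * (l * s) -> W <= S ^+ 2 * J + K1 * S ^+ 2 * T -> J' ^+ 2 <= K2 * l ->
  M <= S * J' + K2 * S ^+ 2 * (1 + S ^+ 2) + W / S ^+ 2 ->
  b1 <= n / 8 * l + 2 * M / (4 * (n / 8)) -> b2 <= n / 8 * l + W / 2 / (4 * (n / 8)) ->
  b1 + b2 <= n / 2 * l + (a1 / n + 4 / n * (a2 + K2 * F ^+ 2) + 1) * (T + T ^+ 2).
Proof.
move=> n0 T0 F0 K10 K20 Y0 l0 s0 sF sY S0 S2 hJ hW hJ' hM hb1 hb2.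
have T0' := ltW T0; have F0' := ltW F0; have K10' := ltW K10; have K20' := ltW K20; have n0' := ltW n0.
have S20 : 0 < S ^+ 2 by nn.
have nn : 0 < n ^+ 2 by nn.
have nz : n != 0 by rewrite gt_eqF.
have W1 : W <= n ^+ 2 / 8 * l + a1 * T ^+ 2.
  have h : (S ^+ 2 * J) ^+ 2 <= l * (K1 * F ^+ 2 * Y * T ^+ 2).
    rewrite exprMn S2 (_ : l * _ = (F * T) ^+ 2 * (K1 * (l * Y))); last by ring.
    apply: lem_l (sqr_ge0 _) _; apply: (le_trans hJ); apply: lem_l => //; exact: lem_l.
  have e0 : 0 < n ^+ 2 / 8 by nn.
  have c0' : 0 <= K1 * F ^+ 2 * Y * T ^+ 2 by nn.
  have := young h l0 c0' e0; rewrite (_ : _ / (4 * (n ^+ 2 / 8)) = 2 / n ^+ 2 * (K1 * F ^+ 2 * Y) * T ^+ 2); last by field.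
  move=> h2; apply: (le_trans hW); rewrite [K1 * S ^+ 2 * T](_ : _ = K1 * F * T ^+ 2); last by rewrite S2; ring.
  by rewrite /a1 mulrDl addrA lerD2r; apply: (le_trans (ler_norm _)).
have W2 : W / S ^+ 2 <= n ^+ 2 / 64 * l + (16 / n ^+ 2 * (K1 * F) + K1) * T.
  have h : J ^+ 2 <= l * (K1 * (F * T)).
    apply: (le_trans hJ); rewrite mulrCA; apply: lem_l => //; exact: lem_l.
  have e0 : 0 < n ^+ 2 / 64 by nn.
  have c0' : 0 <= K1 * (F * T) by nn.
  have := young h l0 c0' e0; rewrite (_ : _ / (4 * (n ^+ 2 / 64)) = 16 / n ^+ 2 * (K1 * F) * T); last by field.
  move=> h2; rewrite ler_pdivrMr//; apply: (le_trans hW).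
  rewrite (_ : S ^+ 2 * J + K1 * S ^+ 2 * T = (J + K1 * T) * S ^+ 2); last by ring.
  apply: lem_r; first exact: ltW.
  by rewrite mulrDl addrA lerD2r; apply: (le_trans (ler_norm _)).
have M1 : S * J' <= n ^+ 2 / 64 * l + 16 / n ^+ 2 * (K2 * F) * T.
  have h : (S * J') ^+ 2 <= l * (K2 * (F * T)).
    rewrite exprMn S2 (_ : l * _ = F * T * (K2 * l)); last by ring.
    by apply: lem_l => //; exact: mulr_ge0.
  have e0 : 0 < n ^+ 2 / 64 by nn.
  have c0' : 0 <= K2 * (F * T) by nn.
  have := young h l0 c0' e0; rewrite (_ : _ / (4 * (n ^+ 2 / 64)) = 16 / n ^+ 2 * (K2 * F) * T); last by field.
  by move=> h2; apply: (le_trans (ler_norm _)).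
have M2 : M <= n ^+ 2 / 32 * l + a2 * T + K2 * F ^+ 2 * T ^+ 2.
  apply: (le_trans hM); apply: (le_trans (lerD (lerD M1 (lexx _)) W2)).
  by rewrite S2 /a2 le_eqVlt; apply/orP; left; apply/eqP; field.
have A1 : 0 <= a1 by rewrite /a1; nn.
have d0 : 0 <= 16 / n ^+ 2 by nn.
have A2 : 0 <= a2 by rewrite /a2; nn.
have B1 : b1 <= n / 4 * l + 4 / n * (a2 * T + K2 * F ^+ 2 * T ^+ 2).
  apply: (le_trans hb1); rewrite (_ : 2 * M / (4 * (n / 8)) = 4 / n * M); last by field.
  have q0 : 0 <= 4 / n by nn.
  apply: (le_trans (lerD (lexx _) (lem_l q0 M2))).
  by apply: le_of_eq; field.
have B2 : b2 <= n / 4 * l + a1 / n * T ^+ 2.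
  apply: (le_trans hb2); rewrite (_ : W / 2 / (4 * (n / 8)) = n^-1 * W); last by field.
  have q0 : 0 <= n^-1 by nn.
  apply: (le_trans (lerD (lexx _) (lem_l q0 W1))).
  by apply: le_of_eq; field.
apply: (le_trans (lerD B1 B2)).
have q1 : 0 <= a1 / n * T by nn.
have q2 : 0 <= 4 / n * (a2 * T ^+ 2) by nn.
have q3 : 0 <= 4 / n * (K2 * F ^+ 2 * T) by nn.
have q4 : 0 <= T ^+ 2 := sqr_ge0 _.
rewrite -subr_ge0 (_ : _ - _ = a1 / n * T + 4 / n * (a2 * T ^+ 2) + 4 / n * (K2 * F ^+ 2 * T) + (T + T ^+ 2)); last by field.
by rewrite !addr_ge0.
Qed.

Lemma abs_split (a b e : R) : `|a - b| <= e -> `|a| <= `|b| + e.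
Proof. by move=> h; have := ler_normD (a - b) b; rewrite subrK; lra. Qed.

Lemma mixed_arith (S P X W U K1 q6 Q h : R) : 0 < S -> X <= - (4 * S^-1 * P) + 4 * K1 * (1 + S ^+ 2) + 4 * q6 + h ->
  0 <= W -> U <= Q -> 0 <= K1 -> 0 <= q6 -> 0 <= h -> 0 <= Q ->
  S ^+ 2 * (3 / 4 * (X + W / S ^+ 2 / S ^+ 2 + U)) <=
  S * - (3 * P) + (3 * K1 + 3 * q6 + h + Q) * S ^+ 2 * (1 + S ^+ 2) + W / S ^+ 2.
Proof.
move=> S0 hX W0 UQ k0 q0 h0 Q0; have s0 : 0 <= S ^+ 2 := sqr_ge0 _.
have hX' := lem_l s0 hX; have hU := lem_l s0 UQ.
have W1 : 0 <= W / S ^+ 2 by nn.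
have -> : S ^+ 2 * (3 / 4 * (X + W / S ^+ 2 / S ^+ 2 + U)) = 3 / 4 * (S ^+ 2 * X) + 3 / 4 * (W / S ^+ 2) + 3 / 4 * (S ^+ 2 * U).
  by field; rewrite gt_eqF.
have E : S ^+ 2 * (- (4 * S^-1 * P) + 4 * K1 * (1 + S ^+ 2) + 4 * q6 + h) =
  - (4 * (S * P)) + S ^+ 2 * (4 * K1 * (1 + S ^+ 2) + 4 * q6 + h) by field; rewrite gt_eqF.
rewrite E in hX'; clear E hX UQ.
have s4 : 0 <= S ^+ 2 * S ^+ 2 by nn.
have m1 := mulr_ge0 q0 s0; have m2 := mulr_ge0 h0 s0; have m3 := mulr_ge0 Q0 s0.
have m4 := mulr_ge0 q0 s4; have m5 := mulr_ge0 h0 s4; have m6 := mulr_ge0 Q0 s4.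
have -> : S * - (3 * P) = - (3 * (S * P)) by ring.
move: (W / S ^+ 2) (S * P) hX' hU W1 m1 m2 m3 m4 m5 m6 => w1 p1; move: (S ^+ 2) => t hX' hU W1 m1 m2 m3 m4 m5 m6.
lra.
Qed.

(** With w = S q and q of H^1 norm at most 1, all boundary integrals are bounded by constants; the
    feedback divided by S contributes a factor S^2 through its cubic part only. *)
Lemma mixed_bdry (Q D H2 : R) : 0 <= Q -> 0 <= D -> 0 <= H2 -> exists2 K1 : R, 0 <= K1 &
  forall u u1 u2 q q1 q2 v v1 v2 chi, PC1 u u1 u2 -> PC1 q q1 q2 -> PC1 v v1 v2 -> CC cl chi ->
  sqn u + gsq u <= Q -> sqn q + gsq q <= 1 -> sqn v + gsq v <= H2 ->
  (forall x, cl x -> `|chi x| <= `|v x| ^+ 3 + D * v x ^+ 2) -> forall S : R, 0 < S ->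
  - (S^-1 * (nu^-1 * bint (fun x => feedback c0 nu (u x) (S * q x) * chi x))) <= K1 * (1 + S ^+ 2).
Proof.
move=> Q0 D0 H20; have c0' := c00; have nu0' := nu0; have [T3 T30 HT3] := trace_pow Om 2.
have b10 : 0 <= bint (fun=> 1) by apply: bint_ge0 => x _.
pose p6 : R := 2 ^+ 6 * 2 ^+ 6; have p60 : 0 <= p6 by rewrite mulr_ge0// exprn_ge0.
pose M := bint (fun=> 1) + T3 * (Q ^+ 3 + (1 + H2 ^+ 3)).
have M0 : 0 <= M.
  apply: addr_ge0 => //; apply: mulr_ge0; first exact: ltW.
  by apply: addr_ge0; [exact: exprn_ge0|apply: addr_ge0 => //; exact: exprn_ge0].
pose c := 2 / (9 * c0); have cp : 0 <= c by rewrite divr_ge0// mulr_ge0// ltW.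
have A0 : 0 <= c0 + nu by nn.
have A2 : 0 <= c0 + nu + 2 + c by lra.
have D1 : 0 <= 1 + D by lra.
have ni : 0 <= nu^-1 by nn.
pose k1 := (c0 + nu + 2 + c) * (1 + D) * p6; have k10 : 0 <= k1 by rewrite !mulr_ge0.
exists (nu^-1 * k1 * M); first by rewrite !mulr_ge0.
move=> u u1 u2 q q1 q2 v v1 v2 chi pu pq pv cc uQ qQ vQ chx S S0.
have cu := MkCC (pc_cont pu); have cq := MkCC (pc_cont pq); have cv := MkCC (pc_cont pv).
have S20 : 0 <= S ^+ 2 := sqr_ge0 _.
have h4 : c0 + nu + 2 + c * S ^+ 2 <= (c0 + nu + 2 + c) * (1 + S ^+ 2).
  by have := mulr_ge0 cp S20; have := mulr_ge0 A0 S20; move: (S ^+ 2) S20 => s s0; lra.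
have e6 (y : R) : 0 <= y ^+ 6 by rewrite (exprM y 2 3) exprn_ge0// sqr_ge0.
have h3 : bint (fun x => (- S^-1) * (feedback c0 nu (u x) (S * q x) * chi x)) <=
   bint (fun x => (k1 * (1 + S ^+ 2)) * ((1 + u x ^+ 6) + (q x ^+ 6 + v x ^+ 6))).
  apply: bint_le; [by cbt|by cbt|move=> x [clx _]].
  have e : - S^-1 * (feedback c0 nu (u x) (S * q x) * chi x) =
      - (((c0 + nu + 2 * `|u x|) * q x + (c * S ^+ 2) * q x ^+ 3) * chi x).
    by rewrite /feedback /c; field; apply/andP; split; rewrite gt_eqF.
  rewrite e; apply: (le_trans (ler_norm _)); rewrite normrN.
  have cS : 0 <= c * S ^+ 2 by nn.
  apply: (le_trans (mixed_pointwise (u x) (q x) A0 cS D0 (chx x clx))).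
  rewrite -/p6; apply: lem_r; first by rewrite !addr_ge0.
  rewrite (_ : k1 * (1 + S ^+ 2) = (c0 + nu + 2 + c) * (1 + S ^+ 2) * (1 + D) * p6); last by rewrite /k1; ring.
  by apply: lem_r => //; exact: lem_r.
rewrite bint_scale in h3; last by cbt.
rewrite bint_scale in h3; last by cbt.
have h5 : bint (fun x => (1 + u x ^+ 6) + (q x ^+ 6 + v x ^+ 6)) <= M.
  rewrite bint_add; [|by cbt|by cbt]; rewrite bint_add; [|by cbt|by cbt]; rewrite bint_add; [|by cbt|by cbt].
  have p3 (g g1 g2 : R * R -> R) (Y : R) : PC1 g g1 g2 -> sqn g + gsq g <= Y -> bint (fun x => g x ^+ 6) <= T3 * Y ^+ 3.
    move=> py yY; apply: (le_trans (HT3 _ _ _ py)); apply: lem_l; first exact: ltW.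
    have y0 : 0 <= sqn g + gsq g by rewrite addr_ge0 ?sqn_ge0 ?gsq_ge0.
    by rewrite lerXn2r// nnegrE; exact: le_trans yY.
  have a1 := p3 _ _ _ _ pu uQ; have a2 := p3 _ _ _ _ pq qQ; have a3 := p3 _ _ _ _ pv vQ.
  rewrite expr1n mulr1 in a2; rewrite /M !mulrDr mulr1 -addrA lerD2l.
  by apply: lerD => //; exact: lerD.
have k0 : 0 <= nu^-1 * (k1 * (1 + S ^+ 2)) by nn.
have z1 := lem_l k0 h5; have z2 := lem_l ni h3.
apply: le_trans (_ : _ <= nu^-1 * (k1 * (1 + S ^+ 2)) * M) _; last by apply: le_of_eq; ring.
apply: le_trans z1; rewrite -[leRHS]mulrA; apply: le_trans z2.
by apply: le_of_eq; ring.
Qed.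

(* Polarization: the product of u and w/S is controlled by the squares of
   w/S + u, w/S and u, to which the quartic test applies. *)
Lemma mixed_bound (Q : R) : 1 <= Q -> exists2 K : R, 0 < K & forall (Th : triangulation Om), regular Th sigma -> forall uh w L,
  Vh Th uh -> sqn uh + gsq uh <= Q -> gsq (fun x => uh x ^+ 2) <= Q ->
  (forall chi, Vh Th chi -> grad_inner Om uh chi ^+ 2 <= Q * sqn chi) ->
  Vh Th w -> is_disc_laplacian Th nu c0 uh w L ->
  forall S : R, 0 < S -> sqn w + gsq w <= S ^+ 2 ->
  exists2 J : R, J ^+ 2 <= K * sqn L &
    gsq (fun x => uh x * w x) <= S * J + K * S ^+ 2 * (1 + S ^+ 2) + gsq (fun x => w x ^+ 2) / S ^+ 2.
Proof.
move=> Q1; have Q0 : 0 <= Q by lra. 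
have [C C0 HC] := quartic_test Om sigma.
pose H2 := 2 + 2 * Q; have H20 : 0 < H2 by rewrite /H2; lra.
have H20' := ltW H20.
pose Hr := Num.sqrt H2; have Hr0 : 0 < Hr by rewrite sqrtr_gt0.
have HrE : Hr ^+ 2 = H2 by rewrite sqr_sqrtr.
pose c6 := C * H2 ^+ 2 * H2; have c60 : 0 < c6 by rewrite !mulr_gt0// exprn_gt0.
pose D := C * Hr; have D0 : 0 <= D by rewrite mulr_ge0// ltW.
have [K1 K10 HK1] := mixed_bdry Q0 D0 H20'.
have CH : 0 <= C * H2 ^+ 2 by nn.
have c60' := ltW c60; have Qc : 0 <= Q + c6 by exact: addr_ge0.
pose K' := 3 * K1 + 3 * (Q + c6) + C * H2 ^+ 2 + Q.
have K'0 : 0 <= K' by nn.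
exists (9 * c6 + K'); first by apply: ltr_pwDl => //; exact: mulr_gt0.
move=> Th reg uh w L Vu uQ u2Q uT Vw isL S S0 wS.
have [u1 [u2 pu]] := Vh_PC1_ex Vu; have [w1 [w2 pw]] := Vh_PC1_ex Vw.
have [bu bu1 bu2] := PC1_bm pu; have [bw bw1 bw2] := PC1_bm pw.
have cu := MkCC Vu.1; have cw := MkCC Vw.1; have bL := cont_cl_bm isL.1.1.
(* The scaling makes the H^1 norm of v = q + uh bounded independently of w, so the quartic test is
   applied to v at the fixed scale [Hr]. *)
pose q x := S^-1 * w x; pose v x := q x + uh x.
have pq : PC1 q (fun x => S^-1 * w1 x) (fun x => S^-1 * w2 x) by exact: PC1_scaled.
have pv : PC1 v _ _ := PC1_add pq pu; have [bq bq1 bq2] := PC1_bm pq.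
have Vv : Vh Th v.
  by have := Vh_lin S^-1 Vu Vw; congr Vh; apply/funext => x; rewrite /v /q addrC.
have Si : 0 < S^-1 by nn.
have q1 : sqn q + gsq q <= 1.
  have -> : sqn q + gsq q = S^-1 ^+ 2 * (sqn w + gsq w) by rewrite [RHS]mulrDr -(sqn_scale _ bw) -(gsq_scale _ pw).
  by rewrite exprVn ler_pdivrMl ?exprn_gt0// mulr1.
have vH : sqn v + gsq v <= H2.
  have := H1_parallelogram (PC1_sobolev pq) (PC1_sobolev pu) (expr1n _ 2).
  rewrite (_ : (fun x => q x + 1 * uh x) = v); last by apply/funext => x; rewrite mul1r.
  by move: q1 uQ; rewrite /H2; move: (_ + gsq v) (_ + gsq q) (_ + gsq uh) => s1 s2 s3; lra.
have [|chi [Vc t1 t2 _ t4]] := HC Th reg v Vv Hr Hr0; first by rewrite HrE.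
rewrite HrE in t1; rewrite (exprM Hr 2 2) HrE in t2; rewrite -/D in t4.
have cc := MkCC Vc.1; have bc := cont_cl_bm (CCc cc).
have [h1 [h2 pc]] := Vh_PC1_ex Vc; have [_ bh1 bh2] := PC1_bm pc.
have sv : sqn v <= H2 by apply: le_trans vH; rewrite lerDl gsq_ge0.
have gv : gsq v <= H2 by apply: le_trans vH; rewrite lerDr sqn_ge0.
have sc6 : sqn chi <= c6 by apply: (le_trans t2); apply: lem_l.
pose P := I (fun x => L x * chi x).
have hP : P ^+ 2 <= sqn L * c6 by apply: (le_trans (CS (bm_lsq bL) (bm_lsq bc))); apply: lem_l sc6; exact: sqn_ge0.
have gsplit : grad_inner Om v chi = S^-1 * grad_inner Om w chi + grad_inner Om uh chi.
  have E1 := PC1_grad_inner pv pc; have E2 := PC1_grad_inner pw pc; have E3 := PC1_grad_inner pu pc.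
  rewrite E1 E2 E3 -I_scale; [|by bmt]; rewrite -I_add; [|by bmt|by bmt].
  by apply: I_ext => x _; ring.
have gu : grad_inner Om uh chi <= Q + c6.
  have h : grad_inner Om uh chi ^+ 2 <= Q * c6 by apply: (le_trans (uT chi Vc)); exact: lem_l.
  have := young h Q0 c60' ltr01; rewrite mul1r mulr1 => h'.
  apply: (le_trans (ler_norm _)); apply: (le_trans h'); rewrite lerD2l ler_pdivrMr// ler_peMr// -[leLHS]/(1%:R) ler_nat//.
have chx x : cl x -> `|chi x| <= `|v x| ^+ 3 + D * v x ^+ 2.
  by move=> clx; rewrite -normrX; apply: abs_split; exact: t4.
have hb := HK1 _ _ _ _ _ _ _ _ _ _ pu pq pv cc uQ q1 vH chx S S0.
have {hb}hb : - (S^-1 * (nu^-1 * bint (fun x => feedback c0 nu (uh x) (w x) * chi x))) <= K1 * (1 + S ^+ 2).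
  have Sw x : S * q x = w x by rewrite /q mulrA divff ?mul1r// gt_eqF.
  have := hb; under eq_fun do rewrite Sw; exact: id.
have E := laplacian_test isL Vc cu cw; rewrite -/P in E.
pose X := gsq (fun x => v x ^+ 2).
have hX : X <= - (4 * S^-1 * P) + 4 * K1 * (1 + S ^+ 2) + 4 * (Q + c6) + C * H2 ^+ 2.
  have h3 : C * H2 * gsq v <= C * H2 ^+ 2 by rewrite expr2 mulrA; apply: lem_l gv; apply: mulr_ge0 H20'; exact: ltW.
  rewrite -(mulrA 4 K1); apply: (le_trans t1); rewrite gsplit E; move: hb gu h3.
  move: (grad_inner Om uh chi) (C * H2 * gsq v) (C * H2 ^+ 2) (nu^-1 * bint _) (Q + c6) (K1 * (1 + S ^+ 2)) => a b' d e g k hb gu h3.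
  have -> : 4 * (S^-1 * (- P - e) + a) = - (4 * S^-1 * P) + 4 * (- (S^-1 * e)) + 4 * a by ring.
  exact: sum4_le.
have gp := gsq_prod pu pq.
have e1 : gsq (fun x => uh x * w x) = S ^+ 2 * gsq (fun x => uh x * q x).
  rewrite -(gsq_scale S (PC1_mul pu pq)).
  suff -> : (fun x => uh x * w x) = (fun x => S * (uh x * q x)) by [].
  by apply/funext => x; rewrite /q; field; rewrite gt_eqF.
have e2 : gsq (fun x => q x ^+ 2) = gsq (fun x => w x ^+ 2) / S ^+ 2 / S ^+ 2.
  have -> : (fun x => q x ^+ 2) = (fun x => (S^-1 ^+ 2) * w x ^+ 2) by apply/funext => x; rewrite exprMn.
  by rewrite (gsq_scale _ (PC1_exp 1 pw)) !exprVn; field; rewrite gt_eqF.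
exists (- (3 * P)).
  rewrite sqrrN exprMn (_ : 3 ^+ 2 = 9 :> R); last by ring.
  apply: (le_trans (lem_l (ler0n _ 9) hP)); rewrite mulrCA mulrC; apply: lem_r; first exact: sqn_ge0.
  by rewrite lerDl.
rewrite e1; rewrite e2 -/X in gp.
apply: (le_trans (lem_l (sqr_ge0 S) gp)).
have W0 : 0 <= gsq (fun x => w x ^+ 2) := gsq_ge0 _ _.
apply: (le_trans (mixed_arith S0 hX W0 u2Q K10 Qc CH Q0)); rewrite -/K'.
rewrite lerD2r lerD2l; apply: lem_r; first by apply: addr_ge0 => //; exact: sqr_ge0.
by apply: lem_r; [exact: sqr_ge0|rewrite lerDr; exact: mulr_ge0].
Qed.

(** The three terms are the derivatives of uh w and of w^2/2 along (1, 1), tested with L; Young's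
    inequality leaves half of nu times the dissipation. *)
Lemma nonlinear_bound (Y : R) : 0 <= Y -> exists2 K : R, 0 < K & forall (Th : triangulation Om), regular Th sigma -> forall uh w L,
  disc_steady_state Th nu f uh -> grad_norm Om uh <= nu / (4 * N) ->
  Vh Th w -> is_disc_laplacian Th nu c0 uh w L -> sqn w <= Y ->
  `|trilinear Om uh w L + trilinear Om w uh L + trilinear Om w w L| <=
    nu / 2 * sqn L + K * (energy uh w + energy uh w ^+ 2).
Proof.
move=> Y0; have c0' := c00; have nu0' := nu0; have [CF0 _] := hCF.
have [Q Q1 HQ] := steady_bounds sigma hN nu0 lf.
have [K1 K10 HK1] := self_bound; have [K2 K20 HK2] := mixed_bound Q1.
pose F := CF + 1; have F0 : 0 < F by rewrite /F; lra.
pose a1 := 2 / nu ^+ 2 * (K1 * F ^+ 2 * Y) + K1 * F.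
pose a2 := 16 / nu ^+ 2 * (K2 * F) + K2 * F + 16 / nu ^+ 2 * (K1 * F) + K1.
pose K := a1 / nu + 4 / nu * (a2 + K2 * F ^+ 2) + 1.
have K0 : 0 < K by rewrite /K /a1 /a2; nn.
exists K => // Th reg uh w L st gu Vw isL wY.
have [uQ u2Q uT] := HQ Th uh reg st gu; have [Vu _ _] := st.
have [u1 [u2 pu]] := Vh_PC1_ex Vu; have [w1 [w2 pw]] := Vh_PC1_ex Vw.
have [bu bu1 bu2] := PC1_bm pu; have [bw bw1 bw2] := PC1_bm pw.
have cu := MkCC Vu.1; have cw := MkCC Vw.1; have bL := cont_cl_bm isL.1.1.
have sL : 0 <= sqn L := sqn_ge0 _ _.
have E0 : 0 <= energy uh w.
  by have [_ h _ _] := energy_parts cu cw (lexx (energy uh w)); apply: le_trans h; exact: gsq_ge0.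
pose B1 := I (fun x => (uh x * w1 x + w x * u1 x + (uh x * w2 x + w x * u2 x)) * L x).
pose B2 := I (fun x => (w x * w1 x + w x * w2 x) * L x).
have BE : trilinear Om uh w L + trilinear Om w uh L + trilinear Om w w L = B1 + B2.
  have T1 := PC1_trilinear bu.1 bL.1 pw; have T2 := PC1_trilinear bw.1 bL.1 pu; have T3 := PC1_trilinear bw.1 bL.1 pw.
  rewrite T1 T2 T3 /B1 /B2 -I_add; [|by bmt|by bmt]; congr (_ + _); last by apply: I_ext => x _; ring.
  by rewrite -?I_add; try bmt; apply: I_ext => x _; ring.
rewrite BE.
pose W := gsq (fun x => w x ^+ 2); pose M := gsq (fun x => uh x * w x).
have W0 : 0 <= W := gsq_ge0 _ _; have M0 : 0 <= M := gsq_ge0 _ _.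
have hB1 : B1 ^+ 2 <= sqn L * (2 * M).
  have b1 : bm (fun x => uh x * w1 x + w x * u1 x + (uh x * w2 x + w x * u2 x)) by bmt.
  apply: (le_trans (CS (bm_lsq b1) (bm_lsq bL))); rewrite mulrC; apply: lem_l => //.
  rewrite /M (PC1_gsq (PC1_mul pu pw)) -I_scale; last by bmt.
  apply: sqn_le; [by bmt|by bmt|move=> x _].
  exact: sqD_le.
have hB2 : B2 ^+ 2 <= sqn L * (W / 2).
  have b1 : bm (fun x => w x * w1 x + w x * w2 x) by bmt.
  apply: (le_trans (CS (bm_lsq b1) (bm_lsq bL))); rewrite mulrC; apply: lem_l => //.
  rewrite /W (PC1_sq_gsq pw) (_ : 4 * I _ / 2 = 2 * I (fun x => w x ^+ 2 * (w1 x ^+ 2 + w2 x ^+ 2))); last by gen_integrals; field.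
  rewrite -I_scale; last by bmt.
  apply: sqn_le; [by bmt|by bmt|move=> x _].
  rewrite -mulrDr exprMn [leRHS]mulrCA; apply: lem_l (sqr_ge0 _) _.
  exact: sqD_le.
have e8 : 0 < nu / 8 by nn.
have y1 := young hB1 sL (mulr_ge0 (ler0n _ 2) M0) e8.
have y2 := young hB2 sL (divr_ge0 W0 (ler0n _ 2)) e8.
have step (T : R) : 0 < T -> energy uh w <= T -> `|B1 + B2| <= nu / 2 * sqn L + K * (T + T ^+ 2).
  move=> T0 ET; have [gT1 gT _ _] := energy_parts cu cw ET.
  pose S := Num.sqrt (F * T); have FT : 0 < F * T by rewrite mulr_gt0.
  have S0 : 0 < S by rewrite sqrtr_gt0.
  have S2 : S ^+ 2 = F * T by rewrite sqr_sqrtr// ltW.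
  have swF : sqn w <= CF * T by apply: (le_trans (friedrichs_PC1 pw)); apply: lem_l gT1; exact: ltW.
  have wS : sqn w + gsq w <= S ^+ 2 by rewrite S2 /F mulrDl mul1r; exact: lerD.
  have sw0 : 0 <= sqn w := sqn_ge0 _ _.
  have swFT : sqn w <= F * T by rewrite -S2; apply: le_trans wS; rewrite lerDl gsq_ge0.
  have [J hJ hW] := HK1 Th reg uh w L cu Vw isL S T S0 ET wS; rewrite -/W in hW.
  have [J' hJ' hM] := HK2 Th reg uh w L Vu uQ u2Q uT Vw isL S S0 wS; rewrite -/W -/M in hM.
  apply: (le_trans (ler_normD _ _)).
  exact: (nonlinear_arith nu0' T0 F0 K10 K20 Y0 sL sw0 swFT wY S0 S2 hJ hW hJ' hM y1 y2).
(* The scale S has to be positive: for zero energy the estimate is used with small T > 0, and T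
   tends to 0. *)
have [E00|E00] := eqVneq (energy uh w) 0; last by apply: step => //; rewrite lt_neqAle eq_sym E00.
rewrite E00 expr0n addr0 mulr0 addr0; apply/ler_addgt0Pr => e e0.
have t0 : 0 < Num.min 1 (e / (2 * K)) by rewrite lt_min ltr01 divr_gt0// mulr_gt0.
have := step _ t0; rewrite E00 => /(_ (ltW t0)) h; apply: (le_trans h); rewrite lerD2l.
have : Num.min 1 (e / (2 * K)) <= 1 by rewrite ge_min lexx.
have : Num.min 1 (e / (2 * K)) <= e / (2 * K) by rewrite ge_min lexx orbT.
move: t0; move: (Num.min _ _) => t t0; rewrite ler_pdivlMr ?mulr_gt0// => h1 h2.
have : t ^+ 2 <= t by rewrite expr2 ger_pMl.
move=> h3; apply: le_trans h1; rewrite (_ : t * (2 * K) = K * (t + t)); last by ring.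
by apply: lem_l (ltW K0) _; rewrite lerD2l.
Qed.

End discrete_regularity.

(** * Point values of discrete functions as inner products *)

Section riesz.
Variables (R : realType) (Om : smooth_domain R).
Notation cl := (clos Om).
Notation I := (@I R Om).
Notation bm := (@bm R Om).
Notation sqn := (@sqn R Om).
Implicit Types (u v g : R * R -> R) (x y : R * R) (V : (R * R -> R) -> Prop).

Lemma I_comb (n : nat) (a : nat -> R) (F : nat -> R * R -> R) v : (forall m, bm (F m)) -> bm v ->
  I (fun x => v x * \sum_(m < n) a m * F m x) = \sum_(m < n) a m * I (fun x => v x * F m x).
Proof.
move=> bF bv; rewrite -(_ : I (fun x => \sum_(m < n) a m * (v x * F m x)) = I (fun x => v x * \sum_(m < n) a m * F m x)).
  by rewrite I_sum => [|m]; [apply: eq_bigr => m _; rewrite I_scale//; bmt|bmt].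
by apply: I_ext => x _; rewrite mulr_sumr; apply: eq_bigr => m _; rewrite mulrCA.
Qed.

Lemma comb_closed V (n : nat) (a : nat -> R) (F : nat -> R * R -> R) : V (fun=> 0) ->
  (forall c u v, V u -> V v -> V (fun x => u x + c * v x)) -> (forall m, V (F m)) ->
  V (fun x => \sum_(m < n) a m * F m x).
Proof.
move=> V0 Vl VF; elim: n => [|n IH]; first by under eq_fun do rewrite big_ord0.
by under eq_fun do rewrite big_ord_recr/=; exact: Vl.
Qed.

(* Induction on the points: the functions of V that vanish at the last point
   form the smaller space, and V is spanned by it and one function orthogonal to it. *)
Lemma riesz_points (p : nat -> R * R) (n : nat) V : V (fun=> 0) ->
  (forall c u v, V u -> V v -> V (fun x => u x + c * v x)) -> (forall v, V v -> bm v) ->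
  (forall v, V v -> (forall m, (m < n)%N -> v (p m) = 0) -> forall x, cl x -> v x = 0) ->
  (forall v, V v -> sqn v = 0 -> forall m, (m < n)%N -> v (p m) = 0) ->
  exists E r : nat -> R * R -> R, [/\ forall m, V (E m), forall m, V (r m) & forall v, V v ->
    (forall x, cl x -> v x = \sum_(m < n) v (p m) * E m x) /\
    forall m, (m < n)%N -> v (p m) = I (fun x => v x * r m x)].
Proof.
elim: n V => [|n IH] V V0 Vl Vb Vd Vp.
  exists (fun _ _ => 0), (fun _ _ => 0); split => // v Vv; split => // x clx.
  by rewrite big_ord0; apply: Vd clx.
have [all0|] := pselect (forall v, V v -> v (p n) = 0).
  have [||E [r [VE Vr H]]] := IH V V0 Vl Vb.
  - by move=> v Vv v0; apply: Vd => // m; rewrite ltnS leq_eqVlt => /predU1P[->|/v0]; [exact: all0|].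
  - by move=> v Vv v0 m mn; apply: Vp => //; exact: ltnW.
  exists E, (fun m => if m == n then fun=> 0 else r m); split => // [m|v Vv]; first by case: eqP.
  have [h1 h2] := H v Vv; split => [x clx|m]; first by rewrite big_ord_recr/= (all0 v)// mul0r addr0 h1.
  rewrite ltnS leq_eqVlt => /predU1P[->|mn]; last by rewrite ltn_eqF// h2.
  rewrite eqxx (all0 v)// -[LHS](mul0r (I (fun=> 1))) -I_scale; last exact: bm_cst.
  by apply: I_ext => x _; rewrite mul0r mulr0.
move=> /existsNP[g0 /not_implyP[Vg0 /eqP gn0]].
have Vs c v : V v -> V (fun x => c * v x) by move=> Vv; have := Vl c _ _ V0 Vv; under eq_fun do rewrite add0r.
pose g1 := fun x => (g0 (p n))^-1 * g0 x; have Vg1 : V g1 := Vs _ _ Vg0.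
have g1p : g1 (p n) = 1 by rewrite /g1 mulVf.
pose V' v := V v /\ v (p n) = 0.
have [//|||||E [r [VE Vr H]]] := IH V'.
- by move=> c u v [Vu u0] [Vv v0]; split; [exact: Vl|rewrite u0 v0 mulr0 addr0].
- by move=> v [Vv _]; exact: Vb.
- by move=> v [Vv v0] vn; apply: Vd => // m; rewrite ltnS leq_eqVlt => /predU1P[->|/vn].
- by move=> v [Vv v0] vn m mn; apply: Vp => //; exact: ltnW.
have bE m : bm (E m) by apply: Vb; case: (VE m).
have br m : bm (r m) by apply: Vb; case: (Vr m).
have V'0 : V' (fun=> 0) by [].
have V'l c u v : V' u -> V' v -> V' (fun x => u x + c * v x).
  by move=> [Vu u0] [Vv v0]; split; [exact: Vl|rewrite u0 v0 mulr0 addr0].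
pose Pg x := \sum_(m < n) I (fun x => g1 x * E m x) * r m x.
have VPg : V' Pg := comb_closed n (fun m => I (fun x => g1 x * E m x)) V'0 V'l Vr.
pose g x := g1 x + (-1) * Pg x; have Vg : V g by apply: Vl => //; case: VPg.
have gp : g (p n) = 1 by rewrite /g g1p VPg.2 mulr0 addr0.
have bg := Vb _ Vg; have bg1 := Vb _ Vg1; have bPg := Vb _ VPg.1.
have orth v : V' v -> I (fun x => v x * g x) = 0.
  move=> Vv; have bv := Vb _ Vv.1; have [h1 h2] := H v Vv.
  rewrite (_ : I _ = I (fun x => v x * g1 x) - I (fun x => v x * Pg x)); last first.
    by rewrite -I_sub; [apply: I_ext => x _; rewrite /g; ring|bmt|bmt].
  rewrite [X in _ - X](I_comb n (fun m => I (fun x => g1 x * E m x)) br bv) (_ : I (fun x => v x * g1 x) = I (fun x => g1 x * \sum_(m < n) v (p m) * E m x)).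
    rewrite (I_comb n (fun m => v (p m)) bE bg1); apply/eqP; rewrite subr_eq0; apply/eqP; apply: eq_bigr => m _.
    by rewrite (h2 m)// mulrC.
  by apply: I_ext => x Ox; rewrite {1}h1 1?mulrC//; exact: dom_cl.
have sg : sqn g != 0.
  by apply/eqP => s0; have := Vp _ Vg s0 n (ltnSn n); rewrite gp => /eqP; rewrite oner_eq0.
have dec v : V v -> V' (fun x => v x + (- v (p n)) * g x).
  by move=> Vv; split; [exact: Vl|rewrite gp mulr1 subrr].
pose rn x := (sqn g)^-1 * g x; have Vrn : V rn := Vs _ _ Vg.
have Irn v : V v -> I (fun x => v x * rn x) = v (p n).
  move=> Vv; have bv := Vb _ Vv; have := orth _ (dec _ Vv).
  rewrite (_ : I _ = I (fun x => v x * g x) + - v (p n) * sqn g); last first.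
    by rewrite -I_scale; [rewrite -I_add; [apply: I_ext => x _; ring|bmt|bmt]|bmt].
  move=> /eqP; rewrite mulNr subr_eq0 => /eqP h.
  rewrite (_ : I _ = (sqn g)^-1 * I (fun x => v x * g x)); last first.
    by rewrite -I_scale; [apply: I_ext => x _; rewrite /rn; ring|bmt].
  by rewrite h mulrC mulfK.
exists (fun m => if m == n then fun x => g x + (-1) * \sum_(m < n) g (p m) * E m x else E m).
exists (fun m => if m == n then rn else fun x => r m x + g (p m) * rn x).
split=> [m|m|v Vv].
- case: eqP => // _; last by case: (VE m).
  by apply: (Vl _ g) => //; apply: (comb_closed n (fun m => g (p m)) V0 Vl) => k; case: (VE k).
- by case: eqP => // _; apply: Vl => //; case: (Vr m).
have [h1 h2] := H _ (dec _ Vv); split=> [x clx|m].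
  rewrite big_ord_recr/= eqxx.
  under eq_bigr => m _ do rewrite ltn_eqF//.
  have := h1 x clx; rewrite (_ : \sum_(m < n) _ = \sum_(m < n) v (p m) * E m x - v (p n) * \sum_(m < n) g (p m) * E m x).
    move: (\sum_(m < n) v (p m) * E m x) (\sum_(m < n) g (p m) * E m x) => A B h.
    by rewrite (_ : v x = v x + - v (p n) * g x + v (p n) * g x); [rewrite h; ring|ring].
  by rewrite mulr_sumr -sumrB; apply: eq_bigr => m _; ring.
rewrite ltnS leq_eqVlt => /predU1P[->|mn]; first by rewrite eqxx Irn.
rewrite ltn_eqF//; have bv := Vb _ Vv; have brn := Vb _ Vrn.
rewrite (_ : I _ = I (fun x => v x * r m x) + g (p m) * I (fun x => v x * rn x)); last first.
  by rewrite -I_scale; [rewrite -I_add; [apply: I_ext => x _; ring|bmt|bmt]|bmt].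
rewrite (Irn v Vv); have := h2 m mn.
rewrite (_ : I _ = I (fun x => v x * r m x) + - v (p n) * I (fun x => r m x * g x)); last first.
  by rewrite -I_scale; [rewrite -I_add; [apply: I_ext => x _; ring|bmt|bmt]|bmt].
by rewrite (orth _ (Vr m)) mulr0 addr0 => <-; ring.
Qed.

Lemma Vh_vanish (Th : triangulation Om) i p (rho : R) v : 0 < rho -> [set x | enorm (x - p) <= rho] `<=` element (Th := Th) i ->
  Vh Th v -> sqn v = 0 -> v p = 0.
Proof.
move=> r0 sub Vv s0; have [a [b [c av]]] := Vh_affine Vv; apply/eqP/negPn/negP => vp.
have e0 : 0 < `|v p| / 2 by rewrite divr_gt0// normr_gt0.
pose M := 1 + `|b i| + `|c i|; have M0 : 0 < M by rewrite /M -addrA ltr_pwDl// addr_ge0.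
pose r := Num.min (rho / 2) (`|v p| / 2 / M).
have r1 : 0 < r by rewrite /r lt_min !divr_gt0// normr_gt0.
have h x : `|x.1 - p.1| <= r -> `|x.2 - p.2| <= r -> dom Om x /\ (`|v p| / 2) ^+ 2 <= v x ^+ 2.
  move=> h1 h2; have rr : r <= rho / 2 by rewrite ge_min lexx.
  have [Ox Kx] := ball_element_dom r0 sub (le_trans h1 rr) (le_trans h2 rr); split => //.
  have Kp : element (Th := Th) i p by apply: sub => /=; rewrite subrr /enorm/= expr0n/= addr0 sqrtr0 ltW.
  have rM : r * M <= `|v p| / 2 by rewrite -ler_pdivlMr// ge_min lexx orbT.
  have d : `|v p - v x| <= r * M.
    rewrite (av i _ Kp) (av i _ Kx) (_ : _ - _ = b i * (p.1 - x.1) + c i * (p.2 - x.2)); last by ring.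
    apply: (le_trans (ler_normD _ _)); rewrite !normrM (distrC p.1) (distrC p.2).
    have q1 := lem_l (normr_ge0 (b i)) h1; have q2 := lem_l (normr_ge0 (c i)) h2.
    rewrite /M; lra.
  rewrite -[leRHS]normr2// lerXn2r ?nnegrE ?(ltW e0)//.
  by have := ler_normD (v p - v x) (v x); rewrite subrK; lra.
have := square_bound r1 (bm_exp 2 (cont_cl_bm Vv.1)) (fun x _ => sqr_ge0 (v x)) h.
by rewrite -/(sqn v) s0; apply/negP; rewrite -ltNge mulr_gt0 ?exprn_gt0// mulr_gt0// exprn_gt0.
Qed.

(** The discrete Laplacian is known only through its inner products with discrete functions. Writing
    its point values as such inner products transfers to it the regularity in time of the
    solution. *)
Lemma Vh_riesz (Th : triangulation Om) (sigma : R) : regular Th sigma -> exists (n : nat) (p : nat -> R * R) (E r : nat -> R * R -> R),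
  [/\ forall m, (m < n)%N -> cl (p m), forall m, Vh Th (E m), forall m, Vh Th (r m) & forall v, Vh Th v ->
    (forall x, cl x -> v x = \sum_(m < n) v (p m) * E m x) /\
    forall m, (m < n)%N -> v (p m) = I (fun x => v x * r m x)].
Proof.
move=> reg; have [d Hd] := choice reg; have [rho Hr] := choice Hd.
(* The centre of the disc and two points at distance rho/2 along the axes determine an affine
   function, and each of them is the centre of a disc inside the element. *)
pose q i (k : 'I_3) : R * R := nth (d i) [:: d i; ((d i).1 + rho i / 2, (d i).2); ((d i).1, (d i).2 + rho i / 2)] k.
pose s := [seq q i k | i <- enum 'I_(nelem Th), k <- enum 'I_3].
have dq i (k : 'I_3) : [set x | enorm (x - q i k) <= rho i / 2] `<=` element (Th := Th) i.
  have [r0 sub _] := Hr i; move=> x /= hx; apply: sub => /=.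
  have t : enorm (x - d i) <= enorm (x - q i k) + enorm (q i k - d i).
    exact: enormB_tri.
  apply: (le_trans t); suff : enorm (q i k - d i) <= rho i / 2 by lra.
  have r2 : 0 <= rho i / 2 by rewrite divr_ge0// ltW.
  rewrite /q; case: k {hx t} => [[|[|[|//]]] /= _]; rewrite /enorm/= ?subrr ?(addrAC _ _ (- _)) ?subrr ?add0r ?expr0n/= ?addr0 ?add0r ?sqrtr0// sqrtr_sqr ger0_norm//.
have mem_s y : y \in s -> exists i k, y = q i k.
  by move=> /allpairsP[[i k]/= [_ _ ->]]; exists i, k.
have r0 i : 0 < rho i / 2 by have [h _ _] := Hr i; rewrite divr_gt0.
have Kq i (k : 'I_3) : element (Th := Th) i (q i k).
  by apply: (dq i k) => /=; rewrite subrr /enorm/= expr0n/= addr0 sqrtr0 ltW.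
have [||||E [r [VE Vr H]]] := @riesz_points (nth 0 s) (size s) (Vh Th) (Vh_cst Th 0).
- by move=> c u v; exact: Vh_lin.
- by move=> v Vv; exact: cont_cl_bm Vv.1.
- move=> v Vv v0 x clx; have [a [b [c av]]] := Vh_affine Vv.
  have vq i k : v (q i k) = 0.
    have qs : q i k \in s by apply/allpairsP; exists (i, k); split => //=; exact: mem_enum.
    by rewrite -(nth_index 0 qs); apply: v0; rewrite index_mem.
  have [i Kx] := cl_element Th clx; rewrite (av i _ Kx).
  have := vq i ord0; have := vq i o3_1; have := vq i o3_2.
  rewrite !(av i _ (Kq i _)) /q/=; have := r0 i; move: (rho i / 2) => e e0 h2 h1 h0.
  have b0 : b i = 0 by apply: (@mulIf _ e); [rewrite gt_eqF|rewrite mul0r; lra].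
  have c0 : c i = 0 by apply: (@mulIf _ e); [rewrite gt_eqF|rewrite mul0r; lra].
  by move: h0; rewrite b0 c0; lra.
- by move=> v Vv s0 m ms; have [i [k ->]] := mem_s _ (mem_nth 0 ms); exact: Vh_vanish (r0 i) (dq i k) Vv s0.
exists (size s), (nth 0 s), E, r; split => // m ms.
by have [i [k ->]] := mem_s _ (mem_nth 0 ms); exact: element_cl (Kq i k).
Qed.

End riesz.

(** * Differentiation in time by separation of variables *)

Section modes.
Variable R : realType.
Implicit Types (a b g h : R -> R) (Q : set (R * R)) (K : (R * R -> R) -> Prop) (F H : R -> R * R -> R).

(** Exactly the regularity that [semidiscrete] provides for point values: derivatives for t > 0 and
    continuity from the right at 0. *)
Definition mode g g' : Prop := (forall t : R, 0 < t -> is_derive t 1 g (g' t)) /\ g @ (0 : R)^'+ --> g 0.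

Lemma mode_cst (c : R) : mode (fun=> c) (fun=> 0).
Proof. by split => [t _|]; [exact: is_derive_cst|exact: cvg_cst]. Qed.

Lemma mode_add g g' h h' : mode g g' -> mode h h' -> mode (fun s => g s + h s) (fun s => g' s + h' s).
Proof.
move=> [dg cg] [dh ch]; split => [t t0|]; last exact: cvgD.
by have := dg t t0; have := dh t t0 => ? ?; exact: is_deriveD.
Qed.

Lemma mode_mul g g' h h' : mode g g' -> mode h h' -> mode (fun s => g s * h s) (fun s => g' s * h s + g s * h' s).
Proof.
move=> [dg cg] [dh ch]; split => [t t0|]; last exact: cvgM.
have h1 := dg t t0; have h2 := dh t t0; have h3 := is_deriveM h1 h2; apply: (is_derive_eq h3).
by rewrite /GRing.scale/=; ring.
Qed.

Lemma mode_scale (c : R) g g' : mode g g' -> mode (fun s => c * g s) (fun s => c * g' s).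
Proof.
move=> mg; have := mode_mul (mode_cst c) mg; congr mode.
by apply/funext => s; rewrite mul0r add0r.
Qed.

Lemma mode_sum (J : Type) (r : seq J) (g g' : J -> R -> R) : (forall j, mode (g j) (g' j)) ->
  mode (fun s => \sum_(j <- r) g j s) (fun s => \sum_(j <- r) g' j s).
Proof.
move=> H; elim: r => [|j r IH].
  by under eq_fun do rewrite big_nil; under [X in mode _ X]eq_fun do rewrite big_nil; exact: mode_cst.
by under eq_fun do rewrite big_cons; under [X in mode _ X]eq_fun do rewrite big_cons; exact: mode_add.
Qed.

Lemma mode_ext g g' h h' : mode g g' -> (forall s : R, 0 <= s -> g s = h s) -> (forall s : R, 0 < s -> g' s = h' s) -> mode h h'.
Proof.
move=> [dg cg] gh gh'; split => [t t0|].
  rewrite -gh'//; apply: (near_eq_is_derive _ (dg t t0)).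
  near=> s; rewrite gh//; apply: ltW; near: s; exact: lt_nbhsr.
rewrite -gh//; apply: cvg_trans cg; apply: near_eq_cvg; near=> s.
by rewrite gh//; apply: ltW.
Unshelve. all: by end_near. Qed.

(** Time and space are separated in a finite sum, so a linear functional is differentiated in time
    term by term and no theorem on differentiation under the integral is needed. The set Q limits
    the points at which the expansion holds. *)
Definition lin_family Q K F F' : Prop := exists (J : finType) (g g' : J -> R -> R) (E : J -> R * R -> R),
  [/\ forall j, mode (g j) (g' j), forall j, K (E j),
      forall s : R, 0 <= s -> forall x, Q x -> F s x = \sum_j g j s * E j x &
      forall s : R, 0 < s -> forall x, Q x -> F' s x = \sum_j g' j s * E j x].

Lemma family_static Q K (e : R * R -> R) : K e -> lin_family Q K (fun _ => e) (fun _ _ => 0).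
Proof.
move=> Ke; exists 'I_1, (fun _ _ => 1), (fun _ _ => 0), (fun _ => e); split => // [j|s _ x _|s _ x _].
- exact: mode_cst.
- by rewrite big_ord1 mul1r.
- by rewrite big_ord1 mul0r.
Qed.

Lemma family_mul Q K F F' H H' : (forall e e', K e -> K e' -> K (fun x => e x * e' x)) ->
  lin_family Q K F F' -> lin_family Q K H H' ->
  lin_family Q K (fun s x => F s x * H s x) (fun s x => F' s x * H s x + F s x * H' s x).
Proof.
move=> Km [J [g [g' [E [mg KE FE F'E]]]]] [L [h [h' [D [mh KD HE H'E]]]]].
exists (J * L)%type, (fun q s => g q.1 s * h q.2 s), (fun q s => g' q.1 s * h q.2 s + g q.1 s * h' q.2 s), (fun q x => E q.1 x * D q.2 x).
have prod (a a' : J -> R) (b b' : L -> R) x : (\sum_j a j * E j x) * (\sum_l b l * D l x) = \sum_(q : J * L) (a q.1 * b q.2) * (E q.1 x * D q.2 x).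
  rewrite big_distrlr/= pair_big/=; apply: eq_bigr => -[j l] _ /=; ring.
split => [q|q|s s0 x Qx|s s0 x Qx]; [exact: mode_mul|exact: Km| |].
  by rewrite FE// HE// prod.
rewrite F'E// H'E// FE ?(ltW s0)// HE ?(ltW s0)// !prod// -big_split/=.
by apply: eq_bigr => q _; rewrite mulrDl.
Qed.

Lemma family_sub Q Q' K K' F F' : Q' `<=` Q -> (forall e, K e -> K' e) -> lin_family Q K F F' -> lin_family Q' K' F F'.
Proof.
move=> QQ KK [J [g [g' [E [mg KE FE F'E]]]]]; exists J, g, g', E; split => // [j|s s0 x Qx|s s0 x Qx]; first exact: KK.
  by apply: FE => //; exact: QQ.
by apply: F'E => //; exact: QQ.
Qed.

Lemma family_mode Q K F F' (T : (R * R -> R) -> R) : lin_family Q K F F' ->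
  (forall e e', (forall x, Q x -> e x = e' x) -> T e = T e') ->
  (forall (J : finType) (a : J -> R) (E : J -> R * R -> R), (forall j, K (E j)) ->
    T (fun x => \sum_j a j * E j x) = \sum_j a j * T (E j)) ->
  mode (fun s => T (F s)) (fun s => T (F' s)).
Proof.
move=> [J [g [g' [E [mg KE FE F'E]]]]] Te Tl.
apply: (@mode_ext (fun s => \sum_j g j s * T (E j)) (fun s => \sum_j g' j s * T (E j))).
- apply: mode_sum => j; have := mode_scale (T (E j)) (mg j).
  by congr mode; apply/funext => s; rewrite mulrC.
- by move=> s s0; rewrite -Tl//; apply: Te => x Qx; rewrite FE.
- by move=> s s0; rewrite -Tl//; apply: Te => x Qx; rewrite F'E.
Qed.

End modes.

(** * Time derivatives of area, boundary and gradient integrals *)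

Section integral_modes.
Variables (R : realType) (Om : smooth_domain R).
Notation cl := (clos Om).
Notation I := (@I R Om).
Notation bm := (@bm R Om).
Notation bdry := (@bdry R Om).
Notation bint := (@bint R Om).
Notation fam := (lin_family (Om : set (R * R)) bm).
Notation bfam := (lin_family bdry (CC cl)).
Implicit Types (F H : R -> R * R -> R) (e : R * R -> R).

Lemma fam_mul F F' H H' : fam F F' -> fam H H' ->
  fam (fun s x => F s x * H s x) (fun s x => F' s x * H s x + F s x * H' s x).
Proof. by apply: family_mul => e e'; exact: bm_mul. Qed.

Lemma bfam_mul F F' H H' : bfam F F' -> bfam H H' ->
  bfam (fun s x => F s x * H s x) (fun s x => F' s x * H s x + F s x * H' s x).
Proof. by apply: family_mul => e e'; exact: cc_mul. Qed.

Lemma I_mode F F' : fam F F' -> mode (fun s => I (F s)) (fun s => I (F' s)).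
Proof.
move=> fF; apply: (family_mode fF) => [f g|J a E bE]; first exact: I_ext.
by rewrite I_sum => [|j]; [apply: eq_bigr => j _; rewrite I_scale|bmt].
Qed.

Lemma bint_mode F F' : bfam F F' -> mode (fun s => bint (F s)) (fun s => bint (F' s)).
Proof.
move=> fF; apply: (family_mode fF) => [f g|J a E cE]; first exact: bint_ext.
have cs (r : seq J) : CC cl (fun x => \sum_(j <- r) a j * E j x).
  elim: r => [|j r IH]; first by under eq_fun do rewrite big_nil; exact: cc_cst.
  by under eq_fun do rewrite big_cons; apply: cc_add => //; cct.
elim: (index_enum J) => [|j r IH].
  under eq_fun do rewrite big_nil; rewrite big_nil -[RHS](mul0r (bint (fun=> 0))) -bint_scale; last by cbt.
  by apply: bint_ext => x _; rewrite mul0r.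
under eq_fun do rewrite big_cons; rewrite big_cons bint_add; [|by cbt|by apply: cc_bintg].
by rewrite IH bint_scale//; cbt.
Qed.

Lemma grad_inner_ext u u' v v' : (forall x, dom Om x -> u x = u' x) -> (forall x, dom Om x -> v x = v' x) ->
  grad_inner Om u v = grad_inner Om u' v'.
Proof. by move=> uu vv; rewrite !grad_innerE; have [-> ->] := gsq_ext uu; have [-> ->] := gsq_ext vv. Qed.

(* The gradient of a finite-rank family is one too, by linearity of the
   elementwise gradient. *)
Lemma grad_family (Th : triangulation Om) F F' : lin_family cl (Vh Th) F F' -> exists G1 G1' G2 G2',
  [/\ fam G1 G1', fam G2 G2',
   forall s : R, 0 <= s -> grad_inner Om (F s) (F s) = I (fun x => G1 s x * G1 s x) + I (fun x => G2 s x * G2 s x),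
   forall s : R, 0 < s -> 2 * grad_inner Om (F s) (F' s) = I (fun x => G1' s x * G1 s x + G1 s x * G1' s x) + I (fun x => G2' s x * G2 s x + G2 s x * G2' s x) &
   forall chi c1 c2, PC1 Om chi c1 c2 -> forall s : R, 0 <= s -> grad_inner Om (F s) chi = I (fun x => G1 s x * c1 x) + I (fun x => G2 s x * c2 x)].
Proof.
move=> [J [g [g' [E [mg VE FE F'E]]]]].
have [a Ha] := choice (fun j => Vh_affine (VE j)); have [b Hb] := choice Ha; have [c Hc] := choice Hb.
have pE j := Vh_PC1 (VE j) (Hc j).
have bms j : bm (pw (b j)) /\ bm (pw (c j)) by have [_ h1 h2] := PC1_bm (pE j).
have pS (d : J -> R) : PC1 Om (fun x => \sum_j d j * E j x) (fun x => \sum_j d j * pw (b j) x) (fun x => \sum_j d j * pw (c j) x).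
  exact: (PC1_sum _ (fun j => PC1_scale (d j) (pE j))).
exists (fun s x => \sum_j g j s * pw (b j) x), (fun s x => \sum_j g' j s * pw (b j) x).
exists (fun s x => \sum_j g j s * pw (c j) x), (fun s x => \sum_j g' j s * pw (c j) x).
have [bG1 bG2] : (forall d : J -> R, bm (fun x => \sum_j d j * pw (b j) x)) /\ (forall d : J -> R, bm (fun x => \sum_j d j * pw (c j) x)).
  by split => d; have [_ h1 h2] := PC1_bm (pS d).
have Fd s : 0 <= s -> forall x, dom Om x -> F s x = \sum_j g j s * E j x by move=> s0 x Ox; apply: FE => //; exact: dom_cl.
have F'd s : 0 < s -> forall x, dom Om x -> F' s x = \sum_j g' j s * E j x by move=> s0 x Ox; apply: F'E => //; exact: dom_cl.
split.
- by exists J, g, g', (fun j => pw (b j)); split => // j; case: (bms j).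
- by exists J, g, g', (fun j => pw (c j)); split => // j; case: (bms j).
- by move=> s s0; rewrite (grad_inner_ext (Fd s s0) (Fd s s0)) (PC1_grad_inner (pS _) (pS _)) I_add//; apply: bm_mul.
- move=> s s0; rewrite (grad_inner_ext (Fd s (ltW s0)) (F'd s s0)) (PC1_grad_inner (pS _) (pS _)) I_add ?mulrDr; [|exact: bm_mul|exact: bm_mul].
  by rewrite -!I_scale; [congr (_ + _); apply: I_ext => x _; ring|exact: bm_mul|exact: bm_mul].
- by move=> chi c1 c2 pc s s0; rewrite (grad_inner_ext (Fd s s0) (fun x _ => erefl (chi x))) (PC1_grad_inner (pS _) pc); have [_ h1 h2] := PC1_bm pc; rewrite I_add//; apply: bm_mul.
Qed.

End integral_modes.

(** * Time derivatives of the norm, the energy and the dissipation *)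

Section evolution.
Variables (R : realType) (Om : smooth_domain R) (Th : triangulation Om) (sigma c0 nu : R).
Variables (uh w0h : R * R -> R) (wh wht Dwh : R -> R * R -> R).
Notation cl := (clos Om).
Notation I := (@I R Om).
Notation bm := (@bm R Om).
Notation sqn := (@sqn R Om).
Notation bdry := (@bdry R Om).
Notation bint := (@bint R Om).
Hypothesis c00 : 0 < c0.
Hypothesis nu0 : 0 < nu.
Hypothesis reg : regular Th sigma.
Hypothesis cu : CC cl uh.
Hypothesis sd : semidiscrete Th nu c0 uh w0h wh wht.
Hypothesis lap : forall t : R, 0 <= t -> is_disc_laplacian Th nu c0 uh (wh t) (Dwh t).

Lemma wh_Vh (s : R) : 0 <= s -> Vh Th (wh s). Proof. by case: sd => _ H _ _ _; exact: H. Qed.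
Lemma wht_Vh (s : R) : 0 < s -> Vh Th (wht s). Proof. by case: sd => _ _ _ H _ /H[]. Qed.

Lemma wh_family : lin_family cl (Vh Th) wh wht.
Proof.
have [n [p [E [r [cp VE Vr H]]]]] := Vh_riesz reg; have [_ _ H2 H3 _] := sd.
exists 'I_n, (fun (j : 'I_n) s => wh s (p j)), (fun (j : 'I_n) s => wht s (p j)), (fun j : 'I_n => E j); split => // [j|s s0 x clx|s s0 x clx].
- split => [t t0|]; first by have [_ h] := H3 t t0; exact: h (cp j _).
  exact: H2 (cp j _).
- by have [h _] := H _ (wh_Vh s0); exact: h.
- by have [h _] := H _ (wht_Vh s0); exact: h.
Qed.

Let fam_w : lin_family (Om : set (R * R)) bm wh wht.
Proof. by apply: family_sub wh_family => [x|e Ve]; [exact: dom_cl|exact: cont_cl_bm Ve.1]. Qed.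

Let bfam_w : lin_family bdry (CC cl) wh wht.
Proof. by apply: family_sub wh_family => [x [clx _]//|e Ve]; split; exact: Ve.1. Qed.

Lemma sqn_mode : mode (fun s => sqn (wh s)) (fun s => 2 * I (fun x => wh s x * wht s x)).
Proof.
apply: (mode_ext (I_mode (fam_mul fam_w fam_w))) => // s s0.
have b1 := cont_cl_bm (wh_Vh (ltW s0)).1; have b2 := cont_cl_bm (wht_Vh s0).1.
by rewrite -I_scale; [apply: I_ext => x _; ring|bmt].
Qed.

(** The boundary part of the energy is a primitive of the feedback divided by nu: the derivative of
    w^4/(9 nu c0) is twice that of the cubic term 2/(9 c0) w^3 over nu times w_t. Together with the
    gradient term this is the definition of the discrete Laplacian tested with w_t. *)
Lemma energy_mode : mode (fun s => energy Om c0 nu uh (wh s)) (fun s => - 2 * I (fun x => Dwh s x * wht s x)).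
Proof.
have [G1 [G1' [G2 [G2' [f1 f2 gE g'E _]]]]] := grad_family wh_family.
have nu0' := nu0; have c00' := c00.
pose A x := (c0 + nu + 2 * `|uh x|) / nu.
have cA : CC cl A by rewrite /A; cct.
have m1 := mode_add (I_mode (fam_mul f1 f1)) (I_mode (fam_mul f2 f2)).
have m2 := bint_mode (bfam_mul (family_static bdry cA) (bfam_mul bfam_w bfam_w)).
have bw2 := bfam_mul bfam_w bfam_w; have m3 := mode_scale (1 / (9 * nu * c0)) (bint_mode (bfam_mul bw2 bw2)).
apply: (mode_ext (mode_add (mode_add m1 m2) m3)) => s s0.
  rewrite /energy -grad_inner_gsq gE//; congr (_ + _ + _ * _).
  by apply: bint_ext => x _; rewrite (exprM _ 2 2) !expr2.
have Vw := wh_Vh (ltW s0); have Vt := wht_Vh s0.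
have cw := MkCC Vw.1; have ct := MkCC Vt.1.
have h := laplacian_test (lap (ltW s0)) Vt cu cw;
rewrite -g'E// h (_ : bint (fun x => feedback _ _ _ _ * _) = nu * bint (fun x => A x * (wh s x * wht s x)) + 2 / (9 * c0) * bint (fun x => wh s x ^+ 3 * wht s x)); last first.
  rewrite -bint_scale; [|by cbt]; rewrite -bint_scale; [|by cbt]; rewrite -bint_add; [|by cbt|by cbt].
  by apply: bint_ext => x _; rewrite /feedback /A; field; rewrite !gt_eqF.
rewrite [X in _ + X + _](_ : _ = 2 * bint (fun x => A x * (wh s x * wht s x))); last first.
  by rewrite -bint_scale; [apply: bint_ext => x _; ring|cbt].
rewrite [X in _ + _ * X](_ : _ = 4 * bint (fun x => wh s x ^+ 3 * wht s x)); last first.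
  by rewrite -bint_scale; [apply: bint_ext => x _; ring|cbt].
move: (bint _) (bint _) (I _) => a b d; field; by rewrite !gt_eqF.
Qed.

(** What matters is the continuity in time, which makes the integral of the dissipation meaningful;
    the value of the derivative is left unspecified. *)
Lemma laplacian_mode : exists q, mode (fun s => sqn (Dwh s)) q.
Proof.
have [n [p [E [r [cp VE Vr H]]]]] := Vh_riesz reg.
have [G1 [G1' [G2 [G2' [f1 f2 _ _ chiE]]]]] := grad_family wh_family.
have cc' := c00; have nu' := nu0.
have Dr m : exists a, mode (fun s => I (fun x => Dwh s x * r m x)) a.
  have [c1 [c2 pr]] := Vh_PC1_ex (Vr m); have [_ b1 b2] := PC1_bm pr; have cr := MkCC (Vr m).1.
  pose A x := (c0 + nu + 2 * `|uh x|) * r m x; pose B x := 2 / (9 * c0) * r m x.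
  have cA : CC cl A by rewrite /A; cct.
  have cB : CC cl B by rewrite /B; cct.
  have m1 := mode_add (I_mode (fam_mul f1 (family_static (Om : set (R * R)) b1))) (I_mode (fam_mul f2 (family_static (Om : set (R * R)) b2))).
  have m2 := bint_mode (bfam_mul bfam_w (family_static bdry cA)).
  have m3 := bint_mode (bfam_mul bfam_w (bfam_mul bfam_w (bfam_mul bfam_w (family_static bdry cB)))).
  have := mode_scale (-1) (mode_add m1 (mode_scale nu^-1 (mode_add m2 m3))).
  set a := (X in mode _ X) => ma; exists a; apply: (mode_ext ma) => // s s0.
  have Vw := wh_Vh s0; have cw := MkCC Vw.1.
  have := laplacian_test (lap s0) (Vr m) cu cw; rewrite (chiE _ _ _ pr)// -bint_add; [|by cbt|by cbt].
  rewrite (_ : bint (fun x => feedback _ _ _ _ * _) = bint (fun x => wh s x * A x + wh s x * (wh s x * (wh s x * B x)))); last first.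
    by apply: bint_ext => x _; rewrite /feedback /A /B; ring.
  by move=> ->; rewrite mulN1r opprD; ring.
have [a Ha] := choice Dr.
have fD : lin_family cl (Vh Th) Dwh (fun s x => \sum_(m < n) a m s * E m x).
  exists 'I_n, (fun (j : 'I_n) s => I (fun x => Dwh s x * r j x)), (fun j : 'I_n => a j), (fun j : 'I_n => E j); split => // s s0 x clx.
  have [VL _] := lap s0; have [h1 h2] := H _ VL; rewrite h1//; apply: eq_bigr => m _.
  by rewrite h2.
have fL : lin_family (Om : set (R * R)) bm Dwh (fun s x => \sum_(m < n) a m s * E m x).
  by apply: family_sub fD => [x|e Ve]; [exact: dom_cl|exact: cont_cl_bm Ve.1].
by eexists; exact: I_mode (fam_mul fL fL).
Qed.

End evolution.

(** * The differential inequality for the energy *)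

Section ode.
Variable R : realType.
Implicit Types (g h y E L : R -> R).

Lemma mode_exp g g' : mode g g' -> mode (fun s => expR (g s)) (fun s => g' s * expR (g s)).
Proof.
move=> [dg cg]; split => [t t0|]; last by apply: continuous_cvg cg; exact: continuous_expR.
have h1 := dg t t0; have h2 : is_derive (g t) 1 (@expR R) (expR (g t)) := is_derive_expR _.
by have h3 := is_derive1_comp h2 h1; apply: (is_derive_eq h3); rewrite /GRing.scale/= mulrC.
Qed.

Lemma mode_lin (c : R) : mode (fun s => c * s) (fun=> c).
Proof.
have m : mode (fun s : R => s) (fun=> 1) by split => [t _|]; [exact: is_derive_id|exact/cvg_at_right_filter/cvg_id].
have := mode_scale c m; congr mode; apply/funext => s; exact: mulr1.
Qed.

Lemma mode_continuous g g' (s : R) : mode g g' -> 0 < s -> {for s, continuous g}.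
Proof.
move=> [dg _] s0; apply: differentiable_continuous; apply/derivable1_diffP.
by have h := dg s s0; exact: ex_derive.
Qed.

Lemma mode_cont g g' (t : R) : mode g g' -> 0 < t -> {within `[0, t], continuous g}.
Proof.
move=> mg t0; have cs := mode_continuous mg; have [dg cg0] := mg.
apply/(continuous_within_itvP _ t0); split => //.
  by move=> s; rewrite in_itv/= => /andP[s0 _]; exact: cs.
by apply: cvg_at_left_filter; exact: cs.
Qed.

Lemma mode_nincr g g' (t : R) : mode g g' -> (forall s : R, 0 < s -> g' s <= 0) -> 0 < t -> g t <= g 0.
Proof.
move=> mg neg t0.
have [|s] := @MVT R g g' 0 t t0 _ (mode_cont mg t0).
  by move=> s; rewrite in_itv/= => /andP[s0 _]; exact: mg.1.
rewrite in_itv/= => /andP[s0 _]; rewrite subr0 => E.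
by rewrite -subr_le0 E mulr_le0_ge0// ?neg// ltW.
Qed.

(** By the mean value theorem h plus the integral of g does not increase. The integral is returned
    as a real number because the theorem states it in the extended reals. *)
Lemma mode_integral h h' g a (t : R) : mode h h' -> mode g a ->
  (forall s : R, 0 < s -> h' s <= - g s) -> 0 < t ->
  exists2 J : R, (\int[@lebesgue_measure R]_(s in `[0%R, t]) (g s)%:E = J%:E)%E & J <= h 0 - h t.
Proof.
move=> mh mg le t0; have cg := mode_cont mg t0.
have ig : (@lebesgue_measure R).-integrable `[0, t] (EFin \o g).
  by apply: continuous_compact_integrable => //; exact: segment_compact.
pose G (x : R) : R := \int[@lebesgue_measure R]_(s in [set` `[0, x]]) g s.
have cG : {within `[0, t], continuous G} := parameterized_integral_continuous (ltW t0) ig.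
have cH : {within `[0, t], continuous (fun s => h s + G s)}.
  by move=> x; apply: cvgD; [exact: (mode_cont mh t0)|exact: cG].
have dH s : s \in `]0, t[ -> is_derive s 1 (fun s => h s + G s) (h' s + g s).
  rewrite in_itv/= => /andP[s0 st]; have d1 := mh.1 s s0.
  have [d2 E2] := @continuous_FTC1_closed _ g 0 s t st ig s0 (mode_continuous mg s0).
  have d3 : is_derive s 1 G (g s) by rewrite -E2 derive1E; exact: derivableP.
  exact: is_deriveD.
have [s] := @MVT R _ (fun s => h' s + g s) 0 t t0 dH cH.
rewrite in_itv/= => /andP[s0 _]; rewrite subr0 => E.
have G0 : G 0 = 0 by rewrite /G set_itv1 Rintegral_set1.
have Gt : (\int[@lebesgue_measure R]_(s in `[0%R, t]) (g s)%:E = (G t)%:E)%E.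
  by rewrite /G /Rintegral fineK//; exact: integrable_fin_num ig.
exists (G t) => //; rewrite lerBrDr addrC; have : h t + G t - (h 0 + G 0) <= 0.
  by rewrite E mulr_le0_ge0 ?(ltW t0)//; have := le s s0; lra.
by rewrite G0; lra.
Qed.

(** Term by term: the derivative of th contributes - K F^2 th, which cancels K e E^2 th because e >=
    1 gives e E^2 <= F^2; the choice of k makes k z' cancel the terms linear in E; th >= 1 preserves
    the dissipation. *)
Lemma ode_arith (nu K al F E e th Th L z' E' k : R) : 0 < nu -> 0 < K -> 0 <= al -> 0 <= E -> 0 <= L -> 1 <= e -> 1 <= th -> th <= Th ->
  F = e * E -> z' <= - (nu / 2) * F -> E' <= - nu * L + K * (E + E ^+ 2) -> k = 2 / nu * (2 * al + K) * Th ->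
  (2 * al * e * E + e * E') * th + F * (2 * K / nu * z' * th) + k * z' <= - (nu * (e * L)).
Proof.
move=> nu0 K0 al0 E0 L0 e1 th1 thT FE hz hE kE.
have e0 : 0 <= e by lra.
have F0 : 0 <= F by rewrite FE mulr_ge0.
have th0 : 0 <= th by lra.
have k0 : 0 <= k by rewrite kE !mulr_ge0// ?invr_ge0; lra.
have h1 : k * z' <= - (2 * al + K) * Th * F.
  apply: (le_trans (lem_l k0 hz)); rewrite kE (_ : 2 / nu * _ * _ * _ = - (2 * al + K) * Th * F)//.
  by field; rewrite gt_eqF.
have h2 : F * (2 * K / nu * z' * th) <= - K * F ^+ 2 * th.
  have kk : 0 <= 2 * K / nu by nn.
  have p : 0 <= F * (2 * K / nu) * th by nn.
  rewrite (_ : F * _ = F * (2 * K / nu) * th * z'); last by ring.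
  apply: (le_trans (lem_l p hz)); rewrite (_ : F * (2 * K / nu) * th * (- (nu / 2) * F) = - K * F ^+ 2 * th)//.
  by field; rewrite gt_eqF.
have h3 : e * E' * th <= e * th * (- nu * L + K * (E + E ^+ 2)).
  by rewrite mulrAC; apply: lem_l => //; rewrite mulr_ge0.
have h4 : e * (nu * L) <= e * th * (nu * L).
  rewrite (_ : e * th * (nu * L) = th * (e * (nu * L))); last by ring.
  by rewrite ler_peMl// mulr_ge0// mulr_ge0// ltW.
have h5 : K * th * (e * E ^+ 2) <= K * th * F ^+ 2.
  apply: lem_l; first by rewrite mulr_ge0// ltW.
  by rewrite FE exprMn expr2 -mulrA ler_peMl// mulr_ge0// mulr_ge0// sqr_ge0.
have h6 : (2 * al + K) * F * th <= (2 * al + K) * F * Th by apply: lem_l => //; rewrite mulr_ge0//; lra.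
move: h1 h2 h3 h4 h5 h6; rewrite FE; clear; lra.
Qed.

(* With z = e^(2 al s) y and F = e^(2 al s) E, the factor exp((2 K / nu) z) absorbs
   the quadratic term since z' <= - (nu / 2) F; a multiple of z absorbs the linear one. *)
Lemma ode_bound (nu K al : R) y y' E E' L L' : 0 < nu -> 0 < K -> 0 <= al -> mode y y' -> mode E E' -> mode L L' ->
  (forall s : R, 0 <= s -> [/\ 0 <= y s, 0 <= E s & 0 <= L s]) ->
  (forall s : R, 0 < s -> y' s <= - 2 * al * y s - nu / 2 * E s) ->
  (forall s : R, 0 < s -> E' s <= - nu * L s + K * (E s + E s ^+ 2)) ->
  forall t : R, 0 < t ->
  ((E t)%:E + (nu * expR (- 2 * al * t))%:E * \int[@lebesgue_measure R]_(s in `[0%R, t]) (expR (2 * al * s) * L s)%:E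
   <= ((E 0 + 2 / nu * (2 * al + K) * y 0) * expR (2 * K / nu * y 0) * expR (- 2 * al * t))%:E)%E.
Proof.
move=> nu0 K0 al0 my mE mL pos hy hE t t0.
have mexp := mode_exp (mode_lin (2 * al)).
pose e (s : R) := expR (2 * al * s).
have e1 s : 0 <= s -> 1 <= e s by move=> s0; rewrite /e -[leLHS]expR0 ler_expR mulr_ge0// mulr_ge0.
have mz := mode_mul mexp my; have mF := mode_mul mexp mE.
have z'le s : 0 < s -> 2 * al * e s * y s + e s * y' s <= - (nu / 2) * (e s * E s).
  move=> s0; have e0 : 0 <= e s := expR_ge0 _; have := lem_l e0 (hy s s0); move: (e s) (y s) (y' s) (E s) => a b c d h; lra.
have zle (s : R) : 0 <= s -> e s * y s <= y 0.
  rewrite le_eqVlt => /predU1P[<-|s0]; first by rewrite /e mulr0 expR0 mul1r.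
  have := mode_nincr mz _ s0; rewrite mulr0 expR0 mul1r; apply => r r0; apply: (le_trans (z'le r r0)).
  by have [_ E0 _] := pos r (ltW r0); rewrite mulNr oppr_le0 mulr_ge0// ?divr_ge0 ?mulr_ge0 ?expR_ge0// ltW.
pose th (s : R) := expR (2 * K / nu * (e s * y s)).
have k0 : 0 <= 2 * K / nu by nn.
have mth := mode_exp (mode_scale (2 * K / nu) mz).
pose k := 2 / nu * (2 * al + K) * expR (2 * K / nu * y 0).
(* The functional (F th + k z) / nu, whose derivative is at most minus the weighted dissipation. *)
have mPhi := mode_scale nu^-1 (mode_add (mode_mul mF mth) (mode_scale k mz)).
have mL' := mode_mul mexp mL.
have [y0 E0 L0] := pos t (ltW t0).
have th1 s : 0 <= s -> 1 <= th s.
  move=> s0; have [ys _ _] := pos s s0; rewrite /th -[leLHS]expR0 ler_expR; apply: mulr_ge0 => //.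
  by rewrite mulr_ge0// expR_ge0.
have [s s0|J -> hJ] := mode_integral mPhi mL' _ t0.
  have [ys Es Ls] := pos s (ltW s0).
  rewrite ler_pdivrMl// mulrN.
  apply: (@ode_arith nu K al (e s * E s) (E s) (e s) (th s) (expR (2 * K / nu * y 0))) => //; [exact: e1 (ltW s0)|exact: th1 (ltW s0)| |exact: z'le|exact: hE].
  by rewrite ler_expR; apply: lem_l => //; exact: zle (ltW s0).
have hJ' : nu * J <= (E 0 + 2 / nu * (2 * al + K) * y 0) * expR (2 * K / nu * y 0) - e t * E t.
  rewrite -ler_pdivlMl//; apply: (le_trans hJ); rewrite -mulrBr; apply: lem_l; first by rewrite invr_ge0 ltW.
  rewrite mulr0 expR0 !mul1r; apply: lerB.
    by rewrite /k; move: (expR _) => a; lra.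
  rewrite -[leLHS]addr0; apply: lerD; last first.
    apply: mulr_ge0; last by rewrite mulr_ge0// expR_ge0.
    rewrite /k; apply: mulr_ge0; last exact: expR_ge0.
    by apply: mulr_ge0; [apply: divr_ge0 => //; exact: ltW|lra].
  by rewrite ler_peMr ?th1 ?(ltW t0)// mulr_ge0// expR_ge0.
rewrite -EFinM -EFinD lee_fin.
have ee : e t * expR (- 2 * al * t) = 1 by rewrite /e -expRD -expR0; congr expR; ring.
have em0 := expR_ge0 (- 2 * al * t); have := lem_r em0 hJ'.
rewrite mulrBl (mulrAC (e t)) ee mul1r; move: (expR (- 2 * al * t)) (expR _) => a b; lra.
Qed.

End ode.

(** * Elementary inequalities for the final estimate *)

Section arithmetic.
Variable R : realType.
Implicit Types a b d e g h k y A E M : R.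

Lemma eq0_le a b d e g h : e + h + a + b + d + g = 0 -> 2 * e <= - 2 * (h + (a + b + d) + g).
Proof. by move=> hh; lra. Qed.

Lemma decay_le0 a d y E : 0 <= a -> 0 <= d -> 0 <= y -> 0 <= E -> - 2 * a * y - d / 2 * E <= 0.
Proof. by move=> a0 d0 y0 E0; have := mulr_ge0 a0 y0; have := mulr_ge0 d0 E0; lra. Qed.

Lemma initial_le a d k y A E M g : 0 < d -> 0 < g -> 0 <= a -> 0 <= k -> 0 <= y -> y <= M -> 2 * g * a <= d / 2 ->
  A = d / (2 * g) + k -> E + 2 / d * (2 * a + k) * y <= E + 2 / d * A * M.
Proof.
move=> d0 g0 a0 k0 y0 yM h ->; have h1 : 2 * a <= d / (2 * g) by rewrite ler_pdivlMr ?mulr_gt0//; lra.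
have d1 : 0 <= 2 / d by nn.
have p : 0 <= 2 * a + k by lra.
rewrite lerD2l; apply: ler_pM => //; first exact: mulr_ge0.
by apply: lem_l => //; lra.
Qed.

End arithmetic.

(** * Decay of the L^2 norm and the stability estimate *)

Section stability.
Variables (R : realType) (Om : smooth_domain R) (c0 CF N sigma nu : R).
Notation cl := (clos Om).
Notation I := (@I R Om).
Notation bm := (@bm R Om).
Notation PC1 := (@PC1 R Om).
Notation sqn := (@sqn R Om).
Notation gsq := (@gsq R Om).
Notation bint := (@bint R Om).
Implicit Types (u uh v w f : R * R -> R).
Hypothesis c00 : 0 < c0.
Hypothesis hCF : friedrichs Om CF.
Hypothesis hN : N%:E = maxe (N1 Om) (N2 Om).
Hypothesis nu0 : 0 < nu.

Lemma I_mul0 u v : bm u -> bm v -> sqn u = 0 -> I (fun x => u x * v x) = 0.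
Proof.
move=> bu bv s0; apply/eqP; rewrite -sqrf_eq0 eq_le sqr_ge0 andbT.
by apply: (le_trans (CS (bm_lsq bu) (bm_lsq bv))); rewrite s0 mul0r.
Qed.

(** N times nu/(4 N) is nu/4. The supremum defining N2 excludes zero norms, so these cases are
    treated apart: there uh or w vanishes in L^2, by the Poincare or Friedrichs inequality. *)
Lemma convection_bound uh u1 u2 w w1 w2 : PC1 uh u1 u2 -> H1quot Om uh -> grad_norm Om uh <= nu / (4 * N) ->
  PC1 w w1 w2 -> trilinear Om uh w w <= nu / 4 * (gsq w + bint (fun x => w x ^+ 2)).
Proof.
move=> pu hu gu pw; have [N0 [P P0 HP]] := poincare hN; have nu0' := nu0.
have [bu _ _] := PC1_bm pu; have [bw b1 b2] := PC1_bm pw.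
have b20 : 0 <= bint (fun x => w x ^+ 2) by apply: bint_ge0 => x _; exact: sqr_ge0.
have g0 := gsq_ge0 Om w.
have r0 : 0 <= nu / 4 * (gsq w + bint (fun x => w x ^+ 2)).
  by apply: mulr_ge0; [exact: divr_ge0 (ltW nu0) _|exact: addr_ge0].
have E := PC1_trilinear bu.1 bw.1 pw.
have [z|nz] := eqVneq (grad_norm Om uh) 0.
  have s0 : sqn uh = 0.
    apply/eqP; rewrite eq_le sqn_ge0 andbT; apply: (le_trans (HP _ hu)).
    by rewrite -grad_norm_sq z expr0n/= mulr0.
  rewrite E (_ : I _ = I (fun x => uh x * ((w1 x + w2 x) * w x))); last by apply: I_ext => x _; ring.
  by rewrite I_mul0//; bmt.
have t2 : triple_norm Om w ^+ 2 = gsq w + bint (fun x => trace Om w x ^+ 2).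
  rewrite /triple_norm sqr_sqrtr ?grad_norm_sq//; apply: addr_ge0 => //.
  by apply: bint_ge0 => x _; exact: sqr_ge0.
have [z|tz] := eqVneq (triple_norm Om w) 0.
  have s0 : sqn w = 0.
    have [CF0 H] := hCF; have := H w (PC1_sobolev pw).
    rewrite /L2norm sqr_sqrtr inner_sqn ?sqn_ge0// grad_norm_sq -t2 z expr0n/= mulr0 => h.
    by apply/eqP; rewrite eq_le h sqn_ge0.
  rewrite E (_ : I _ = I (fun x => w x * (uh x * (w1 x + w2 x)))); last by apply: I_ext => x _; ring.
  by rewrite I_mul0//; bmt.
apply: (le_trans (N2_bound hN hu (PC1_sobolev pw) (PC1_sobolev pw) nz tz tz)).
rewrite -[_ * _ * triple_norm Om w]mulrA -expr2 t2 mulrA.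
apply: (@le_trans _ _ (N * (nu / (4 * N)) * (gsq w + bint (fun x => trace Om w x ^+ 2)))).
  apply: lem_r; last exact: lem_l (ltW N0) gu.
  by rewrite -t2 sqr_ge0.
rewrite (_ : N * (nu / (4 * N)) = nu / 4); last by field; rewrite gt_eqF.
by apply: lem_l; [exact: divr_ge0 (ltW nu0) _|rewrite lerD2l; exact: trace_le pw].
Qed.

(* The transport terms are a divergence, which Green's formula turns into the
   boundary integrals absorbed by the feedback, minus the convection by uh. *)
Lemma transport_bound uh u1 u2 w w1 w2 : PC1 uh u1 u2 -> PC1 w w1 w2 ->
  - (trilinear Om uh w w + trilinear Om w uh w + trilinear Om w w w) <=
  trilinear Om uh w w + 3 / 2 * bint (fun x => `|uh x| * w x ^+ 2) + 1 / 2 * bint (fun x => `|w x| ^+ 3).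
Proof.
move=> pu pw; have [bu b1 b2] := PC1_bm pu; have [bw b3 b4] := PC1_bm pw.
rewrite (PC1_trilinear bu.1 bw.1 pw) (PC1_trilinear bw.1 bw.1 pu) (PC1_trilinear bw.1 bw.1 pw).
have g1 := green_bound (PC1_mul pu (PC1_exp 1 pw)).
have g2 := green_bound (PC1_exp 2 pw).
rewrite (_ : bint (fun x => `|uh x * w x ^+ 2|) = bint (fun x => `|uh x| * w x ^+ 2)) in g1; last first.
  by apply: bint_ext => x _; rewrite normrM (ger0_norm (sqr_ge0 (w x))).
rewrite (_ : bint (fun x => `|w x ^+ 3|) = bint (fun x => `|w x| ^+ 3)) in g2; last first.
  by apply: bint_ext => x _; rewrite normrX.
rewrite (_ : I _ = I (fun x => w x * (u1 x + u2 x) * w x) + 2 * I (fun x => uh x * (w1 x + w2 x) * w x)) in g1; last first.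
  by rewrite -I_scale; [rewrite -I_add; [apply: I_ext => x _; ring|bmt|bmt]|bmt].
rewrite (_ : I _ = 3 * I (fun x => w x * (w1 x + w2 x) * w x)) in g2; last first.
  by rewrite -I_scale; [apply: I_ext => x _; ring|bmt].
move: g1 g2; rewrite !ler_norml => /andP[g1 _] /andP[g2 _]; move: g1 g2.
by move: (bint _) (bint _) (I _) (I _) (I _) => p q a b d g1 g2; lra.
Qed.

(** The difference is a perfect square, as 9/28 times 7/36 is 1/16. The coefficient 7/36 is 2/9 -
    1/36, which leaves 1/(36 c0) of the quartic feedback for the energy. *)
Lemma cubic_young (a : R) : 1 / 2 * `|a| ^+ 3 <= 9 / 28 * c0 * a ^+ 2 + 7 / (36 * c0) * a ^+ 4.
Proof.
have c0' := c00; rewrite (exprM a 2 2) -(real_normK (num_real a)); move: `|a| => s.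
rewrite -subr_ge0 (_ : _ - _ = s ^+ 2 * (9 * c0 - 7 * s) ^+ 2 / (252 * c0)); last by field; rewrite gt_eqF.
by apply: divr_ge0; apply: mulr_ge0; [exact: sqr_ge0|exact: sqr_ge0|exact: ler0n|exact: ltW].
Qed.

(** The budget of the feedback: 2|u| is shared by the transport term (3/2) and the energy (1/2), m
    by the convection and the weight e^(2 alpha t) (3/4) and the energy (1/4), and the cubic
    boundary term is paid from c0 and the quartic part. *)
Lemma decay_pointwise (m u a : R) : 3 / 2 * (`|u| * a ^+ 2) + 1 / 2 * `|a| ^+ 3 + 3 / 4 * m * a ^+ 2 +
  1 / 4 * ((c0 + m + 2 * `|u|) * a ^+ 2) <= feedback c0 m u a * a + - (1 / (36 * c0)) * a ^+ 4.
Proof.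
have k := cubic_young a; rewrite /feedback.
have p2 : 0 <= c0 * a ^+ 2 by apply: mulr_ge0 (sqr_ge0 _); exact: ltW.
rewrite (_ : _ * a + _ = c0 * a ^+ 2 + m * a ^+ 2 + 2 * (`|u| * a ^+ 2) + 7 / (36 * c0) * a ^+ 4); last by field; rewrite gt_eqF.
rewrite (_ : 1 / 4 * _ = 1 / 4 * (c0 * a ^+ 2) + 1 / 4 * (m * a ^+ 2) + 1 / 2 * (`|u| * a ^+ 2)); last by field.
move: k p2; rewrite -(mulrA (9 / 28)) -(mulrA (3 / 4)).
by move: (`|u| * a ^+ 2) (c0 * a ^+ 2) (m * a ^+ 2) (7 / (36 * c0) * a ^+ 4) (`|a| ^+ 3) => e1 e2 e3 e4 e5 k p2; lra.
Qed.

(** Of the dissipation 2 nu |grad w|^2, the convection by uh, the term in [al] through Friedrichs's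
    inequality, and the energy each take at most nu/2; the boundary terms are compared pointwise by
    [decay_pointwise]. *)
Lemma energy_decay uh u1 u2 w w1 w2 (al : R) : PC1 uh u1 u2 -> H1quot Om uh -> grad_norm Om uh <= nu / (4 * N) ->
  PC1 w w1 w2 -> 0 <= al -> 2 * CF * al <= nu / 2 ->
  - 2 * (nu * gsq w + (trilinear Om uh w w + trilinear Om w uh w + trilinear Om w w w)
    + bint (fun x => feedback c0 nu (uh x) (w x) * w x)) <= - 2 * al * sqn w - nu / 2 * energy Om c0 nu uh w.
Proof.
move=> pu hu gu pw al0 hal; have c0' := c00; have nu0' := nu0.
have cu := MkCC (pc_cont pu); have cw := MkCC (pc_cont pw).
have g0 := gsq_ge0 Om w; have b20 : 0 <= bint (fun x => w x ^+ 2) by apply: bint_ge0 => x _; exact: sqr_ge0.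
have h1 := transport_bound pu pw; have h2 := convection_bound pu hu gu pw.
have h3 : 2 * al * sqn w <= nu / 2 * (gsq w + bint (fun x => w x ^+ 2)).
  apply: (le_trans (lem_l (mulr_ge0 (ler0n _ 2) al0) (friedrichs_PC1 hCF pw))).
  rewrite mulrA; apply: lem_r; first exact: addr_ge0.
  by rewrite mulrAC.
pose A x := (c0 + nu + 2 * `|uh x|) * w x ^+ 2.
have cA : CC cl A by rewrite /A; cct.
have h4 : bint (fun x => 3 / 2 * (`|uh x| * w x ^+ 2) + 1 / 2 * `|w x| ^+ 3 + 3 / 4 * nu * w x ^+ 2 + 1 / 4 * A x) <=
    bint (fun x => feedback c0 nu (uh x) (w x) * w x + - (1 / (36 * c0)) * w x ^+ 4).
  apply: bint_le; [by cbt|by cbt|move=> x _]; exact: decay_pointwise.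
rewrite !bint_add in h4; try by cbt.
rewrite !bint_scale in h4; try by cbt.
rewrite /energy (_ : bint (fun x => (c0 + nu + 2 * `|uh x|) / nu * w x ^+ 2) = nu^-1 * bint A); last first.
  by rewrite -bint_scale; [apply: bint_ext => x _; rewrite /A; ring|cbt].
rewrite (_ : nu / 2 * _ = nu / 2 * gsq w + 1 / 2 * bint A + 2 * (1 / (36 * c0)) * bint (fun x => w x ^+ 4)); last first.
  by move: (bint A) (bint _) (gsq w) => a b d; field; rewrite !gt_eqF.
move: h1 h2 h3 h4 g0 b20; clearbody A; clear cA.
move: (bint A) (bint (fun x => feedback _ _ _ _ * _)) (bint (fun x => w x ^+ 4)) (bint (fun x => w x ^+ 2)) (bint (fun x => `|w x| ^+ 3)) (bint (fun x => `|uh x| * w x ^+ 2)) (1 / (36 * c0)) => a fb b4 b2 b3 bu k.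
move: (trilinear Om w uh w) (trilinear Om w w w) (trilinear Om uh w w) (gsq w) (sqn w) => t1 t2 t3 g y h1 h2 h3 h4 g0 b20.
have g1 : 0 <= nu * g := mulr_ge0 (ltW nu0') g0.
by have g2 : 0 <= nu * b2 := mulr_ge0 (ltW nu0') b20; clear -h1 h2 h3 h4 g1 g2; lra.
Qed.

(** u - v is orthogonal to v in H^1, so the squared norms add up. *)
Lemma projection_bound (Th : triangulation Om) u v : sobolev Om 1 u -> is_H1_projection Th u v ->
  sqn v + gsq v <= sqn u + gsq u.
Proof.
move=> su [Vv H]; have [v1 [v2 pv]] := Vh_PC1_ex Vv; have sv := PC1_sobolev pv.
have [sd _ _] := sobolev_lin (-1) su sv; have [ld _ _] := sobolev1_lsq sd; have [lv _ _] := sobolev1_lsq sv.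
have E : u = (fun x => (u x + -1 * v x) + 1 * v x) by apply/funext => x; ring.
have := H v Vv; rewrite (_ : (fun x => u x - v x) = (fun x => u x + -1 * v x)); last by apply/funext => x; rewrite mulN1r.
rewrite innerE => h; rewrite E sqnD// gsq_lin//.
have := sqn_ge0 Om (fun x => u x + -1 * v x); have := gsq_ge0 Om (fun x => u x + -1 * v x).
by move: h; move: (I _) (grad_inner Om _ _) (sqn v) (gsq v) (sqn _) (gsq _) => a b d e i j h h1 h2; lra.
Qed.

Lemma energy_bound (M : R) : exists C : R, forall uh u1 u2 w w1 w2, PC1 uh u1 u2 -> PC1 w w1 w2 ->
  sqn uh + gsq uh <= M -> sqn w + gsq w <= M -> energy Om c0 nu uh w <= C.
Proof.
have [T1 T10 HT1] := trace_pow Om 0; have [T2 T20 HT2] := trace_pow Om 1; have c0' := c00; have nu0' := nu0.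
exists (M + nu^-1 * ((c0 + nu) * (T1 * M) + (T1 * M + T2 * M ^+ 2)) + 1 / (9 * nu * c0) * (T2 * M ^+ 2)).
move=> uh u1 u2 w w1 w2 pu pw hu hw; have cu := MkCC (pc_cont pu); have cw := MkCC (pc_cont pw).
have b2 v v1 v2 : PC1 v v1 v2 -> sqn v + gsq v <= M -> bint (fun x => v x ^+ 2) <= T1 * M.
  by move=> pv hv; apply: (le_trans (HT1 _ _ _ pv)); rewrite expr1; exact: lem_l (ltW T10) hv.
have b4 : bint (fun x => w x ^+ 4) <= T2 * M ^+ 2.
  apply: (le_trans (HT2 _ _ _ pw)); apply: lem_l (ltW T20) _.
  have s0 : 0 <= sqn w + gsq w by rewrite addr_ge0 ?sqn_ge0 ?gsq_ge0.
  by rewrite lerXn2r// nnegrE// (le_trans s0).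
have n0 : 0 <= nu^-1 by nn.
rewrite /energy; apply: lerD; first apply: lerD.
- by apply: le_trans hw; rewrite lerDr sqn_ge0.
- apply: (@le_trans _ _ (bint (fun x => nu^-1 * ((c0 + nu) * w x ^+ 2 + (uh x ^+ 2 + w x ^+ 4))))).
    apply: bint_le; [by cbt|by cbt|move=> x _]; rewrite mulrAC mulrC; apply: lem_l => //.
    have := sqr_ge0 (`|uh x| - w x ^+ 2); rewrite sqrrB normr2// -exprM.
    by move: (`|uh x|) => a; lra.
  rewrite bint_scale; last by cbt.
  apply: lem_l => //; rewrite bint_add; [|by cbt|by cbt]; apply: lerD.
    rewrite bint_scale; last by cbt.
    by apply: lem_l; [lra|exact: b2 pw hw].
  by rewrite bint_add; [apply: lerD => //; exact: b2 pu hu|cbt|cbt].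
by apply: lem_l b4; apply: divr_ge0 => //; rewrite !mulr_ge0// ltW.
Qed.

Lemma energy_ge0 uh w : 0 <= energy Om c0 nu uh w.
Proof.
have c0' := c00; have nu0' := nu0; rewrite /energy; apply: addr_ge0; [apply: addr_ge0; first exact: gsq_ge0|].
  apply: bint_ge0 => x _; apply: mulr_ge0 (sqr_ge0 _); apply: divr_ge0 (ltW nu0).
  by have := normr_ge0 (uh x); lra.
apply: mulr_ge0; first by apply: divr_ge0 => //; rewrite !mulr_ge0// ltW.
by apply: bint_ge0 => x _; rewrite (exprM _ 2 2) sqr_ge0.
Qed.

Lemma energy_ext uh w w' : (forall x, cl x -> w x = w' x) -> energy Om c0 nu uh w = energy Om c0 nu uh w'.
Proof.
move=> ww; have bw x : bdry Om x -> w x = w' x by move=> [clx _]; exact: ww.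
have e1 : gsq w = gsq w'.
  by rewrite -(grad_inner_gsq Om w) -(grad_inner_gsq Om w'); apply: grad_inner_ext => x Ox; apply: ww; exact: dom_cl.
have e2 : bint (fun x => (c0 + nu + 2 * `|uh x|) / nu * w x ^+ 2) = bint (fun x => (c0 + nu + 2 * `|uh x|) / nu * w' x ^+ 2).
  by apply: bint_ext => x /bw ->.
have e3 : bint (fun x => w x ^+ 4) = bint (fun x => w' x ^+ 4) by apply: bint_ext => x /bw ->.
by rewrite /energy e1 e2 e3.
Qed.

Variable f : R * R -> R.
Hypothesis lf : L2 Om f.

(** The data, the mesh and the solution are quantified after C, so that C depends on them through r
    only; this is the uniformity in h and t. *)
Definition stability_bound (r C : R) : Prop :=
  forall u0 uinf (Th : triangulation Om) uh Pu0 (wh wht Dwh : R -> R * R -> R) (al : R),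
  H1quot Om uinf -> grad_norm Om uinf <= nu / (4 * N) ->
  sobolev Om 1 (fun x => u0 x - uinf x) -> Hnorm Om 3 (fun x => u0 x - uinf x) = r ->
  regular Th sigma -> disc_steady_state Th nu f uh -> grad_norm Om uh <= nu / (4 * N) ->
  is_H1_projection Th u0 Pu0 -> semidiscrete Th nu c0 uh (fun x => Pu0 x - uh x) wh wht ->
  (forall t, 0 <= t -> is_disc_laplacian Th nu c0 uh (wh t) (Dwh t)) ->
  0 <= al -> 2 * CF * al <= nu / 2 -> forall t : R, 0 < t ->
  ((energy Om c0 nu uh (wh t))%:E + (nu * expR (- 2 * al * t))%:E *
    \int[@lebesgue_measure R]_(s in `[0%R, t]) (expR (2 * al * s) * sqn (Dwh s))%:E
   <= (C * expR (- 2 * al * t))%:E)%E.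

Lemma semidiscrete_bound (r : R) : exists2 C : R, 0 < C & stability_bound r C.
Proof.
have [N0 [P P0 HP]] := poincare hN; have [CF0 _] := hCF.
have [Q Q1 HQ] := steady_bounds sigma hN nu0 lf; have c0' := c00; have nu0' := nu0.
pose G := (nu / (4 * N)) ^+ 2; have G0 : 0 <= G := sqr_ge0 _.
(* Bounds the squared H^1 norm of the initial value P_h u_0 - u_h: the projection does not increase
   the norm of u_0 = w_0 + uinf, and Q bounds the discrete steady state. *)
pose M := 2 * (2 * r ^+ 2 + 2 * (P * G + G)) + 2 * Q.
have PG0 : 0 <= P * G by nn.
have r20 := sqr_ge0 r.
have M0 : 0 <= M by rewrite /M; lra.
have QM : Q <= M by rewrite /M; lra.
have [E0 HE0] := energy_bound M.
have [K K0 HK] := nonlinear_bound sigma c00 hCF hN nu0 lf M0.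
(* [A] dominates 2 alpha + 2 K, because 2 CF alpha <= nu/2; K is doubled since the test with the
   discrete Laplacian carries a factor 2. *)
pose E1 := `|E0|; pose A := nu / (2 * CF) + 2 * K.
have A0 : 0 < A by nn.
have k0 : 0 <= 2 * (2 * K) / nu by nn.
have nA0 : 0 <= 2 / nu * A by nn.
exists ((E1 + 2 / nu * A * M + 1) * expR (2 * (2 * K) / nu * M)).
  by rewrite mulr_gt0 ?expR_gt0// ltr_wpDl// addr_ge0 ?normr_ge0// mulr_ge0.
move=> u0 uinf Th uh Pu0 wh wht Dwh al hui gui sw0 rE reg ss guh pj sd lap al0 hal.
have [Vuh huh _] := ss; have [uh1 [uh2 pu]] := Vh_PC1_ex Vuh; have cu := MkCC Vuh.1.
have [hQ _ _] := HQ Th uh reg ss guh.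
have su0 : sobolev Om 1 u0.
  have [h _ _] := sobolev_lin 1 sw0 hui.1; move: h; congr sobolev.
  by apply/funext => x; rewrite mul1r subrK.
have b0 : sqn u0 + gsq u0 <= 2 * r ^+ 2 + 2 * (P * G + G).
  have := H1_parallelogram sw0 hui.1 (expr1n _ 2).
  rewrite (_ : (fun x => u0 x - uinf x + 1 * uinf x) = u0); last by apply/funext => x; rewrite mul1r subrK.
  move=> h; apply: (le_trans h); apply: lerD; apply: lem_l => //.
    by rewrite -Hnorm1_sq// -rE; exact: Hnorm13.
  have gG : gsq uinf <= G.
    have g1 := grad_norm_ge0 Om uinf; have g2 := le_trans g1 gui.
    by rewrite -grad_norm_sq /G; apply: lerXn2r gui; rewrite nnegrE.
  by apply: lerD => //; apply: (le_trans (HP _ hui)); exact: lem_l (ltW P0) gG.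
have [VP _] := pj; have [p1 [p2 pP]] := Vh_PC1_ex VP.
have w0E x : cl x -> wh 0 x = Pu0 x + -1 * uh x by have [H _ _ _ _] := sd; move=> clx; rewrite (H x clx) mulN1r.
pose v x := Pu0 x + -1 * uh x; have Vv : Vh Th v := Vh_lin (-1) VP Vuh.
have [v1 [v2 pv]] := Vh_PC1_ex Vv.
have hv : sqn v + gsq v <= M.
  apply: (le_trans (H1_parallelogram (PC1_sobolev pP) (PC1_sobolev pu) _)); first by rewrite sqrrN expr1n.
  apply: lerD; apply: lem_l => //.
  by apply: (le_trans (projection_bound su0 pj)).
have my := sqn_mode reg sd; have mE := energy_mode c00 nu0 reg cu sd lap.
have [q mL] := laplacian_mode c00 nu0 reg cu sd lap.
have Vw s : 0 <= s -> Vh Th (wh s) by case: sd => _ H _ _ _; exact: H.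
have pos s : 0 <= s -> [/\ 0 <= sqn (wh s), 0 <= energy Om c0 nu uh (wh s) & 0 <= sqn (Dwh s)].
  by move=> _; split; [exact: sqn_ge0|exact: energy_ge0|exact: sqn_ge0].
have hy s : 0 < s -> 2 * I (fun x => wh s x * wht s x) <= - 2 * al * sqn (wh s) - nu / 2 * energy Om c0 nu uh (wh s).
  move=> s0; have [w1 [w2 pw]] := Vh_PC1_ex (Vw s (ltW s0)).
  apply: le_trans (energy_decay pu huh guh pw al0 hal).
  have [_ _ _ _ H] := sd; have := H s s0 _ (Vw s (ltW s0)); rewrite innerE grad_inner_gsq.
  rewrite (_ : I (fun x => wht s x * wh s x) = I (fun x => wh s x * wht s x)); last by apply: I_ext => x _; rewrite mulrC.
  exact: eq0_le.
have y0 : sqn (wh 0) <= M.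
  apply: le_trans hv; rewrite (_ : sqn (wh 0) = sqn v) ?lerDl ?gsq_ge0//.
  by apply: I_ext => x Ox; rewrite w0E//; exact: dom_cl.
(* The L^2 norm does not increase; this a priori bound is the Y of [nonlinear_bound], which keeps
   the energy inequality quadratic. *)
have yM s : 0 <= s -> sqn (wh s) <= M.
  rewrite le_eqVlt => /predU1P[<-//|s0]; apply: le_trans y0; apply: (mode_nincr my) => // t t0.
  have [a1 a2 _] := pos t (ltW t0); apply: (le_trans (hy t t0)).
  exact: decay_le0 (ltW nu0) a1 a2.
have hE s : 0 < s -> - 2 * I (fun x => Dwh s x * wht s x) <= - nu * sqn (Dwh s) + 2 * K * (energy Om c0 nu uh (wh s) + energy Om c0 nu uh (wh s) ^+ 2).
  move=> s0; have s0' := ltW s0; have [VL _] := lap s s0'.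
  have := HK Th reg uh (wh s) (Dwh s) ss guh (Vw s s0') (lap s s0') (yM s s0').
  have := laplacian_test (lap s s0') VL cu (MkCC (Vw s s0').1).
  have [_ _ _ _ H] := sd; have := H s s0 _ VL; rewrite innerE.
  rewrite (_ : I (fun x => wht s x * Dwh s x) = I (fun x => Dwh s x * wht s x)); last by apply: I_ext => x _; rewrite mulrC.
  rewrite (_ : I (fun x => Dwh s x * Dwh s x) = sqn (Dwh s)); last by apply: I_ext => x _; rewrite expr2.
  move: (trilinear _ _ _ _) (trilinear _ _ _ _) (trilinear _ _ _ _) (I _) (bint _) (grad_inner _ _ _) (sqn _) (energy _ _ _ _ _) => a b d i g h l e h1 h2.
  rewrite ler_norml => /andP[_ h3]; have : nu * h = - nu * l - g by rewrite h2; field; rewrite gt_eqF.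
  by move: h1 h3; clear -nu0'; lra.
move=> t t0; apply: (le_trans (ode_bound nu0 _ al0 my mE mL pos hy hE t0)); first by rewrite mulr_gt0.
rewrite lee_fin; apply: lem_r; first exact: expR_ge0.
have s00 := sqn_ge0 Om (wh 0).
apply: ler_pM; rewrite ?expR_ge0//.
- rewrite addr_ge0 ?energy_ge0// mulr_ge0// mulr_ge0//; first by rewrite divr_ge0// ltW.
  by rewrite addr_ge0// mulr_ge0// ?mulr_ge0// ltW.
- have e1 : energy Om c0 nu uh (wh 0) <= E1.
    by rewrite (energy_ext uh w0E); apply: le_trans (ler_norm _); exact: HE0 pu pv (le_trans hQ QM) hv.
  have K2 : 0 <= 2 * K by nn.
  apply: (le_trans (initial_le _ nu0 CF0 al0 K2 s00 y0 hal erefl)).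
  by rewrite -[leLHS]addr0; apply: lerD => //; rewrite lerD2r.
by rewrite ler_expR; apply: lem_l.
Qed.

End stability.

Theorem lemma4p3 (R : realType) (Om : smooth_domain R)
  (c0 CF N sigma CP : R)
  (hc0 : 0 < c0) (hCF : friedrichs Om CF)
  (hN : N%:E = maxe (N1 Om) (N2 Om)) :
  exists C : R -> R -> (R * R -> R) -> R,
  (forall r nu f, 0 < C r nu f) /\
  forall (nu : R) (f u0 uinf : R * R -> R),
  0 < nu ->
  (dual_norm Om f <= (3 * nu ^+ 2 / (16 * N))%:E)%E ->
  steady_state Om nu N f uinf ->
  let w0 := fun x => u0 x - uinf x in
  assumption_A2 Om nu c0 f uinf w0 ->
  sobolev Om 1 w0 -> sobolev Om 3 w0 ->
  forall (Th : triangulation Om) (uh Pu0 : R * R -> R)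
         (wh wht Dwh : R -> R * R -> R) (alpha : R),
  regular Th sigma ->
  disc_steady_state Th nu f uh ->
  grad_norm Om uh <= nu / (4 * N) ->
  is_H1_projection Th u0 Pu0 ->
  (forall j : nat, (j <= 1)%N ->
    Hnorm Om j (fun x => u0 x - Pu0 x)
      <= CP * mesh_size Th ^+ (2 - j) * Hnorm Om 2 u0) ->
  semidiscrete Th nu c0 uh (fun x => Pu0 x - uh x) wh wht ->
  (forall t, 0 <= t -> is_disc_laplacian Th nu c0 uh (wh t) (Dwh t)) ->
  0 <= alpha ->
  alpha <= 1 / (2 * CF) * Num.min (nu / 2) (c0 + 7 * nu / 4) ->
  forall t : R, 0 < t ->
  let Cw := C (Hnorm Om 3 w0) nu f in
  ((grad_norm Om (wh t) ^+ 2
    + bint Om (fun x => (c0 + nu + 2 * `|uh x|) / nu * wh t x ^+ 2)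
    + 1 / (9 * nu * c0) * bint Om (fun x => wh t x ^+ 4))%:E
   + (nu * expR (- 2 * alpha * t))%:E
     * \int[@lebesgue_measure R]_(s in `[0%R, t])
         (L2norm Om (fun x => expR (alpha * s) * Dwh s x) ^+ 2)%:E
   <= (Cw * expR Cw * expR (- 2 * alpha * t))%:E)%E.
Proof.
(* The constant is chosen as a function of the triple (r, nu, f) alone; where nu is not positive or
   f is not in L^2 it is given the value 1. *)
pose P (q : R * R * (R * R -> R)) (C : R) := 0 < C /\ (0 < q.1.2 -> L2 Om q.2 -> stability_bound Om c0 CF N sigma q.1.2 q.2 q.1.1 C).
have exC q : exists C, P q C.
  have [[nu0 lf]|nn] := pselect (0 < q.1.2 /\ L2 Om q.2).
    by have [C C0 HC] := semidiscrete_bound sigma hc0 hCF hN nu0 lf q.1.1; exists C; split.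
  by exists 1; split => // nu0 lf; case: nn.
have [C HC] := choice exC; exists (fun r nu f => C (r, nu, f)); split; first by move=> r nu f; case: (HC (r, nu, f)).
move=> nu f u0 uinf nu0 _ [hui _ gui] w0 [_ lf _] sw0 _ Th uh Pu0 wh wht Dwh al reg ss guh pj _ sd lap al0 hal t t0 /=.
have [C0 {}HC] := HC (Hnorm Om 3 w0, nu, f); have [CF0 _] := hCF.
have hal' : 2 * CF * al <= nu / 2.
  have m1 : Num.min (nu / 2) (c0 + 7 * nu / 4) <= nu / 2 by rewrite ge_min lexx.
  have c2 : 0 <= 2 * CF by rewrite mulr_ge0// ltW.
  apply: (le_trans (lem_l c2 hal)); rewrite mulrA mulrC mul1r mulfV ?mulr1//.
  by rewrite gt_eqF// mulr_gt0.
have {HC} := HC nu0 lf u0 uinf Th uh Pu0 wh wht Dwh al hui gui sw0 erefl reg ss guh pj sd lap al0 hal' t t0.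
rewrite /energy -grad_norm_sq => H.
rewrite [X in ((nu * expR (- 2 * al * t))%:E * X)%E](_ : _ = \int[@lebesgue_measure R]_(s in `[0%R, t]) (expR (2 * al * s) * sqn Om (Dwh s))%:E)%E.
  (* The estimate holds with C itself, and C <= C e^C as C is positive. *)
  apply: (le_trans H); rewrite lee_fin; apply: lem_r; first exact: expR_ge0.
  by rewrite ler_peMr ?(ltW C0)// -[leLHS]expR0 ler_expR ltW.
apply: eq_integral => s; rewrite inE /= in_itv /= => /andP[s0 _].
have [VL _] := lap s s0; rewrite /L2norm sqr_sqrtr inner_sqn ?sqn_ge0// sqn_scale; last exact: cont_cl_bm VL.1.
by rewrite expr2 -expRD; congr (expR _ * _)%:E; ring.
Qed.
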